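(* Let $\mathbb{G}$ be a $k$-step Carnot group of homogeneous dimension $Q$ endowed with a homogeneous distance $\varrho$ as in the context. Let $S\subset\mathbb{G}$ be a compact hypersurface of class $C^2$ without boundary, with horizontal mean curvature $\mathcal{H}_H\in L^1(S;\sigma_R^{n-1})$. Then for every $\psi\in C^1(S)$ $$\left(\int_S|\psi|^{\frac{Q-1}{Q-2}}\,\sigma_H^{n-1}\right)^{\frac{Q-2}{Q-1}}\le C_{Isop}\left(\int_S\left(|\psi|\,|\mathcal{H}_H|+|\mathrm{grad}_{HS}\psi|\right)\sigma_H^{n-1}+\sum_{i=2}^k\left(\mathbf{r}(S)\right)^{i-1}\int_S|\mathrm{grad}_{H_iS}\psi|\,\sigma_R^{n-1}\right),$$ where $C_{Isop}$ is the constant, depending only on $\mathbb{G}$ and $\varrho$, of the isoperimetric-type inequality recalled in the context.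
   Context: Group. A $k$-step Carnot group $(\mathbb{G},\bullet)$ is an $n$-dimensional connected, simply connected, nilpotent Lie group (identity $0$) whose Lie algebra satisfies $\mathfrak{g}=H_1\oplus\dots\oplus H_k$, $[H_1,H_{i-1}]=H_i$ for $2\le i\le k$, $[H_1,H_k]=0$; here $k\ge2$. Put $H:=H_1$ and $V:=H_2\oplus\dots\oplus H_k$, regarded as left-invariant subbundles of $T\mathbb{G}$; $h_i=\dim H_i$, $h=h_1$, $n_i=h_1+\dots+h_i$, $Q=\sum_i i\,h_i$. $X_1,\dots,X_n$ is a left-invariant frame with $X_j\in H_i$ for $n_{i-1}<j\le n_i$, orthonormal for a fixed left-invariant Riemannian metric $\langle\cdot,\cdot\rangle$. $P_E$ denotes orthogonal projection onto a subbundle $E$. $\mathbb{G}$ is identified with $\mathfrak{g}\cong\mathbb{R}^n$ by exponential coordinates, $x_{H_i}$ is the $H_i$-component of $x$, and $\delta_t$ is the dilation multiplying $x_{H_i}$ by $t^i$. Distance. $\varrho$ is a continuous left-invariant distance with $\varrho(\delta_tx,\delta_ty)=t\varrho(x,y)$ for $t\ge0$, piecewise $C^1$, with $|\mathrm{grad}_H\varrho|\le1$ at every regular point ($\mathrm{grad}_H f=\sum_{j\le h}(X_jf)X_j$), $|x_H|\le\varrho(0,x)$, and constants $\mathbf{c}_i>0$ with $|x_{H_i}|\le\mathbf{c}_i\,\varrho(0,x)^i$ for $i=2,\dots,k$. $B_\varrho(x,r)$ is the open $\varrho$-ball. Hypersurfaces. $\nu$ is the Riemannian unit normal orienting $S$;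 $C_S=\{x\in S:|P_H\nu|=0\}$. Off $C_S$, $\nu_H=P_H\nu/|P_H\nu|$. $\sigma_R^{m}$ is $m$-dimensional Riemannian measure; $\sigma_H^{n-1}=|P_H\nu|\,\sigma_R^{n-1}$. $H_xS=H_x\cap T_xS$. At non-characteristic points $\mathcal{H}_H=-\mathrm{div}_H\nu_H=-\sum_j\langle\nabla^H_{\tau_j}\nu_H,\tau_j\rangle$, where $(\tau_j)$ is an orthonormal basis of $H_xS$ and $\nabla^H$ is the flat horizontal connection with $\nabla^H_{X_i}X_j=0$ ($i,j\le h$). With $T^iS=TS\cap(H_1\oplus\dots\oplus H_i)$, $H_iS$ is the orthogonal complement of $T^{i-1}S$ in $T^iS$ (so $H_1S=HS$). $\mathrm{grad}_{HS}\psi$ and $\mathrm{grad}_{H_iS}\psi$ are the orthogonal projections onto $HS$ and $H_iS$ of the Riemannian tangential gradient of $\psi$ on $S$. Metric factor. For $x\in S\setminus C_S$, $\kappa_\varrho(\nu_H(x))=\sigma_H^{n-1}(\mathcal{I}(\nu_H(x))\cap B_\varrho(x,1))$, where $\mathcal{I}(\nu_H(x))=\{y:\langle y_H-x_H,\nu_H(x)\rangle=0\}$. $\mathbf{r}(S)=\sup_{x\in\mathrm{Int}(S\setminus C_S)}r_0(x)$, with $r_0(x)=2\left(\sigma_H^{n-1}(S)/\kappa_\varrho(\nu_H(x))\right)^{1/(Q-1)}$ (for any hypersurface $S$; $\mathrm{Int}$ excludes $\partial S$). Constant. $C_{Isop}>0$ is the constant, depending only on $\mathbb{G}$ and $\varrho$,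 such that for every compact $C^2$ hypersurface $S$ with (piecewise) $C^1$ (possibly empty) boundary and $\mathcal{H}_H\in L^1(S;\sigma_R^{n-1})$, $(\sigma_H^{n-1}(S))^{\frac{Q-2}{Q-1}}\le C_{Isop}\big(\int_S|\mathcal{H}_H|\sigma_H^{n-1}+\sigma_H^{n-2}(\partial S)+\sum_{i=2}^k\mathbf{r}(S)^{i-1}\int_{\partial S}|P_{H_iS}\eta|\sigma_R^{n-2}\big)$, where $\eta$ is the outward unit normal along $\partial S$ tangent to $S$ and $\sigma_H^{n-2}=|P_H\nu||P_{HS}\eta|\sigma_R^{n-2}$. *)

(* Defs.v *)
From HB Require Import structures.
From mathcomp Require Import all_boot all_order all_algebra.
From mathcomp Require Import all_classical all_reals all_analysis.

Set Implicit Arguments.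
Unset Strict Implicit.
Unset Printing Implicit Defensive.

Import Order.TTheory GRing.Theory Num.Theory.
Import numFieldNormedType.Exports.

Local Open Scope classical_set_scope.
Local Open Scope ring_scope.

Section euclidean.
Context {R : realType}.

Definition dot n (u v : 'rV[R]_n) : R := (u *m v^T) 0 0.

(* The Euclidean norm; the library's norm on matrices is the sup norm. *)
Definition enorm n (u : 'rV[R]_n) : R := Num.sqrt (dot u u).

Definition normalize n (u : 'rV[R]_n) : 'rV[R]_n := (enorm u)^-1 *: u.

Definition orthc n (E : 'M[R]_n) : 'M[R]_n := kermx E^T.

Definition oproj n (E : 'M[R]_n) (v : 'rV[R]_n) : 'rV[R]_n :=
  v *m proj_mx E (orthc E).

Fixpoint Ck n (r : nat) (U : set 'rV[R]_n) (f : 'rV[R]_n -> R) : Prop :=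
  (forall x, U x -> {for x, continuous f}) /\
  match r with
  | 0 => True
  | r'.+1 => forall j : 'I_n,
      (forall x, U x -> derivable f x (delta_mx 0 j)) /\
      Ck r' U (fun x => 'D_(delta_mx 0 j) f x)
  end.

(* The Lebesgue integral over R^m of a nonnegative Borel function, as an
   iterated one-dimensional integral (Tonelli). *)
Fixpoint leb_int (m : nat) : ('rV[R]_m -> \bar R) -> \bar R :=
  match m with
  | 0 => fun f => f 0
  | m'.+1 => fun f =>
      (\int[@lebesgue_measure R]_t
         leb_int (fun x : 'rV[R]_m' => f (row_mx (t%:M : 'rV[R]_1) x)))%E
  end.

End euclidean.

Definition borelT (R : realType) (n : nat) :=
  g_sigma_algebraType (@open 'rV[R]_n).

Section left_invariant.
Context {R : realType} (n : nat) (op : 'rV[R]_n -> 'rV[R]_n -> 'rV[R]_n).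

(* The value at x of the left-invariant vector field equal to u at 0. *)
Definition left_field (u x : 'rV[R]_n) : 'rV[R]_n := 'D_u (op x) 0.

(* The commutator at 0 of the left-invariant fields u and v. *)
Definition lie_bracket (u v : 'rV[R]_n) : 'rV[R]_n :=
  'D_u (left_field v) 0 - 'D_v (left_field u) 0.

End left_invariant.

Definition layer_mx (R : realType) n (deg : 'I_n -> nat) (i : nat) : 'M[R]_n :=
  diag_mx (\row_a (deg a == i)%:R).

(* A Carnot group read in exponential coordinates, with respect to an
   orthonormal basis of its Lie algebra adapted to the stratification: the
   carrier is R^n, the j-th basis vector lies in the layer H_(cdeg j), and
   [cmul_exp] says that the lines through 0 are the one-parameter subgroups,
   so that exp is the identity.  Being R^n, the group is connected and simply
   connected; nilpotency follows from the stratification. *)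
Record carnot (R : realType) := Carnot {
  cdim : nat;
  cstep : nat;
  cdeg : 'I_cdim -> nat;
  cmul : 'rV[R]_cdim -> 'rV[R]_cdim -> 'rV[R]_cdim;
  cmulA : associative cmul;
  cmul0x : left_id 0 cmul;
  cmulx0 : right_id 0 cmul;
  cmul_smooth : forall (r : nat) (i : 'I_cdim),
    Ck r setT
      (fun z : 'rV[R]_(cdim + cdim) => cmul (lsubmx z) (rsubmx z) 0 i);
  cmul_exp : forall (s t : R) (x : 'rV[R]_cdim),
    cmul (s *: x) (t *: x) = (s + t) *: x;
  cstep_ge2 : (2 <= cstep)%N;
  cdeg_bounds : forall j, (1 <= cdeg j <= cstep)%N;
  cdeg_mono : {homo cdeg : i j / (i <= j)%N};
  cdeg_top : exists j, cdeg j = cstep;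
  cstrat : forall i, (2 <= i <= cstep)%N ->
    (\sum_(p : 'I_cdim * 'I_cdim | (cdeg p.1 == 1%N) && (cdeg p.2 == i.-1))
        <<lie_bracket cmul (delta_mx 0 p.1) (delta_mx 0 p.2)>>
     == layer_mx R cdeg i)%MS;
  cstrat_top : forall a b, cdeg a = 1%N -> cdeg b = cstep ->
    lie_bracket cmul (delta_mx 0 a) (delta_mx 0 b) = 0
}.

Section carnot_geometry.
Context {R : realType} (G : carnot R).
Local Notation n := (cdim G).
Local Notation k := (cstep G).
Local Notation deg := (@cdeg R G).
Local Notation pt := 'rV[R]_n.

Definition hdim : nat := #|[pred j | deg j == 1%N]|.

Definition homdim : nat :=
  (\sum_(1 <= i < k.+1) i * #|[pred j | deg j == i]|)%N.

Definition dilation (t : R) (x : pt) : pt := \row_j (t ^+ deg j * x 0 j).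

(* Tangent vectors at any point are represented by their components in the
   orthonormal frame X_1, ..., X_n; subbundles are then row spaces of
   matrices, and layer i is H_i. *)
Definition layer (i : nat) : 'M[R]_n := layer_mx R deg i.

Definition flag (i : nat) : 'M[R]_n := diag_mx (\row_a (deg a <= i)%N%:R).

Definition P_H (v : pt) : pt := oproj (layer 1) v.

Definition lfield (j : 'I_n) (x : pt) : pt :=
  left_field (@cmul R G) (delta_mx 0 j) x.

Definition frame (x : pt) : 'M[R]_n := \matrix_j lfield j x.

(* From R^n-coordinates to frame components, at x. *)
Definition frame_coord (x v : pt) : pt := v *m invmx (frame x).

Definition rgrad (f : pt -> R) (x : pt) : pt := \row_j 'D_(lfield j x) f x.

Definition C1_submanifold (c : nat) (M : set pt) : Prop :=
  forall x, M x -> exists (U : set pt) (F : 'I_c -> pt -> R),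
    [/\ open U, U x, forall i, Ck 1 U (F i),
        forall y, U y -> row_free (\matrix_i rgrad (F i) y)
      & M `&` U = [set y | U y /\ forall i, F i y = 0]].

(* An injective C^1 immersion of an open subset of R^m into M. *)
Record C1_patch (m : nat) (M : set pt) (U : set 'rV[R]_m)
    (phi : 'rV[R]_m -> pt) : Prop := C1Patch {
  patch_open : open U;
  patch_C1 : forall i, Ck 1 U (fun u => phi u 0 i);
  patch_inj : {in U &, injective phi};
  patch_imm : forall u, U u -> row_free (\matrix_j 'D_(delta_mx 0 j) phi u);
  patch_sub : phi @` U `<=` M
}.

(* The square root of the determinant of the metric in the coordinates phi. *)
Definition vol_density (m : nat) (phi : 'rV[R]_m -> pt) (u : 'rV[R]_m) : R :=
  let D j := frame_coord (phi u) ('D_(delta_mx 0 j) phi u) in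
  Num.sqrt (\det (\matrix_(i, j) dot (D i) (D j))).

Definition is_riem_measure (m : nat) (M : set pt)
    (s : {measure set (borelT R n) -> \bar R}) : Prop :=
  (forall (U : set 'rV[R]_m) (phi : 'rV[R]_m -> pt) (A : set (borelT R n)),
     C1_patch M U phi -> measurable A ->
     s (A `&` phi @` U) =
     leb_int (fun u => (vol_density phi u * \1_(U `&` phi @^-1` A) u)%:E)) /\
  (forall A : set (borelT R n), measurable A ->
     (forall (U : set 'rV[R]_m) (phi : 'rV[R]_m -> pt),
        C1_patch M U phi -> A `&` phi @` U = set0) ->
     s A = 0%E).

(* The m-dimensional Riemannian measure of the m-dimensional submanifold M
   (determined by is_riem_measure, as countably many patches cover M up to its
   lower-dimensional part). *)
Definition riem_measure (m : nat) (M : set pt) :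
    {measure set (borelT R n) -> \bar R} :=
  if pselect (exists s, is_riem_measure m M s) is left e
  then projT1 (cid e) else mzero.

Definition defining_fun (U : set pt) (F : pt -> R) : Prop :=
  [/\ open U, Ck 2 U F & forall y, U y -> rgrad F y != 0].

Definition mint (S : set pt) : set pt :=
  [set x | exists (U : set pt) (F : pt -> R),
     [/\ defining_fun U F, U x & S `&` U = [set y | U y /\ F y = 0]]]
  `&` S.

Definition mbd (S : set pt) : set pt := S `\` mint S.

Definition bd_chart (S : set pt) (x : pt) (U : set pt) (F g : pt -> R) : Prop :=
  [/\ defining_fun U F, Ck 1 U g,
      forall y, U y -> row_free (col_mx (rgrad F y) (rgrad g y)),
      [/\ U x, F x = 0 & g x = 0]
    & S `&` U = [set y | [/\ U y, F y = 0 & g y <= 0]]].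

Definition regular_bd (S : set pt) : set pt :=
  [set x | exists (U : set pt) (F g : pt -> R), bd_chart S x U F g].

Definition in_finitely_many_pieces (c : nat) (Z : set pt) : Prop :=
  exists (p : nat) (M K : 'I_p -> set pt),
    (forall i, [/\ C1_submanifold c (M i), compact (K i) & K i `<=` M i]) /\
    Z `<=` \bigcup_i K i.

(* A compact C^2 hypersurface S with piecewise C^1, possibly empty, boundary
   mbd S, oriented by the unit normal nu (in frame components): the boundary
   consists of finitely many C^1 pieces, and is C^1 outside finitely many
   pieces of codimension one in it. *)
Record compact_hypersurface (S : set pt) (nu : pt -> pt) : Prop := {
  hyp_compact : compact S;
  hyp_closure : S = closure (mint S);
  hyp_normal : forall x, S x -> exists (U : set pt) (F : pt -> R),
    [/\ defining_fun U F, U x, S `&` U `<=` [set y | F y = 0]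
      & forall y, S y -> U y -> nu y = normalize (rgrad F y)];
  hyp_bd : in_finitely_many_pieces 2 (mbd S);
  hyp_bd_regular : in_finitely_many_pieces 3 (mbd S `\` regular_bd S)
}.

(* TS, HS, TiS and HiS depend on the point only through the unit normal N of
   the tangent hyperplane. *)
Definition TS (N : pt) : 'M[R]_n := kermx N^T.

Definition HS (N : pt) : 'M[R]_n := (layer 1 :&: TS N)%MS.

Definition TiS (i : nat) (N : pt) : 'M[R]_n := (TS N :&: flag i)%MS.

Definition HiS (i : nat) (N : pt) : 'M[R]_n :=
  (TiS i N :&: orthc (TiS i.-1 N))%MS.

Definition char_set (S : set pt) (nu : pt -> pt) : set pt :=
  [set x | S x /\ enorm (P_H (nu x)) = 0].

Definition nuH (nu : pt -> pt) (x : pt) : pt := normalize (P_H (nu x)).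

Definition C1_ext (S : set pt) (f : pt -> R) (x : pt)
    (U : set pt) (F : pt -> R) : Prop :=
  [/\ open U, U x, Ck 1 U F & forall y, S y -> U y -> F y = f y].

Definition C1_on (S : set pt) (f : pt -> R) : Prop :=
  forall x, S x -> exists (U : set pt) (F : pt -> R), C1_ext S f x U F.

(* The Riemannian tangential gradient on S: the tangential part of the
   gradient of any local C^1 extension. *)
Definition tgrad (S : set pt) (nu : pt -> pt) (f : pt -> R) (x : pt) : pt :=
  get [set v | exists (U : set pt) (F : pt -> R),
         C1_ext S f x U F /\ v = oproj (TS (nu x)) (rgrad F x)].

(* The outward unit conormal at regular boundary points: tangent to S, and
   orthogonal to the boundary as a combination of the gradients of F and g. *)
Definition conormal (S : set pt) (x : pt) : pt :=
  get [set e | exists (U : set pt) (F g : pt -> R),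
         [/\ bd_chart S x U F g,
             (e <= col_mx (rgrad F x) (rgrad g x))%MS,
             dot e (rgrad F x) = 0, 0 < dot e (rgrad g x) & enorm e = 1]].

(* The horizontal mean curvature: tau is an orthonormal basis of HS, and the
   flat connection differentiates the frame components of nuH. *)
Definition hmean_curv (S : set pt) (nu : pt -> pt) (x : pt) : R :=
  get [set m | exists tau : 'M[R]_(hdim.-1, n),
         [/\ (tau == HS (nu x))%MS, tau *m tau^T = 1%:M
           & m = - \sum_j dot
               (\row_i dot (tgrad (S `\` char_set S nu) nu
                              (fun y => nuH nu y 0 i) x) (row j tau))
               (row j tau)]].

Definition int_sigmaH (S : set pt) (nu : pt -> pt) (A : set pt)
    (f : pt -> R) : \bar R :=
  (\int[riem_measure n.-1 S]_(x in (A : set (borelT R n)))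
     (f x * enorm (P_H (nu x)))%:E)%E.

Definition sigmaH (S : set pt) (nu : pt -> pt) (A : set pt) : \bar R :=
  int_sigmaH S nu A (fun=> 1).

Definition int_sigmaR (S : set pt) (f : pt -> R) : \bar R :=
  (\int[riem_measure n.-1 S]_(x in (S : set (borelT R n))) (f x)%:E)%E.

Definition int_bd (S : set pt) (f : pt -> R) : \bar R :=
  (\int[riem_measure n.-2 (mbd S)]_(x in (mbd S : set (borelT R n))) (f x)%:E)%E.

Definition hmean_curv_L1 (S : set pt) (nu : pt -> pt) : Prop :=
  (riem_measure n.-1 S).-integrable (S `\` char_set S nu : set (borelT R n))
    (fun x => (hmean_curv S nu x)%:E).

Definition C1_near (f : pt -> R) (x : pt) : Prop :=
  exists U : set pt, [/\ open U, U x & Ck 1 U f].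

(* C^1 off finitely many embedded C^1 hypersurfaces. *)
Definition piecewise_C1 (f : pt -> R) : Prop :=
  exists (p : nat) (M : 'I_p -> set pt),
    (forall i, C1_submanifold 1 (M i)) /\
    [set x | ~ C1_near f x] `<=` \bigcup_i M i.

(* By left invariance, regularity is read off from rho 0. *)
Record homogeneous_distance (rho : pt -> pt -> R) : Prop := {
  hd_eq0 : forall x y, rho x y = 0 <-> x = y;
  hd_sym : forall x y, rho x y = rho y x;
  hd_triangle : forall x y z, rho x z <= rho x y + rho y z;
  hd_cont : continuous (fun p : pt * pt => rho p.1 p.2);
  hd_left : forall z x y, rho (cmul z x) (cmul z y) = rho x y;
  hd_dil : forall t x y, 0 <= t ->
    rho (dilation t x) (dilation t y) = t * rho x y;
  hd_C1 : piecewise_C1 (rho 0);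
  hd_grad : forall x, C1_near (rho 0) x -> enorm (P_H (rgrad (rho 0) x)) <= 1;
  hd_H : forall x, enorm (P_H x) <= rho 0 x;
  hd_layer : exists c : nat -> R, forall i, (2 <= i <= k)%N ->
    0 < c i /\ forall x, enorm (oproj (layer i) x) <= c i * rho 0 x ^+ i
}.

(* The vertical hyperplane through x, with horizontal normal N, is the zero
   set of this function. *)
Definition vplane_fun (x N y : pt) : R := dot (P_H (y - x)) N.

Definition vplane (x N : pt) : set pt := [set y | vplane_fun x N y = 0].

Definition metric_factor (rho : pt -> pt -> R) (nu : pt -> pt) (x : pt) :
    \bar R :=
  let N := nuH nu x in
  sigmaH (vplane x N) (fun y => normalize (rgrad (vplane_fun x N) y))
    (vplane x N `&` [set y | rho x y < 1]).

Definition radius_at (rho : pt -> pt -> R) (S : set pt) (nu : pt -> pt)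
    (x : pt) : \bar R :=
  (2%:E * (sigmaH S nu S / metric_factor rho nu x)
            `^ (homdim%:R - 1)^-1)%E.

Definition max_radius (rho : pt -> pt -> R) (S : set pt) (nu : pt -> pt) :
    \bar R :=
  ereal_sup [set radius_at rho S nu x | x in mint S `\` char_set S nu].

Local Notation Q := (homdim%:R : R).

Definition isoperimetric_constant (rho : pt -> pt -> R) (C : R) : Prop :=
  0 < C /\
  forall (S : set pt) (nu : pt -> pt),
    compact_hypersurface S nu -> hmean_curv_L1 S nu ->
    ((sigmaH S nu S) `^ ((Q - 2) / (Q - 1)) <=
     C%:E * (int_sigmaH S nu S (fun x => `|hmean_curv S nu x|%R)
             + int_bd S (fun x => (enorm (P_H (nu x)) *
                          enorm (oproj (HS (nu x)) (conormal S x)))%R)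
             + \sum_(2 <= i < k.+1)
                 (max_radius rho S nu) ^+ i.-1 *
                 int_bd S (fun x =>
                   enorm (oproj (HiS i (nu x)) (conormal S x)))))%E.

End carnot_geometry.

(* Main.v *)
Require Import Defs.
From HB Require Import structures.
From mathcomp Require Import all_boot all_order all_algebra.
From mathcomp Require Import all_classical all_reals all_analysis.
From mathcomp Require Import measurable_realfun ring lra.
Set Implicit Arguments.
Unset Strict Implicit.
Unset Printing Implicit Defensive.
Import Order.TTheory GRing.Theory Num.Theory.
Import numFieldNormedType.Exports.
Local Open Scope classical_set_scope.
Local Open Scope ring_scope.

(** The function |psi| is approximated from above by C^1 functions g > 0 that are
regular on S: outside an open set D of levels of measure at most e, the gradient
of g is nowhere normal to S.  Such g are obtained by smoothing psi, regularising
the absolute value and adding a small linear function; since psi is only C^1 and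
S only C^2, a counting argument on grids, which bounds the measure of the bad
levels for some choice of the linear function, plays the role of Sard's theorem.
For a level t outside D, the superlevel {g >= t} of S is a compact C^2
hypersurface with C^1 boundary {g = t}, whose conormal is the normalised tangential
gradient of g up to sign, and whose radius is at most r(S); so the isoperimetric
inequality applies to it.  Integrating in t, the boundary terms become the gradient
terms by the coarea formula, and the left side dominates the L^((Q-1)/(Q-2)) norm
of g by the layer cake inequality.  The levels in D cost at most e times a power
of the total area.  When e tends to 0 all errors vanish because r(S) is finite:
the metric factor is bounded below, uniformly in the normal. *)

(** [riem_measure] is chosen by a description and is [mzero] when no measure satisfies it. If this
    happens for S, every integral over S is 0 and the claim is trivial. Otherwise the existence of a
    Riemannian measure on S becomes a tool. Restriction gives the measures of the superlevels. It
    also yields the change of variables formula in R^(n-1): a piece of S read in a patch and in a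
    reparametrised patch has one measure, and comparing the two integrals produces the Jacobian.
    That formula in turn provides vertical planes with a Riemannian measure, without which their
    metric factor would be 0 and r(S) infinite. The geometric input about the group is that, in
    exponential coordinates, the H_1-components of the left-invariant fields are constant. Hence
    vertical planes have a constant horizontal normal, and a coordinate of degree 1 attains its
    maximum on S at a noncharacteristic point, so that r(S) is the supremum of a nonempty set.
    Linear perturbations suit the counting because the pairs (perturbation, critical level) depend
    on n parameters, a point of S and a multiplier, while they lie in a space of dimension n+1. *)

Section rV_norm.
Context {R : realType} {n : nat}.
Implicit Types x y z : 'rV[R]_n.

Lemma rV_coord_le x i : `|x 0 i| <= `|x|.
Proof.
rewrite [leRHS]/Num.Def.normr /= mx_normrE.
by apply: (le_bigmax _ (fun i : 'I_1 * 'I_n => `|x i.1 i.2|) (0, i)).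
Qed.

Lemma rV_norm_le x r : 0 <= r -> (forall i, `|x 0 i| <= r) -> `|x| <= r.
Proof.
move=> r0 h; rewrite [leLHS]/Num.Def.normr /= mx_normrE; apply: bigmax_le => // -[i j] _.
by rewrite ord1; exact: h.
Qed.

Lemma rV_norm_lt x r : 0 < r -> (forall i, `|x 0 i| < r) -> `|x| < r.
Proof.
move=> r0 h; rewrite [ltLHS]/Num.Def.normr /= mx_normrE; apply: bigmax_lt => // -[i j] _.
by rewrite ord1; exact: h.
Qed.

Lemma ballN x y (r : R) : ball x r y <-> `|x - y| < r.
Proof. by rewrite -ball_normE. Qed.

Lemma cvg_rV T (F : set_system T) {FF : Filter F} (f : T -> 'rV[R]_n) x :
  (forall i, (fun t => f t 0 i) @ F --> x 0 i) -> f @ F --> x.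
Proof.
move=> h; apply/cvgrPdist_le => e e0; near=> t.
apply: rV_norm_le; first exact: ltW.
move=> i; rewrite !mxE; move: i; near: t; apply: filter_forall => i.
by have /cvgrPdist_le := h i; apply.
Unshelve. all: by end_near. Qed.

Lemma continuous_rV (T : topologicalType) (f : T -> 'rV[R]_n) (x : T) :
  (forall i, {for x, continuous (fun t => f t 0 i)}) -> {for x, continuous f}.
Proof. by move=> fx; have FF := nbhs_filter x; apply: cvg_rV => i; exact: fx. Qed.

Lemma rV_near_forall (T : topologicalType) (I : finType) (P : I -> T -> Prop) (x : T) :
  (forall i, \forall y \near x, P i y) -> \forall y \near x, forall i, P i y.
Proof. by move=> Px; have FF := nbhs_filter x; exact: filter_forall. Qed.

End rV_norm.

Notation ee := (delta_mx 0) (only parsing).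

Lemma near_continuous (V W : topologicalType) (f g : V -> W) x :
  (\forall y \near x, f y = g y) -> {for x, continuous f} -> {for x, continuous g}.
Proof.
move=> fg cf; suff : g @ x --> f x by rewrite (nbhs_singleton fg).
apply: (@cvg_trans _ (f @ x)) => //; apply: near_eq_cvg.
by apply: filterS fg => y ->.
Qed.

(** * Directional derivatives and functions of class C^r *)

Section derive_basics.
Context {R : realType} {V W : normedModType R}.
Implicit Types (f : V -> W) (a v : V).

Lemma is_derive_affine f a v l :
  (forall h : R, f (h *: v + a) = f a + h *: l) -> is_derive a v f l.
Proof.
move=> fE; have cv : (fun h => h^-1 *: ((f \o shift a) (h *: v) - f a)) @ 0^' --> l.
  apply: (@cvg_trans _ ((fun=> l) @ (0 : R)^')); last exact: cvg_cst.
  apply: near_eq_cvg; near=> h; rewrite /= fE addrAC subrr add0r scalerA mulVf ?scale1r//.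
  by near: h; exact: nbhs_dnbhs_neq.
by apply: DeriveDef; [apply/cvg_ex; exists l|exact: cvg_lim cv].
Unshelve. all: by end_near. Qed.

Lemma is_derive_line f a v (t : R) df :
  is_derive (a + t *: v) v f df -> is_derive t 1 (fun s => f (a + s *: v)) df.
Proof.
have E : (fun h => h^-1 *: (((fun s => f (a + s *: v)) \o shift t) (h *: 1) - f (a + t *: v)))
    = (fun h => h^-1 *: ((f \o shift (a + t *: v)) (h *: v) - f (a + t *: v))).
  apply/funext => h /=; congr (_ *: (f _ - _)).
  by rewrite [h *: 1]mulr1 scalerDl addrCA.
by move=> [d1 d2]; apply: DeriveDef; [rewrite /derivable E|rewrite /derive E].
Qed.

End derive_basics.

(** The increment [d] may have either sign, which is why the condition on [s] has two halves. *)
Lemma MVT_line (R : realType) (V : normedModType R) (f : V -> R) (a v : V) (d : R) :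
  (forall s, (0 <= s <= d) || (d <= s <= 0) -> derivable f (a + s *: v) v) ->
  exists2 s, (0 <= s <= d) || (d <= s <= 0) &
    f (a + d *: v) - f a = d * 'D_v f (a + s *: v).
Proof.
move=> df; pose g s := f (a + s *: v).
have dg s : (0 <= s <= d) || (d <= s <= 0) -> is_derive s 1 g ('D_v f (a + s *: v)).
  by move=> /df /derivableP ?; exact: is_derive_line.
have E : f (a + d *: v) - f a = g d - g 0 by rewrite /g scale0r addr0.
rewrite E; have [d0|/ltW d0] := leP 0 d.
- have [||s sd ->] := @MVT_segment R g (fun s => 'D_v f (a + s *: v)) 0 d d0.
  + by move=> s /[!in_itv] /= /andP[s0 sd]; apply: dg; rewrite (ltW s0) (ltW sd).
  + by apply: derivable_within_continuous => s /[!in_itv] /= sd; have [] // := dg s; rewrite sd.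
  by exists s; [move: sd; rewrite in_itv /= => ->|rewrite subr0 mulrC].
- have [||s sd E'] := @MVT_segment R g (fun s => 'D_v f (a + s *: v)) d 0 d0.
  + by move=> s /[!in_itv] /= /andP[s0 sd]; apply: dg; rewrite (ltW s0) (ltW sd) orbT.
  + by apply: derivable_within_continuous => s /[!in_itv] /= sd; have [] // := dg s; rewrite sd orbT.
  exists s; first by move: sd; rewrite in_itv /= => ->; rewrite orbT.
  by rewrite -opprB E' sub0r mulrN opprK mulrC.
Qed.

Lemma cvg_sumr (R : realType) T (F : set_system T) {FF : Filter F} I (s : seq I)
    (f : I -> T -> R) (l : I -> R) :
  (forall i, f i @ F --> l i) ->
  (fun t => \sum_(i <- s) f i t) @ F --> \sum_(i <- s) l i.
Proof. by move=> fl; apply: cvg_big => [|i _]; [exact: add_continuous|exact: fl]. Qed.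

Section Ck.
Context {R : realType} {n : nat}.
Implicit Types (U : set 'rV[R]_n) (f g : 'rV[R]_n -> R) (r : nat).

Lemma open_near_eq U f g x : open U -> U x -> (forall y, U y -> f y = g y) ->
  \forall y \near x, f y = g y.
Proof. by move=> oU Ux fg; have := open_nbhs_nbhs (conj oU Ux); apply: filterS. Qed.

Lemma Ck_cont r U f x : Ck r U f -> U x -> {for x, continuous f}.
Proof. by case: r => [|r] [+ _]; exact. Qed.

Lemma Ck_sub r U V f : V `<=` U -> Ck r U f -> Ck r V f.
Proof.
move=> VU; elim: r f => [|r IH] f [cf df]; split => //; first by move=> x /VU; exact: cf.
- by move=> x /VU; exact: cf.
- by move=> j; have [d1 d2] := df j; split; [move=> x /VU; exact: d1|exact: IH].
Qed.

Lemma Ck_eq r U f g : open U -> (forall y, U y -> f y = g y) -> Ck r U f -> Ck r U g.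
Proof.
move=> oU; elim: r f g => [|r IH] f g fg [cf df].
  split=> // x Ux; exact: near_continuous (open_near_eq oU Ux fg) (cf x Ux).
split.
  by move=> x Ux; exact: near_continuous (open_near_eq oU Ux fg) (cf x Ux).
move=> j; have [d1 d2] := df j; split.
  by move=> x Ux; apply: near_eq_derivable (d1 x Ux); exact: (open_near_eq oU Ux fg).
apply: IH d2 => x Ux; apply: near_eq_derive; exact: (open_near_eq oU Ux fg).
Qed.

Lemma CkS r U f : Ck r.+1 U f -> Ck r U f.
Proof.
elim: r f => [|r IH] f [cf df]; split=> // j; have [d1 d2] := df j.
by split => //; exact: IH.
Qed.

Lemma Ck_le r s U f : (r <= s)%N -> Ck s U f -> Ck r U f.
Proof.
elim: s => [|s IH]; first by rewrite leqn0 => /eqP ->.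
by rewrite leq_eqVlt => /predU1P[-> //|rs] /CkS; exact: IH.
Qed.

Lemma Ck_cst r U (c : R) : Ck r U (fun=> c).
Proof.
elim: r c => [|r IH] c; split => //; try by move=> x _; exact: (@cst_continuous _ _ c x).
move=> j; split; first by move=> x _; exact: derivable_cst.
suff -> : 'D_(ee j) (fun=> c) = (fun=> 0 : R) :> ('rV[R]_n -> R) by exact: IH.
by apply/funext => x; exact: derive_cst.
Qed.

Lemma is_derive_coord (i : 'I_n) (x v : 'rV[R]_n) :
  is_derive x v (fun y : 'rV[R]_n => y 0 i) (v 0 i).
Proof. by apply: is_derive_affine => h; rewrite !mxE addrC. Qed.

(** Strict differentiability: both points move while the differential stays at [x]. The difference
    is split along a path [w] that replaces the coordinates of [z] by those of [y] one at a time.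
    The mean value theorem turns each leg into a partial derivative at a point of the ball, because
    balls of the sup norm contain such paths. *)
Lemma C1_strict U f x : open U -> Ck 1 U f -> U x -> forall e, 0 < e ->
  exists r : R, [/\ 0 < r, ball x r `<=` U & forall y z, ball x r y -> ball x r z ->
    `|f y - f z - \sum_j (y - z) 0 j * 'D_(ee j) f x| <= e * `|y - z|].
Proof.
move=> oU [_ df] Ux e e0.
have /nbhs_ballP[r1 /= r10 r1U] := open_nbhs_nbhs (conj oU Ux).
(* The [n] legs share the error [e]; [n.+1] keeps the quotient meaningful for [n = 0]. *)
have e'0 : 0 < e / n.+1%:R by rewrite divr_gt0.
have : \forall y \near x, forall j : 'I_n, `|'D_(ee j) f x - 'D_(ee j) f y| <= e / n.+1%:R.
  apply: rV_near_forall => j; have [_ [+ _]] := df j => /(_ x Ux).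
  by move=> /cvgrPdist_le /(_ _ e'0).
move=> /nbhs_ballP[r2 /= r20 r2P].
pose r := Num.min r1 r2; have r0 : 0 < r by rewrite lt_min r10.
have rr1 : ball x r `<=` ball x r1 by apply: le_ball; rewrite ge_min lexx.
have rr2 : ball x r `<=` ball x r2 by apply: le_ball; rewrite ge_min lexx orbT.
exists r; split => //; first exact: subset_trans rr1 r1U.
move=> y z By Bz.
pose w k : 'rV[R]_n := \row_j if (j < k)%N then y 0 j else z 0 j.
have wS (k : 'I_n) : w k.+1 = w k + ((y - z) 0 k) *: ee k.
  apply/rowP => j; rewrite !mxE /= ?eqxx /= ltnS [j == k]eq_sym.
  have [->|jk] := eqVneq k j; first by rewrite leqnn ltnn mulr1; ring.
  rewrite mulr0 addr0 leq_eqVlt; case: ltngtP => //= /val_inj E.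
  by rewrite E eqxx in jk.
have fE : f y - f z = \sum_(k < n) (f (w k.+1) - f (w k)).
  rewrite -(big_mkord xpredT (fun k => f (w k.+1) - f (w k))) telescope_sumr //.
  by congr (f _ - f _); apply/rowP => j; rewrite !mxE ?ltn_ord.
have step (k : 'I_n) : exists2 c : R, `|'D_(ee k) f x - c| <= e / n.+1%:R &
    f (w k.+1) - f (w k) = (y - z) 0 k * c.
  rewrite wS; have inB s : (0 <= s <= (y - z) 0 k) || ((y - z) 0 k <= s <= 0) ->
      ball x r (w k + s *: ee k).
    move=> sd; apply/ballN/rV_norm_lt => // j; rewrite !mxE /= [j == k]eq_sym.
    have Yj : `|x 0 j - y 0 j| < r.
      by move/ballN: By; apply: le_lt_trans; have := rV_coord_le (x - y) j; rewrite !mxE.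
    have Zj : `|x 0 j - z 0 j| < r.
      by move/ballN: Bz; apply: le_lt_trans; have := rV_coord_le (x - z) j; rewrite !mxE.
    have [kj|kj] := eqVneq k j; last first.
      by rewrite mulr0 addr0; case: ifP.
    subst j; rewrite ltnn mulr1; move: sd Yj Zj; rewrite !mxE !ltr_norml.
    by move=> /orP[/andP[? ?]|/andP[? ?]] /andP[? ?] /andP[? ?]; apply/andP; split; lra.
  have [|s /inB sB ->] := @MVT_line _ _ f (w k) (ee k) ((y - z) 0 k).
    by move=> s /inB /rr1 /r1U; have [+ _] := df k; exact.
  by exists ('D_(ee k) f (w k + s *: ee k)) => //; apply: r2P; exact: rr2.
rewrite fE -sumrB.
apply: le_trans (ler_norm_sum _ _ _) _.
have le1 (k : 'I_n) : true ->
    `|f (w k.+1) - f (w k) - (y - z) 0 k * 'D_(ee k) f x| <= e / n.+1%:R * `|y - z|.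
  move=> _; have [c cP ->] := step k; rewrite -mulrBr normrM mulrC ler_pM //.
    by rewrite distrC.
  exact: rV_coord_le.
apply: le_trans (ler_sum _ le1) _; rewrite sumr_const card_ord -mulrnAl ler_wpM2r //.
by rewrite -mulr_natr mulrAC ler_pdivrMr // ler_pM2l // ler_nat.
Qed.

(** [phi] is only assumed differentiable in the direction [v]. This suffices because the strict
    differentiability of [f] applies to the two points [phi (h *: v + u)] and [phi u], whatever path
    joins them. *)
Lemma C1_chain (V : normedModType R) U f (phi : V -> 'rV[R]_n) u v w :
  open U -> Ck 1 U f -> U (phi u) -> is_derive u v phi w ->
  is_derive u v (fun x => f (phi x)) (\sum_j w 0 j * 'D_(ee j) f (phi u)).
Proof.
move=> oU fU Uu [d1 d2].
have cq : (fun h => h^-1 *: ((phi \o shift u) (h *: v) - phi u)) @ (0 : R)^' --> w.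
  by rewrite -d2; exact: d1.
set L := \sum_j _.
suff cv : (fun h => h^-1 *: (((fun x => f (phi x)) \o shift u) (h *: v) - f (phi u)))
    @ (0 : R)^' --> L.
  by apply: DeriveDef; [apply/cvg_ex; exists L|exact: cvg_lim cv].
pose Lq (p : 'rV[R]_n) := \sum_j p 0 j * 'D_(ee j) f (phi u).
have cL : (fun h => Lq (h^-1 *: ((phi \o shift u) (h *: v) - phi u))) @ (0 : R)^' --> L.
  apply: cvg_sumr => j; apply: cvgMr_tmp => /=.
  exact: (cvg_comp _ (fun q : 'rV[R]_n => q 0 j) cq (@coord_continuous _ _ _ 0 j w)).
have cphi : (fun h => (phi \o shift u) (h *: v)) @ (0 : R)^' --> phi u.
  have : (fun h : R => h *: (h^-1 *: ((phi \o shift u) (h *: v) - phi u)) + phi u)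
      @ (0 : R)^' --> 0 *: w + phi u.
    apply: cvgD; last exact: cvg_cst.
    by apply: cvgZ => //; exact: cvg_within.
  rewrite scale0r add0r; apply: cvg_trans; apply: near_eq_cvg; near=> h.
  rewrite scalerA divff ?scale1r ?subrK //.
  by near: h; exact: nbhs_dnbhs_neq.
apply/cvgrPdist_le => e e0.
(* Linearising [f] costs at most [e1 * |q|], and the difference quotient [q] of [phi] satisfies
   [|q| <= |w| + 1] for small [h]. The other half of [e] pays for the convergence of [Lq q] to
   [L]. *)
pose e1 := e / 2 / (`|w| + 1).
have e10 : 0 < e1 by rewrite !divr_gt0 // ltr_wpDl.
have [r [r0 rU rP]] := C1_strict oU fU Uu e10.
near=> h.
have h0 : h != 0 by near: h; exact: nbhs_dnbhs_neq.
set q := h^-1 *: ((phi \o shift u) (h *: v) - phi u).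
have q1 : `|q| <= `|w| + 1.
  have : `|w - q| <= 1 by rewrite /q; near: h; move/cvgrPdist_le: cq; apply.
  move=> wq; rewrite -[q](subrK w) (le_trans (ler_normD _ _)) // addrC lerD2l.
  by rewrite distrC.
have Lq2 : `|L - Lq q| <= e / 2.
  by rewrite /q; near: h; move/cvgrPdist_le: cL; apply; rewrite divr_gt0.
have Bh : ball (phi u) r (phi (h *: v + u)).
  by near: h; move/cvgrPdist_lt: cphi => /(_ r r0); apply: filterS => h' H; apply/ballN.
have H := rP _ _ Bh (ballxx _ r0).
apply: le_trans (ler_distD (Lq q) _ _) _; rewrite (splitr e); apply: lerD => //.
suff : `|Lq q - h^-1 *: (f (phi (h *: v + u)) - f (phi u))| <= e / 2 by [].
have -> : Lq q - h^-1 *: (f (phi (h *: v + u)) - f (phi u)) =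
  - h^-1 * (f (phi (h *: v + u)) - f (phi u)
      - \sum_j (phi (h *: v + u) - phi u) 0 j * 'D_(ee j) f (phi u)).
  rewrite mulNr mulrBr opprB; congr (_ - _).
  by rewrite /Lq /q mulr_sumr; apply: eq_bigr => j _; rewrite !mxE mulrA.
rewrite normrM normrN; apply: le_trans (ler_wpM2l (normr_ge0 _) H) _.
rewrite mulrCA.
have -> : `|h^-1| * `|phi (h *: v + u) - phi u| = `|q| by rewrite /q normrZ.
apply: le_trans (ler_wpM2l (ltW e10) q1) _.
by rewrite /e1 divfK // gt_eqF // ltr_wpDl.
Unshelve. all: by end_near. Qed.

Lemma C1_derive U f x v : open U -> Ck 1 U f -> U x ->
  is_derive x v f (\sum_j v 0 j * 'D_(ee j) f x).
Proof.
by move=> oU fU Ux; exact: (C1_chain oU fU Ux (is_derive_id x v)).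
Qed.

Lemma C1_derivable U f x v : open U -> Ck 1 U f -> U x -> derivable f x v.
Proof. by move=> oU fU Ux; case: (C1_derive v oU fU Ux). Qed.

Lemma C1_deriveE U f x v : open U -> Ck 1 U f -> U x ->
  'D_v f x = \sum_j v 0 j * 'D_(ee j) f x.
Proof. by move=> oU fU Ux; case: (C1_derive v oU fU Ux). Qed.

Lemma CkD r U f g : open U -> Ck r U f -> Ck r U g -> Ck r U (fun x => f x + g x).
Proof.
move=> oU; elim: r f g => [|r IH] f g [cf df] [cg dg].
  by split=> // x Ux; apply: continuousD; [exact: cf|exact: cg].
split; first by move=> x Ux; apply: continuousD; [exact: cf|exact: cg].
move=> j; have [f1 f2] := df j; have [g1 g2] := dg j; split.
  by move=> x Ux; apply: derivableD; [exact: f1|exact: g1].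
apply: Ck_eq (IH _ _ f2 g2) => // x Ux.
by rewrite (@deriveD _ _ _ f g) //; [exact: f1|exact: g1].
Qed.

Lemma CkM r U f g : open U -> Ck r U f -> Ck r U g -> Ck r U (fun x => f x * g x).
Proof.
move=> oU; elim: r f g => [|r IH] f g Cf Cg; have [cf df] := Cf; have [cg dg] := Cg.
  by split=> // x Ux; apply: continuousM; [exact: cf|exact: cg].
split; first by move=> x Ux; apply: continuousM; [exact: cf|exact: cg].
move=> j; have [f1 f2] := df j; have [g1 g2] := dg j; split.
  by move=> x Ux; apply: derivableM; [exact: f1|exact: g1].
apply: Ck_eq (CkD oU (IH _ _ (CkS Cf) g2) (IH _ _ (CkS Cg) f2)) => // x Ux.
by rewrite (@deriveM _ _ f g) //; [exact: f1|exact: g1].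
Qed.

Lemma Ck_sum r U I (s : seq I) (F : I -> 'rV[R]_n -> R) : open U ->
  (forall i, Ck r U (F i)) -> Ck r U (fun x => \sum_(i <- s) F i x).
Proof.
move=> oU FU; elim: s => [|i s IH].
  by apply: Ck_eq (Ck_cst r U 0) => // x _; rewrite big_nil.
by apply: Ck_eq (CkD oU (FU i) IH) => // x _; rewrite big_cons.
Qed.

Lemma Ck_prod r U I (s : seq I) (F : I -> 'rV[R]_n -> R) : open U ->
  (forall i, Ck r U (F i)) -> Ck r U (fun x => \prod_(i <- s) F i x).
Proof.
move=> oU FU; elim: s => [|i s IH].
  by apply: Ck_eq (Ck_cst r U 1) => // x _; rewrite big_nil.
by apply: Ck_eq (CkM oU (FU i) IH) => // x _; rewrite big_cons.
Qed.

Lemma CkZ r U (c : R) f : open U -> Ck r U f -> Ck r U (fun x => c * f x).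
Proof. by move=> oU; apply: CkM => //; exact: Ck_cst. Qed.

Lemma CkN r U f : open U -> Ck r U f -> Ck r U (fun x => - f x).
Proof. by move=> oU fU; apply: Ck_eq (CkZ (-1) oU fU) => // x _; rewrite mulN1r. Qed.

Lemma CkB r U f g : open U -> Ck r U f -> Ck r U g -> Ck r U (fun x => f x - g x).
Proof. by move=> oU fU gU; apply: CkD => //; exact: CkN. Qed.

Lemma Ck_coord r U (i : 'I_n) : Ck r U (fun x => x 0 i).
Proof.
elim: r => [|r IH]; split => //; try by move=> x _; exact: coord_continuous.
move=> j; split; first by move=> x _; have [] := is_derive_coord i x (ee j).
suff -> : 'D_(ee j) (fun x : 'rV[R]_n => x 0 i) = (fun=> (ee j : 'rV[R]_n) 0 i).
  exact: Ck_cst.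
by apply/funext => x; case: (is_derive_coord i x (ee j)).
Qed.

Lemma CkV r U f : open U -> (forall x, U x -> f x != 0) -> Ck r U f ->
  Ck r U (fun x => (f x)^-1).
Proof.
move=> oU f0; elim: r => [|r IH] Cf; have [cf df] := Cf.
  by split=> // x Ux; apply: continuousV; [exact: f0|exact: cf].
split; first by move=> x Ux; apply: continuousV; [exact: f0|exact: cf].
move=> j; have [f1 f2] := df j; split.
  by move=> x Ux; apply: derivableV; [exact: f0|exact: f1].
have fV := IH (CkS Cf).
apply: Ck_eq (CkN oU (CkM oU (CkM oU fV fV) f2)) => // x Ux.
rewrite (@deriveV _ _ f) //; [|exact: f0|exact: f1].
by rewrite /GRing.scale /= mulNr expr2 invfM.
Qed.

End Ck.

Lemma Ck_comp (R : realType) (n p r : nat) (U : set 'rV[R]_n) (V : set 'rV[R]_p)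
    (f : 'rV[R]_n -> R) (phi : 'rV[R]_p -> 'rV[R]_n) :
  open U -> open V -> (forall i, Ck r V (fun u => phi u 0 i)) ->
  (forall u, V u -> U (phi u)) -> Ck r U f -> Ck r V (fun u => f (phi u)).
Proof.
move=> oU oV; elim: r f => [|r IH] f phiV VU fU.
  split=> // u Vu; apply: (@continuous_comp _ _ _ phi f).
    by apply: continuous_rV => i; exact: (Ck_cont (phiV i)).
  exact: (Ck_cont fU (VU _ Vu)).
have cphi u : V u -> {for u, continuous phi}.
  by move=> Vu; apply: continuous_rV => i; exact: (Ck_cont (phiV i)).
have dphi u j : V u -> derivable phi u (delta_mx 0 j).
  move=> Vu; apply/derivable_mxP => i i'; rewrite ord1.
  by have [_ /(_ j)[+ _]] := phiV i'; exact.
have dC u j : V u -> is_derive u (delta_mx 0 j) (fun x => f (phi x))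
    (\sum_i 'D_(delta_mx 0 j) (fun u => phi u 0 i) u * 'D_(delta_mx 0 i) f (phi u)).
  move=> Vu; have := C1_chain oU (Ck_le (ltn0Sn r) fU) (VU _ Vu) (derivableP (dphi u j Vu)).
  rewrite (derive_mx (dphi u j Vu)); under eq_bigr do rewrite mxE.
  exact.
split.
  move=> u Vu; apply: (@continuous_comp _ _ _ phi f); first exact: cphi.
  exact: (Ck_cont fU (VU _ Vu)).
move=> j; split; first by move=> u /(dC _ j) [].
have H : Ck r V (fun u => \sum_i 'D_(delta_mx 0 j) (fun u => phi u 0 i) u
    * 'D_(delta_mx 0 i) f (phi u)).
  apply: Ck_sum => // i; apply: CkM => //; first by have [_ /(_ j)[]] := phiV i.
  apply: (IH (fun y => 'D_(ee i) f y)) => //; first by move=> i'; exact: CkS.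
  by have [_ /(_ i)[]] := fU.
by apply: Ck_eq H => // u /(dC _ j) [].
Qed.

Ltac vring := let i := fresh "i" in apply/rowP => i; rewrite !mxE; ring.

Lemma fin_min_gt0 (R : realType) (I : finType) (r : I -> R) :
  (forall i, 0 < r i) -> exists2 s, 0 < s & forall i, s <= r i.
Proof.
move=> r0; exists (\big[Num.min/1]_i r i); first exact: lt_bigmin.
by move=> i; exact: bigmin_le.
Qed.

Section matrix_continuity.
Context {R : realType} {T : topologicalType}.

Lemma continuous_sumr I (s : seq I) (f : I -> T -> R) (x : T) :
  (forall i, {for x, continuous (f i)}) ->
  {for x, continuous (fun t => \sum_(i <- s) f i t)}.
Proof. by move=> fx; have FF := nbhs_filter x; apply: cvg_sumr => i; exact: fx. Qed.

Lemma continuous_prodr I (s : seq I) (f : I -> T -> R) (x : T) :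
  (forall i, {for x, continuous (f i)}) ->
  {for x, continuous (fun t => \prod_(i <- s) f i t)}.
Proof.
move=> fx; have FF := nbhs_filter x; apply: cvg_big => [|i _]; last exact: fx.
exact: mul_continuous.
Qed.

Lemma continuous_det n (A : T -> 'M[R]_n) (x : T) :
  (forall i j, {for x, continuous (fun t => A t i j)}) ->
  {for x, continuous (fun t => \det (A t))}.
Proof.
move=> Ax; apply: continuous_sumr => s; apply: continuousM; first exact: cvg_cst.
by apply: continuous_prodr => i; exact: Ax.
Qed.

Lemma continuous_mulmx m n p (A : T -> 'M[R]_(m, n)) (B : T -> 'M[R]_(n, p)) (x : T) :
  (forall i j, {for x, continuous (fun t => A t i j)}) ->
  (forall i j, {for x, continuous (fun t => B t i j)}) ->
  forall i j, {for x, continuous (fun t => (A t *m B t) i j)}.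
Proof.
move=> Ax Bx i j; have -> : (fun t => (A t *m B t) i j) =
    (fun t => \sum_k A t i k * B t k j) by apply/funext => t; rewrite mxE.
by apply: continuous_sumr => k; apply: continuousM; [exact: Ax|exact: Bx].
Qed.

Lemma continuous_invmx n (A : T -> 'M[R]_n) (x : T) : A x \in unitmx ->
  (forall i j, {for x, continuous (fun t => A t i j)}) ->
  forall i j, {for x, continuous (fun t => invmx (A t) i j)}.
Proof.
move=> uA Ax i j; have dx := continuous_det Ax.
have d0 : \det (A x) != 0 by move: uA; rewrite unitmxE unitfE.
have FF := nbhs_filter x.
apply: (@near_continuous _ _ (fun t => (\det (A t))^-1 * cofactor (A t) j i)).
  have : \forall t \near x, \det (A t) != 0.
    by apply: (dx [set y | y != 0]); apply: open_nbhs_nbhs; split => //; exact: open_neq.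
  apply: filterS => t d; rewrite /invmx unitmxE unitfE d !mxE //.
apply: continuousM; first exact: continuousV.
apply: continuousM; first exact: cvg_cst.
apply: continuous_det => k l.
by have -> : (fun t => row' j (col' i (A t)) k l) = (fun t => A t (lift j k) (lift i l))
  by apply/funext => t; rewrite !mxE.
Qed.

End matrix_continuity.

Lemma mulmx_bound (R : realType) n p (K : 'M[R]_(n, p)) :
  exists2 M, 0 < M & forall v : 'rV_n, `|v *m K| <= M * `|v|.
Proof.
exists (1 + \sum_j \sum_i `|K j i|).
  by rewrite ltr_wpDr // sumr_ge0 // => j _; rewrite sumr_ge0.
move=> v; apply: rV_norm_le => [|i].
  by rewrite mulr_ge0 // addr_ge0 // sumr_ge0 // => j _; rewrite sumr_ge0.
rewrite mxE; apply: le_trans (ler_norm_sum _ _ _) _.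
rewrite mulrDl mul1r ler_wpDl // mulr_suml ler_sum // => j _.
rewrite normrM mulrC ler_pM //; last exact: rV_coord_le.
by rewrite (bigD1 i) //= lerDl sumr_ge0.
Qed.

(** * Jacobians, the inverse function theorem and adapted charts *)

Section jacobian.
Context {R : realType} {n p : nat}.
Implicit Types (U : set 'rV[R]_n) (F : 'rV[R]_n -> 'rV[R]_p).

Definition C1map U F := forall i, Ck 1 U (fun x => F x 0 i).

(** Row [j] is the [j]-th partial derivative: tangent vectors are row vectors and multiply from the
    left, so Jacobians compose in the order in which the maps are applied. *)
Definition jac F x : 'M[R]_(n, p) := \matrix_(j, i) 'D_(ee j) (fun y => F y 0 i) x.

Lemma C1map_is_derive U F x v : open U -> C1map U F -> U x ->
  is_derive x v F (v *m jac F x).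
Proof.
move=> oU FU Ux; have dF : derivable F x v.
  apply/derivable_mxP => i j; rewrite (ord1 i). exact: (C1_derivable oU (FU j) Ux).
apply: DeriveDef => //; rewrite derive_mx //; apply/rowP => i; rewrite !mxE.
by rewrite (C1_deriveE v oU (FU i) Ux); apply: eq_bigr => j _; rewrite mxE.
Qed.

Lemma row_jac U F x j : open U -> C1map U F -> U x ->
  row j (jac F x) = 'D_(ee j) F x.
Proof.
by move=> oU FU Ux; have [_ ->] := C1map_is_derive (ee j) oU FU Ux; rewrite rowE.
Qed.

Lemma C1map_continuous U F x : C1map U F -> U x -> {for x, continuous F}.
Proof. by move=> FU Ux; apply: continuous_rV => i; exact: (Ck_cont (FU i)). Qed.

Lemma jac_continuous U F x i j : C1map U F -> U x ->
  {for x, continuous (fun y => jac F y i j)}.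
Proof.
move=> FU Ux; have [_ /(_ i)[_ [H _]]] := FU j; have {H} := H x Ux.
suff -> : (fun y => jac F y i j) = (fun y => 'D_(ee i) (fun z => F z 0 j) y) by [].
by apply/funext => y; rewrite mxE.
Qed.

Lemma C1map_strict U F x : open U -> C1map U F -> U x -> forall e, 0 < e ->
  exists r : R, [/\ 0 < r, ball x r `<=` U & forall y z, ball x r y -> ball x r z ->
    `|F y - F z - (y - z) *m jac F x| <= e * `|y - z|].
Proof.
move=> oU FU Ux e e0.
have /choice[r rP] i := C1_strict oU (FU i) Ux e0.
have /nbhs_ballP[r1 /= r10 r1U] := open_nbhs_nbhs (conj oU Ux).
have [|s s0 sr] := @fin_min_gt0 R _ r; first by move=> i; have [] := rP i.
exists (Num.min s r1); split.
- by rewrite lt_min s0.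
- by apply: subset_trans r1U; apply: le_ball; rewrite ge_min lexx orbT.
- move=> y z By Bz; apply: rV_norm_le => [|i]; first by rewrite mulr_ge0 // ltW.
  have [_ _ /(_ y z)] := rP i; rewrite !mxE.
  under eq_bigr => j _ do rewrite !mxE.
  under [in X in _ -> X]eq_bigr => j _ do rewrite !mxE.
  by apply; [move: By|move: Bz]; apply: le_ball; rewrite ge_min sr.
Qed.

End jacobian.

Lemma lipschitz_near_continuous (R : realType) (V W : normedModType R) (f : V -> W)
    (x : V) (M : R) : 0 < M -> (\forall y \near x, `|f x - f y| <= M * `|x - y|) ->
  {for x, continuous f}.
Proof.
move=> M0 fM; apply/cvgrPdist_le => e e0; near=> y.
apply: (@le_trans _ _ (M * `|x - y|)); first by near: y.
rewrite -ler_pdivlMl // ltW //; near: y.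
by apply: cvgr_dist_lt => //; rewrite mulr_gt0 // invr_gt0.
Unshelve. all: by end_near. Qed.

Lemma closed_ball_compact (R : realType) n (x : 'rV[R]_n) (r : R) : 0 < r ->
  compact (closed_ball x r).
Proof.
move=> r0; apply: bounded_closed_compact; last exact: closed_ball_closed.
exists (`|x| + r); split; first exact: num_real.
move=> M' M'P z; rewrite closed_ballE // /closed_ball_ /= => zB.
have := ler_normB x (x - z); rewrite opprB addrC subrK; lra.
Qed.

(* A point minimizing [|x - f x|] is fixed, as [f] halves this quantity. *)
Lemma contraction_fixed (R : realType) n (U : set 'rV[R]_n)
    (f : 'rV[R]_n -> 'rV[R]_n) (x0 : 'rV[R]_n) : compact U -> U x0 ->
  (forall x, U x -> U (f x)) -> (forall x, U x -> {for x, continuous f}) ->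
  (forall x y, U x -> U y -> `|f x - f y| <= 2^-1 * `|x - y|) ->
  exists2 p, U p & f p = p.
Proof.
move=> cU Ux0 fU cf fc.
have [||p /set_mem Up pmin] := @EVT_min_rV R n (fun x => `|f x - x|) U _ cU.
- by exists x0.
- apply: continuous_in_subspaceT => x /set_mem Ux.
  apply: (@continuous_comp _ _ _ (fun x => f x - x)); last exact: norm_continuous.
  apply: continuousB; [exact: cf|].
  exact: cvg_id.
- exists p => //; have := fc _ _ (fU _ Up) Up.
  have := pmin (f p) (mem_set (fU _ Up)); have := normr_ge0 (f p - p) => h1 h2 h3.
  by apply/eqP; rewrite -subr_eq0 -normr_le0; lra.
Qed.

Section inverse_function.
Context {R : realType} {n : nat}.
Variables (U : set 'rV[R]_n) (F : 'rV[R]_n -> 'rV[R]_n) (x0 : 'rV[R]_n).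
Hypotheses (oU : open U) (FU : C1map U F) (Ux0 : U x0) (uJ : jac F x0 \in unitmx).

(** With [K] the inverse of the Jacobian at [x0], the map [x - F x *m K] has Lipschitz constant 1/2
    near [x0]. So [x - F x *m K + y *m K] has a fixed point in a closed ball for each [y] near
    [F x0], and a fixed point solves [F x = y]. The same estimate makes [F] injective with Lipschitz
    inverse [G], and strict differentiability of [F] at [G y] then differentiates [G] at [y]. *)
Lemma inverse_function : exists (W Y : set 'rV[R]_n) (G : 'rV[R]_n -> 'rV[R]_n),
  [/\ [/\ open W, W x0, W `<=` U & forall x, W x -> jac F x \in unitmx],
      open Y, C1map Y G, forall x, W x -> Y (F x) /\ G (F x) = x
    & forall y, Y y -> W (G y) /\ F (G y) = y].
Proof.
have jU x i j : U x -> {for x, continuous (fun y => jac F y i j)}.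
  exact: jac_continuous FU.
have [K0 K0P] : exists r1 : R, 0 < r1 /\ ball x0 r1 `<=` [set x | jac F x \in unitmx].
  have := continuous_det (fun i j => jU _ i j Ux0) => /(_ [set y | y != 0]) [].
    apply: open_nbhs_nbhs; split; first exact: open_neq.
    by move: uJ; rewrite unitmxE unitfE.
  move=> P /= P1 P2.
  have /nbhs_ballP[r /= r0 rP] : nbhs x0 [set x | \det (jac F x) != 0] by exists P.
  by exists r; split => // x /rP; rewrite /= unitmxE unitfE.
have {K0P} [K00 K0u] := K0P.
pose K := invmx (jac F x0).
have [M M0 MP] := mulmx_bound K.
(* [M] bounds multiplication by [K], so an error of [(2 * M)^-1] in the linearisation becomes the
   contraction ratio 1/2. *)
have e0 : 0 < (2 * M)^-1 by rewrite invr_gt0 mulr_gt0.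
have [r1 [r10 r1U r1P]] := C1map_strict oU FU Ux0 e0.
pose r := Num.min r1 K0.
have r0 : 0 < r by rewrite lt_min r10.
have rr1 : ball x0 r `<=` ball x0 r1 by apply: le_ball; rewrite ge_min lexx.
have rU : ball x0 r `<=` U by apply: subset_trans r1U.
have ru x : ball x0 r x -> jac F x \in unitmx.
  by move=> Bx; apply: K0u; move: Bx; apply: le_ball; rewrite ge_min lexx orbT.
have KJ (v : 'rV_n) : v *m jac F x0 *m K = v by rewrite mulmxK.
have H x y : ball x0 r x -> ball x0 r y ->
    `|(x - F x *m K) - (y - F y *m K)| <= 2^-1 * `|x - y|.
  move=> Bx By.
  have -> : (x - F x *m K) - (y - F y *m K) =
      - ((F x - F y - (x - y) *m jac F x0) *m K).
    rewrite !mulmxBl !KJ; move: (F x *m K) (F y *m K) => a b; vring.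
  rewrite normrN; apply: le_trans (MP _) _.
  rewrite -ler_pdivlMl //; apply: le_trans (r1P _ _ (rr1 _ Bx) (rr1 _ By)) _.
  by rewrite invfM [2^-1 * M^-1]mulrC -mulrA.
have inj x y : ball x0 r x -> ball x0 r y -> `|x - y| <= 2 * M * `|F x - F y|.
  move=> Bx By; have := H _ _ Bx By.
  have -> : (x - F x *m K) - (y - F y *m K) = (x - y) - (F x - F y) *m K.
    by rewrite mulmxBl; move: (F x *m K) (F y *m K) => a b; vring.
  have := MP (F x - F y); have := lerB_normD (x - y) (- ((F x - F y) *m K)).
  rewrite normrN; lra.
(* The radius [r / 4] makes the closed ball of radius [r / 2] invariant: contraction contributes
   half of [r / 2], and moving from [F x0] to [y] less than [r / 4]. *)
pose Y := [set y : 'rV[R]_n | `|F x0 *m K - y *m K| < r / 4].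
have cK : continuous (fun y : 'rV[R]_n => y *m K).
  move=> y; apply: continuous_rV => i.
  have := @continuous_mulmx R _ 1 n n id (fun=> K) y (fun i j => @coord_continuous _ _ _ i j y)
    (fun i j => @cst_continuous _ _ (K i j) y) 0 i.
  exact.
have oY : open Y.
  have -> : Y = (fun y => y *m K) @^-1` (ball (F x0 *m K) (r / 4)).
    by apply/seteqP; split => y /=; rewrite ballN.
  by apply: open_comp => [y _|]; [exact: cK|exact: ball_open].
have cbB : closed_ball x0 (r / 2) `<=` ball x0 r.
  move=> x; rewrite closed_ballE ?divr_gt0 // /closed_ball_ /= => h; apply/ballN.
  by apply: le_lt_trans h _; lra.
have fixY y : Y y -> exists x, ball x0 r x /\ F x = y.
  move=> Yy; have [||x Ux|x Ux|x z Ux Uz|x Ux xE] := @contraction_fixed R n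
    (closed_ball x0 (r / 2)) (fun x => x - F x *m K + y *m K) x0.
  - by apply: closed_ball_compact; rewrite divr_gt0.
  - exact/closed_ballxx/divr_gt0.
  - move: (Ux); rewrite !closed_ballE ?divr_gt0 // /closed_ball_ /= => h.
    have := H _ _ (cbB _ Ux) (ballxx x0 r0).
    have -> : x0 - (x - F x *m K + y *m K) =
      - (x - F x *m K - (x0 - F x0 *m K)) + (F x0 *m K - y *m K).
      by move: (F x *m K) (y *m K) (F x0 *m K) => a b c; vring.
    move=> h2; apply: le_trans (ler_normD _ _) _; rewrite normrN.
    by move: h2 Yy; rewrite /Y /= distrC [`|x - x0|]distrC; lra.
  - apply: continuousD; last exact: (@cst_continuous _ _ (y *m K) x).
    apply: continuousB; first exact: cvg_id.
    apply: (@continuous_comp _ _ _ F (fun y => y *m K)); last exact: cK.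
    exact: (C1map_continuous FU (rU _ (cbB _ Ux))).
  - rewrite opprD addrACA subrr addr0; apply: H; exact: cbB.
  - exists x; split; first exact: cbB.
    have : F x *m K = y *m K.
      by move: xE; move: (F x *m K) (y *m K) => a b /rowP xE; apply/rowP => i;
        have := xE i; rewrite !mxE; lra.
    by move/(congr1 (mulmx^~ (jac F x0))); rewrite /K !mulmxKV.
pose G y := if pselect (Y y) is left e then sval (cid (fixY y e)) else x0.
have GP y : Y y -> ball x0 r (G y) /\ F (G y) = y.
  by move=> Yy; rewrite /G; case: pselect => // Yy'; case: cid.
pose W := ball x0 r `&` F @^-1` Y.
have cF x : U x -> {for x, continuous F} by exact: C1map_continuous.
have oW : open W.
  rewrite openE => x [Bx Yx]; apply: filterI.
    by apply: open_nbhs_nbhs; split => //; exact: ball_open.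
  by apply: (cF _ (rU _ Bx)); apply: open_nbhs_nbhs.
have YF : Y (F x0) by rewrite /Y /= subrr normr0 divr_gt0.
have GF x : W x -> G (F x) = x.
  move=> [Bx Yx]; have [Bg Fg] := GP _ Yx.
  have := inj _ _ Bg Bx; rewrite Fg subrr normr0 mulr0 normr_le0 subr_eq0.
  by move/eqP.
have GW y : Y y -> W (G y) by move=> Yy; have [? FG] := GP _ Yy; split => //; rewrite /= FG.
have Glip y z : Y y -> Y z -> `|G y - G z| <= 2 * M * `|y - z|.
  move=> Yy Yz; have [By Fy] := GP _ Yy; have [Bz Fz] := GP _ Yz.
  by have := inj _ _ By Bz; rewrite Fy Fz.
have cG y : Y y -> {for y, continuous G}.
  move=> Yy; apply: (@lipschitz_near_continuous _ _ _ _ _ (2 * M)).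
    by rewrite mulr_gt0.
  have := open_nbhs_nbhs (conj oY Yy); apply: filterS => z Yz; exact: Glip.
have dG y v : Y y -> is_derive y v G (v *m invmx (jac F (G y))).
  move=> Yy; set x := G y; have [Bx Fx] := GP _ Yy.
  set K' := invmx _; have [M' M'0 M'P] := mulmx_bound K'.
  suff cv : (fun h => h^-1 *: ((G \o shift y) (h *: v) - G y)) @ (0 : R)^' --> v *m K'.
    by apply: DeriveDef; [apply/cvg_ex; exists (v *m K')|exact: cvg_lim cv].
  apply/cvgrPdist_le => e ep.
  (* [M'] bounds the inverse Jacobian at [G y] and [2 * M] is the Lipschitz constant of [G]; the
     added 1 allows [v = 0]. *)
  pose e1 := e / (M' * (2 * M) * (`|v| + 1)).
  have d0 : 0 < M' * (2 * M) * (`|v| + 1) by rewrite !mulr_gt0 // ltr_wpDl.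
  have e10 : 0 < e1 by rewrite divr_gt0.
  have [s [s0 sU sP]] := C1map_strict oU FU (rU _ Bx) e10.
  have cs : (fun h : R => h *: v + y) @ (0 : R)^' --> y.
    rewrite -[X in _ --> X]add0r -(scale0r v); apply: cvgD; last exact: cvg_cst.
    by apply: cvgZr_tmp; exact: cvg_within.
  have nY : \forall h \near (0 : R)^', Y (h *: v + y) := cs Y (open_nbhs_nbhs (conj oY Yy)).
  have nB : \forall h \near (0 : R)^', ball x s (G (h *: v + y)).
    have := cG _ Yy => /(_ (ball x s) (nbhsx_ballx _ _ s0)) nb.
    exact: (cs _ nb).
  near=> h; have h0 : h != 0 by near: h; exact: nbhs_dnbhs_neq.
  have Yh : Y (h *: v + y) by near: h.
  have Bs : ball x s (G (h *: v + y)) by near: h.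
  have [_ Fh] := GP _ Yh.
  have := sP _ _ Bs (ballxx _ s0); rewrite Fh Fx addrK => h1.
  set X := G (h *: v + y) - x in h1 *.
  have h2 : `|X| <= 2 * M * (`|h| * `|v|).
    by have := Glip _ _ Yh Yy; rewrite addrK normrZ.
  have -> : v *m K' - h^-1 *: ((G \o shift y) (h *: v) - x) =
      h^-1 *: ((h *: v - X *m jac F x) *m K').
    have -> : (G \o shift y) (h *: v) - x = X by [].
    rewrite mulmxBl mulmxK; last exact: ru.
    have -> : (h *: v) *m K' = h *: (v *m K') by rewrite scalemxAl.
    have gen (a b : 'rV[R]_n) : a - h^-1 *: b = h^-1 *: (h *: a - b).
      by apply/rowP => i; rewrite !mxE; field.
    exact: gen.
  rewrite normrZ normfV ler_pdivrMl ?normr_gt0 //.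
  apply: le_trans (M'P _) _; apply: le_trans (ler_wpM2l (ltW M'0) h1) _.
  apply: le_trans (ler_wpM2l (ltW M'0) (ler_wpM2l (ltW e10) h2)) _.
  have -> : M' * (e1 * (2 * M * (`|h| * `|v|))) = `|h| * (e1 * (M' * (2 * M) * `|v|)) by ring.
  rewrite ler_wpM2l // /e1 mulrAC ler_pdivrMr // ler_wpM2l ?ltW //.
  by rewrite ltr_pM2l ?mulr_gt0 // ltrDl.
exists W, Y, G; split => //; last first.
- by move=> y Yy; have [? ?] := GP _ Yy; split => //; exact: GW.
- by move=> x Wx; split; [case: Wx|exact: GF].
- move=> i; split; first by move=> y Yy; apply: continuous_comp (cG _ Yy) (@coord_continuous _ _ _ _ _ _).
  move=> j; have dGi y : Y y -> is_derive y (ee j) (fun z => G z 0 i)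
      (invmx (jac F (G y)) j i).
    move=> Yy; have [d1 d2] := dG y (ee j) Yy.
    have := derive_mx d1; rewrite d2 -rowE => /rowP /(_ i); rewrite [LHS]mxE [RHS]mxE => ->.
    by move/derivable_mxP: d1 => /(_ 0 i) /derivableP.
  split; first by move=> y /dGi [].
  apply: (@Ck_eq _ _ 0 Y (fun y => invmx (jac F (G y)) j i)) => //.
    by move=> y /dGi [_ ->].
  split=> // y Yy; apply: continuous_invmx; first by have [/ru] := GP _ Yy.
  move=> k l; apply: (@continuous_comp _ _ _ G (fun x => jac F x k l)); first exact: cG.
  by apply: jU; have [/rU] := GP _ Yy.
- split => //; [by split => //; exact: ballxx|by move=> x [/rU]|by move=> x [/ru]].
Unshelve. all: by end_near. Qed.

End inverse_function.

Definition grad (R : realType) n (f : 'rV[R]_n -> R) (x : 'rV[R]_n) : 'rV[R]_n :=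
  \row_j 'D_(ee j) f x.

Section C1maps.
Context {R : realType}.

Lemma jac_comp n p q (U : set 'rV[R]_n) (V : set 'rV[R]_p) (F : 'rV[R]_n -> 'rV[R]_p)
    (G : 'rV[R]_p -> 'rV[R]_q) x :
  open U -> open V -> C1map U F -> C1map V G -> U x -> V (F x) ->
  jac (fun y => G (F y)) x = jac F x *m jac G (F x).
Proof.
move=> oU oV FU GV Ux VFx; apply/row_matrixP => j; rewrite row_mul.
have dF := C1map_is_derive (ee j) oU FU Ux.
apply/rowP => i; rewrite !mxE.
have [_ ->] := C1_chain oV (GV i) VFx dF.
by apply: eq_bigr => k _; rewrite -rowE !mxE.
Qed.

Lemma jac_id n (x : 'rV[R]_n) : jac id x = 1%:M.
Proof.
apply/matrixP => j i; rewrite !mxE; have [_ ->] := is_derive_coord i x (ee j).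
by rewrite mxE eqxx eq_sym.
Qed.

Lemma jac_near_eq n p (F G : 'rV[R]_n -> 'rV[R]_p) x :
  (\forall y \near x, F y = G y) -> jac F x = jac G x.
Proof.
move=> FG; apply/matrixP => j i; rewrite !mxE; apply: near_eq_derive.
by have FF := nbhs_filter x; apply: filterS FG => y ->.
Qed.

Lemma C1map_comp n p q (U : set 'rV[R]_n) (V : set 'rV[R]_p) (F : 'rV[R]_n -> 'rV[R]_p)
    (G : 'rV[R]_p -> 'rV[R]_q) : open U -> open V -> C1map U F -> C1map V G ->
  (forall x, U x -> V (F x)) -> C1map U (fun y => G (F y)).
Proof. by move=> oU oV FU GV UV i; exact: (Ck_comp oV oU FU UV (GV i)). Qed.

Lemma C1map_sub n p (U V : set 'rV[R]_n) (F : 'rV[R]_n -> 'rV[R]_p) :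
  V `<=` U -> C1map U F -> C1map V F.
Proof. by move=> VU FU i; exact: Ck_sub VU (FU i). Qed.

Lemma Ck_mulmxr n p r (U : set 'rV[R]_n) (C : 'M[R]_(n, p)) i : open U ->
  Ck r U (fun y => (y *m C) 0 i).
Proof.
move=> oU; apply: (@Ck_eq _ _ _ _ (fun y => \sum_j y 0 j * C j i)) => //.
  by move=> y _; rewrite mxE.
by apply: Ck_sum => // j; apply: CkM => //; [exact: Ck_coord|exact: Ck_cst].
Qed.

Lemma jac_mulmxr n p (C : 'M[R]_(n, p)) x : jac (fun y => y *m C) x = C.
Proof.
apply/matrixP => j i; rewrite !mxE.
have [_ ->] : is_derive x (ee j) (fun y : 'rV[R]_n => (y *m C) 0 i) (C j i) => //.
by apply: is_derive_affine => h; rewrite mulmxDl mxE -scalemxAl -rowE !mxE addrC.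
Qed.

Lemma C1map_row_mx n p q (U : set 'rV[R]_n) (F : 'rV[R]_n -> 'rV[R]_p)
    (G : 'rV[R]_n -> 'rV[R]_q) : C1map U F -> C1map U G ->
  C1map U (fun y => row_mx (F y) (G y)).
Proof.
move=> FU GU i; case: (split_ordP i) => k ->.
  have -> : (fun x => row_mx (F x) (G x) 0 (lshift q k)) = (fun x => F x 0 k).
    by apply/funext => x; rewrite row_mxEl.
  exact: FU.
have -> : (fun x => row_mx (F x) (G x) 0 (rshift p k)) = (fun x => G x 0 k).
  by apply/funext => x; rewrite row_mxEr.
exact: GU.
Qed.

Lemma jac_row_mx n p q (F : 'rV[R]_n -> 'rV[R]_p) (G : 'rV[R]_n -> 'rV[R]_q) x :
  jac (fun y => row_mx (F y) (G y)) x = row_mx (jac F x) (jac G x).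
Proof.
apply/matrixP => j i; rewrite [LHS]mxE; case: (split_ordP i) => k ->.
  rewrite row_mxEl mxE -/(ee j); congr ('D_(ee j) _ x).
  by apply/funext => y; rewrite row_mxEl.
rewrite row_mxEr mxE -/(ee j); congr ('D_(ee j) _ x).
by apply/funext => y; rewrite row_mxEr.
Qed.

Lemma C1map_scalar n (U : set 'rV[R]_n) (f : 'rV[R]_n -> R) : Ck 1 U f ->
  C1map U (fun y => (f y)%:M : 'rV_1).
Proof.
move=> fU i; suff -> : (fun x => ((f x)%:M : 'rV_1) 0 i) = f by [].
by apply/funext => x; rewrite ord1 mxE eqxx mulr1n.
Qed.

Lemma jac_scalar n (f : 'rV[R]_n -> R) x : jac (fun y => (f y)%:M : 'rV_1) x = (grad f x)^T.
Proof.
apply/matrixP => j i; rewrite !mxE; congr ('D_ _ _ _).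
by apply/funext => y; rewrite ord1 mxE eqxx mulr1n.
Qed.

End C1maps.

(** A free [A] is an invertible matrix times the first [p] rows of [row_ebase A], so the remaining
    rows of that invertible matrix complete it. *)
Lemma row_free_completion (R : fieldType) p q (A : 'M[R]_(p, p + q)) : row_free A ->
  exists C : 'M[R]_(q, p + q), col_mx A C \in unitmx.
Proof.
move=> fA; have rA : \rank A = p by apply/eqP.
exists (dsubmx (row_ebase A)); rewrite -row_free_unit; apply: inj_row_free => v.
rewrite -[v]hsubmxK mul_row_col -{1}(mulmx_ebase A) rA pid_mx_row.
rewrite -{1}[row_ebase A]vsubmxK -mulmxA mul_row_col mul1mx mul0mx addr0 mulmxA -mul_row_col.
rewrite vsubmxK => /(congr1 (mulmx^~ (invmx (row_ebase A)))).
rewrite mulmxK ?row_ebase_unit // mul0mx -row_mx0 => /eq_row_mx[aL ->].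
suff -> : lsubmx v = 0 by [].
by rewrite -[lsubmx v](mulmxK (col_ebase_unit A)) aL mul0mx.
Qed.

Section adapted_patch.
Context {R : realType}.

(* [f] is used as the first coordinate of a chart of the hypersurface [F = 0];
   the slices of the chart are then charts of the level sets of [f]. *)
Lemma adapted_patch n m (U : set 'rV[R]_n) (F f : 'rV[R]_n -> R) (x : 'rV[R]_n) :
  n = m.+2 -> open U -> Ck 1 U F -> Ck 1 U f -> U x -> F x = 0 ->
  row_free (col_mx (grad F x) (grad f x)) ->
  exists (W : set 'rV[R]_n) (b : 'rV[R]_m.+1) (r : R)
    (phi : 'rV[R]_m.+1 -> 'rV[R]_n) (pi : 'rV[R]_n -> 'rV[R]_m.+1),
  [/\ [/\ 0 < r, open W, W x, W `<=` U & phi b = x],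
      C1map (ball b r) phi, C1map W pi,
      forall u, ball b r u -> [/\ W (phi u), F (phi u) = 0, f (phi u) = u 0 0,
        pi (phi u) = u & row_free (jac phi u)]
    & forall y, W y -> F y = 0 -> ball b r (pi y) /\ phi (pi y) = y].
Proof.
move=> nm; subst n => oU FU fU Ux Fx0 fr.
have [C uC] := @row_free_completion R 2 m (col_mx (grad F x) (grad f x)) fr.
(* The coordinates are [F], [f] and the linear forms given by [C], which completes the two gradients
   at [x]; hence the Jacobian is invertible there. The patch is the local inverse restricted to the
   hyperplane where the first coordinate is 0, which [i0] embeds. *)
pose Phi y : 'rV[R]_(1 + (1 + m)) :=
  row_mx ((F y)%:M : 'rV_1) (row_mx ((f y)%:M : 'rV_1) (y *m C^T)).
have CPhi : @C1map R m.+2 m.+2 U Phi.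
  apply: (@C1map_row_mx R m.+2 1 m.+1); first exact: C1map_scalar.
  by apply: (@C1map_row_mx R m.+2 1 m); [exact: C1map_scalar|move=> i; exact: Ck_mulmxr].
have uJ : @jac R m.+2 m.+2 Phi x \in unitmx.
  rewrite /Phi (@jac_row_mx R m.+2 1 m.+1) (@jac_row_mx R m.+2 1 m) !jac_scalar jac_mulmxr.
  rewrite -!tr_col_mx unitmx_tr.
  rewrite -row_free_unit; apply: inj_row_free => v.
  have [a [b [c ->]]] : exists a b c, v = @row_mx _ 1 1 m.+1 a (@row_mx _ 1 1 m b c).
    exists (@lsubmx _ 1 1 m.+1 v), (@lsubmx _ 1 1 m (@rsubmx _ 1 1 m.+1 v)).
    by exists (@rsubmx _ 1 1 m (@rsubmx _ 1 1 m.+1 v)); rewrite !hsubmxK.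
  rewrite (@mul_row_col _ 1 1 m.+1 m.+2) (@mul_row_col _ 1 1 m m.+2) addrA => v0.
  have : @row_mx _ 1 2 m (@row_mx _ 1 1 1 a b) c *m col_mx (col_mx (grad F x) (grad f x)) C = 0.
    by rewrite (@mul_row_col _ 1 2 m m.+2) (@mul_row_col _ 1 1 1 m.+2).
  move/(congr1 (mulmx^~ (invmx (col_mx (col_mx (grad F x) (grad f x)) C)))).
  rewrite mulmxK // mul0mx -row_mx0 => /eq_row_mx[+ ->].
  by rewrite -row_mx0 => /eq_row_mx[-> ->]; rewrite !row_mx0.
have [W0 [Y [Psi [[oW0 W0x W0U _] oY CPsi PhiW PsiY]]]] := inverse_function oU CPhi Ux uJ.
have /nbhs_ballP[r /= r0 rY] := open_nbhs_nbhs (conj oY (PhiW _ W0x).1).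
pose b : 'rV[R]_m.+1 := @rsubmx _ 1 1 m.+1 (Phi x).
pose i0 (u : 'rV[R]_m.+1) : 'rV[R]_m.+2 := @row_mx _ 1 1 m.+1 0 u.
have PhiF y : F y = 0 -> Phi y = i0 (@rsubmx _ 1 1 m.+1 (Phi y)).
  by move=> Fy; rewrite /i0 /Phi Fy row_mxKr; congr row_mx; apply/rowP => i; rewrite !mxE mul0rn.
have ibE : i0 b = Phi x by rewrite [RHS]PhiF.
have ib u : ball b r u <-> ball (Phi x) r (i0 u).
  rewrite -ibE !ballN; have -> : i0 b - i0 u = i0 (b - u).
    apply/rowP => i; rewrite [LHS]mxE [X in _ + X]mxE /i0.
    case: (@split_ordP 1 m.+1 i) => k ->; rewrite ?(@row_mxEl _ 1 1 m.+1) ?(@row_mxEr _ 1 1 m.+1);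
      by rewrite !mxE ?subr0.
  suff -> : `|i0 (b - u)| = `|b - u| by [].
  apply/eqP; rewrite eq_le; apply/andP; split; apply: rV_norm_le => // i.
    rewrite /i0; case: (@split_ordP 1 m.+1 i) => k ->.
      by rewrite (@row_mxEl _ 1 1 m.+1) mxE normr0.
    by rewrite (@row_mxEr _ 1 1 m.+1); exact: rV_coord_le.
  by rewrite -(@row_mxEr _ 1 1 m.+1 0 (b - u) 0 i); exact: rV_coord_le.
pose phi u := Psi (i0 u).
pose pi y : 'rV[R]_m.+1 := @rsubmx _ 1 1 m.+1 (Phi y).
pose W := W0 `&` Phi @^-1` (ball (Phi x) r).
have oB : open (ball b r) by exact: ball_open.
have Ci0 : C1map setT i0.
  apply: (@C1map_row_mx R m.+1 1 m.+1) => i; first exact: Ck_cst.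
  exact: Ck_coord.
have Cphi : C1map (ball b r) phi.
  apply: C1map_comp (C1map_sub _ Ci0) CPsi _ => // u /ib; exact: rY.
have Cpi : C1map W pi.
  move=> i; have := CPhi (rshift 1 i) => /(@Ck_sub _ _ _ _ W).
  have -> : (fun x => Phi x 0 (rshift 1 i)) = (fun y => pi y 0 i).
    by apply/funext => y; rewrite /pi [in RHS]mxE.
  by apply => y [/W0U].
have oW : open W.
  rewrite openE => y [W0y By]; apply: filterI; first exact: open_nbhs_nbhs.
  apply: (C1map_continuous CPhi (W0U _ W0y)); apply: open_nbhs_nbhs.
  by split => //; exact: ball_open.
have phiP u : ball b r u -> W (phi u) /\ Phi (phi u) = i0 u.
  by move=> /ib Bu; have [Wu E] := PsiY _ (rY _ Bu); rewrite /W /= E.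
have piphi u : ball b r u -> pi (phi u) = u.
  by move=> /phiP[_ E]; rewrite /pi E row_mxKr.
exists W, b, r, phi, pi; split => //.
- split => //; first by split => //; exact: ballxx.
    by move=> y [/W0U].
  by rewrite /phi ibE; exact: (PhiW _ W0x).2.
- move=> u Bu; have [Wu Eu] := phiP _ Bu; split => //.
  + have := congr1 (fun w => @lsubmx _ 1 1 m.+1 w 0 0) Eu.
    by rewrite /Phi /i0 !row_mxKl !mxE eqxx mulr1n.
  + have := congr1 (fun w => @rsubmx _ 1 1 m.+1 w) Eu.
    rewrite /Phi /i0 !row_mxKr => /(congr1 (fun w => @lsubmx _ 1 1 m w 0 0)).
    rewrite row_mxKl !mxE eqxx mulr1n => ->; congr (u _ _); exact/val_inj.
  + exact: piphi.
  + apply/row_freeP; exists (jac pi (phi u)).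
    rewrite -(jac_comp oB oW Cphi Cpi Bu Wu) -[RHS](jac_id u); apply: jac_near_eq.
    have := open_nbhs_nbhs (conj oB Bu); have FF := nbhs_filter u.
    by apply: filterS => v /piphi.
- move=> y [W0y By] Fy; split; first by apply/ib; rewrite /pi -PhiF.
  by rewrite /phi /pi -PhiF //; exact: (PhiW _ W0y).2.
Qed.

End adapted_patch.

(** * Borel sets and iterated integrals *)

Section borel.
Context {R : realType}.

Lemma open_borel n (A : set 'rV[R]_n) : open A -> measurable (A : set (borelT R n)).
Proof. by move=> oA; exact: sub_sigma_algebra. Qed.

Lemma closed_borel n (A : set 'rV[R]_n) : closed A -> measurable (A : set (borelT R n)).
Proof. by move=> /closed_openC/open_borel/measurableC; rewrite setCK. Qed.

Lemma compact_borel n (A : set 'rV[R]_n) : compact A -> measurable (A : set (borelT R n)).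
Proof.
have hd := @norm_hausdorff R 'rV[R]_n; move=> cA; apply: closed_borel.
exact: (compact_closed hd cA). Qed.

Lemma measurable_fun_borel d (T : measurableType d) n (D : set T) (f : T -> borelT R n) :
  (forall O : set 'rV[R]_n, open O -> measurable (D `&` f @^-1` O)) -> measurable_fun D f.
Proof.
move=> fO; apply: (@measurability _ _ _ (borelT R n) _ _ (@open 'rV[R]_n)); first by [].
by move=> _ [B oB <-]; exact: fO.
Qed.

Lemma ball_borel n (x : 'rV[R]_n) r : measurable (ball x r : set (borelT R n)).
Proof. by apply: open_borel; exact: ball_open. Qed.

(* Rational balls form a countable base of the topology. *)
Definition qball n (i : 'rV[rat]_n * nat) : set 'rV[R]_n :=
  ball (map_mx ratr i.1 : 'rV[R]_n) i.2.+1%:R^-1.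

Lemma qball_nbhs n (O : set 'rV[R]_n) x : open O -> O x ->
  exists2 i, qball i x & qball i `<=` O.
Proof.
move=> oO Ox; have /nbhs_ballP[e /= e0 eO] := open_nbhs_nbhs (conj oO Ox).
have [k ke] : exists k, k.+1%:R^-1 < e / 2.
  have e20 : 0 < e / 2 by rewrite divr_gt0.
  have [k _ /(_ k (leqnn k)) kP] := near_infty_natSinv_lt (PosNum e20).
  by exists k.
have k0 : 0 < k.+1%:R^-1 :> R by rewrite invr_gt0.
have /choice[q qP] (j : 'I_n) : exists q, ratr q \in `]x 0 j - k.+1%:R^-1, x 0 j + k.+1%:R^-1[.
  by apply: rat_in_itvoo; rewrite ltrBlDr -addrA ltrDl addr_gt0.
have qx : ball (map_mx ratr (\row_j q j) : 'rV[R]_n) k.+1%:R^-1 x.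
  apply/ballN/rV_norm_lt => // j; rewrite !mxE; have := qP j.
  by rewrite in_itv /= -ltr_distl.
exists (\row_j q j, k) => // y /ballN By; apply/eO/ballN.
move/ballN: qx; rewrite -normrN opprB => qx.
rewrite -(subrKA (map_mx ratr (\row_j q j))) (le_lt_trans (ler_normD _ _)) //.
by rewrite (splitr e) ltrD // (lt_trans _ ke).
Qed.

Lemma bigcup_qball n (O : set 'rV[R]_n) : open O ->
  O = \bigcup_(i in [set i | qball i `<=` O]) qball i.
Proof.
move=> oO; apply/seteqP; split => [x Ox|x [i /= iO /iO //]].
by have [i ix iO] := qball_nbhs oO Ox; exists i.
Qed.

Lemma countable_bigcup_measurable d (T : measurableType d) (I : countType) (P : set I)
    (F : I -> set T) : (forall i, P i -> measurable (F i)) ->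
  measurable (\bigcup_(i in P) F i).
Proof.
move=> mF; rewrite bigcup_mkcond; apply: countable_bigcupT_measurable => [|i].
  exact: countableP.
by case: ifP => [/set_mem/mF|].
Qed.

(** The continuous function may change from point to point. The preimage of an open interval is the
    trace on [D] of [V], the union of all open sets whose trace lies in that preimage. *)
Lemma measurable_fun_locally n (D : set (borelT R n)) (f : 'rV[R]_n -> R) :
  measurable D ->
  (forall x, D x -> exists (U : set 'rV[R]_n) (g : 'rV[R]_n -> R),
    [/\ open U, U x, forall y, U y -> {for y, continuous g} &
        forall y, D y -> U y -> f y = g y]) ->
  measurable_fun D (f : borelT R n -> R).
Proof.
move=> mD fg; apply: (@measurability _ _ (borelT R n) (measurableTypeR R) D f _ (RGenOpens.measurableE R)) => _ [_ [a [b ->]] <-].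
pose V : set 'rV[R]_n := \bigcup_(U in [set U | open U /\ D `&` U `<=` f @^-1` `]a, b[]) U.
have -> : D `&` f @^-1` `]a, b[ = D `&` V.
  apply/seteqP; split => x [Dx]; last by move=> [U [_ UP] Ux]; split => //; exact: UP.
  move=> fx; split => //; have [U [g [oU Ux cg fgE]]] := fg x Dx.
  exists (U `&` g @^-1` `]a, b[); last by split => //; rewrite /= -fgE.
  split; last by move=> y [Dy [Uy gy]]; rewrite /= fgE.
  rewrite openE => y [Uy gy]; apply: filterI; first exact: open_nbhs_nbhs.
  by apply: (cg _ Uy); apply: open_nbhs_nbhs; split => //; exact: interval_open.
apply: measurableI => //; apply: open_borel; apply: bigcup_open.
by move=> U [].
Qed.

Lemma measurable_fun_on n (D : set (borelT R n)) (f : 'rV[R]_n -> R) :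
  measurable D -> (forall x, D x -> {for x, continuous f}) -> open (D : set 'rV[R]_n) ->
  measurable_fun D (f : borelT R n -> R).
Proof. by move=> mD cf oD; apply: measurable_fun_locally => // x Dx; exists D, f. Qed.

Lemma measurable_fun_on_borel n p (U : set 'rV[R]_n) (f : 'rV[R]_n -> 'rV[R]_p) :
  open U -> (forall x, U x -> {for x, continuous f}) ->
  measurable_fun (U : set (borelT R n)) (f : borelT R n -> borelT R p).
Proof.
move=> oU cf; apply: measurable_fun_borel => O oO; apply: open_borel.
rewrite openE => x [Ux Ox]; apply: filterI; first exact: open_nbhs_nbhs.
by apply: (cf x Ux); exact: open_nbhs_nbhs.
Qed.

End borel.

Section lebesgue_rV.
Context {R : realType}.

Definition rowc m (t : R) (x : 'rV[R]_m) : 'rV[R]_m.+1 := @row_mx _ 1 1 m t%:M x.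

Lemma rowcE m (z : 'rV[R]_m.+1) :
  z = rowc (z 0 0) (@rsubmx _ 1 1 m z).
Proof.
rewrite /rowc -{1}[z](@hsubmxK _ 1 1 m).
suff -> : @lsubmx _ 1 1 m z = (z 0 0)%:M by [].
by apply/rowP => i; rewrite !mxE ord1 eqxx mulr1n; congr (z _ _); exact/val_inj.
Qed.

Lemma rowc00 m t (x : 'rV[R]_m) : rowc t x 0 0 = t.
Proof.
have -> : 0 = @lshift 1 m 0 by exact/val_inj.
by rewrite /rowc (@row_mxEl _ 1 1 m) mxE eqxx.
Qed.

Lemma rowcR m t (x : 'rV[R]_m) : @rsubmx _ 1 1 m (rowc t x) = x.
Proof. exact: row_mxKr. Qed.

Lemma ball_rowc m (b : 'rV[R]_m.+1) r t (x : 'rV[R]_m) :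
  ball b r (rowc t x) <-> ball (b 0 0) r t /\ ball (@rsubmx _ 1 1 m b) r x.
Proof.
have [r0|r0] := leP r 0.
  have z0 (T : normedModType R) (x' y : T) : ~ ball x' r y.
    by rewrite -ball_normE /= => /(le_lt_trans (normr_ge0 _)); rewrite ltNge r0.
  by split => [/z0|[_ /z0]].
rewrite !ballN; have -> : ball (b 0 0) r t <-> `|b 0 0 - t| < r by rewrite -ball_normE.
have E1 : (b - rowc t x) 0 0 = b 0 0 - t by rewrite mxE [X in _ + X]mxE rowc00.
have E2 i : (b - rowc t x) 0 (@rshift 1 m i) = (@rsubmx _ 1 1 m b - x) 0 i.
  by rewrite -[in RHS](rowcR t x) !mxE.
split => [h|[h1 h2]].
  split; first by rewrite -E1 (le_lt_trans (rV_coord_le _ _)).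
  by apply: rV_norm_lt => // i; rewrite -E2 (le_lt_trans (rV_coord_le _ _)).
apply: rV_norm_lt => // i; case: (@split_ordP 1 m i) => k ->.
  by rewrite ord1 (_ : lshift m 0 = 0) ?E1 //; exact/val_inj.
by rewrite E2 (le_lt_trans (rV_coord_le _ _)).
Qed.

Lemma measurable_rowc m : measurable_fun setT
  (fun p : measurableTypeR R * borelT R m => rowc p.1 p.2 : borelT R m.+1).
Proof.
apply: measurable_fun_borel => O oO; rewrite setTI (bigcup_qball oO) preimage_bigcup.
apply: countable_bigcup_measurable => i _.
have -> : (fun p : measurableTypeR R * borelT R m => rowc p.1 p.2) @^-1` (qball i) =
    ball ((map_mx ratr i.1 : 'rV[R]_m.+1) 0 0) i.2.+1%:R^-1 `*`
    (ball (@rsubmx _ 1 1 m (map_mx ratr i.1 : 'rV[R]_m.+1)) i.2.+1%:R^-1 : set (borelT R m)).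
  by apply/seteqP; split => -[t x] /=; rewrite /qball => /ball_rowc.
apply: measurableX; first exact: measurable_ball.
exact: ball_borel.
Qed.

Lemma measurable_rowc2 m t : measurable_fun setT
  (fun x : borelT R m => rowc t x : borelT R m.+1).
Proof. exact: (measurableT_comp (@measurable_rowc m) (measurable_pair1 t)). Qed.

(** The iterated integral is the integral for a genuine measure: a Dirac mass for [m = 0], then the
    push-forward under [rowc] of a product with Lebesgue measure. The measure of balls is carried
    along because it gives the sigma-finiteness that the next product requires. *)
Lemma leb_int_measure m : exists mu : {sigma_finite_measure set (borelT R m) -> \bar R},
  (forall f : borelT R m -> \bar R, measurable_fun setT f -> (forall x, 0 <= f x)%E ->
     leb_int f = \int[mu]_x f x)%E /\
  (forall (b : 'rV[R]_m) (r : R), 0 < r -> mu (ball b r) = ((r *+ 2) ^+ m)%:E).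
Proof.
elim: m => [|m [mu [muE muB]]].
  exists [the {sigma_finite_measure set (borelT R 0) -> \bar R} of \d_(0 : borelT R 0)].
  split; first by move=> f mf f0 /=; rewrite integral_dirac // diracT mul1e.
  move=> b r r0; rewrite /= expr0 diracE mem_set //.
  by apply/ballN; rewrite [b]thinmx0 subrr normr0.
pose rc := fun p : measurableTypeR R * borelT R m => rowc p.1 p.2 : borelT R m.+1.
pose nuM := measure_function_pushforward__canonical__measure_function_Measure
  (@lebesgue_measure R \x mu)%E (@measurable_rowc m).
have nuB (b : 'rV[R]_m.+1) (r : R) : 0 < r -> nuM (ball b r) = ((r *+ 2) ^+ m.+1)%:E.
  move=> r0; rewrite /nuM /= /pushforward.
  have -> : (fun p : measurableTypeR R * borelT R m => rowc p.1 p.2) @^-1` (ball b r) =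
      ball (b 0 0) r `*` (ball (@rsubmx _ 1 1 m b) r : set (borelT R m)).
    by apply/seteqP; split => -[t x] /= /ball_rowc.
  rewrite product_measure1E; [|exact: measurable_ball|exact: ball_borel].
  transitivity (lebesgue_measure (ball (b 0%R 0%R) r) * mu (ball (@rsubmx _ 1 1 m b) r))%E; first by [].
  by rewrite lebesgue_measure_ball ?ltW // muB // -EFinM -exprS.
have sfin : sigma_finite setT nuM.
  exists (fun k => ball (0 : 'rV[R]_m.+1) k.+1%:R : set (borelT R m.+1)).
    apply/seteqP; split => // x _; exists (Num.bound `|x : 'rV[R]_m.+1|) => //.
    apply/ballN; rewrite sub0r normrN (lt_trans (archi_boundP _)) //.
    by rewrite ltr_nat.
  move=> k; split; first exact: ball_borel.
  by rewrite nuB // ltry.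
pose nuS : {sigma_finite_measure set (borelT R m.+1) -> \bar R} :=
  HB.pack (nuM : set (borelT R m.+1) -> \bar R) nuM
    (Measure_isSigmaFinite.Build _ _ _ (nuM : set (borelT R m.+1) -> \bar R) sfin).
exists nuS; split; last exact: nuB.
move=> f mf f0 /=.
have mft (t : R) : measurable_fun setT (fun x : borelT R m => f (rowc t x)).
  exact: (measurableT_comp mf (measurable_rowc2 t)).
transitivity (\int[lebesgue_measure]_t \int[mu]_x f (rowc t x))%E.
  by apply: eq_integral => t _; rewrite -(muE _ (mft t) (fun x => f0 _)).
rewrite ge0_integral_pushforward //; last exact: measurable_rowc.
by rewrite preimage_setT (@fubini_tonelli1 _ _ _ _ R _ mu _
  (measurableT_comp mf (@measurable_rowc m)) (fun x => f0 _)).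
Qed.

Definition lebm m : {sigma_finite_measure set (borelT R m) -> \bar R} :=
  sval (cid (leb_int_measure m)).

Lemma leb_intE m (f : borelT R m -> \bar R) : measurable_fun setT f ->
  (forall x, 0 <= f x)%E -> leb_int f = (\int[lebm m]_x f x)%E.
Proof. by rewrite /lebm; case: cid => mu [muE _] /= mf f0; rewrite -muE. Qed.

Lemma lebm_ball m (b : 'rV[R]_m) (r : R) : 0 < r ->
  lebm m (ball b r) = ((r *+ 2) ^+ m)%:E.
Proof. by move=> r0; rewrite /lebm; case: cid => mu [_ muB] /=; rewrite muB. Qed.

Lemma measurable_leb_int_rowc m (f : borelT R m.+1 -> \bar R) : measurable_fun setT f ->
  (forall x, 0 <= f x)%E ->
  measurable_fun setT (fun t : measurableTypeR R => leb_int (fun x => f (rowc t x))).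
Proof.
move=> mf f0.
have := @measurable_fun_fubini_tonelli_F _ _ _ _ R (lebm m)
  (fun p : measurableTypeR R * borelT R m => f (rowc p.1 p.2))
  (measurableT_comp mf (@measurable_rowc m)) (fun p => f0 _).
congr (measurable_fun _ _); apply/funext => t.
rewrite leb_intE //; exact: (measurableT_comp mf (measurable_rowc2 t)).
Qed.

End lebesgue_rV.

Section image_density.
Local Open Scope ereal_scope.
Context d1 d2 (X : measurableType d1) (Y : measurableType d2) (R : realType).
Variables (l : {measure set X -> \bar R}) (s : {measure set Y -> \bar R}).
Variables (U : set X) (P : set Y) (phi : X -> Y) (w : X -> R).
Hypotheses (mU : measurable U) (mP : measurable P) (mphi : measurable_fun U phi).
Hypotheses (mw : measurable_fun U w) (w0 : forall x, U x -> (0 <= w x)%R).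
Hypothesis sP : forall A, measurable A ->
  s (A `&` P) = \int[l]_(x in U `&` phi @^-1` A) (w x)%:E.

Import HBNNSimple.

(** The hypothesis [sP] is the formula for indicators; simple functions and monotone convergence
    extend it. *)
Lemma ge0_integral_image_density D (g : Y -> \bar R) : measurable D ->
  measurable_fun D g -> (forall y, D y -> 0 <= g y) ->
  \int[s]_(y in D `&` P) g y = \int[l]_(x in U `&` phi @^-1` D) ((w x)%:E * g (phi x)).
Proof.
move=> mD mg g0; have mUD A : measurable A -> measurable (U `&` phi @^-1` A).
  by move=> mA; exact: mphi.
have mDP : measurable (D `&` P) by exact: measurableI.
have mwD A : measurable A -> measurable_fun (U `&` phi @^-1` A) (fun x => (w x)%:E).
  by move=> mA; apply/measurable_EFinP; apply: measurable_funS mw => //; exact: subIsetl.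
pose f_ := nnsfun_approx mD mg.
have mfphi n : measurable_fun (U `&` phi @^-1` D) (fun x => (f_ n (phi x))%:E).
  apply/measurable_EFinP; apply: (@measurableT_comp _ _ _ _ _ _ (f_ n)) => //.
  by apply: measurable_funS mphi => //; exact: subIsetl.
transitivity (limn (fun n => \int[s]_(y in D `&` P) (f_ n y)%:E)).
  rewrite -monotone_convergence//.
  - apply: eq_integral => y /[!inE] -[Dy _]; apply/esym/cvg_lim => //.
    exact: cvg_nnsfun_approx.
  - by move=> n; exact/measurable_EFinP/measurable_funTS.
  - by move=> n y _; rewrite lee_fin.
  - by move=> y _ m n mn; rewrite lee_fin; exact/lefP/nd_nnsfun_approx.
transitivity (limn (fun n => \int[l]_(x in U `&` phi @^-1` D) ((w x)%:E * (f_ n (phi x))%:E)));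
    last first.
  rewrite -monotone_convergence //.
  - apply: eq_integral => x /[!inE] -[Ux Dx]; apply/cvg_lim => //.
    by apply: cvgeZl => //; exact: cvg_nnsfun_approx.
  - exact: mUD.
  - by move=> n; apply: emeasurable_funM; [exact: mwD|exact: mfphi].
  - by move=> n x [Ux _]; rewrite -EFinM lee_fin mulr_ge0 ?w0.
  - move=> x [Ux _] m n mn; apply: lee_wpmul2l; first by rewrite lee_fin w0.
    by rewrite lee_fin; exact/lefP/nd_nnsfun_approx.
congr (limn _); apply/funext => n.
transitivity (\sum_(k \in range (f_ n)) \int[s]_(y in D `&` P)
    (k * \1_(f_ n @^-1` [set k]) y)%:E).
  under eq_integral do rewrite fimfunE -fsumEFin//.
  rewrite ge0_integral_fsum//.
  - by move=> y; exact/measurable_EFinP/measurable_funM.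
  - by move=> y x _; rewrite nnfun_muleindic_ge0.
transitivity (\sum_(k \in range (f_ n)) \int[l]_(x in U `&` phi @^-1` D)
    ((w x)%:E * (k * \1_(f_ n @^-1` [set k]) (phi x))%:E)); last first.
  rewrite -ge0_integral_fsum//.
  - apply: eq_integral => x /[!inE] -[Ux _].
    rewrite -ge0_mule_fsumr; last by move=> k; rewrite nnfun_muleindic_ge0.
    by rewrite fsumEFin // -fimfunE.
  - exact: mUD.
  - move=> k; apply: emeasurable_funM; first exact: mwD.
    apply/measurable_EFinP; apply: measurable_funM => //.
    have H : measurable_fun setT (\1_(f_ n @^-1` [set k]) : Y -> R).
      by apply: measurable_indic; exact: measurable_sfunP.
    exact: (measurableT_comp H (measurable_funS mU (@subIsetl _ _ _) mphi)).
  - move=> k x [Ux _]; apply: mule_ge0; first by rewrite lee_fin w0.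
    by rewrite nnfun_muleindic_ge0.
apply: eq_fsbigr => k /[!inE] -[y _ ky].
have k0 : (0 <= k)%R by rewrite -ky.
have mk : measurable (f_ n @^-1` [set k]) by exact: measurable_sfunP.
under eq_integral do rewrite EFinM.
rewrite ge0_integralZl //; last exact/measurable_EFinP/measurable_indic.
rewrite integral_indic // [_ `&` (D `&` P)]setIA [f_ n @^-1` _ `&` D]setIC sP; last exact: measurableI.
under [RHS]eq_integral do rewrite EFinM muleCA.
rewrite [RHS]ge0_integralZl //; last 3 first.
- exact: mUD.
- apply: emeasurable_funM; first exact: mwD.
  apply/measurable_EFinP; have H : measurable_fun setT (\1_(f_ n @^-1` [set k]) : Y -> R).
    exact: measurable_indic.
  exact: (measurableT_comp H (measurable_funS mU (@subIsetl _ _ _) mphi)).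
- by move=> x [Ux _]; rewrite mule_ge0 ?lee_fin ?w0.
congr (_ * _); rewrite preimage_setI setIA integral_mkcondr.
apply: eq_integral => x _; rewrite patchE; case: ifPn => [/set_mem xk|xk].
  by rewrite indicE mem_set // mule1.
by rewrite indicE (_ : _ \in _ = false) ?mule0 //; apply/negbTE.
Qed.

End image_density.

(** * Orthogonal projections and Gram determinants *)

Section dot.
Context {R : realType}.

Lemma dotE n (u v : 'rV[R]_n) : dot u v = \sum_i u 0 i * v 0 i.
Proof. by rewrite /dot mxE; apply: eq_bigr => i _; rewrite mxE. Qed.

Lemma dotC n (u v : 'rV[R]_n) : dot u v = dot v u.
Proof. by rewrite !dotE; apply: eq_bigr => i _; rewrite mulrC. Qed.

Lemma dotDl n (u v w : 'rV[R]_n) : dot (u + v) w = dot u w + dot v w.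
Proof. by rewrite /dot mulmxDl mxE. Qed.

Lemma dotZl n c (u v : 'rV[R]_n) : dot (c *: u) v = c * dot u v.
Proof. by rewrite /dot -scalemxAl mxE. Qed.

Lemma dotNl n (u v : 'rV[R]_n) : dot (- u) v = - dot u v.
Proof. by rewrite /dot mulNmx mxE. Qed.

Lemma dotBl n (u v w : 'rV[R]_n) : dot (u - v) w = dot u w - dot v w.
Proof. by rewrite dotDl dotNl. Qed.

Lemma dotDr n (u v w : 'rV[R]_n) : dot w (u + v) = dot w u + dot w v.
Proof. by rewrite !(dotC w) dotDl. Qed.

Lemma dotZr n c (u v : 'rV[R]_n) : dot u (c *: v) = c * dot u v.
Proof. by rewrite !(dotC u) dotZl. Qed.

Lemma dotNr n (u v : 'rV[R]_n) : dot u (- v) = - dot u v.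
Proof. by rewrite !(dotC u) dotNl. Qed.

Lemma dotBr n (u v w : 'rV[R]_n) : dot w (u - v) = dot w u - dot w v.
Proof. by rewrite dotDr dotNr. Qed.

Lemma dot0l n (u : 'rV[R]_n) : dot 0 u = 0.
Proof. by rewrite /dot mul0mx mxE. Qed.

Lemma dot_mulmxl n p (u : 'rV[R]_n) (A : 'M[R]_(n, p)) v : dot (u *m A) v = dot u (v *m A^T).
Proof. by rewrite /dot trmx_mul trmxK mulmxA. Qed.

Lemma dot_ge0 n (u : 'rV[R]_n) : 0 <= dot u u.
Proof. by rewrite dotE sumr_ge0 // => i _; rewrite -expr2 sqr_ge0. Qed.

Lemma dot_eq0 n (u : 'rV[R]_n) : (dot u u == 0) = (u == 0).
Proof.
rewrite dotE psumr_eq0 => [|i _]; last by rewrite -expr2 sqr_ge0.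
apply/allP/eqP => [h|-> i _]; last by rewrite mxE mul0r eqxx implybT.
apply/rowP => i; rewrite mxE; have := h i (mem_index_enum i).
by rewrite /= mulf_eq0 orbb => /eqP.
Qed.

Lemma enorm_ge0 n (u : 'rV[R]_n) : 0 <= enorm u. Proof. exact: sqrtr_ge0. Qed.

Lemma enorm_sqr n (u : 'rV[R]_n) : enorm u ^+ 2 = dot u u.
Proof. by rewrite sqr_sqrtr // dot_ge0. Qed.

Lemma enorm_eq0 n (u : 'rV[R]_n) : (enorm u == 0) = (u == 0).
Proof. by rewrite -dot_eq0 -enorm_sqr expf_eq0. Qed.

Lemma enorm_gt0 n (u : 'rV[R]_n) : (0 < enorm u) = (u != 0).
Proof. by rewrite lt_def enorm_ge0 andbT enorm_eq0. Qed.

Lemma enorm0 n : enorm (0 : 'rV[R]_n) = 0.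
Proof. by apply/eqP; rewrite enorm_eq0. Qed.

Lemma enormZ n c (u : 'rV[R]_n) : enorm (c *: u) = `|c| * enorm u.
Proof. by rewrite /enorm dotZl dotZr mulrA sqrtrM -expr2 ?sqr_ge0 // sqrtr_sqr. Qed.

Lemma enormN n (u : 'rV[R]_n) : enorm (- u) = enorm u.
Proof. by rewrite /enorm dotNl dotNr opprK. Qed.

Lemma dot_le_enorm n (u v : 'rV[R]_n) : dot u v <= enorm u * enorm v.
Proof.
have [->|v0] := eqVneq v 0; first by rewrite enorm0 mulr0 dotC dot0l.
have vv0 : 0 < enorm v by rewrite enorm_gt0.
have [->|u0] := eqVneq u 0; first by rewrite enorm0 dot0l mul0r.
have uu0 : 0 < enorm u by rewrite enorm_gt0.
have := dot_ge0 (enorm v *: u - enorm u *: v).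
rewrite dotBl !dotBr !dotZl !dotZr -!enorm_sqr (dotC v u).
set a := enorm v; set b := enorm u; set d := dot u v => h.
have ab : 0 < b * a by rewrite mulr_gt0.
rewrite -(ler_pM2l ab); lra.
Qed.

Lemma enormD n (u v : 'rV[R]_n) : enorm (u + v) <= enorm u + enorm v.
Proof.
rewrite -(@ler_pXn2r _ 2) ?nnegrE ?addr_ge0 ?enorm_ge0 //.
rewrite enorm_sqr dotDl !dotDr -!enorm_sqr (dotC v u).
by have := dot_le_enorm u v; nra.
Qed.

Lemma enorm_norm_le n (u : 'rV[R]_n) : enorm u <= n%:R * `|u|.
Proof.
rewrite -(@ler_pXn2r _ 2) ?nnegrE ?mulr_ge0 ?enorm_ge0 //.
rewrite enorm_sqr dotE exprMn.
apply: (@le_trans _ _ (\sum_(i < n) `|u| ^+ 2)).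
  by apply: ler_sum => i _; rewrite -expr2 -real_normK ?num_real // lerXn2r ?nnegrE // rV_coord_le.
have -> : \sum_(i < n) `|u| ^+ 2 = n%:R * `|u| ^+ 2 by rewrite sumr_const card_ord mulr_natl.
apply: ler_wpM2r; first exact: sqr_ge0.
rewrite -natrX ler_nat.
by case: n u => // n _; rewrite -{1}[n.+1]expn1 leq_pexp2l.
Qed.

Lemma norm_enorm_le n (u : 'rV[R]_n) : `|u| <= enorm u.
Proof.
apply: rV_norm_le => [|i]; first exact: enorm_ge0.
rewrite -sqrtr_sqr ler_sqrt ?dot_ge0 // dotE (bigD1 i) //= -expr2 lerDl sumr_ge0 //.
by move=> j _; rewrite -expr2 sqr_ge0.
Qed.

Lemma enorm_normalize n (u : 'rV[R]_n) : u != 0 -> enorm (normalize u) = 1.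
Proof.
move=> u0; rewrite /normalize enormZ ger0_norm ?invr_ge0 ?enorm_ge0 //.
by rewrite mulVf // enorm_eq0.
Qed.

End dot.

Section oproj.
Context {R : realType} {n : nat}.
Implicit Types (E : 'M[R]_n) (u v p : 'rV[R]_n).

Lemma dot_sub_orthc E u v : (u <= E)%MS -> (v <= orthc E)%MS -> dot v u = 0.
Proof.
move=> /submxP[a ->]; rewrite /orthc => /sub_kermxP vE.
by rewrite /dot trmx_mul mulmxA vE mul0mx mxE.
Qed.

Lemma sub_orthcP E v : (forall u, (u <= E)%MS -> dot v u = 0) -> (v <= orthc E)%MS.
Proof.
move=> vE; apply/sub_kermxP/rowP => i; rewrite [RHS]mxE.
have := vE (row i E) (row_sub i E); rewrite /dot tr_row => <-.
by rewrite -colE_subproof || rewrite !mxE; apply: eq_bigr => j _; rewrite !mxE.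
Qed.

Lemma orthc_direct E : (E :&: orthc E = 0)%MS.
Proof.
apply/eqP; rewrite -submx0; apply/row_subP => i; set u := row i _.
have : (u <= E :&: orthc E)%MS by exact: row_sub.
rewrite sub_capmx => /andP[uE uo].
by rewrite submx0 -dot_eq0 (dot_sub_orthc uE uo).
Qed.

Lemma orthc_full E v : (v <= E + orthc E)%MS.
Proof.
have : row_full (E + orthc E)%MS.
  have := mxrank_sum_cap E (orthc E); rewrite orthc_direct mxrank0 addn0 /orthc mxrank_ker.
  by rewrite mxrank_tr subnKC ?rank_leq_row // /row_full => ->.
by rewrite -sub1mx => /(submx_trans (submx1 v)).
Qed.

Lemma oproj_sub E v : (oproj E v <= E)%MS. Proof. exact: proj_mx_sub. Qed.

Lemma oproj_compl E v : (v - oproj E v <= orthc E)%MS.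
Proof. by apply: proj_mx_compl_sub; exact: orthc_full. Qed.

Lemma oproj_dot E v u : (u <= E)%MS -> dot (v - oproj E v) u = 0.
Proof. by move=> uE; apply: dot_sub_orthc uE _; exact: oproj_compl. Qed.

Lemma oprojP E v p : (p <= E)%MS -> (forall u, (u <= E)%MS -> dot (v - p) u = 0) ->
  oproj E v = p.
Proof.
move=> pE pv; apply/eqP; rewrite -subr_eq0 -dot_eq0.
have dE : (oproj E v - p <= E)%MS by rewrite addmx_sub ?oproj_sub // eqmx_opp.
have -> : oproj E v - p = (v - p) - (v - oproj E v) by move: (oproj E v) => w; vring.
set d := v - p - _; have dE' : (d <= E)%MS.
  by rewrite (_ : d = oproj E v - p) //; rewrite /d; move: (oproj E v) => w; vring.
by rewrite dotBl pv // oproj_dot // subrr.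
Qed.

Lemma oprojD E u v : oproj E (u + v) = oproj E u + oproj E v.
Proof. exact: mulmxDl. Qed.

Lemma oprojZ E c v : oproj E (c *: v) = c *: oproj E v.
Proof. by rewrite /oproj -scalemxAl. Qed.

Lemma oprojB E u v : oproj E (u - v) = oproj E u - oproj E v.
Proof. exact: mulmxBl. Qed.

Lemma oproj_enorm_le E v : enorm (oproj E v) <= enorm v.
Proof.
rewrite -(@ler_pXn2r _ 2) ?nnegrE ?enorm_ge0 // !enorm_sqr.
have := oproj_dot v (oproj_sub E v); rewrite dotBl => /eqP; rewrite subr_eq0 => /eqP h.
have := dot_ge0 (v - oproj E v); rewrite dotBl !dotBr (dotC _ v) h.
by rewrite -h; lra.
Qed.

End oproj.

Section tangent.
Context {R : realType} (G : carnot R).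
Local Notation n := (cdim G).
Implicit Types (E : 'M[R]_n) (N u v : 'rV[R]_n).

(** The projection on [TiS i N] in closed form: cut [v] to the first [i] layers and remove its
    component along the equally cut normal [Ni]. For [Ni = 0] the correction vanishes. Measurability
    in the point is read off from this formula. *)
Definition flag_proj (i : nat) N v : 'rV[R]_n :=
  let Ni := N *m flag G i in v *m flag G i - (dot v Ni / dot Ni Ni) *: Ni.

Lemma oproj_TS N v : dot N N = 1 -> oproj (TS N) v = v - dot v N *: N.
Proof.
move=> N1; apply: oprojP.
  apply/sub_kermxP/rowP => i; rewrite ord1 -[LHS]/(dot _ N) dotBl dotZl N1 mulr1 subrr.
  by rewrite mxE.
move=> u /sub_kermxP/rowP/(_ 0); rewrite -[LHS]/(dot u N) mxE => uN.
by rewrite opprB addrC subrK dotZl (dotC N) uN mulr0.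
Qed.

Lemma sub_TSP N v : reflect (dot v N = 0) (v <= TS N)%MS.
Proof.
apply: (iffP sub_kermxP) => [/rowP/(_ 0)|vN]; first by rewrite -[LHS]/(dot v N) mxE.
by apply/rowP => i; rewrite ord1 -[LHS]/(dot v N) vN mxE.
Qed.

Lemma orthc_TS_tangent E N v : dot N N = 1 ->
  (E <= TS N)%MS -> oproj E (oproj (TS N) v) = oproj E v.
Proof.
move=> N1 EN; rewrite oproj_TS // oprojB oprojZ; suff -> : oproj E N = 0 by rewrite scaler0 subr0.
apply: oprojP; first exact: sub0mx.
by move=> u uE; rewrite subr0 dotC; apply/sub_TSP; exact: submx_trans uE EN.
Qed.

Lemma flag_tr i : (flag G i)^T = flag G i. Proof. exact: tr_diag_mx. Qed.

Lemma flag_mul i j : (i <= j)%N -> flag G i *m flag G j = flag G i.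
Proof.
move=> ij; rewrite /flag mulmx_diag; congr diag_mx; apply/rowP => a; rewrite !mxE.
case: leqP => ai; last by rewrite mul0r.
by rewrite (leq_trans ai ij) mulr1.
Qed.

Lemma sub_flagP i v : reflect (v *m flag G i = v) (v <= flag G i)%MS.
Proof.
apply: (iffP submxP) => [[a ->]|<-]; last by exists v.
by rewrite -mulmxA flag_mul.
Qed.

Lemma sub_TiSP i N v : reflect (dot v N = 0 /\ v *m flag G i = v) (v <= TiS i N)%MS.
Proof.
rewrite /TiS sub_capmx; apply: (iffP andP) => -[].
  by move=> /sub_TSP ? /sub_flagP.
by move=> ? ?; split; [exact/sub_TSP|exact/sub_flagP].
Qed.

Lemma oproj_TiS i N v : oproj (TiS i N) v = flag_proj i N v.
Proof.
set Ni := N *m flag G i; have NiN u : dot (u *m flag G i) N = dot u Ni.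
  by rewrite dot_mulmxl flag_tr.
have Nif : Ni *m flag G i = Ni by rewrite /Ni -mulmxA flag_mul.
apply: oprojP.
  apply/sub_TiSP; split; last by rewrite mulmxBl -mulmxA flag_mul // -scalemxAl Nif.
  have NiNi : dot Ni N = dot Ni Ni by rewrite -{1}Nif NiN.
  rewrite /flag_proj -/Ni dotBl dotZl NiN NiNi.
  have [d0|d0] := eqVneq (dot Ni Ni) 0; last by rewrite divfK ?subrr.
  have N0 : Ni = 0 by apply/eqP; rewrite -dot_eq0 d0.
  by rewrite d0 mulr0 subr0 N0 dotC dot0l.
move=> u /sub_TiSP[uN uf]; rewrite /flag_proj -/Ni opprB addrA addrAC dotDl dotZl.
have -> : dot Ni u = 0 by rewrite -uN dotC -NiN uf.
rewrite mulr0 addr0 dotBl (_ : dot (v *m flag G i) u = dot v u) ?subrr //.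
by rewrite dot_mulmxl flag_tr uf.
Qed.

(** [TiS i.-1 N] lies in [TiS i N], so projecting on its orthogonal complement there amounts to a
    difference of projections. *)
Lemma oproj_HiS i N v : (0 < i)%N ->
  oproj (HiS i N) v = flag_proj i N v - flag_proj i.-1 N v.
Proof.
move=> i0; rewrite -!oproj_TiS; set p := oproj (TiS i N) v; set q := oproj (TiS i.-1 N) v.
have sub u : (u <= TiS i.-1 N)%MS -> (u <= TiS i N)%MS.
  move=> /sub_TiSP[uN uf]; apply/sub_TiSP; split => //.
  by rewrite -{1}uf -mulmxA flag_mul ?leq_pred.
apply: oprojP.
  rewrite /HiS sub_capmx; apply/andP; split.
    by rewrite addmx_sub ?oproj_sub // eqmx_opp sub // oproj_sub.
  apply: sub_orthcP => u uT.
  have -> : p - q = (v - q) - (v - p) by move: p q => a b; vring.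
  by rewrite dotBl !oproj_dot ?subrr // sub.
move=> u; rewrite /HiS sub_capmx => /andP[uT uo].
have -> : v - (p - q) = (v - p) + q by move: p q => a b; vring.
by rewrite dotDl oproj_dot // add0r dotC (dot_sub_orthc (oproj_sub _ _) uo).
Qed.

Lemma layer1_flag : layer G 1 = flag G 1.
Proof.
congr diag_mx; apply/rowP => a; rewrite !mxE; congr (_%:R).
by have /andP[+ _] := cdeg_bounds a; case: (cdeg a) => [//|[]].
Qed.

Lemma oproj_HS N v : oproj (HS N) v = flag_proj 1 N v.
Proof.
rewrite -oproj_TiS; apply: oprojP.
  by rewrite /HS layer1_flag capmxC; exact: oproj_sub.
move=> u; rewrite /HS layer1_flag => uH; apply: oproj_dot.
by move: uH; rewrite /TiS !sub_capmx andbC.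
Qed.

Lemma P_HE v : P_H v = v *m flag G 1.
Proof.
rewrite /P_H layer1_flag; apply: oprojP; first exact: submxMl.
move=> u /sub_flagP uf; rewrite dotBl dot_mulmxl flag_tr uf subrr //.
Qed.

Lemma HS_TS N : (HS N <= TS N)%MS. Proof. exact: capmxSr. Qed.

Lemma HiS_TS i N : (HiS i N <= TS N)%MS.
Proof. exact: submx_trans (capmxSl _ _) (capmxSl _ _). Qed.

End tangent.

Section Gram.
Context {R : realType}.

Definition gram p n (D : 'M[R]_(p, n)) : R := \det (D *m D^T).

Lemma gram_dot p n (D : 'I_p -> 'rV[R]_n) :
  \det (\matrix_(i, j) dot (D i) (D j)) = gram (\matrix_i D i).
Proof.
congr (\det _); apply/matrixP => i j; rewrite !mxE dotE; apply: eq_bigr => k _.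
by rewrite !mxE.
Qed.

Lemma gram_mull p n (A : 'M[R]_p) (D : 'M[R]_(p, n)) : gram (A *m D) = \det A ^+ 2 * gram D.
Proof. by rewrite /gram trmx_mul !mulmxA det_mulmx det_tr -mulmxA det_mulmx mulrAC -expr2. Qed.

(** With a normal row stacked below [D], the Gram matrix becomes block diagonal. *)
Lemma gram_normal p (D : 'M[R]_(p, p + 1)) (N : 'rV[R]_(p + 1)) :
  D *m N^T = 0 -> \det (col_mx D N) ^+ 2 = gram D * dot N N.
Proof.
move=> DN; rewrite expr2 -[X in _ * X]det_tr -det_mulmx tr_col_mx mul_col_row DN.
have -> : N *m D^T = 0 by rewrite -[LHS]trmxK trmx_mul trmxK DN trmx0.
by rewrite det_ublock /gram; congr (_ * _); rewrite [N *m N^T]mx11_scalar det_scalar1.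
Qed.

(* The vector [g] is the gradient of the first coordinate in the coordinates
   whose frame is [D]. *)
Lemma gram_slice m n (D : 'M[R]_(m.+1, n)) (g : 'rV[R]_n) : (g <= D)%MS ->
  D *m g^T = delta_mx 0 0 -> gram (@dsubmx _ 1 m n D) = dot g g * gram D.
Proof.
move=> /submxP[c gE] Dg.
have gg : dot g g = c 0 0.
  by rewrite /dot {1}gE -mulmxA Dg mxE (bigD1 0) //= mxE eqxx mulr1 big1 ?addr0 // => i i0;
     rewrite mxE (negbTE i0) mulr0.
have g0 : dot g g != 0.
  rewrite dot_eq0; apply/eqP => g0; move: Dg; rewrite g0 trmx0 mulmx0.
  by move/matrixP/(_ 0 0); rewrite !mxE eqxx => /eqP; rewrite eq_sym oner_eq0.
pose D' : 'M[R]_(m, n) := @dsubmx _ 1 m n D.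
(* [T] replaces the first row of [D] by [g], which is orthogonal to the other rows, so the Gram
   matrix of [T *m D] is block diagonal. Its determinant [c 0 0] equals [dot g g], one factor of
   which cancels at the end. *)
pose T : 'M[R]_(1 + m) := block_mx (c 0 0)%:M (@rsubmx _ 1 1 m c) 0 1%:M.
have TD : T *m (D : 'M[R]_(1 + m, n)) = col_mx g D'.
  rewrite -{1}[D](@vsubmxK _ 1 m n) mul_block_col mul0mx add0r mul1mx; congr col_mx.
  have : @row_mx _ 1 1 m (@lsubmx _ 1 1 m c) (@rsubmx _ 1 1 m c)
      *m @col_mx _ 1 m n (@usubmx _ 1 m n D) (@dsubmx _ 1 m n D) = g.
    by rewrite hsubmxK vsubmxK -gE.
  rewrite mul_row_col => <-; congr (_ *m _ + _); apply/rowP => i.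
  by rewrite !ord1 !mxE eqxx mulr1n; congr (c _ _); exact/val_inj.
have dT : \det T = c 0 0 by rewrite det_ublock det1 mulr1 det_scalar1.
have D'g : D' *m g^T = 0.
  rewrite /D' mul_dsub_mx Dg; by apply/matrixP => i j; rewrite !mxE.
have G1 : gram (T *m (D : 'M[R]_(1 + m, n))) = dot g g * gram D'.
  rewrite TD /gram tr_col_mx mul_col_row D'g det_ublock; congr (_ * _).
  by rewrite [g *m g^T]mx11_scalar det_scalar1.
have := gram_mull T D; rewrite G1 dT -gg expr2 -mulrA => /(mulfI g0) ->.
by [].
Qed.

End Gram.

Definition smooth (R : realType) n (f : 'rV[R]_n -> R) := forall r, Ck r setT f.

(** * The left-invariant frame in exponential coordinates *)

Section smooth_functions.
Context {R : realType} {n : nat}.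
Implicit Types f g : 'rV[R]_n -> R.

Lemma smooth_partial f j : smooth f -> smooth (fun x => 'D_(ee j) f x).
Proof. by move=> sf r; have [_ /(_ j)[]] := sf r.+1. Qed.

Lemma smoothB f g : smooth f -> smooth g -> smooth (fun x => f x - g x).
Proof. by move=> sf sg r; apply: CkB => //; exact: openT. Qed.

Lemma smoothM f g : smooth f -> smooth g -> smooth (fun x => f x * g x).
Proof. by move=> sf sg r; apply: CkM => //; exact: openT. Qed.

Lemma smooth_cst (c : R) : smooth ((fun=> c) : 'rV[R]_n -> R). Proof. by move=> r; exact: Ck_cst. Qed.

Lemma smooth_sum I (s : seq I) (F : I -> 'rV[R]_n -> R) :
  (forall i, smooth (F i)) -> smooth (fun x => \sum_(i <- s) F i x).
Proof. by move=> sF r; apply: Ck_sum => // [|i]; [exact: openT|exact: sF]. Qed.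

Lemma smooth_derivable f x v : smooth f -> derivable f x v.
Proof. by move=> sf; apply: (C1_derivable openT (sf 1%N)). Qed.

Lemma smooth_deriveE f x v : smooth f -> 'D_v f x = \sum_j v 0 j * 'D_(ee j) f x.
Proof. by move=> sf; apply: (C1_deriveE v openT (sf 1%N)). Qed.

Lemma grad_comp p (F : 'rV[R]_n -> 'rV[R]_p) (f : 'rV[R]_p -> R) U V x :
  open U -> open V -> C1map U F -> Ck 1 V f -> U x -> V (F x) ->
  grad (fun y => f (F y)) x = grad f (F x) *m (jac F x)^T.
Proof.
move=> oU oV FU fV Ux VFx; apply/rowP => j; rewrite !mxE.
have [_ ->] := C1_chain oV fV VFx (C1map_is_derive (ee j) oU FU Ux).
by apply: eq_bigr => k _; rewrite -rowE !mxE mulrC.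
Qed.

(* Both mixed partials are limits of the second difference quotient. *)
Lemma Schwarz f i j x : Ck 2 setT f ->
  'D_(ee i) (fun y => 'D_(ee j) f y) x = 'D_(ee j) (fun y => 'D_(ee i) f y) x.
Proof.
move=> f2; have f1 : Ck 1 setT f by exact: CkS.
have df y v : derivable f y v by apply: (C1_derivable openT f1).
have Cd k : Ck 1 setT (fun y => 'D_(ee k) f y) by have [_ /(_ k)[]] := f2.
have ddf k y v : derivable (fun y => 'D_(ee k) f y) y v by apply: (C1_derivable openT (Cd k)).
have [D2 D2E] : exists D2 : 'I_n -> 'I_n -> 'rV[R]_n -> R,
    D2 = fun k l y => 'D_(ee k) (fun y => 'D_(ee l) f y) y by exists (fun k l y => 'D_(ee k) (fun y => 'D_(ee l) f y) y).
have cD2 k l : {for x, continuous (D2 k l)} by rewrite D2E; have [_ /(_ k)[_ [+ _]]] := Cd l; exact.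
have diffq (k l : 'I_n) (t : R) : 0 < t -> exists s1 s2 : R, [/\ 0 <= s1 <= t, 0 <= s2 <= t &
    f (x + t *: ee k + t *: ee l) - f (x + t *: ee k) - (f (x + t *: ee l) - f x)
    = t * t * D2 l k (x + s1 *: ee k + s2 *: ee l)].
  move=> t0; pose g y := f (y + t *: ee l) - f y.
  have dshift y : is_derive y (ee k) (fun z => f (z + t *: ee l)) ('D_(ee k) f (y + t *: ee l)).
    have [d1 d2] := derivableP (df (y + t *: ee l) (ee k)).
    have E : (fun h => h^-1 *: (((fun z => f (z + t *: ee l)) \o shift y) (h *: ee k) -
       f (y + t *: ee l))) = (fun h => h^-1 *: ((f \o shift (y + t *: ee l)) (h *: ee k) -
       f (y + t *: ee l))) by apply/funext => h /=; rewrite addrA.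
    by apply: DeriveDef; [rewrite /derivable E|rewrite /derive E].
  have dg y : is_derive y (ee k) g ('D_(ee k) f (y + t *: ee l) - 'D_(ee k) f y).
    by apply: is_deriveB; exact/derivableP/df.
  have [s|s1 s1t E1] := @MVT_line _ _ g x (ee k) t; first by move=> _; case: (dg (x + s *: ee k)).
  have [s|s2 s2t E2] := @MVT_line _ _ (fun y => 'D_(ee k) f y) (x + s1 *: ee k) (ee l) t.
    by move=> _; exact: ddf.
  have nn s : (0 <= s <= t) || (t <= s <= 0) -> 0 <= s <= t by case/orP => //; lra.
  exists s1, s2; split; [exact: nn|exact: nn|].
  have [_ dgE] := dg (x + s1 *: ee k).
  have -> : f (x + t *: ee k + t *: ee l) - f (x + t *: ee k) - (f (x + t *: ee l) - f x)
    = g (x + t *: ee k) - g x by [].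
  by rewrite E1 dgE E2 mulrA D2E.
have -> : 'D_(ee i) (fun y => 'D_(ee j) f y) x = D2 i j x by rewrite D2E.
have -> : 'D_(ee j) (fun y => 'D_(ee i) f y) x = D2 j i x by rewrite D2E.
move: D2 {D2E} cD2 diffq => D2 cD2 diffq.
apply/eqP; rewrite -subr_eq0 -normr_le0; apply/ler_addgt0Pl => e e0; rewrite addr0.
have FF := nbhs_filter x; have e20 : 0 < e / 2 by rewrite divr_gt0.
have near2 k l : \forall y \near x, `|D2 k l x - D2 k l y| <= e / 2.
  by have /cvgrPdist_le := cD2 k l; apply.
have /nbhs_ballP[d /= d0 dP] := @filterI _ _ FF _ _ (near2 i j) (near2 j i).
have t0 : 0 < d / 4 by rewrite divr_gt0.
have [s1 [s2 [s1t s2t E1]]] := diffq i j _ t0.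
have [s3 [s4 [s3t s4t E2]]] := diffq j i _ t0.
have inB (k l : 'I_n) (s s' : R) : 0 <= s <= d / 4 -> 0 <= s' <= d / 4 ->
    ball x d (x + s *: ee k + s' *: ee l).
  move=> /andP[? ?] /andP[? ?]; apply/ballN.
  have -> : x - (x + s *: ee k + s' *: ee l) = - (s *: ee k + s' *: ee l) by vring.
  rewrite normrN (le_lt_trans (ler_normD _ _)) // !normrZ.
  have ne (k' : 'I_n) : `|ee k' : 'rV[R]_n| <= 1.
    by apply: rV_norm_le => // a; rewrite mxE; case: andP => _; rewrite ?normr1 ?normr0.
  rewrite !ger0_norm //; have := ne k; have := ne l.
  have := normr_ge0 (ee k : 'rV[R]_n); have := normr_ge0 (ee l : 'rV[R]_n); nra.
have E : D2 j i (x + s1 *: ee i + s2 *: ee j) = D2 i j (x + s3 *: ee j + s4 *: ee i).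
  have : d / 4 * (d / 4) != 0 by rewrite mulf_neq0 ?gt_eqF.
  move=> /mulfI; apply; rewrite -E1 -E2.
  rewrite [x + _ *: ee j + _ *: ee i]addrAC; move: (f _) (f _) (f _) (f _) => *; ring.
have [P1 _] := dP (x + s3 *: ee j + s4 *: ee i) (inB j i _ _ s3t s4t); have [_ P2] := dP (x + s1 *: ee i + s2 *: ee j) (inB i j _ _ s1t s2t).
rewrite (splitr e).
rewrite -(subrKA (D2 i j (x + s3 *: ee j + s4 *: ee i))) (le_trans (ler_normD _ _)) //.
by rewrite lerD // -E distrC.
Qed.

End smooth_functions.

(** The Gronwall argument for the sum [k] of the squares. The equation is assumed on the open
    interval only, since the coefficients to which it is applied contain a division by [t]. *)
Lemma linear_ode_zero (R : realType) n (K : 'I_n -> R -> R) (C : 'I_n -> 'I_n -> R -> R) :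
  (forall j (t : R), 0 < t < 1 -> is_derive t 1 (K j) (\sum_l C j l t * K l t)) ->
  (forall j l, exists c, forall t : R, 0 < t < 1 -> `|C j l t| <= c) ->
  (forall j, continuous (K j)) -> (forall j, K j 0 = 0) ->
  forall j, K j 1 = 0.
Proof.
move=> dK /= Cc0 cK K0 j0.
have [c Cc] : exists c, forall j l (t : R), 0 < t < 1 -> `|C j l t| <= c.
  have /choice[c cP] : forall jl, exists c, forall t : R, 0 < t < 1 -> `|C jl.1 jl.2 t| <= c.
    by move=> jl; exact: Cc0.
  exists (\sum_jl `|c jl|) => j l t t01; rewrite (le_trans (cP (j, l) t t01)) //.
  by rewrite (bigD1 (j, l)) //= (le_trans (ler_norm _)) // lerDl sumr_ge0.
pose k t := \sum_j K j t ^+ 2.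
(* Each term [2 * K j * C j l * K l] is at most [c * (K j ^+ 2 + K l ^+ 2)], and summing this over
   [j] and [l] gives [2 n c] times [k]. *)
pose a : R := 2 * n%:R * c.
pose E t := k t * expR (- a * t).
pose kd t := \sum_j 2 * (K j t * \sum_l C j l t * K l t).
have dk (t : R) : 0 < t < 1 -> is_derive t 1 k (kd t).
  move=> t01; rewrite (_ : k = \sum_j (fun t => K j t ^+ 2)); last first.
    by apply/funext => s; rewrite /k fct_sumE.
  have H (j : 'I_n) : is_derive t 1 (fun t => K j t ^+ 2) (2 * (K j t * \sum_l C j l t * K l t)).
    rewrite (_ : (fun t => _) = K j * K j); last by apply/funext => u; rewrite expr2.
    by apply: is_derive_eq (is_deriveM (dK j t t01) (dK j t t01)) _; rewrite /GRing.scale /=; ring.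
  apply: is_derive_eq (is_derive_sum (fun j => H j)) _.
  by [].
have kdle (t : R) : 0 < t < 1 -> kd t <= a * k t.
  move=> t01; have c0 : 0 <= c.
    exact: le_trans (normr_ge0 _) (Cc j0 j0 t t01).
  have -> : a * k t = \sum_(j < n) \sum_(l < n) c * (K j t ^+ 2 + K l t ^+ 2).
    under eq_bigr do rewrite -mulr_sumr big_split /= sumr_const card_ord -/(k t).
    rewrite -mulr_sumr big_split /= sumr_const card_ord sumrMnl -/(k t) /a.
    by rewrite -[k t *+ n]mulr_natl; ring.
  apply: ler_sum => j _; rewrite mulrCA mulr_sumr mulr_sumr; apply: ler_sum => l _.
  have : - c <= C j l t <= c by rewrite -ler_norml Cc.
  move: (C j l t) (K j t) (K l t) => x y z /andP[h1 h2].
  have : 0 <= (c + x) * (y - z) ^+ 2 by rewrite mulr_ge0 ?sqr_ge0 //; lra.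
  have : 0 <= (c - x) * (y + z) ^+ 2 by rewrite mulr_ge0 ?sqr_ge0 //; lra.
  by rewrite -subr_ge0 => p1 p2; nra.
have dE (t : R) : 0 < t < 1 -> is_derive t 1 E ((kd t - a * k t) * expR (- a * t)).
  move=> t01; have de : is_derive t 1 (fun t => expR (- a * t)) (- a * expR (- a * t)).
    have := is_derive1_comp (is_derive_expR (- a * t)) (is_deriveZ (- a) (is_derive_id t (1 : R))).
    move=> H; apply: is_derive_eq H _; rewrite /GRing.scale /=; ring.
  apply: is_derive_eq (is_deriveM (dk t t01) de) _.
  by rewrite /GRing.scale /=; ring.
have cE : {within `[0, 1], continuous E}.
  apply: continuous_subspaceT => s; apply: continuousM.
    apply: (continuous_sumr (f := fun j t => K j t ^+ 2)) => j.
    by apply: (@continuous_comp _ _ _ (K j) (fun x : R => x ^+ 2)); [exact: cK|exact: exprn_continuous].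
  apply: (@continuous_comp _ _ _ (fun t : R => - a * t) expR); last exact: continuous_expR.
  by apply: cvgM; [exact: cvg_cst|exact: cvg_id].
have E10 : E 1 <= E 0.
  apply: (ler0_derive1_le_cc _ _ cE); rewrite ?in_itv /= ?lexx ?ler01 //.
    by move=> t; rewrite in_itv /= => t01; case: (dE t t01).
  move=> t; rewrite in_itv /= => t01; have [_ d] := dE t t01.
  by rewrite derive1E d mulr_le0_ge0 ?expR_ge0 // subr_le0 kdle.
have k0 : k 0 = 0 by rewrite /k big1 // => j _; rewrite K0 expr0n.
have k1 : k 1 <= 0.
  by move: E10; rewrite /E k0 mul0r pmulr_lle0 // expR_gt0.
apply/eqP; rewrite -sqrf_eq0 eq_le sqr_ge0 andbT (le_trans _ k1) //.
by rewrite /k (bigD1 j0) //= lerDl sumr_ge0 // => l _; exact: sqr_ge0.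
Qed.

Lemma mxBE (R : realType) p q (A B : 'M[R]_(p, q)) i j : (A - B) i j = A i j - B i j.
Proof. by rewrite !mxE. Qed.

Section group.
Context {R : realType} (G : carnot R).
Local Notation n := (cdim G).
Local Notation pt := 'rV[R]_n.
Local Notation M := (@cmul R G).
Implicit Types (x y u v : pt) (f g : pt -> R).

Lemma cmul_Ck r p (U : set 'rV[R]_p) (A B : 'rV[R]_p -> pt) i : open U ->
  (forall i, Ck r U (fun t => A t 0 i)) -> (forall i, Ck r U (fun t => B t 0 i)) ->
  Ck r U (fun t => M (A t) (B t) 0 i).
Proof.
move=> oU AU BU.
have -> : (fun t => M (A t) (B t) 0 i) = (fun t => (fun z : 'rV[R]_(n + n) =>
    M (lsubmx z) (rsubmx z) 0 i) (row_mx (A t) (B t))).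
  by apply/funext => t /=; rewrite row_mxKl row_mxKr.
apply: (Ck_comp openT oU _ _ (cmul_smooth r i)) => // k.
case: (split_ordP k) => l ->.
  by apply: Ck_eq oU _ (AU l) => u _; rewrite row_mxEl.
by apply: Ck_eq oU _ (BU l) => u _; rewrite row_mxEr.
Qed.

Lemma cmul_C1map x : C1map setT (M x).
Proof. by move=> i; apply: cmul_Ck => [|k|k]; [exact: openT|exact: Ck_cst|exact: Ck_coord]. Qed.

Lemma frame_jac x : frame x = jac (M x) 0.
Proof.
apply/row_matrixP => j; rewrite rowK.
by rewrite (row_jac _ openT (cmul_C1map x)).
Qed.

Lemma left_field_frame u x : left_field M u x = u *m frame x.
Proof. by rewrite frame_jac; have [_ H] := C1map_is_derive u openT (cmul_C1map x) (I : setT (0 : pt)); rewrite /left_field H. Qed.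

Lemma frame_smooth j i : smooth (fun x => frame x j i).
Proof.
move=> r; pose F := (fun z : 'rV[R]_(n + n) => M (lsubmx z) (rsubmx z) 0 i).
have dF : Ck r setT (fun z => 'D_(ee (rshift n j)) F z).
  by have [_ /(_ (rshift n j))[]] := @cmul_smooth R G r.+1 i.
have -> : (fun x => frame x j i) = (fun x => (fun z => 'D_(ee (rshift n j)) F z) (row_mx x 0)).
  apply/funext => x; rewrite frame_jac mxE.
  have E : (fun h : R => h^-1 *: (((fun y => M x y 0 i) \o shift 0) (h *: ee j) - M x 0 0 i)) =
    (fun h => h^-1 *: ((F \o shift (row_mx x 0)) (h *: ee (rshift n j)) - F (row_mx x 0))).
    apply/funext => h /=; rewrite /F row_mxKl row_mxKr.
    have -> : h *: ee (rshift n j) + row_mx x 0 = row_mx x (h *: ee j + 0) :> 'rV[R]_(n + n).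
      apply/rowP => k; rewrite [LHS]mxE [X in X + _]mxE [X in _ * X]mxE eqxx andTb.
      case: (split_ordP k) => l ->; rewrite ?row_mxEl ?row_mxEr.
        by rewrite eq_lrshift mulr0 add0r.
      by rewrite eq_rshift !mxE eqxx.
    by rewrite row_mxKl row_mxKr.
  by rewrite /derive E.
apply: (Ck_comp openT openT _ _ dF) => // k; case: (split_ordP k) => l ->.
  by apply: (Ck_eq openT _ (Ck_coord _ _ l)) => u _; rewrite row_mxEl.
by apply: (Ck_eq openT _ (Ck_cst _ _ 0)) => u _; rewrite row_mxEr mxE.
Qed.

Lemma cmulNx x : M (- x) x = 0.
Proof. by have := @cmul_exp _ G (-1) 1 x; rewrite scaleN1r scale1r addNr scale0r. Qed.

(** Left invariance, as the chain rule for associativity. *)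
Lemma frame_mul x y : frame (M x y) = frame y *m jac (M x) y.
Proof.
rewrite !frame_jac -{3}(cmulx0 y) -(jac_comp openT openT (cmul_C1map y) (cmul_C1map x)) //.
by rewrite (_ : M (M x y) = fun z => M x (M y z)) //; apply/funext => z; rewrite cmulA.
Qed.

Lemma frame0 : frame (0 : pt) = 1%:M.
Proof.
by rewrite frame_jac (_ : M 0 = id) ?jac_id //; apply/funext => z; exact: cmul0x.
Qed.

Lemma jac_cmul_unit x y : jac (M x) y \in unitmx.
Proof.
have H : jac (M x) y *m jac (M (- x)) (M x y) = 1%:M.
  rewrite -(jac_comp openT openT (cmul_C1map x) (cmul_C1map (- x))) // -(jac_id y).
  by rewrite (_ : (fun z => _) = id) //; apply/funext => z; rewrite cmulA cmulNx cmul0x.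
by have [] := mulmx1_unit H.
Qed.

Lemma frame_unit x : frame x \in unitmx.
Proof. by rewrite frame_jac jac_cmul_unit. Qed.

Lemma frame_ray x : x *m frame x = x.
Proof.
rewrite -left_field_frame /left_field.
have H : is_derive (0 : pt) x (M x) x.
  apply: is_derive_affine => h; rewrite addr0 cmulx0 -{1 4}[x]scale1r.
  by rewrite cmul_exp scalerDl scale1r.
by case: H.
Qed.

Lemma rgrad_grad U f x : open U -> Ck 1 U f -> U x -> rgrad f x = grad f x *m (frame x)^T.
Proof.
move=> oU fU Ux; apply/rowP => j; rewrite !mxE (C1_deriveE _ oU fU Ux).
by apply: eq_bigr => i _; rewrite /frame !mxE mulrC.
Qed.

Lemma grad_rgrad U f x : open U -> Ck 1 U f -> U x -> grad f x = rgrad f x *m invmx (frame x)^T.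
Proof. by move=> oU fU Ux; rewrite (rgrad_grad oU fU Ux) mulmxK // unitmx_tr frame_unit. Qed.

(** The left-invariant vector field equal to [u] at 0, acting on functions as a differential
    operator. *)
Definition lop u f x : R := dot (u *m frame x) (grad f x).

Lemma lopE u f x : lop u f x = \sum_j (u *m frame x) 0 j * 'D_(ee j) f x.
Proof. by rewrite /lop dotE; apply: eq_bigr => j _; rewrite [grad _ _ _ _]mxE. Qed.

Lemma lop_smooth u f : smooth f -> smooth (lop u f).
Proof.
move=> sf; rewrite (_ : lop u f = fun x => \sum_j (u *m frame x) 0 j * 'D_(ee j) f x); last first.
  by apply/funext => x; rewrite lopE.
apply: smooth_sum => j; apply: smoothM; last exact: smooth_partial.
rewrite (_ : (fun x => _) = fun x => \sum_k u 0 k * frame x k j); last first.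
  by apply/funext => x; rewrite mxE.
by apply: smooth_sum => k; apply: smoothM; [exact: smooth_cst|exact: frame_smooth].
Qed.

Lemma lopB u f g x : smooth f -> smooth g ->
  lop u (fun x => f x - g x) x = lop u f x - lop u g x.
Proof.
move=> sf sg; rewrite !lopE -sumrB; apply: eq_bigr => j _.
by rewrite -mulrBr deriveB //; exact: smooth_derivable.
Qed.

Lemma lop_shift u f x y : smooth f -> lop u f (M x y) = lop u (fun y => f (M x y)) y.
Proof.
move=> sf; rewrite /lop (grad_comp openT openT (cmul_C1map x) (sf 1%N)) //.
by rewrite frame_mul mulmxA dot_mulmxl.
Qed.

Lemma deriveMsum I (s : seq I) (a b : I -> pt -> R) x v :
  (forall j, smooth (a j)) -> (forall j, smooth (b j)) ->
  'D_v (fun x => \sum_(j <- s) a j x * b j x) x =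
  \sum_(j <- s) ('D_v (a j) x * b j x + a j x * 'D_v (b j) x).
Proof.
move=> sa sb; elim: s => [|j s IH].
  rewrite big_nil (_ : (fun x => _) = fun=> 0); first by rewrite derive_cst.
  by apply/funext => y; rewrite big_nil.
rewrite big_cons -IH (_ : (fun x => _) = (a j * b j) + (fun x => \sum_(j <- s) a j x * b j x)).
  have da : derivable (a j) x v := smooth_derivable (sa j).
  have db : derivable (b j) x v := smooth_derivable (sb j).
  have ds : derivable (fun x => \sum_(j <- s) a j x * b j x) x v.
    by apply: smooth_derivable; apply: smooth_sum => i; exact: smoothM.
  by rewrite (deriveD (derivableM da db) ds) (deriveM da db) /GRing.scale /=; ring.
by apply/funext => y; rewrite big_cons.
Qed.

(** Antisymmetrised in [i] and [k], these numbers are the structure constants of the Lie algebra. *)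
Definition lie_coef (k i j : 'I_n) : R := 'D_(ee i) (fun x : pt => frame x k j) 0.

Lemma derive_mulframe u i j x :
  'D_(ee i) (fun x => (u *m frame x) 0 j) x = \sum_k u 0 k * 'D_(ee i) (fun x => frame x k j) x.
Proof.
rewrite (_ : (fun x => _) = fun x => \sum_k (fun=> u 0 k) x * frame x k j); last first.
  by apply/funext => y; rewrite mxE.
rewrite deriveMsum; [|by move=> k; exact: smooth_cst|by move=> k; exact: frame_smooth].
by apply: eq_bigr => k _; rewrite derive_cst mul0r add0r.
Qed.

Lemma mulframe_smooth u j : smooth (fun x => (u *m frame x) 0 j).
Proof.
rewrite (_ : (fun x => _) = fun x => \sum_k u 0 k * frame x k j).
  by apply: smooth_sum => k; apply: smoothM; [exact: smooth_cst|exact: frame_smooth].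
by apply/funext => x; rewrite mxE.
Qed.

Lemma mulframe_C1map u : C1map setT (fun x => u *m frame x).
Proof. by move=> j; exact: mulframe_smooth. Qed.

Lemma derive_left_field u v j :
  ('D_u (left_field M v) 0) 0 j = \sum_i \sum_k u 0 i * v 0 k * lie_coef k i j.
Proof.
have -> : left_field M v = fun x => v *m frame x by apply/funext => x; exact: left_field_frame.
have [_ ->] := C1map_is_derive u openT (mulframe_C1map v) (I : setT (0 : pt)).
rewrite mxE; apply: eq_bigr => i _; rewrite mxE derive_mulframe mulr_sumr.
by apply: eq_bigr => k _; rewrite mulrA.
Qed.

Lemma lieE u v j : lie_bracket M u v 0 j =
  \sum_i \sum_k (u 0 i * v 0 k - v 0 i * u 0 k) * lie_coef k i j.
Proof.
apply: (etrans (mxBE _ _ _ _)).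
apply: (etrans (congr2 (fun a b => a - b) (derive_left_field u v j) (derive_left_field v u j))).
rewrite -sumrB; apply: eq_bigr => i _.
by rewrite -sumrB; apply: eq_bigr => k _; rewrite mulrBl.
Qed.

Lemma lie_suml u v : lie_bracket M u v = \sum_l u 0 l *: lie_bracket M (ee l) v.
Proof.
apply/rowP => j; rewrite summxE.
under eq_bigr do rewrite mxE lieE mulr_sumr.
rewrite lieE [RHS]exchange_big /=; apply: eq_bigr => i _.
under [RHS]eq_bigr do rewrite mulr_sumr.
rewrite [RHS]exchange_big /=; apply: eq_bigr => k _.
under [RHS]eq_bigr do rewrite mulrA.
rewrite -mulr_suml; congr (_ * _); rewrite {1 2}(row_sum_delta u) !summxE mulr_suml mulr_sumr -sumrB.
by apply: eq_bigr => l _; rewrite !mxE; ring.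
Qed.

Lemma lieN u v : lie_bracket M u v = - lie_bracket M v u.
Proof. by rewrite /lie_bracket opprB. Qed.

(** The second-order parts of the two compositions cancel by [Schwarz]. The first-order parts
    differentiate the frame at 0, exactly as [lie_bracket] does. *)
Lemma lop_commutator0 u v f : smooth f ->
  lop u (lop v f) 0 - lop v (lop u f) 0 = lop (lie_bracket M u v) f 0.
Proof.
move=> sf; have E a b : lop a (lop b f) 0 = \sum_i \sum_j (\sum_k a 0 i * b 0 k * lie_coef k i j) * 'D_(ee j) f 0
   + \sum_i \sum_j a 0 i * b 0 j * 'D_(ee i) (fun y => 'D_(ee j) f y) 0.
  rewrite lopE frame0 mulmx1 -big_split /=; apply: eq_bigr => i _.
  rewrite (_ : lop b f = fun x => \sum_j (fun x => (b *m frame x) 0 j) x * 'D_(ee j) f x); last first.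
    by apply/funext => x; rewrite lopE.
  rewrite deriveMsum; [|by move=> j; exact: mulframe_smooth|by move=> j; exact: smooth_partial].
  rewrite mulr_sumr -big_split /=; apply: eq_bigr => j _.
  rewrite frame0 mulmx1 mulrDr derive_mulframe; congr (_ + _); last by rewrite mulrA.
  rewrite mulrA mulr_sumr; congr (_ * _).
  by apply: eq_bigr => k _; rewrite mulrA.
rewrite !E [lop _ f 0]lopE frame0 mulmx1.
rewrite [X in _ - (_ + X)]exchange_big /=.
rewrite [X in _ - (_ + X)](_ : _ = \sum_i \sum_j u 0 i * v 0 j * 'D_(ee i) (fun y => 'D_(ee j) f y) 0); last first.
  apply: eq_bigr => i _; apply: eq_bigr => j _; 
  exact: (f_equal2 *%R (mulrC _ _) (Schwarz j i 0 (sf 2%N))).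
rewrite opprD addrACA subrr addr0 exchange_big [X in _ - X]exchange_big -sumrB /=.
apply: eq_bigr => j _; rewrite -!mulr_suml -mulrBl; congr (_ * _).
rewrite lieE -sumrB; apply: eq_bigr => i _; rewrite -sumrB.
by apply: eq_bigr => k _; rewrite mulrBl.
Qed.

(** Left translation by [x] reduces the identity to the point 0. *)
Lemma lop_commutator u v f x : smooth f ->
  lop u (lop v f) x - lop v (lop u f) x = lop (lie_bracket M u v) f x.
Proof.
move=> sf; rewrite -[x](@cmulx0 R G).
rewrite !lop_shift //; [|exact: lop_smooth..].
have E w : (fun y => lop w f (M x y)) = lop w (fun y => f (M x y)).
  by apply/funext => y; rewrite lop_shift.
rewrite !E; apply: lop_commutator0 => r.
by apply: (Ck_comp openT openT _ _ (sf r)) => // i; apply: cmul_Ck => [|k|k]; [exact: openT|exact: Ck_cst|exact: Ck_coord].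
Qed.

Lemma lop_coord u j x : lop u (fun x => x 0 j) x = (u *m frame x) 0 j.
Proof.
rewrite lopE (bigD1 j) //= big1 ?addr0 => [|i ij].
  have [_ ->] := is_derive_coord j x (ee j).
  by rewrite [X in _ * X]mxE !eqxx mulr1.
have [_ ->] := is_derive_coord j x (ee i).
by rewrite [X in _ * X]mxE eqxx eq_sym (negPf ij) mulr0.
Qed.

Lemma coord_smooth j : smooth (fun x => x 0 j).
Proof. by move=> r; exact: Ck_coord. Qed.

(** Applied to a coordinate function, brackets become commutators of operators, for which the
    identity is formal; evaluating at 0 recovers the coordinate of the vector. *)
Lemma Jacobi a b v : lie_bracket M (lie_bracket M a b) v =
  lie_bracket M a (lie_bracket M b v) - lie_bracket M b (lie_bracket M a v).
Proof.
apply/rowP => j; pose f x := x 0 j; have sf : smooth f := coord_smooth j.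
have L u : smooth (lop u f) by exact: lop_smooth.
have LL u w : smooth (lop u (lop w f)) by exact: lop_smooth.
have [lie lieE] : exists lie, lie = lie_bracket M by exists (lie_bracket M).
have E u w : lop (lie u w) f = fun x => lop u (lop w f) x - lop w (lop u f) x.
  by apply/funext => x; rewrite lieE lop_commutator.
have E0 u w g : smooth g -> lop (lie u w) g 0 = lop u (lop w g) 0 - lop w (lop u g) 0.
  by move=> sg; rewrite lieE lop_commutator.
have C (w : pt) : w 0 j = lop w f 0 by rewrite lop_coord frame0 mulmx1.
rewrite -lieE; clear lieE; rewrite [RHS]mxBE.
rewrite (C (lie (lie a b) v)) (C (lie a (lie b v))) (C (lie b (lie a v))).
rewrite (E0 (lie a b) v f sf) (E0 a (lie b v) f sf) (E0 b (lie a v) f sf) (E a b) (E b v) (E a v).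
rewrite (E0 a b _ (L v)) (E0 b v _ (L a)) (E0 a v _ (L b)).
rewrite (lopB v _ (LL a b) (LL b a)) (lopB a _ (LL b v) (LL v b)) (lopB b _ (LL a v) (LL v a)).
move: (lop a (lop b (lop v f)) 0) (lop b (lop a (lop v f)) 0) (lop v (lop a (lop b f)) 0).
move: (lop v (lop b (lop a f)) 0) (lop a (lop v (lop b f)) 0) (lop b (lop v (lop a f)) 0) => *; ring.
Qed.

Lemma layer_delta i (j : 'I_n) : cdeg j = i -> ((ee j : pt) <= layer G i)%MS.
Proof.
move=> <-; apply/submxP; exists (ee j); apply/rowP => l.
rewrite /layer /layer_mx mul_mx_diag !mxE eqxx /=.
by case: eqVneq => [->|]; rewrite ?eqxx ?mulr1 ?mul0r.
Qed.

Lemma sub_layer_coord i (w : pt) (j : 'I_n) : (w <= layer G i)%MS -> cdeg j != i -> w 0 j = 0.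
Proof.
case/submxP => D -> jd; rewrite /layer /layer_mx mul_mx_diag !mxE.
by rewrite (negPf jd) mulr0.
Qed.

(** Brackets have no component in H_1. If one factor lies in H_1 this is the stratification,
    including the vanishing of [H_1, H_k]. A factor of higher degree is spanned by brackets with
    elements of H_1, and [Jacobi] reduces its degree. *)
Lemma lie_H0 i u v : cdeg i = 1%N -> lie_bracket M u v 0 i = 0.
Proof.
move=> i1.
have H1 (b : 'I_n) : cdeg b = 1%N -> forall v, lie_bracket M (ee b) v 0 i = 0.
  move=> b1 w; rewrite lieN lie_suml mxE summxE big1 ?oppr0 // => l _; rewrite mxE lieN mxE.
  have /andP[l1 lk] := cdeg_bounds l.
  suff -> : lie_bracket M (ee b) (ee l) 0 i = 0 by rewrite oppr0 mulr0.
  move: lk; rewrite leq_eqVlt => /orP[/eqP lk|lk]; first by rewrite cstrat_top // mxE.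
  have := @cstrat R G (cdeg l).+1; rewrite ltnS l1 lk => /(_ isT)/andP[+ _] => sub.
  apply: (@sub_layer_coord (cdeg l).+1); last by rewrite i1 eqSS eq_sym -lt0n.
  apply: submx_trans sub; apply: (submx_trans _ (sumsmx_sup (b, l) _ (submx_refl _))).
    by rewrite genmxE.
  by rewrite /= b1 !eqxx.
suff H d : forall b : 'I_n, cdeg b = d.+1 -> forall v, lie_bracket M (ee b) v 0 i = 0.
  rewrite lie_suml summxE big1 // => l _; rewrite mxE.
  have /andP[l1 _] := cdeg_bounds l.
  by rewrite (H (cdeg l).-1) ?mulr0 ?prednK.
elim: d => [|d IH b bd w]; first exact: H1.
have := @cstrat R G (cdeg b); have /andP[_ ->] := cdeg_bounds b; rewrite bd => /(_ isT)/andP[_ sub].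
(* Writing the linear form, coordinate [i] of the bracket with [w], as a column turns its vanishing
   on a span into a kernel inclusion, to be checked on generators. *)
pose c : 'cV[R]_n := \col_l lie_bracket M (ee l) w 0 i.
have cE u' : (u' *m c) 0 0 = lie_bracket M u' w 0 i.
  by rewrite lie_suml summxE mxE; apply: eq_bigr => l _; rewrite !mxE.
rewrite -cE (_ : _ *m c = 0) ?mxE //; apply/sub_kermxP.
apply: submx_trans (layer_delta bd) (submx_trans sub _).
apply/sumsmx_subP => -[a b'] /= /andP[/eqP a1 /eqP b'd]; rewrite genmxE.
apply/sub_kermxP/matrixP => p q; rewrite !ord1 cE [RHS]mxE Jacobi.
apply: (etrans (mxBE _ _ _ _)).
apply: (etrans (congr2 (fun a b => a - b) (H1 a a1 _) (IH b' b'd _))); exact: subr0.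
Qed.

(* With [B] the [i]-th column of [frame - 1], [x *m B x = 0] because rays are
   one-parameter subgroups.  Differentiating along left-invariant fields and
   using that [v |-> v *m B] is compatible with brackets ([lie_H0]) gives a
   homogeneous linear system for [t *: B (t *: p)]. *)
Lemma frame_H i j x : cdeg i = 1%N -> frame x j i = (j == i)%:R.
Proof.
move=> i1; rename x into p; pose al := fun x : pt => x 0 i.
pose B (l : 'I_n) x := frame x l i - (l == i)%:R.
have sB l : smooth (B l) by apply: smoothB; [exact: frame_smooth|exact: smooth_cst].
have lopB u x : lop u al x = \sum_l u 0 l * B l x + u 0 i.
  rewrite lop_coord mxE (_ : u 0 i = \sum_l u 0 l * (l == i)%:R); last first.
    by rewrite (bigD1 i) //= eqxx mulr1 big1 ?addr0 // => l /negPf ->; rewrite mulr0.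
  by rewrite -big_split /=; apply: eq_bigr => l _; rewrite -mulrDr subrK.
have dlop u v x : lop v (lop u al) x = \sum_l u 0 l * lop v (B l) x.
  rewrite lopE; under eq_bigr => a _.
    rewrite (_ : lop u al = (fun x => \sum_l (fun=> u 0 l) x * B l x) + (fun=> u 0 i)); last first.
      by apply/funext => y; exact: lopB.
    rewrite deriveD ?derive_cst ?addr0; last exact: derivable_cst.
      rewrite deriveMsum => [|l|l]; [|exact: smooth_cst|exact: sB].
      rewrite (eq_bigr (fun l => u 0 l * 'D_(ee a) (B l) x)); last first.
        by move=> l _; rewrite derive_cst mul0r add0r.
      rewrite mulr_sumr.
      over.
    by apply: smooth_derivable; apply: smooth_sum => l; apply: smoothM; [exact: smooth_cst|exact: sB].
  rewrite exchange_big /=; apply: eq_bigr => l _; rewrite lopE mulr_sumr.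
  by apply: eq_bigr => a _; rewrite mulrCA.
have ray x : \sum_l x 0 l * B l x = 0.
  have := lopB x x; rewrite lop_coord frame_ray => /eqP.
  by rewrite -subr_eq addrN eq_sym => /eqP.
have dray v x : \sum_l ((v *m frame x) 0 l * B l x + x 0 l * lop v (B l) x) = 0.
  transitivity (lop v (fun x => \sum_l (fun x : pt => x 0 l) x * B l x) x); last first.
    rewrite (_ : (fun x => _) = fun=> 0); last by apply/funext => y; exact: ray.
    by rewrite lopE big1 // => a _; rewrite derive_cst mulr0.
  rewrite lopE; under [RHS]eq_bigr => a _.
    rewrite deriveMsum => [|l|l]; [|exact: coord_smooth|exact: sB].
    rewrite mulr_sumr; over.
  rewrite exchange_big /=; apply: eq_bigr => l _.
  under [RHS]eq_bigr => a _ do rewrite mulrDr [X in _ + X]mulrCA [X in X + _]mulrA.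
  rewrite big_split -mulr_suml -mulr_sumr -!lopE; congr (_ * _ + _).
  by rewrite lop_coord.
have comm u v x : \sum_l u 0 l * lop v (B l) x =
    \sum_l v 0 l * lop u (B l) x - \sum_l lie_bracket M u v 0 l * B l x.
  rewrite -!dlop; have := lop_commutator u v x (coord_smooth i); rewrite -/al lopB lie_H0 // addr0.
  by move=> <-; ring.
have frame_scale (t : R) : p *m frame (t *: p) = p.
  have [->|t0] := eqVneq t 0; first by rewrite scale0r frame0 mulmx1.
  apply: (scalerI t0); rewrite scalemxAl; exact: frame_ray.
pose K l (t : R) := t * B l (0 + t *: p).
(* The derivative of [t * B a (t *: p)] is [B a + t * lop p (B a)]. By [dray] and [comm] this equals
   [B a] minus the frame-weighted sum of the [B l], plus the bracket term; the quotient by [t]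
   restores [K l] from [B l]. *)
pose C a l (t : R) := - ((frame (0 + t *: p) a l - (a == l)%:R) / t) + lie_bracket M p (ee a) 0 l.
suff : K j 1 = 0 by rewrite /K add0r mul1r scale1r => /eqP; rewrite subr_eq0 => /eqP.
apply: (@linear_ode_zero R n K C).
- move=> a t /andP[t0 t1].
  have dB : is_derive t 1 (fun s : R => B a (0 + s *: p)) (lop p (B a) (0 + t *: p)).
    apply: is_derive_line; have := C1_derive p openT (sB a 1%N) (I : setT (0 + t *: p)).
    have -> : lop p (B a) (0 + t *: p) = \sum_j p 0 j * 'D_(ee j) (B a) (0 + t *: p).
      by rewrite lopE; have -> : p *m frame (0 + t *: p) = p by rewrite add0r frame_scale.
    by [].
  apply: is_derive_eq (is_deriveM (is_derive_id t (1 : R)) dB) _.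
  rewrite /GRing.scale /= add0r mulr1.
  have tp0 : t * lop p (B a) (t *: p) = - (\sum_l (((ee a : pt) *m frame (t *: p)) 0 l * B l (t *: p)))
     + \sum_l t * (lie_bracket M p (ee a) 0 l * B l (t *: p)).
    have := dray (ee a) (t *: p); rewrite big_split /=.
    have -> : \sum_l (t *: p) 0 l * lop (ee a) (B l) (t *: p) = t * \sum_l p 0 l * lop (ee a) (B l) (t *: p).
      by rewrite mulr_sumr; apply: eq_bigr => l _; rewrite mxE mulrA.
    have -> : \sum_l p 0 l * lop (ee a) (B l) (t *: p) =
        lop p (B a) (t *: p) - \sum_l lie_bracket M p (ee a) 0 l * B l (t *: p).
      rewrite comm; congr (_ - _); rewrite (bigD1 a) //= mxE !eqxx mul1r big1 ?addr0 // => l la.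
      by rewrite mxE eqxx (negPf la) mul0r.
    rewrite -[\sum_l t * _]mulr_sumr.
    move: (\sum_l ((ee a : pt) *m _) 0 l * _) (lop p (B a) _) (\sum_l lie_bracket _ _ _ _ _ * _) => X Y Z.
    by lra.
  rewrite tp0 -sumrN [X in _ + X](_ : _ = \sum_l (a == l)%:R * B l (t *: p)); last first.
    by rewrite (bigD1 a) //= eqxx mul1r big1 ?addr0 // => l la; rewrite eq_sym (negPf la) mul0r.
  rewrite -!big_split /=; apply: eq_bigr => l _; rewrite /K /C !add0r -rowE [row _ _ _ _]mxE.
  by field; rewrite gt_eqF.
(* The quotient stays bounded near [t = 0] because the frame is the identity at 0 and the mean value
   theorem applies. *)
- move=> a l; pose F := fun x : pt => frame x a l.
  have cd : continuous (fun s : R => 'D_p F (0 + s *: p)).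
    move=> s; apply: (@continuous_comp _ _ _ (fun s : R => 0 + s *: p) (fun x => 'D_p F x)).
      by apply: continuousD; [exact: cst_continuous|apply: scalel_continuous].
    rewrite (_ : (fun x => _) = fun x => \sum_j p 0 j * 'D_(ee j) F x); last first.
      by apply/funext => x; rewrite smooth_deriveE //; exact: frame_smooth.
    apply: (@Ck_cont _ _ 1 setT) => //; apply: smooth_sum => b; apply: smoothM; first exact: smooth_cst.
    exact/smooth_partial/frame_smooth.
  have /compact_bounded : compact [set 'D_p F (0 + s *: p) | s in `[0%R, 1%R]].
    by apply: continuous_compact; [exact: continuous_subspaceT|exact: segment_compact].
  move=> -[c [_ /(_ (c + 1))]]; rewrite ltrDl ltr01 => /(_ isT) cP.
  exists (c + 1 + `|lie_bracket M p (ee a) 0 l|) => t /andP[t0 t1].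
  rewrite (le_trans (ler_normD _ _)) // lerD2r normrN.
  have [s|s st E] := @MVT_line _ _ F 0 p t; first by move=> _; apply/smooth_derivable/frame_smooth.
  have {E} E : frame (0 + t *: p) a l - (a == l)%:R = t * 'D_p F (0 + s *: p).
    by rewrite -E /F frame0 [1%:M _ _]mxE.
  rewrite E mulrC mulKf ?gt_eqF //; apply: cP; exists s => //=; rewrite in_itv /=.
  by case/orP: st => /andP[] *; lra.
- move=> a t; apply: (@continuousM R R (fun t : R => t) (fun t : R => B a (0 + t *: p))); first exact: cvg_id.
  apply: (@continuous_comp _ _ _ (fun s : R => 0 + s *: p) (B a)).
    by apply: continuousD; [exact: cst_continuous|apply: scalel_continuous].
  exact: (Ck_cont (sB a 1%N)).
- by move=> a; rewrite /K mul0r.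
Qed.

End group.

(** * Charts of the hypersurface *)

(** The orthogonal complement of the rows of [D] has dimension [q], so the free rows of [E], which
    lie in it, span it. *)
Lemma kernel_span (K : fieldType) p q s n (D : 'M[K]_(p, n)) (E : 'M[K]_(q, n)) (u : 'M[K]_(s, n)) :
  (p + q)%N = n -> row_free D -> row_free E -> D *m E^T = 0 -> D *m u^T = 0 -> (u <= E)%MS.
Proof.
move=> pq /eqP rD /eqP rE DE Du.
have sub s' (w : 'M[K]_(s', n)) : D *m w^T = 0 -> (w <= kermx D^T)%MS.
  by move=> Dw; apply/sub_kermxP; rewrite -[w]trmxK -trmx_mul Dw trmx0.
have [_ /esym] := mxrank_leqif_sup (sub _ _ DE).
have qn : q == (n - p)%N by rewrite -pq addKn.
rewrite mxrank_ker mxrank_tr rD rE qn => KE.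
exact: submx_trans (sub _ _ Du) KE.
Qed.

(** A completion to an invertible square matrix at [x] remains invertible nearby. *)
Lemma near_row_free (R : realType) (T : topologicalType) p n (A : T -> 'M[R]_(p, n)) (x : T) :
  (forall i j, {for x, continuous (fun t => A t i j)}) -> row_free (A x) ->
  \forall y \near x, row_free (A y).
Proof.
move=> cA rf; have pn : (p <= n)%N by rewrite -(eqP rf) rank_leq_col.
move: A cA rf; rewrite -(subnKC pn); move: (n - p)%N => q A cA rf.
have [C uC] := row_free_completion rf.
have cd : {for x, continuous (fun t => \det (col_mx (A t) C))}.
  apply: continuous_det => i j; rewrite -(@splitK p q i); case: (fintype.split i) => k /=.
    rewrite (_ : (fun t => _) = fun t => A t k j); first exact: cA.
    by apply/funext => t; rewrite col_mxEu.
  rewrite (_ : (fun t => _) = fun=> C k j); first exact: cst_continuous.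
  by apply/funext => t; rewrite col_mxEd.
have d0 : \det (col_mx (A x) C) != 0 by rewrite -unitfE -unitmxE.
have FF := nbhs_filter x.
apply: filterS (cvgr_neq0 _ cd d0) => y dy.
apply: inj_row_free => v vA; have : row_mx v (0 : 'rV_q) *m col_mx (A y) C = 0.
  by rewrite mul_row_col vA mul0mx addr0.
have uy : col_mx (A y) C \in unitmx by rewrite unitmxE unitfE.
move/(congr1 (mulmxr (invmx (col_mx (A y) C)))); rewrite /= mul0mx mulmxK // => /(congr1 lsubmx).
by rewrite row_mxKl raddf0.
Qed.

Lemma norm_delta (R : realType) n (k : 'I_n) : `|ee k : 'rV[R]_n| <= 1.
Proof. by apply: rV_norm_le => // a; rewrite mxE; case: andP => _; rewrite ?normr1 ?normr0. Qed.

(** At boundary points functions are known on one side only. Since [h] is C^1 around [b], one-sided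
    vanishing already determines the derivative at [b]. *)
Lemma side_derive0 (R : realType) n (h : 'rV[R]_n -> R) b (r : R) j : 0 < r -> Ck 1 (ball b r) h ->
  (forall s : R, 0 <= s < r -> h (b - s *: ee j) = 0) -> 'D_(ee j) h b = 0.
Proof.
move=> r0 hb h0; apply/eqP; rewrite -normr_le0; apply/ler_addgt0Pl => e e0; rewrite addr0.
have [d [d0 dr dP]] := C1_strict (@ball_open _ _ b r) hb (ballxx b r0) e0.
pose s := Num.min d r / 2; have s0 : 0 < s by rewrite divr_gt0 // lt_min d0.
have [sd sr] : s < d /\ s < r.
  have : Num.min d r <= d by rewrite ge_min lexx.
  have : Num.min d r <= r by rewrite ge_min lexx orbT.
  rewrite /s; move: (Num.min d r) (s0) => z; rewrite /s; lra.
have E : b - (b - s *: ee j) = s *: ee j by vring.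
have nE : `|s *: (ee j : 'rV[R]_n)| <= s.
  by rewrite normrZ gtr0_norm // ler_piMr ?norm_delta // ltW.
have := dP b (b - s *: ee j) (ballxx b d0); rewrite ballN E.
move=> /(_ (le_lt_trans nE sd)); rewrite h0; last by rewrite (ltW s0).
have -> : h b = 0 by have := h0 0; rewrite scale0r subr0 lexx => ->.
rewrite subrr sub0r normrN (bigD1 j) //= big1 ?addr0; last first.
  by move=> k kj; rewrite !mxE eqxx (negPf kj) mulr0 mul0r.
rewrite !mxE !eqxx mulr1 normrM (gtr0_norm s0) => H.
by rewrite -(ler_pM2l s0) (le_trans H) // mulrC ler_wpM2r // ltW.
Qed.

Record patch_at (R : realType) m n (U : set 'rV[R]_n) (F f : 'rV[R]_n -> R) (x : 'rV[R]_n)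
    (W : set 'rV[R]_n) (b : 'rV[R]_m.+1) (r : R)
    (phi : 'rV[R]_m.+1 -> 'rV[R]_n) (pi : 'rV[R]_n -> 'rV[R]_m.+1) : Prop := PatchAt {
  pa_r : 0 < r; pa_open : open W; pa_x : W x; pa_sub : W `<=` U; pa_b : phi b = x;
  pa_phi : C1map (ball b r) phi; pa_pi : C1map W pi;
  pa_ball : forall u, ball b r u -> [/\ W (phi u), F (phi u) = 0, f (phi u) = u 0 0,
        pi (phi u) = u & row_free (jac phi u)];
  pa_inv : forall y, W y -> F y = 0 -> ball b r (pi y) /\ phi (pi y) = y }.

Lemma patch_at_exists (R : realType) n m (U : set 'rV[R]_n) (F f : 'rV[R]_n -> R) (x : 'rV[R]_n) :
  n = m.+2 -> open U -> Ck 1 U F -> Ck 1 U f -> U x -> F x = 0 ->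
  row_free (col_mx (grad F x) (grad f x)) ->
  exists W b r phi pi, @patch_at R m n U F f x W b r phi pi.
Proof.
move=> nm oU F1 f1 Ux Fx rf.
have [W [b [r [phi [pi [[r0 oW Wx WU pb] Cphi Cpi H1 H2]]]]]] := adapted_patch nm oU F1 f1 Ux Fx rf.
by exists W, b, r, phi, pi.
Qed.

Section patch_theory.
Context {R : realType} {m n : nat}.
Variables (U : set 'rV[R]_n) (F f : 'rV[R]_n -> R) (x : 'rV[R]_n).
Variables (W : set 'rV[R]_n) (b : 'rV[R]_m.+1) (r : R).
Variables (phi : 'rV[R]_m.+1 -> 'rV[R]_n) (pi : 'rV[R]_n -> 'rV[R]_m.+1).
Hypothesis pa : @patch_at R m n U F f x W b r phi pi.
Variables (V : set 'rV[R]_n) (g : 'rV[R]_n -> R).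
Hypotheses (oV : open V) (gV : Ck 1 V g) (WV : W `<=` V).

Lemma patch_V u : ball b r u -> V (phi u).
Proof. by move=> bu; apply: WV; case: (pa_ball pa bu). Qed.

Lemma patch_comp_C1 : Ck 1 (ball b r) (fun u => g (phi u)).
Proof. by apply: (Ck_comp oV (@ball_open _ _ b r) (pa_phi pa) patch_V gV). Qed.

Lemma patch_derive u j : ball b r u ->
  'D_(ee j) (fun u => g (phi u)) u = (jac phi u *m (grad g (phi u))^T) j 0.
Proof.
move=> bu.
have /(congr1 (fun v : 'rV_m.+1 => v 0 j)) := grad_comp (@ball_open _ _ b r) oV (pa_phi pa) gV bu (patch_V bu).
by rewrite [LHS]mxE => ->; rewrite -[jac phi u *m _]trmxK trmx_mul trmxK [RHS]mxE.
Qed.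

Lemma patch_ballS (s : R) j : 0 <= s < r -> ball b r (b - s *: ee j).
Proof.
move=> /andP[s0 sr]; apply/ballN.
have -> : b - (b - s *: ee j) = s *: ee j by vring.
rewrite normrZ ger0_norm // (le_lt_trans _ sr) // ler_piMr //; exact: norm_delta.
Qed.

(** Moving backwards in direction [j] keeps [u 0 0 <= b 0 0], and stays in the slice [u 0 0 = b 0 0]
    if [j != 0]. So one statement covers functions vanishing on one side of the slice and, for
    [j != 0], functions vanishing on the slice alone. *)
Lemma patch_side_derive0 j :
  (forall u, ball b r u -> u 0 0 <= b 0 0 -> (j != 0 -> u 0 0 = b 0 0) -> g (phi u) = 0) ->
  (jac phi b *m (grad g x)^T) j 0 = 0.
Proof.
move=> g0; rewrite -(pa_b pa) -patch_derive; last exact: ballxx (pa_r pa).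
apply: side_derive0 (pa_r pa) patch_comp_C1 _ => s sr.
apply: g0; first exact: patch_ballS.
  rewrite !mxE gerBl mulr_ge0 ?ler0n //; by case/andP: sr.
by move=> j0; rewrite !mxE [0 == j]eq_sym (negPf j0) andbF mulr0 subr0.
Qed.

Lemma patch_side0 : (forall u, ball b r u -> u 0 0 <= b 0 0 -> g (phi u) = 0) ->
  jac phi b *m (grad g x)^T = 0.
Proof.
move=> g0; apply/colP => j; rewrite [RHS]mxE; apply: patch_side_derive0 => u bu ub _; exact: g0.
Qed.

End patch_theory.

Section hypersurface.
Context {R : realType} (G : carnot R).
Local Notation n := (cdim G).
Local Notation pt := 'rV[R]_n.
Variable m : nat.
Hypothesis nm : n = m.+2.
Implicit Types (S U V : set pt) (F g : pt -> R) (x y : pt).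

Lemma row_free_rgrad U F g x : open U -> Ck 1 U F -> Ck 1 U g -> U x ->
  row_free (col_mx (rgrad F x) (rgrad g x)) = row_free (col_mx (grad F x) (grad g x)).
Proof.
move=> oU F1 g1 Ux; rewrite (rgrad_grad oU F1 Ux) (rgrad_grad oU g1 Ux) -mul_col_mx.
by rewrite /row_free mxrankMfree // row_free_unit unitmx_tr frame_unit.
Qed.

Lemma grad_neq0 U F x : open U -> Ck 1 U F -> U x -> rgrad F x != 0 -> grad F x != 0.
Proof.
by move=> oU F1 Ux; apply: contra_neq => gF; rewrite (rgrad_grad oU F1 Ux) gF mul0mx.
Qed.

Lemma row_free_rV p (v : 'rV[R]_p) : row_free v = (v != 0).
Proof. by rewrite /row_free rank_rV; case: (v != 0). Qed.

Lemma row_free_col_mxl p q k (A : 'M[R]_(p, k)) (B : 'M[R]_(q, k)) :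
  row_free (col_mx A B) -> row_free A.
Proof.
move=> rf; apply: inj_row_free => v vA.
have := row_free_inj rf; move/(_ _ (row_mx v 0) 0); rewrite mul_row_col vA mul0mx addr0 mul0mx.
by move=> /(_ erefl) /(congr1 lsubmx); rewrite row_mxKl raddf0.
Qed.

(* The gradient of a function vanishing on one side of a slice of the
   hypersurface [F = 0] is normal to that hypersurface. *)
Lemma patch_side_normal U F g x W b r phi pi V h : @patch_at R m n U F g x W b r phi pi ->
  open U -> Ck 1 U F -> U x -> grad F x != 0 -> open V -> Ck 1 V h -> W `<=` V ->
  (forall u, ball b r u -> u 0 0 <= b 0 0 -> h (phi u) = 0) ->
  exists c, grad h x = c *: grad F x.
Proof.
move=> pa oU F1 Ux gF0 oV h1 WV h0.
have dF := patch_side0 pa oU F1 (pa_sub pa).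
have dh := patch_side0 pa oV h1 WV h0.
have [_ _ _ _ rj] := pa_ball pa (ballxx b (pa_r pa)).
apply/sub_rVP; apply: (kernel_span _ rj _ (dF _) dh); rewrite ?addn1 ?row_free_rV //.
by move=> u bu _; have [_ ->] := pa_ball pa bu.
Qed.

(** Let [h] define [S] near [x] as an interior point. It vanishes on half of a patch of [F = 0], so
    its gradient is parallel to that of [F] and independent of that of [g]. A patch of [h = 0]
    adapted to [g] then contains points with [g > 0], which belong to [S] by the interior chart and
    not by the boundary chart. *)
Lemma bd_chart_notin_mint S x U F g : bd_chart S x U F g -> ~ mint S x.
Proof.
move=> [[oU F2 F0] g1 rf [Ux Fx gx] SU] [[V [h [[oV h2 h0] Vx SV]]] Sx].
have F1 := CkS F2; have h1 := CkS h2.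
have oI := openI oU oV; have sU : U `&` V `<=` U by move=> ? [].
have sV : U `&` V `<=` V by move=> ? [].
have := rf x Ux; rewrite (row_free_rgrad oU F1 g1 Ux) => rfx.
have [W [b [r [phi [pi pa]]]]] := patch_at_exists nm oI (Ck_sub sU F1) (Ck_sub sU g1) (conj Ux Vx) Fx rfx.
have b0 : b 0 0 = 0.
  by have [_ _ <- _ _] := pa_ball pa (ballxx b (pa_r pa)); rewrite (pa_b pa).
have gFx := grad_neq0 oU F1 Ux (F0 x Ux).
have [c hF] : exists c, grad h x = c *: grad F x.
  apply: (patch_side_normal pa oI (Ck_sub sU F1) (conj Ux Vx) gFx oV h1 (subset_trans (pa_sub pa) sV)).
  move=> u bu; rewrite b0 => u0; have [Wu Fu gu _ _] := pa_ball pa bu.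
  have [Uu Vu] := pa_sub pa Wu.
  have [Su _] : (S `&` U) (phi u) by rewrite SU; split=> //; rewrite gu.
  by have : (S `&` V) (phi u) by []; rewrite SV => -[].
have ghx := grad_neq0 oV h1 Vx (h0 x Vx).
have c0 : c != 0 by apply: contra_neq ghx => c0; rewrite hF c0 scale0r.
have rfh : row_free (col_mx (grad h x) (grad g x)).
  have -> : col_mx (grad h x) (grad g x) = block_mx c%:M 0 0 1%:M *m col_mx (grad F x) (grad g x).
    by rewrite mul_block_col !mul0mx addr0 add0r mul1mx mul_scalar_mx hF.
  rewrite /row_free; have uB : block_mx c%:M 0 0 1%:M \in @unitmx R (1 + 1).
    by rewrite unitmxE det_ublock det_scalar det1 mulr1 expr1 unitfE.
  by rewrite eqmxMfull ?row_full_unit //; exact: rfx.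
have hx : h x = 0 by have : (S `&` V) x by []; rewrite SV => -[].
have [W' [b' [r' [phi' [pi' pa']]]]] :=
  patch_at_exists nm oI (Ck_sub sV h1) (Ck_sub sU g1) (conj Ux Vx) hx rfh.
have r'0 := pa_r pa'; have b'0 : b' 0 0 = 0.
  by have [_ _ <- _ _] := pa_ball pa' (ballxx b' r'0); rewrite (pa_b pa').
pose u := b' + (r' / 2) *: ee 0.
have bu : ball b' r' u.
  apply/ballN; rewrite /u opprD addNKr normrN normrZ gtr0_norm ?divr_gt0 //.
  by apply: le_lt_trans (ler_piMr _ (norm_delta _ _)) _; lra.
have [Wu hu gu _ _] := pa_ball pa' bu; have [Uu Vu] := pa_sub pa' Wu.
have : (S `&` V) (phi' u) by rewrite SV.
case=> Su _; have : (S `&` U) (phi' u) by []; rewrite SU => -[_ _].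
by rewrite gu !mxE b'0 !eqxx mulr1 add0r leNgt divr_gt0.
Qed.

Lemma row_free_col_mxr p q k (A : 'M[R]_(p, k)) (B : 'M[R]_(q, k)) :
  row_free (col_mx A B) -> row_free B.
Proof.
move=> rf; apply: inj_row_free => v vB.
have := row_free_inj rf; move/(_ _ (row_mx 0 v) 0); rewrite mul_row_col vB mul0mx addr0 mul0mx.
by move=> /(_ erefl) /(congr1 rsubmx); rewrite row_mxKr raddf0.
Qed.

Lemma open_pos (T : topologicalType) (U : set T) (g : T -> R) : open U ->
  (forall z, U z -> {for z, continuous g}) -> open (U `&` [set z | 0 < g z]).
Proof.
move=> oU cg; rewrite openE => y [Uy /= gy].
have FF := nbhs_filter y; rewrite /interior.
apply: filterS (filterI (open_nbhs_nbhs (conj oU Uy)) (cvgr_gt _ (cg y Uy) _ gy)).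
by move=> z [].
Qed.

Lemma open_neg (T : topologicalType) (U : set T) (g : T -> R) : open U ->
  (forall z, U z -> {for z, continuous g}) -> open (U `&` [set z | g z < 0]).
Proof.
move=> oU cg; rewrite (_ : _ `&` _ = U `&` [set z | 0 < - g z]).
  by apply: open_pos => // y Uy; apply: continuousN; exact: cg.
by apply/seteqP; split=> y [Uy] /= gy; split=> //=; rewrite ?oppr_gt0 // -oppr_gt0.
Qed.

(** Two boundary charts have the same normal line and the same plane normal to the boundary. In a
    patch of the second chart, [F] vanishes on the side of [S], and [g] on the boundary slice; both
    are then differentiated along the patch. *)
Lemma bd_chart_span S x U F g U' F' g' : bd_chart S x U F g -> bd_chart S x U' F' g' ->
  (col_mx (rgrad F' x) (rgrad g' x) <= col_mx (rgrad F x) (rgrad g x))%MS /\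
  exists c, rgrad F' x = c *: rgrad F x.
Proof.
move=> [[oU F2 F0] g1 rf [Ux Fx gx] SU] bdx'.
have [[oU' F2' F0'] g1' rf' [Ux' Fx' gx'] SU'] := bdx'.
have F1 := CkS F2; have F1' := CkS F2'.
have oI := openI oU oU'; have sU : U `&` U' `<=` U by move=> ? [].
have sU' : U `&` U' `<=` U' by move=> ? [].
have := rf x Ux; rewrite (row_free_rgrad oU F1 g1 Ux) => rfx.
have := rf' x Ux'; rewrite (row_free_rgrad oU' F1' g1' Ux') => rfx'.
have [W [b [r [phi [pi pa]]]]] :=
  patch_at_exists nm oI (Ck_sub sU' F1') (Ck_sub sU' g1') (conj Ux Ux') Fx' rfx'.
have b0 : b 0 0 = 0.
  by have [_ _ <- _ _] := pa_ball pa (ballxx b (pa_r pa)); rewrite (pa_b pa).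
have inS u : ball b r u -> u 0 0 <= 0 -> [/\ S (phi u), U (phi u), U' (phi u), F (phi u) = 0 & g (phi u) <= 0].
  move=> bu u0; have [Wu F'u g'u _ _] := pa_ball pa bu; have [Uu Uu'] := pa_sub pa Wu.
  have [Su _] : (S `&` U') (phi u) by rewrite SU'; split=> //; rewrite g'u.
  by have : (S `&` U) (phi u) by []; rewrite SU => -[].
(* A point with [g < 0] is interior for the first chart, whereas a boundary point of the second
   chart is not in [mint S]. *)
have on0 u : ball b r u -> u 0 0 = 0 -> g (phi u) = 0.
  move=> bu u0; have [|Su Uu Uu' Fu gu] := inS u bu; first by rewrite u0.
  have [_ F'u g'u _ _] := pa_ball pa bu.
  apply/eqP; rewrite eq_le gu /= leNgt; apply/negP => gu0.
  apply: (@bd_chart_notin_mint S (phi u) U' F' g').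
    by split=> //; split=> //; rewrite g'u.
  split=> //; exists (U `&` [set y | g y < 0]), F; split=> //.
    split; [|by apply: Ck_sub F2 => ? []|by move=> y [Uy _]; exact: F0].
    by apply: open_neg => // y Uy; exact: Ck_cont g1 Uy.
  apply/seteqP; split=> y /=.
    by move=> [Sy [Uy gy]]; split=> //; have : (S `&` U) y by []; rewrite SU => -[].
  move=> [[Uy gy] Fy]; split=> //; have [] : (S `&` U) y by rewrite SU; split=> //; exact: ltW.
  by [].
have sW : W `<=` U := subset_trans (pa_sub pa) sU.
have sW' : W `<=` U' := subset_trans (pa_sub pa) sU'.
have [_ _ _ _ rj] := pa_ball pa (ballxx b (pa_r pa)).
have gFx := grad_neq0 oU F1 Ux (F0 x Ux).
have dF : jac phi b *m (grad F x)^T = 0.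
  by apply: (patch_side0 pa oU F1 sW) => u bu; rewrite b0 => /(inS _ bu)[].
have dF' : jac phi b *m (grad F' x)^T = 0.
  by apply: (patch_side0 pa oU' F1' sW') => u bu; rewrite b0 => /(inS _ bu) _; case: (pa_ball pa bu).
split; last first.
  have [c E] : exists c, grad F' x = c *: grad F x.
    by apply/sub_rVP; apply: (kernel_span _ rj _ dF dF'); rewrite ?addn1 ?row_free_rV.
  exists c; rewrite (rgrad_grad oU F1 Ux) (rgrad_grad oU' F1' Ux') E scalemxAl //.
pose D := @dsubmx _ 1 m n (jac phi b).
have rD : row_free D.
  by apply: (@row_free_col_mxr 1 m n (@usubmx _ 1 m n (jac phi b))); rewrite vsubmxK.
have Dk (v : pt) : (forall k, (jac phi b *m v^T) (rshift 1 k) 0 = 0) -> D *m v^T = 0.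
  move=> H; apply/colP => k; rewrite [RHS]mxE -(H k) !mxE; apply: eq_bigr => l _.
  by rewrite !mxE.
have k0 (k : 'I_m) : rshift 1 k != 0 :> 'I_m.+1 by [].
have dg : D *m (grad g x)^T = 0.
  apply: Dk => k; apply: (patch_side_derive0 pa oU g1 sW) => u bu _.
  by rewrite b0 => /(_ (k0 k)) /(on0 u bu).
have dg' : D *m (grad g' x)^T = 0.
  apply: Dk => k; apply: (patch_side_derive0 pa oU' g1' sW') => u bu _.
  by rewrite b0 => /(_ (k0 k)) u0; case: (pa_ball pa bu) => _ _ ->.
have DF (v : pt) : jac phi b *m v^T = 0 -> D *m v^T = 0.
  by move=> H; apply: Dk => k; rewrite H mxE.
rewrite (rgrad_grad oU F1 Ux) (rgrad_grad oU' F1' Ux') (rgrad_grad oU g1 Ux) (rgrad_grad oU' g1' Ux').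
rewrite -!mul_col_mx; apply: submxMr; apply: (kernel_span _ rD rfx).
- by rewrite nm addn2.
- by rewrite tr_col_mx mul_mx_row (DF _ dF) dg row_mx0.
- by rewrite tr_col_mx mul_mx_row (DF _ dF') dg' row_mx0.
Qed.

(** [conormal] is picked among the vectors offered by all boundary charts, and [bd_chart_span] makes
    each of them a multiple of [t]. The factor is described up to sign, since only norms of
    projections of the conormal are used. *)
Lemma conormalP S x U F g N c : bd_chart S x U F g -> rgrad F x = c *: N -> dot N N = 1 ->
  let t := oproj (TS N) (rgrad g x) in
  exists a, conormal S x = a *: t /\ `|a| * enorm t = 1.
Proof.
move=> bd FN N1 t; have [[oU F2 F0] g1 rf [Ux Fx gx] SU] := bd.
have c0 : c != 0 by apply: contra_neq (F0 x Ux) => c0; rewrite FN c0 scale0r.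
pose d := dot (rgrad g x) N; have tE : t = rgrad g x - d *: N by rewrite /t oproj_TS.
have tC : t = row_mx (- (d / c))%:M 1%:M *m col_mx (rgrad F x) (rgrad g x).
  by rewrite mul_row_col mul1mx mul_scalar_mx FN scalerA mulNr divfK // scaleNr addrC tE.
have t0 : t != 0.
  apply/eqP => t0; have := row_free_inj (rf x Ux); move/(_ _ (row_mx (- (d / c))%:M 1%:M) 0).
  rewrite -tC t0 mul0mx => /(_ erefl) /(congr1 (fun v : 'rV_(1 + 1) => rsubmx v 0 0)).
  by rewrite row_mxKr !mxE eqxx => /eqP; rewrite oner_eq0.
have tN : dot t N = 0 by rewrite tE dotBl dotZl N1 mulr1 subrr.
have tg : dot t (rgrad g x) = dot t t by rewrite {3}tE dotBr dotZr tN mulr0 subr0.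
have nt : 0 < enorm t by rewrite enorm_gt0.
have := @getPex _ [set e | exists (U : set pt) (F g : pt -> R),
         [/\ bd_chart S x U F g,
             (e <= col_mx (rgrad F x) (rgrad g x))%MS,
             dot e (rgrad F x) = 0, 0 < dot e (rgrad g x) & enorm e = 1]].
rewrite -/(conormal S x) => -[|U' [F' [g' [bd' eS eF _ e1]]]].
  exists ((enorm t)^-1 *: t), U, F, g; split=> //.
  - by rewrite scalemx_sub // tC submxMl.
  - by rewrite FN dotZr dotZl tN !mulr0.
  - by rewrite dotZl tg -enorm_sqr expr2 mulKf ?gt_eqF.
  - by rewrite enormZ gtr0_norm ?invr_gt0 // mulVf ?gt_eqF.
have [sp [c' FF']] := bd_chart_span bd bd'.
have [[_ _ F0'] _ _ [Ux' _ _] _] := bd'.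
have c'0 : c' != 0 by apply: contra_neq (F0' x Ux') => c0'; rewrite FF' c0' scale0r.
have eN : dot (conormal S x) N = 0.
  move: eF; rewrite FF' FN !dotZr => /eqP.
  by rewrite mulf_eq0 (negPf c'0) mulf_eq0 (negPf c0) => /eqP.
have /submxP[D eD] := submx_trans eS sp.
have {}eD : conormal S x = (lsubmx D 0 0 * c) *: N + rsubmx D 0 0 *: rgrad g x.
  rewrite eD -[in LHS](hsubmxK D) mul_row_col.
  rewrite [lsubmx D]mx11_scalar [rsubmx D]mx11_scalar !mul_scalar_mx FN scalerA.
  by rewrite !mxE !mulr1n.
move: (lsubmx D 0 0 * c) (rsubmx D 0 0) eD => p q eD.
have pq : p = - (q * d).
  by move: eN; rewrite eD dotDl !dotZl N1 mulr1 => /eqP; rewrite addr_eq0 => /eqP.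
have E : conormal S x = q *: t.
  by rewrite eD pq tE scalerBr scaleNr scalerA addrC.
by exists q; split=> //; rewrite -enormZ -E.
Qed.

Lemma ex_row_free (v : pt) : v != 0 -> exists j, row_free (col_mx v (ee j : pt)).
Proof.
move=> v0; have [i vi] : exists i, v 0 i != 0.
  apply/existsP; apply: contraNT v0; rewrite negb_exists => /forallP H.
  by apply/eqP/rowP => i; rewrite mxE; apply/eqP; have := H i; rewrite negbK.
have [j ji] : exists j : 'I_n, j != i.
  have /card_gt1P[j [k [_ _ jk]]] : (1 < #|'I_n|)%N by rewrite card_ord nm.
  by have [ji|] := eqVneq j i; [exists k; rewrite -ji eq_sym|exists j].
exists j; apply: inj_row_free => w; rewrite -[w]hsubmxK mul_row_col.
rewrite [lsubmx w]mx11_scalar [rsubmx w]mx11_scalar !mul_scalar_mx => H.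
have a0 : lsubmx w 0 0 = 0.
  have /(congr1 (fun u : pt => u 0 i)) := H; rewrite [LHS]mxE ![(_ *: _ : pt) _ _]mxE !mxE.
  by rewrite eqxx [i == j]eq_sym (negPf ji) mulr0 addr0 => /eqP; rewrite mulf_eq0 (negPf vi) orbF => /eqP.
have b0 : rsubmx w 0 0 = 0.
  have /(congr1 (fun u : pt => u 0 j)) := H; rewrite a0 scale0r add0r !mxE !eqxx mulr1.
  by [].
by rewrite a0 b0 raddf0 row_mx0.
Qed.

Lemma grad_coord j x : grad (fun y : pt => y 0 j) x = ee j.
Proof.
apply/rowP => i; rewrite mxE; have [_ ->] := is_derive_coord j x (ee i).
by rewrite !mxE eq_sym.
Qed.

Lemma gradB U f g x : open U -> Ck 1 U f -> Ck 1 U g -> U x ->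
  grad (fun y => f y - g y) x = grad f x - grad g x.
Proof.
move=> oU f1 g1 Ux; apply/rowP => j; rewrite !mxE.
by apply: deriveB; [exact: (C1_derivable oU f1 Ux)|exact: (C1_derivable oU g1 Ux)].
Qed.

Lemma gradZ U a f x : open U -> Ck 1 U f -> U x ->
  grad (fun y => a * f y) x = a *: grad f x.
Proof.
move=> oU f1 Ux; apply/rowP => j; rewrite !mxE.
have d : derivable f x (ee j) by exact: C1_derivable Ux.
by have [_ ->] := is_deriveZ a (derivableP d).
Qed.

Definition chart S nu x U F := [/\ defining_fun U F, U x,
  S `&` U = [set y | U y /\ F y = 0] & forall y, S y -> U y -> nu y = normalize (rgrad F y)].

Lemma rgrad_continuous U f x : open U -> Ck 1 U f -> U x ->
  forall j, {for x, continuous (fun y => rgrad f y 0 j)}.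
Proof.
move=> oU f1 Ux j; apply: (@near_continuous _ _ (fun y => (grad f y *m (frame y)^T) 0 j)).
  by apply: (open_near_eq oU Ux) => y Uy; rewrite (rgrad_grad oU f1 Uy).
move: (0 : 'I_1) j; apply: continuous_mulmx => i j.
  apply: (@near_continuous _ _ (fun y => 'D_(ee j) f y)).
    by near=> y; rewrite mxE.
  by have [_ /(_ j)[_ [H _]]] := f1; exact: H.
rewrite (_ : (fun y => _) = fun y => frame y j i); last by apply/funext => y; rewrite mxE.
exact: (Ck_cont (frame_smooth j i 0%N)).
Unshelve. all: by end_near. Qed.

Lemma dot_continuous (T : topologicalType) (a b : T -> pt) (x : T) :
  (forall j, {for x, continuous (fun t => a t 0 j)}) ->
  (forall j, {for x, continuous (fun t => b t 0 j)}) ->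
  {for x, continuous (fun t => dot (a t) (b t))}.
Proof.
move=> ca cb; rewrite (_ : (fun t => _) = fun t => \sum_j a t 0 j * b t 0 j).
  by apply: continuous_sumr => j; apply: continuousM.
by apply/funext => t; rewrite dotE.
Qed.

(* The chart of [S] given by [mint] and the one given by [hyp_normal] have
   parallel gradients, as both defining functions vanish on [S]. *)
Lemma surface_chart S nu x : compact_hypersurface S nu -> mbd S = set0 -> S x ->
  exists U F, chart S nu x U F.
Proof.
move=> hS S0 Sx; have mS : mint S x.
  by apply: contrapT => mx; have : mbd S x by []; rewrite S0.
have [[V [h [[oV h2 h0] Vx SV]]] _] := mS.
have [U [F [[oU F2 F0] Ux SU nuU]]] := hyp_normal hS Sx.
have F1 := CkS F2; have h1 := CkS h2; have oI := openI oU oV.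
have par y : S y -> U y -> V y -> exists c, rgrad F y = c *: rgrad h y.
  move=> Sy Uy Vy; have hy : h y = 0 by have : (S `&` V) y by []; rewrite SV => -[].
  have ghy := grad_neq0 oV h1 Vy (h0 y Vy).
  have [j rj] := ex_row_free ghy; rewrite -(grad_coord j y) in rj.
  have [W [b [r [phi [pi pa]]]]] := patch_at_exists nm oI (Ck_sub (@subIsetr _ U V) h1)
    (Ck_coord _ _ j) (conj Uy Vy) hy rj.
  have [c E] : exists c, grad F y = c *: grad h y.
    apply: (patch_side_normal pa oI (Ck_sub (@subIsetr _ U V) h1) (conj Uy Vy) ghy oU F1).
      by move=> z /(pa_sub pa)[].
    move=> u bu _; have [/(pa_sub pa)[Uu Vu] hu _ _ _] := pa_ball pa bu.
    by apply: SU; split=> //; have [] : (S `&` V) (phi u) by rewrite SV.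
  by exists c; rewrite (rgrad_grad oU F1 Uy) (rgrad_grad oV h1 Vy) E scalemxAl.
pose d y := dot (rgrad F y) (rgrad h y).
have d0 : d x != 0.
  have [c E] := par x Sx Ux Vx; rewrite /d E dotZl mulf_neq0 ?dot_eq0 ?h0 //.
  by apply: contra_neq (F0 x Ux) => c0; rewrite E c0 scale0r.
(* The function [h] from [mint] cuts out [S] exactly, and the one from [hyp_normal] orients it.
   Where the product of the gradients keeps its sign, multiplying [h] by that sign gives a defining
   function with the normal [nu]. *)
pose s := Num.sg (d x); have s0 : s != 0 by rewrite sgr_eq0.
have cd y : U y -> V y -> {for y, continuous (fun y => s * d y)}.
  move=> Uy Vy; apply: continuousM; first exact: cst_continuous.
  by apply: dot_continuous => j; [exact: rgrad_continuous F1 Uy j|exact: rgrad_continuous h1 Vy j].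
have sdx : 0 < s * d x by rewrite -normrEsg normr_gt0.
pose B := (U `&` V) `&` [set y | 0 < s * d y].
have oB : open B by apply: open_pos => // y [Uy Vy]; exact: cd.
have h1B : Ck 1 B h by apply: Ck_sub h1 => y [[]].
have rs y : B y -> rgrad (fun y => s * h y) y = s *: rgrad h y.
  move=> By; rewrite (rgrad_grad oB (CkZ s oB h1B) By) (gradZ s oB h1B By).
  by rewrite (rgrad_grad oB h1B By) scalemxAl.
exists B, (fun y => s * h y); split=> //.
- split=> //; first by apply: CkZ => //; apply: Ck_sub h2 => y [[]].
  by move=> y By; rewrite rs // scaler_eq0 negb_or s0 h0 //; case: By => -[].
- apply/seteqP; split=> y /=.
    move=> [Sy By]; split=> //; have [[_ Vy] _] := By.
    by have : (S `&` V) y by []; rewrite SV => -[_ ->]; rewrite mulr0.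
  move=> [By /eqP]; rewrite mulf_eq0 (negPf s0) => /eqP hy; split=> //.
  by have [[_ Vy] _] := By; have [] : (S `&` V) y by rewrite SV.
- move=> y Sy By; have [[Uy Vy] /= dy] := By; rewrite nuU // rs //.
  have [c E] := par y Sy Uy Vy; move: dy; rewrite /d E dotZl.
  have h00 : 0 < dot (rgrad h y) (rgrad h y) by rewrite lt_neqAle eq_sym dot_eq0 h0 // dot_ge0.
  rewrite mulrA pmulr_lgt0 // => sc.
  rewrite /normalize !enormZ !invfM !scalerA; congr (_ *: _).
  rewrite mulrAC [in RHS]mulrAC; congr (_ * _).
  have cE : c = s * `|c|.
    move: sc; rewrite /s; case: (sgrP (d x)) d0 => // _ _; rewrite ?mul1r ?mulN1r.
      by move=> c0; rewrite gtr0_norm.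
    by rewrite oppr_gt0 => c0; rewrite ltr0_norm ?opprK.
  have c0 : `|c| != 0 by rewrite normr_eq0; apply: contraTneq sc => ->; rewrite mulr0 ltxx.
  by rewrite {2}cE mulrCA mulVf // mulr1 normr_sg d0 invr1 mul1r.
Qed.

Lemma chart_facts S nu x U F y : chart S nu x U F -> S y -> U y ->
  [/\ F y = 0, dot (nu y) (nu y) = 1, 0 < enorm (rgrad F y) &
    rgrad F y = enorm (rgrad F y) *: nu y].
Proof.
move=> [[oU F2 F0] Ux SU nuE] Sy Uy.
have e0 : 0 < enorm (rgrad F y) by rewrite enorm_gt0 F0.
split=> //; first by have : (S `&` U) y by []; rewrite SU => -[].
  by rewrite nuE // -enorm_sqr enorm_normalize ?F0 // expr1n.
by rewrite nuE // /normalize scalerA mulfV ?gt_eqF // scale1r.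
Qed.

(** The difference of two extensions vanishes on the part [g <= 0] of the patch, and this forces its
    gradient at [x] to be normal. So the tangential gradient makes sense at boundary points too. *)
Lemma tangential_unique S f x U F g N c V1 G1 V2 G2 :
  open U -> Ck 1 U F -> Ck 1 U g -> U x -> F x = 0 -> g x = 0 ->
  row_free (col_mx (grad F x) (grad g x)) -> (forall y, U y -> F y = 0 -> g y <= 0 -> S y) ->
  rgrad F x = c *: N -> dot N N = 1 -> C1_ext S f x V1 G1 -> C1_ext S f x V2 G2 ->
  oproj (TS N) (rgrad G1 x) = oproj (TS N) (rgrad G2 x).
Proof.
move=> oU F1 g1 Ux Fx gx rf SF FN N1 [oV1 V1x G11 E1] [oV2 V2x G21 E2].
have oI : open (U `&` (V1 `&` V2)) by apply: openI => //; exact: openI.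
have [W [b [r [phi [pi pa]]]]] := patch_at_exists nm oI (Ck_sub (@subIsetl _ U _) F1)
  (Ck_sub (@subIsetl _ U _) g1) (conj Ux (conj V1x V2x)) Fx rf.
have b0 : b 0 0 = 0.
  by have [_ _ <- _ _] := pa_ball pa (ballxx b (pa_r pa)); rewrite (pa_b pa).
have oV := openI oV1 oV2.
have G1V := Ck_sub (@subIsetl _ V1 V2) G11; have G2V := Ck_sub (@subIsetr _ V1 V2) G21.
have gF : grad F x != 0 by have := row_free_col_mxl rf; rewrite row_free_rV.
have [a E] : exists a, grad (fun y => G1 y - G2 y) x = a *: grad F x.
  apply: (patch_side_normal pa oI (Ck_sub (@subIsetl _ U _) F1) (conj Ux (conj V1x V2x)) gF oV
    (CkB oV G1V G2V)).
    by move=> z /(pa_sub pa)[].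
  move=> u bu; rewrite b0 => u0; have [/(pa_sub pa)[Uu [V1u V2u]] Fu gu _ _] := pa_ball pa bu.
  have Su : S (phi u) by apply: SF => //; rewrite gu.
  by rewrite E1 // E2 // subrr.
move: E; rewrite (gradB oV G1V G2V) // => /(congr1 (mulmxr (frame x)^T)) /=.
rewrite mulmxBl -scalemxAl -(rgrad_grad oV1 G11 V1x) -(rgrad_grad oV2 G21 V2x) -(rgrad_grad oU F1 Ux) FN => E.
apply/eqP; rewrite -subr_eq0 -oprojB E scalerA oprojZ oproj_TS // N1 scale1r subrr scaler0.
exact: eqxx.
Qed.

Lemma tgradE S nu f x U F g c V1 G1 :
  open U -> Ck 1 U F -> Ck 1 U g -> U x -> F x = 0 -> g x = 0 ->
  row_free (col_mx (grad F x) (grad g x)) -> (forall y, U y -> F y = 0 -> g y <= 0 -> S y) ->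
  rgrad F x = c *: nu x -> dot (nu x) (nu x) = 1 -> C1_ext S f x V1 G1 ->
  tgrad S nu f x = oproj (TS (nu x)) (rgrad G1 x).
Proof.
move=> oU F1 g1 Ux Fx gx rf SF FN N1 e1.
have := @getPex _ [set v | exists (U : set pt) (F : pt -> R),
         C1_ext S f x U F /\ v = oproj (TS (nu x)) (rgrad F x)].
rewrite -/(tgrad S nu f x) => -[|V2 [G2 [e2 ->]]]; first by exists (oproj (TS (nu x)) (rgrad G1 x)), V1, G1.
exact: (tangential_unique oU F1 g1 Ux Fx gx rf SF FN N1 e2 e1).
Qed.

(** At an interior point a shifted coordinate, with gradient independent of that of [F], serves as
    the auxiliary [g]. *)
Lemma tgrad_chart S nu f x y U F V1 G1 : chart S nu y U F -> S x -> U x -> C1_ext S f x V1 G1 ->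
  tgrad S nu f x = oproj (TS (nu x)) (rgrad G1 x).
Proof.
move=> ch Sx Ux e1; have [Fx N1 e0 FN] := chart_facts ch Sx Ux.
have [[oU F2 F0] _ SU nuE] := ch; have F1 := CkS F2.
have [j rj] := ex_row_free (grad_neq0 oU F1 Ux (F0 x Ux)).
apply: (@tgradE S nu f x U F (fun y => y 0 j - x 0 j) _ V1 G1 oU F1 _ Ux Fx _ _ _ FN N1 e1).
- exact: (CkB oU (Ck_coord 1 U j) (Ck_cst 1 U (x 0 j))).
- by rewrite subrr.
- have -> : grad (fun y => y 0 j - x 0 j) x = ee j; last by [].
  rewrite (gradB oU (Ck_coord 1 U j) (Ck_cst 1 U (x 0 j)) Ux) grad_coord.
  by apply/rowP => i; rewrite !mxE derive_cst subr0.
- by move=> z Uz Fz _; have [] : (S `&` U) z by rewrite SU.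
Qed.

End hypersurface.

(** * Superlevels *)

Lemma is_derive_lineE (R : realType) (V : normedModType R) (f : V -> R) (x v : V) (d : R) :
  is_derive x v f d <-> is_derive (0 : R) 1 (fun s : R => f (s *: v + x)) d.
Proof.
have E : (fun h : R => h^-1 *: (((fun s : R => f (s *: v + x)) \o shift 0) (h *: 1) - f (0 *: v + x)))
    = (fun h : R => h^-1 *: ((f \o shift x) (h *: v) - f x)).
  by apply/funext => h /=; rewrite addr0 scale0r add0r /GRing.scale /= mulr1.
by split=> -[d1 d2]; apply: DeriveDef; move: d1 d2; rewrite /derivable /derive E.
Qed.

Lemma is_derive_comp1 (R : realType) (V : normedModType R) (f : V -> R) (h : R -> R) (x v : V) (d l : R) :
  is_derive (f x) 1 h l -> is_derive x v f d -> is_derive x v (fun y => h (f y)) (l * d).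
Proof.
move=> dh /is_derive_lineE df; apply/is_derive_lineE.
by apply: (is_derive1_comp (f := h) _ df); rewrite scale0r add0r.
Qed.

Lemma Ck_sqrt (R : realType) n r (U : set 'rV[R]_n) f : open U -> (forall x, U x -> 0 < f x) -> Ck r U f ->
  Ck r U (fun x => Num.sqrt (f x)).
Proof.
move=> oU f0; have cs x : {for x, continuous f} -> {for x, continuous (fun x => Num.sqrt (f x))}.
  by move=> cf; apply: (@continuous_comp _ _ _ f (@Num.sqrt R)) cf _; exact: sqrt_continuous.
elim: r => [|r IH] Cf; have [cf df] := Cf; first by split=> // x Ux; exact/cs/cf.
split=> [x Ux|j]; first exact/cs/cf.
have [f1 f2] := df j.
have D x : U x -> is_derive x (ee j) (fun x => Num.sqrt (f x)) ((2 * Num.sqrt (f x))^-1 * 'D_(ee j) f x).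
  by move=> Ux; apply: is_derive_comp1; [exact/is_derive1_sqrt/f0|exact/derivableP/f1].
split; first by move=> x /D[].
have s0 x : U x -> 2 * Num.sqrt (f x) != 0 by move=> Ux; rewrite mulf_neq0 // gt_eqF // sqrtr_gt0 f0.
apply: Ck_eq (CkM oU (CkV oU s0 (CkZ 2 oU (IH (CkS Cf)))) f2) => // x Ux.
by have [_ ->] := D x Ux.
Qed.

Section superlevel.
Context {R : realType} (G : carnot R).
Local Notation n := (cdim G).
Local Notation pt := 'rV[R]_n.
Variables (m : nat) (S : set pt) (nu : pt -> pt).
Hypothesis nm : n = m.+2.
Hypotheses (hS : compact_hypersurface S nu) (S0 : mbd S = set0).

Lemma nuE_sq x : S x -> dot (nu x) (nu x) = 1.
Proof.
move=> Sx; have [U [F ch]] := surface_chart nm hS S0 Sx.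
have [_ Ux _ _] := ch; by have [] := chart_facts ch Sx Ux.
Qed.

Lemma mint_surface x : S x -> mint S x.
Proof. by move=> Sx; apply: contrapT => mx; have : mbd S x by []; rewrite S0. Qed.

Lemma rgrad_Ck r U F j : open U -> Ck r.+1 U F -> Ck r U (fun y : pt => rgrad F y 0 j).
Proof.
move=> oU F2; apply: (@Ck_eq _ _ _ _ (fun y => \sum_i frame y j i * 'D_(ee i) F y)) => //.
  move=> y Uy; rewrite (rgrad_grad oU (Ck_le _ F2) Uy) // mxE.
  by apply: eq_bigr => i _; rewrite !mxE mulrC.
apply: Ck_sum => // i; apply: CkM => //; last by have [_ /(_ i)[]] := F2.
exact: Ck_sub (frame_smooth j i r).
Qed.

Lemma PH_Ck r U F j : open U -> Ck r.+1 U F -> Ck r U (fun y : pt => P_H (rgrad F y) 0 j).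
Proof.
move=> oU F2; apply: (@Ck_eq _ _ _ _ (fun y => \sum_i rgrad F y 0 i * flag G 1 i j)) => //.
  by move=> y Uy; rewrite P_HE mxE.
apply: Ck_sum => // i; apply: CkM => //; last exact: Ck_cst.
exact: rgrad_Ck.
Qed.

Lemma P_HZ (a : R) v : P_H (a *: v : pt) = a *: P_H v.
Proof. by rewrite !P_HE scalemxAl. Qed.

(** Being noncharacteristic is expressed through the defining function so as to get an open set of
    the ambient space; [nu] is controlled on [S] only. *)
Definition nonchar U F := U `&` [set y : pt | 0 < dot (P_H (rgrad F y)) (P_H (rgrad F y))].

Lemma nonchar_open U F : open U -> Ck 2 U F -> open (nonchar U F).
Proof.
move=> oU F2; apply: open_pos => // z Uz.
apply: dot_continuous => j; exact: Ck_cont (PH_Ck j oU F2) Uz.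
Qed.

Lemma nonchar_iff U F x y : chart S nu x U F -> S y -> U y ->
  nonchar U F y <-> enorm (P_H (nu y)) != 0.
Proof.
move=> ch Sy Uy; have [_ _ e0 E] := chart_facts ch Sy Uy.
rewrite /nonchar /= E P_HZ dotZl dotZr enorm_eq0 -dot_eq0 mulrA pmulr_rgt0 ?mulr_gt0 //.
by rewrite lt_neqAle dot_ge0 andbT eq_sym; split=> [[_ ->]|].
Qed.

(** The horizontal normal is a normalised first derivative of a C^2 function, and normalising
    removes the length of [rgrad F]. The denominator is nonzero off the characteristic set. *)
Lemma nuH_ext x i : S x -> ~ char_set S nu x ->
  exists V H, C1_ext (S `\` char_set S nu) (fun y => nuH nu y 0 i) x V H.
Proof.
move=> Sx cx; have [U [F ch]] := surface_chart nm hS S0 Sx.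
have [[oU F2 F0] Ux SU nuE] := ch.
have nx : enorm (P_H (nu x)) != 0 by apply/eqP => e0; apply: cx.
pose q y := dot (P_H (rgrad F y)) (P_H (rgrad F y)).
have oN := nonchar_open oU F2.
have Cq : Ck 1 (nonchar U F) q.
  rewrite (_ : q = fun y => \sum_j P_H (rgrad F y) 0 j * P_H (rgrad F y) 0 j).
    by apply: Ck_sum => // j; apply: CkM => //; apply: Ck_sub (PH_Ck j oU F2) => y [].
  by apply/funext => y; rewrite /q dotE.
exists (nonchar U F), (fun y => P_H (rgrad F y) 0 i * (Num.sqrt (q y))^-1); split=> //.
- by apply/(nonchar_iff ch Sx Ux).
- apply: CkM => //; first by apply: Ck_sub (PH_Ck i oU F2) => y [].
  apply: CkV => //; last by apply: Ck_sqrt => // y [].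
  by move=> y [_ qy]; rewrite gt_eqF // sqrtr_gt0.
- move=> y [Sy cy] [Uy qy]; have [_ _ e0 E] := chart_facts ch Sy Uy.
  rewrite /q -/(enorm _) /nuH /normalize E P_HZ enormZ gtr0_norm //.
  move: (P_H (nu y)) (enorm (rgrad F y)) e0 => w e e0; rewrite !mxE.
  by rewrite invfM mulrACA mulfV ?gt_eqF // mul1r mulrC.
Qed.

Variables (f : pt -> R) (t : R).
Hypothesis f1 : Ck 1 setT f.
Hypothesis reg : forall x, S x -> f x = t -> row_free (col_mx (nu x) (rgrad f x)).

Definition superlevel : set pt := S `&` [set x | t <= f x].
Local Notation St := superlevel.

Lemma f_continuous x : {for x, continuous f}. Proof. exact: Ck_cont f1 _. Qed.

Lemma level_sub1 : Ck 1 setT (fun y => t - f y).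
Proof. exact: (CkB openT (Ck_cst 1 setT t) f1). Qed.

Lemma grad_level x : grad (fun y => t - f y) x = - grad f x.
Proof.
rewrite (gradB openT (Ck_cst 1 setT t) f1) //; apply/rowP => j.
by rewrite !mxE derive_cst sub0r.
Qed.

Lemma rgrad_level x : rgrad (fun y => t - f y) x = - rgrad f x.
Proof. by rewrite (rgrad_grad openT level_sub1) // grad_level (rgrad_grad openT f1) // mulNmx. Qed.

Lemma row_free_col_mxZ (a b : R) (u v : pt) : a != 0 -> b != 0 ->
  row_free (col_mx u v) -> row_free (col_mx (a *: u) (b *: v)).
Proof.
move=> a0 b0 rf; have uB : block_mx a%:M 0 0 b%:M \in @unitmx R (1 + 1).
  by rewrite unitmxE det_ublock !det_scalar !expr1 unitfE mulf_neq0.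
have -> : col_mx (a *: u) (b *: v) = block_mx a%:M 0 0 b%:M *m col_mx u v.
  by rewrite mul_block_col !mul0mx addr0 add0r !mul_scalar_mx.
by rewrite /row_free eqmxMfull ?row_full_unit //; exact: rf.
Qed.

Lemma chart_sub x U F V : chart S nu x U F -> open V -> V x -> V `<=` U -> chart S nu x V F.
Proof.
move=> [[oU F2 F0] Ux SU nuE] oV Vx VU; split=> //.
- by split=> //; [exact: Ck_sub F2|move=> y /VU; exact: F0].
- apply/seteqP; split=> y /=.
    move=> [Sy Vy]; split=> //; have : (S `&` U) y by split=> //; apply: VU.
    by rewrite SU => -[].
  by move=> [Vy Fy]; have [] : (S `&` U) y by rewrite SU; split=> //; exact: VU.
- by move=> y Sy /VU; exact: nuE.
Qed.

Lemma level_chart x : S x -> f x = t -> exists U F, chart S nu x U F /\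
  forall y, U y -> row_free (col_mx (rgrad F y) (rgrad (fun y => t - f y) y)).
Proof.
move=> Sx fx; have [U [F ch]] := surface_chart nm hS S0 Sx.
have [[oU F2 F0] Ux SU nuE] := ch; have [_ _ e0 E] := chart_facts ch Sx Ux.
have rfx : row_free (col_mx (rgrad F x) (rgrad (fun y => t - f y) x)).
  rewrite rgrad_level E -scaleN1r; apply: row_free_col_mxZ; [by rewrite gt_eqF|by rewrite oppr_eq0 oner_eq0|exact: reg].
have cA i j : {for x, continuous (fun y => col_mx (rgrad F y) (rgrad (fun y => t - f y) y) i j)}.
  rewrite -(@splitK 1 1 i); case: (fintype.split i) => k /=; rewrite (ord1 k).
    rewrite (_ : (fun y => _) = fun y => rgrad F y 0 j); last by apply/funext => y; rewrite col_mxEu.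
    exact: rgrad_continuous (CkS F2) Ux j.
  rewrite (_ : (fun y => _) = fun y => rgrad (fun y => t - f y) y 0 j); last first.
    by apply/funext => y; rewrite col_mxEd.
  exact: (rgrad_continuous openT level_sub1).
have : nbhs x [set y | row_free (col_mx (rgrad F y) (rgrad (fun y => t - f y) y))].
  exact: near_row_free cA rfx.
rewrite nbhsE => -[B [oB Bx] Brf].
exists (U `&` B), F; split; last by move=> y [_ /Brf].
by apply: (chart_sub ch); [exact: openI|split|move=> y []].
Qed.

Lemma level_bd_chart x : S x -> f x = t -> exists U F,
  chart S nu x U F /\ bd_chart St x U F (fun y => t - f y).
Proof.
move=> Sx fx; have [U [F [ch rf]]] := level_chart Sx fx.
have [[oU F2 F0] Ux SU nuE] := ch; have [Fx _ _ _] := chart_facts ch Sx Ux.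
exists U, F; split=> //; split=> //.
- exact: Ck_sub level_sub1.
- by split=> //; rewrite fx subrr.
- apply/seteqP; split=> y /=.
    move=> [[Sy fy] Uy]; split=> //; last by rewrite subr_le0.
    by have : (S `&` U) y by []; rewrite SU => -[].
  rewrite subr_le0 => -[Uy Fy fy]; split=> //; split=> //.
  by have [] : (S `&` U) y by rewrite SU.
Qed.

Lemma mint_superlevel : mint St = S `&` [set x | t < f x].
Proof.
apply/seteqP; split=> x.
  move=> mx; have [_ [Sx fx]] := mx; split=> //=; rewrite lt_neqAle fx andbT.
  apply/eqP => tf; have [U [F [_ bd]]] := level_bd_chart Sx (esym tf).
  exact: (bd_chart_notin_mint nm bd) mx.
move=> [Sx fx]; split; last by split=> //; exact: ltW.
have [U [F [[oU F2 F0] Ux SU nuE]]] := surface_chart nm hS S0 Sx.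
have oB : open (U `&` [set y | 0 < f y - t]).
  by apply: open_pos => // z _; apply: continuousB; [exact: f_continuous|exact: cst_continuous].
exists (U `&` [set y | 0 < f y - t]), F; split=> //.
- by split=> //; [apply: Ck_sub F2 => y []|move=> y [/F0]].
- by split=> //=; rewrite subr_gt0.
- apply/seteqP; split=> y /=.
    by move=> [[Sy _] [Uy fy]]; split=> //; have : (S `&` U) y by []; rewrite SU => -[].
  move=> [[Uy fy] Fy]; have [Sy _] : (S `&` U) y by rewrite SU.
  by split=> //; split=> //=; rewrite ltW // -subr_gt0.
Qed.

Lemma mbd_superlevel : mbd St = S `&` [set x | f x = t].
Proof.
rewrite /mbd mint_superlevel; apply/seteqP; split=> x.
  move=> [[Sx /= fx] nx]; split=> //=; apply/eqP; rewrite eq_le fx andbT leNgt.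
  by apply/negP => tf; apply: nx.
move=> [Sx /= fx]; split; first by split=> //=; rewrite fx.
by move=> [_ /=]; rewrite fx ltxx.
Qed.

Lemma superlevel_compact : compact St.
Proof.
apply: compact_closedI; first exact: hyp_compact hS.
have := @closed_comp _ _ f [set z | t <= z] _ (@closed_ge _ t); apply.
by move=> x _; exact: f_continuous.
Qed.

Lemma level_compact : compact (S `&` [set x | f x = t]).
Proof.
apply: compact_closedI; first exact: hyp_compact hS.
have := @closed_comp _ _ f [set z | z = t] _ (@closed_eq _ t); apply.
by move=> x _; exact: f_continuous.
Qed.

Lemma superlevel_hypersurface : compact_hypersurface St nu.
Proof.
split.
- exact: superlevel_compact.
- apply/seteqP; split=> x; last first.
    have cS : closed St by apply: compact_closed superlevel_compact; exact: norm_hausdorff.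
    by move=> cx; apply: cS; apply: closure_subset cx => y [].
  move=> [Sx fx]; have [/subset_closure|tf] : mint St x \/ f x = t.
  + by rewrite mint_superlevel; move: fx; rewrite /= le_eqVlt => /orP[/eqP ->|]; [right|left].
  + exact.
  (* A point of the level set is approached from the interior: in a patch whose first coordinate is
     [t - f], decrease that coordinate. *)
  have [U [F [ch rf]]] := level_chart Sx tf.
  have [[oU F2 F0] Ux SU nuE] := ch; have [Fx _ _ _] := chart_facts ch Sx Ux.
  have g1U := Ck_sub (@subsetT _ U) level_sub1.
  have := rf x Ux; rewrite (row_free_rgrad oU (CkS F2) g1U Ux) => rfx.
  have [W [b [r [phi [pi pa]]]]] := patch_at_exists nm oU (CkS F2) g1U Ux Fx rfx.
  have b0 : b 0 0 = 0.
    by have [_ _ <- _ _] := pa_ball pa (ballxx b (pa_r pa)); rewrite (pa_b pa) tf subrr.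
  move=> B; rewrite -(pa_b pa) => Bx.
  have /(_ B Bx) /nbhs_ballP[d /= d0 dB] := C1map_continuous (pa_phi pa) (ballxx b (pa_r pa)).
  have [s [s0 sd sr]] : exists s : R, [/\ 0 < s, s < d & s < r].
    exists (Num.min d r / 2); have r0 := pa_r pa.
    have : 0 < Num.min d r by rewrite lt_min d0.
    have : Num.min d r <= d by rewrite ge_min lexx.
    have : Num.min d r <= r by rewrite ge_min lexx orbT.
    by move: (Num.min d r) => z ? ? ?; split; lra.
  pose u := b - s *: ee 0.
  have bu (e : R) : s < e -> ball b e u.
    move=> se; apply/ballN; have -> : b - u = s *: ee 0 by rewrite /u; vring.
    rewrite normrZ gtr0_norm // (le_lt_trans _ se) // ler_piMr ?norm_delta //; exact: ltW.
  have [Wu Fu gu _ _] := pa_ball pa (bu r sr).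
  exists (phi u); split; last exact: (dB _ (bu d sd)).
  rewrite mint_superlevel; split.
    by have [] : (S `&` U) (phi u) by rewrite SU; split=> //; exact: (pa_sub pa Wu).
  have : t - f (phi u) = - s by rewrite gu /u mxBE b0 !mxE !eqxx /= mulr1 sub0r.
  rewrite /=; lra.
- move=> x [Sx fx]; have [U [F [dF Ux SU nuE]]] := surface_chart nm hS S0 Sx.
  exists U, F; split=> //.
    by move=> y [[Sy _] Uy] /=; have : (S `&` U) y by []; rewrite SU => -[].
  by move=> y [Sy _]; exact: nuE.
- rewrite mbd_superlevel; exists 1%N, (fun=> S `&` [set x | f x = t]), (fun=> S `&` [set x | f x = t]).
  split; last by move=> x; exists ord0.
  move=> _; split=> //; last exact: level_compact.
  move=> x [Sx fx]; have [U [F [ch rf]]] := level_chart Sx fx.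
  have [[oU F2 F0] Ux SU nuE] := ch.
  exists U, (fun i : 'I_2 => if i == ord0 then F else fun y => t - f y); split=> //.
  + by move=> i; case: ifP => _; [exact: CkS|exact: Ck_sub level_sub1].
  + move=> y Uy; have := rf y Uy; set C := col_mx _ _.
    rewrite (_ : C = (\matrix_(i < 2) rgrad (if i == ord0 then F else fun y => t - f y) y : 'M[R]_(1 + 1, n))) //.
    apply/matrixP => i j; rewrite [RHS]mxE; case: (@split_ordP 1 1 i) => k ->; rewrite (ord1 k).
      by rewrite col_mxEu.
    by rewrite col_mxEd.
  + apply/seteqP; split=> y /=.
      move=> [[Sy fy] Uy]; split=> // i; case: ifP => _; last by rewrite fy subrr.
      by have : (S `&` U) y by []; rewrite SU => -[].
    move=> [Uy Fy]; split=> //; have := Fy ord0; have := Fy ord_max => /= ft F0y.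
    split; first by have [] : (S `&` U) y by rewrite SU.
    by apply/eqP; rewrite eq_sym -subr_eq0; apply/eqP.
(* Every boundary point has a boundary chart, so there are no exceptional pieces. *)
- exists 0%N, (fun=> set0), (fun=> set0); split; first by case.
  move=> x [mx nx]; exfalso; apply: nx.
  move: mx; rewrite mbd_superlevel => -[Sx fx].
  have [U [F [_ bd]]] := level_bd_chart Sx fx.
  by exists U, F, (fun y => t - f y).
Qed.

Lemma superlevel_conormal x : S x -> f x = t ->
  let v := oproj (TS (nu x)) (rgrad f x) in
  exists a, conormal St x = a *: v /\ `|a| * enorm v = 1.
Proof.
move=> Sx fx v; have [U [F [ch bd]]] := level_bd_chart Sx fx.
have [_ Ux _ _] := ch; have [_ N1 _ E] := chart_facts ch Sx Ux.
have [a] := conormalP nm bd E N1; rewrite rgrad_level -scaleN1r oprojZ -/v => -[-> H].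
by exists (- a); rewrite scaleN1r scalerN -scaleNr normrN; split=> //; rewrite -[enorm v]enormN -scaleN1r.
Qed.

Lemma superlevel_char : St `\` char_set St nu = St `&` (S `\` char_set S nu).
Proof.
apply/seteqP; split=> x.
  by move=> [Sx cx]; split=> //; case: (Sx) => Sx' fx; split=> // -[_ c]; apply: cx.
by move=> [Sx [_ cx]]; split=> // -[[Sx' _] c]; apply: cx.
Qed.

(* Both tangential gradients are computed from one and the same extension. *)
Lemma superlevel_tgrad h x V H : St x -> ~ char_set S nu x ->
  C1_ext (S `\` char_set S nu) h x V H ->
  tgrad (St `\` char_set St nu) nu h x = tgrad (S `\` char_set S nu) nu h x.
Proof.
move=> [Sx fx] cx eH; have [oV Vx H1 HE] := eH.
have eH' : C1_ext (St `\` char_set St nu) h x V H.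
  by split=> // y; rewrite superlevel_char => -[_]; exact: HE.
have nx : enorm (P_H (nu x)) != 0 by apply/eqP => e0; apply: cx.
suff [U [F [g [c [[oU F1 g1 Ux] [Fx gx rf SF] FN]]]]] : exists U F g c,
    [/\ [/\ open U, Ck 1 U F, Ck 1 U g & U x],
        [/\ F x = 0, g x = 0, row_free (col_mx (grad F x) (grad g x)) &
          forall y, U y -> F y = 0 -> g y <= 0 -> (St `&` (S `\` char_set S nu)) y] &
        rgrad F x = c *: nu x].
  rewrite (tgradE nm oU F1 g1 Ux Fx gx rf _ FN (nuE_sq Sx) eH').
    rewrite (tgradE nm oU F1 g1 Ux Fx gx rf _ FN (nuE_sq Sx) eH) // => y Uy Fy gy.
    by have [] := SF y Uy Fy gy.
  by rewrite superlevel_char.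
have [U [F [ch rfU]]] : exists U F, chart S nu x U F /\ (f x = t ->
    forall y, U y -> row_free (col_mx (rgrad F y) (rgrad (fun y => t - f y) y))).
  have [ft|ft] := pselect (f x = t); first by have [U [F [ch rf]]] := level_chart Sx ft; exists U, F.
  by have [U [F ch]] := surface_chart nm hS S0 Sx; exists U, F.
have [[oU F2 F0] Ux SU nuE] := ch; have F1 := CkS F2; have [Fx N1 e0 E] := chart_facts ch Sx Ux.
pose U' := nonchar U F; have oU' : open U' := nonchar_open oU F2.
have U'x : U' x by exact/(nonchar_iff ch Sx Ux).
have F1' : Ck 1 U' F by apply: Ck_sub F1 => y [].
have inS y : U' y -> F y = 0 -> (S `\` char_set S nu) y.
  move=> U'y Fy; have [Uy _] := U'y; have [Sy _] : (S `&` U) y by rewrite SU.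
  by split=> // -[_ /eqP]; apply/negP/(nonchar_iff ch Sy Uy).
have [ft|ft] := eqVneq (f x) t.
  exists U', F, (fun y => t - f y), (enorm (rgrad F x)); split=> //.
    by split=> //; exact: Ck_sub level_sub1.
  split=> //; first by rewrite ft subrr.
    rewrite -(row_free_rgrad oU' F1' (Ck_sub (@subsetT _ U') level_sub1) U'x); exact: rfU.
  move=> y U'y Fy; rewrite subr_le0 => fy; have [Sy cy] := inS y U'y Fy.
  by split=> //; split.
(* Where [t < f x] the point is interior to the superlevel, and a shifted coordinate takes the place
   of [t - f]. *)
have [j rj] := ex_row_free nm (grad_neq0 oU F1 Ux (F0 x Ux)).
have oB : open (U' `&` [set y | 0 < f y - t]).
  by apply: open_pos => // z _; apply: continuousB; [exact: f_continuous|exact: cst_continuous].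
exists (U' `&` [set y | 0 < f y - t]), F, (fun y => y 0 j - x 0 j), (enorm (rgrad F x)); split=> //.
- split=> //; [by apply: Ck_sub F1' => y []| |].
    by apply: CkB => //; [exact: Ck_coord|exact: Ck_cst].
  by split=> //=; rewrite subr_gt0 lt_neqAle eq_sym ft.
- split=> //; first by rewrite subrr.
    rewrite (gradB openT (Ck_coord 1 _ j) (Ck_cst 1 _ (x 0 j))) // grad_coord.
    suff -> : grad (fun=> x 0 j) x = 0 by rewrite subr0.
    by apply/rowP => i; rewrite !mxE derive_cst.
  move=> y [U'y fy] Fy _; have [Sy cy] := inS y U'y Fy.
  by split=> //; split=> //=; rewrite ltW // -subr_gt0.
Qed.

(** The candidate values for the two curvatures form the same set, so [get] returns the same
    element. *)
Lemma superlevel_hmean x : St x -> ~ char_set S nu x -> hmean_curv St nu x = hmean_curv S nu x.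
Proof.
move=> Stx cx; have [Sx fx] := Stx; congr get; apply/funext => z; apply/propext.
have E tau : (- \sum_j dot
               (\row_i dot (tgrad (St `\` char_set St nu) nu
                              (fun y => nuH nu y 0 i) x) (row j tau))
               (row j tau)) = (- \sum_j dot
               (\row_i dot (tgrad (S `\` char_set S nu) nu
                              (fun y => nuH nu y 0 i) x) (row j tau))
               (row j tau)) :> R.
  move: tau => tau; congr (- _); apply: eq_bigr => j _; congr (dot _ _); apply/rowP => i; rewrite !mxE.
  by congr (dot _ _); have [V [H eH]] := nuH_ext i Sx cx; exact: superlevel_tgrad eH.
by split=> -[tau [h1 h2 h3]]; exists tau; split=> //; rewrite h3 E.
Qed.

End superlevel.

(** * The measure of the hypersurface and of its level sets *)

Lemma finite_subcover (R : realType) n (K : set 'rV[R]_n) (P : set 'rV[R]_n -> Prop) :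
  compact K -> (forall x, K x -> exists W, [/\ open W, W x & P W]) ->
  exists N (W : nat -> set 'rV[R]_n),
    (forall i, (i < N)%N -> open (W i) /\ P (W i)) /\ K `<=` \bigcup_(i in `I_N) W i.
Proof.
rewrite compact_cover => cK KW.
have /choice[W WP] x : exists W, K x -> [/\ open W, W x & P W].
  by have [/KW[W HW]|] := pselect (K x); [exists W|exists set0].
have [|x Kx|D DK KD] := cK _ K W; first by move=> x /WP[].
  by exists x => //; have [] := WP x Kx.
exists (size (finmap.enum_fset D)), (fun i => W (nth 0 (finmap.enum_fset D) i)); split=> [i iD|x Kx].
  have := DK _ (mem_nth 0 iD); rewrite inE => /WP[oW _ PW]; by [].
have [y yD Wy] := KD x Kx; exists (index y (finmap.enum_fset D)) => /=; last by rewrite nth_index.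
by rewrite index_mem.
Qed.

Lemma finite_cover_measure_eq d (X : measurableType d) (R : realType)
    (s1 s2 : {measure set X -> \bar R}) (P : nat -> set X) N (B : set X) :
  (forall i, (i < N)%N -> measurable (P i)) ->
  (forall i A, (i < N)%N -> measurable A -> s1 (A `&` P i) = s2 (A `&` P i)) ->
  measurable B -> B `<=` \bigcup_(i in `I_N) P i -> s1 B = s2 B.
Proof.
elim: N B => [B _ _ _ B0|N IH B mP sP mB BP].
  by rewrite (_ : B = set0) ?measure0 //; apply/seteqP; split=> // x /B0[].
rewrite (measureDI s1 mB (mP N (ltnSn N))) (measureDI s2 mB (mP N (ltnSn N))).
congr (_ + _)%E; last exact: (sP N B).
apply: IH => [i iN|i A iN||]; [exact/mP/ltnW|exact/sP/ltnW|by apply: measurableD mB (mP _ _)|].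
move=> x [Bx nx]; have [i /= iN Px] := BP x Bx; exists i => //=.
by move: iN; rewrite ltnS leq_eqVlt => /orP[/eqP iN|//]; rewrite iN in Px.
Qed.

Lemma min_derive0 (R : realType) n (h : 'rV[R]_n -> R) b (r : R) j : 0 < r -> Ck 1 (ball b r) h ->
  (forall v, ball b r v -> h b <= h v) -> 'D_(ee j) h b = 0.
Proof.
move=> r0 hb hmin; apply/eqP; rewrite -normr_le0; apply/ler_addgt0Pl => e e0; rewrite addr0.
have [d [d0 dr dP]] := C1_strict (@ball_open _ _ b r) hb (ballxx b r0) e0.
have side (s : R) : `|s| = d / 2 -> 0 <= s * 'D_(ee j) h b + e * `|s|.
  move=> sd; have E : b - (b + s *: ee j) = - s *: ee j by vring.
  have nE : `|- s *: (ee j : 'rV[R]_n)| <= `|s|.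
    by rewrite normrZ normrN ler_piMr ?norm_delta.
  have bz : ball b d (b + s *: ee j) by apply/ballN; rewrite E (le_lt_trans nE) // sd; lra.
  have := dP b _ (ballxx b d0) bz; rewrite E.
  rewrite (bigD1 j) //= big1 ?addr0; last first.
    by move=> k kj; rewrite !mxE eqxx (negPf kj) mulr0 mul0r.
  rewrite [(_ *: _ : 'rV_n) 0 j]mxE mxE !eqxx mulr1 => H.
  have := hmin _ (dr _ bz); have := le_trans H (ler_wpM2l (ltW e0) nE).
  by rewrite ler_norml => /andP[]; lra.
have := side (d / 2); have := side (- (d / 2)); rewrite normrN gtr0_norm ?divr_gt0 // => /(_ erefl) + /(_ erefl).
move: ('D_ _ _ _) => D; have d20 : 0 < d / 2 by rewrite divr_gt0.
rewrite ler_norml; move: (d / 2) d20 => z z0 h1 h2; apply/andP; split.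
  by rewrite -(ler_pM2l z0); nra.
by rewrite -(ler_pM2l z0); nra.
Qed.

Lemma row_free_col_nsub (K : fieldType) n (u v : 'rV[K]_n) : row_free (col_mx u v) -> ~ (v <= u)%MS.
Proof.
move=> rf /sub_rVP[c vc]; have := row_free_inj rf; move/(_ _ (row_mx (- c)%:M 1%:M) 0).
rewrite mul_row_col mul1mx mul_scalar_mx vc scaleNr addNr mul0mx => /(_ erefl).
move=> /(congr1 (fun w : 'rV_(1 + 1) => rsubmx w 0 0)).
by rewrite row_mxKr !mxE eqxx => /eqP; rewrite oner_eq0.
Qed.

Section measure.
Context {R : realType} (G : carnot R).
Local Notation n := (cdim G).
Local Notation pt := 'rV[R]_n.

Lemma vol_densityE p (U : set 'rV[R]_p) (phi : 'rV[R]_p -> pt) u : open U -> C1map U phi -> U u ->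
  vol_density phi u = Num.sqrt (gram (jac phi u *m invmx (frame (phi u)))).
Proof.
move=> oU Cphi Uu; rewrite /vol_density gram_dot; congr (Num.sqrt (gram _)).
apply/row_matrixP => i; rewrite rowK row_mul /frame_coord.
by rewrite (row_jac i oU Cphi Uu).
Qed.

Lemma vol_density_continuous p (U : set 'rV[R]_p) (phi : 'rV[R]_p -> pt) u : open U -> C1map U phi ->
  U u -> {for u, continuous (vol_density phi)}.
Proof.
move=> oU Cphi Uu.
apply: (@near_continuous _ _ (fun u => Num.sqrt (gram (jac phi u *m invmx (frame (phi u)))))).
  by apply: (open_near_eq oU Uu) => v Uv; rewrite (vol_densityE oU Cphi Uv).
apply: (@continuous_comp _ _ _ (fun u => gram (jac phi u *m invmx (frame (phi u)))) (@Num.sqrt R)).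
  have cD : forall i j, {for u, continuous (fun v => (jac phi v *m invmx (frame (phi v))) i j)}.
    apply: continuous_mulmx => i j; first exact: jac_continuous Cphi Uu.
    apply: (@continuous_invmx _ _ _ (fun v => frame (phi v))); first exact: frame_unit.
    move=> a b; apply: (@continuous_comp _ _ _ phi (fun x => frame x a b)).
      exact: C1map_continuous Cphi Uu.
    exact: (Ck_cont (frame_smooth a b 0%N)).
  apply: (@continuous_det _ _ p (fun v => (jac phi v *m invmx (frame (phi v))) *m (jac phi v *m invmx (frame (phi v)))^T)).
  apply: continuous_mulmx => i j; first exact: cD.
  rewrite (_ : (fun v => _) = fun v => (jac phi v *m invmx (frame (phi v))) j i); first exact: cD.
  by apply/funext => v; rewrite mxE.
exact: sqrt_continuous.
Qed.

Variables (m : nat) (S : set pt) (nu : pt -> pt).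
Hypothesis nm : n = m.+2.
Hypotheses (hS : compact_hypersurface S nu) (S0 : mbd S = set0).

Lemma surface_borel : measurable (S : set (borelT R n)).
Proof. exact: (compact_borel (hyp_compact hS)). Qed.

(** The bound [c] on the volume density, obtained by shrinking the parameter ball, makes each patch
    of finite area. *)
Definition spatch (W : set pt) (b : 'rV[R]_m.+1) (r : R) (phi : 'rV[R]_m.+1 -> pt)
    (pi : pt -> 'rV[R]_m.+1) (c : R) : Prop :=
  [/\ [/\ 0 < r, open W & C1map (ball b r) phi],
      forall u, ball b r u -> [/\ S (phi u), W (phi u), pi (phi u) = u & row_free (jac phi u)],
      forall y, W y -> S y -> ball b r (pi y) /\ phi (pi y) = y
    & forall u, ball b r u -> vol_density phi u <= c].

Lemma adapted_spatch_C1 f x : Ck 1 setT f -> S x -> row_free (col_mx (nu x) (rgrad f x)) ->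
  exists W b r phi pi c, [/\ W x, spatch W b r phi pi c, C1map W pi & forall u, ball b r u -> f (phi u) = u 0 0].
Proof.
move=> f1 Sx rf; have [U [F ch]] := surface_chart nm hS S0 Sx.
have [[oU F2 F0] Ux SU nuE] := ch; have F1 := CkS F2; have [Fx N1 e0 E] := chart_facts ch Sx Ux.
have f1U := Ck_sub (@subsetT _ U) f1.
have rfx : row_free (col_mx (grad F x) (grad f x)).
  rewrite -(row_free_rgrad oU F1 f1U Ux) E -[rgrad f x]scale1r.
  by apply: row_free_col_mxZ; rewrite ?oner_eq0 ?gt_eqF.
have [W [b [r [phi [pi pa]]]]] := patch_at_exists nm oU F1 f1U Ux Fx rfx.
have br := ballxx b (pa_r pa); pose c := vol_density phi b + 1.
have cv := vol_density_continuous (@ball_open _ _ b r) (pa_phi pa) br.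
have /nbhs_ballP[d0 /= d00 dP] : \forall u \near b, vol_density phi u < c.
  have FF := nbhs_filter b; apply: (cvgr_lt _ cv); rewrite /c; lra.
pose d := Num.min d0 r.
have dgt : 0 < d by rewrite lt_min d00 (pa_r pa).
have dr u : ball b d u -> ball b r u by apply: le_ball; rewrite ge_min lexx orbT.
have dd u : ball b d u -> ball b d0 u by apply: le_ball; rewrite ge_min lexx.
have pib : pi x = b by rewrite -(pa_b pa); case: (pa_ball pa br).
exists (W `&` [set y | 0 < d - `|b - pi y|]), b, d, phi, pi, c; split; last first.
- by move=> u /dr bu; case: (pa_ball pa bu).
- by apply: C1map_sub (pa_pi pa) => y [].
- split.
  + split=> //; last by apply: C1map_sub (pa_phi pa).
    apply: open_pos; first exact: pa_open pa.
    move=> y Wy; apply: (@continuousB R R); first exact: cst_continuous.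
    apply: (@continuous_comp _ _ _ (fun y => b - pi y) (fun z => `|z|)); last exact: norm_continuous.
    apply: continuousB; first exact: cst_continuous.
    exact: C1map_continuous (pa_pi pa) Wy.
  + move=> u bu; have [Wu Fu fu piu rj] := pa_ball pa (dr u bu); split=> //.
      by have [] : (S `&` U) (phi u) by rewrite SU; split=> //; exact: (pa_sub pa Wu).
    by split=> //=; rewrite piu subr_gt0; apply/ballN.
  + move=> y [Wy /=]; rewrite subr_gt0 => /ballN by_ Sy.
    have Fy : F y = 0.
      have : (S `&` U) y by split=> //; exact: (pa_sub pa Wy).
      by rewrite SU => -[].
    by have [_ ->] := pa_inv pa Wy Fy.
  + by move=> u bu; apply/ltW/dP/dd.
- by split; [exact: pa_x pa|rewrite /= pib subrr normr0 subr0].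
Qed.

Lemma adapted_spatch f x : Ck 1 setT f -> S x -> row_free (col_mx (nu x) (rgrad f x)) ->
  exists W b r phi pi c, [/\ W x, spatch W b r phi pi c & forall u, ball b r u -> f (phi u) = u 0 0].
Proof.
move=> f1 Sx rf; have [W [b [r [phi [pi [c [Wx sp _ H]]]]]]] := adapted_spatch_C1 f1 Sx rf.
by exists W, b, r, phi, pi, c.
Qed.

Lemma spatch_exists_C1 x : S x -> exists W b r phi pi c, [/\ W x, spatch W b r phi pi c & C1map W pi].
Proof.
move=> Sx; have N0 : nu x != 0.
  by rewrite -dot_eq0 (nuE_sq nm hS S0 Sx) oner_eq0.
have [j rj] : exists j, row_free (col_mx (nu x) (rgrad (fun y : pt => y 0 j) x)).
  have : nu x *m invmx (frame x)^T != 0.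
    apply: contra_neq N0 => /(congr1 (mulmxr (frame x)^T)).
    by rewrite /= mulmxKV ?mul0mx // unitmx_tr frame_unit.
  move=> /(ex_row_free nm)[j rj]; exists j.
  have -> : col_mx (nu x) (rgrad (fun y : pt => y 0 j) x) = col_mx (nu x *m invmx (frame x)^T) (ee j) *m (frame x)^T.
    rewrite mul_col_mx mulmxKV ?unitmx_tr ?frame_unit //.
    by rewrite (rgrad_grad openT (Ck_coord 1 _ j)) // grad_coord.
  by rewrite /row_free mxrankMfree // row_free_unit unitmx_tr frame_unit.
have [W [b [r [phi [pi [c [Wx sp Cpi _]]]]]]] := adapted_spatch_C1 (Ck_coord 1 _ j) Sx rj.
by exists W, b, r, phi, pi, c.
Qed.

Lemma spatch_exists x : S x -> exists W b r phi pi c, W x /\ spatch W b r phi pi c.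
Proof.
move=> /spatch_exists_C1[W [b [r [phi [pi [c [Wx sp _]]]]]]].
by exists W, b, r, phi, pi, c.
Qed.

Lemma spatch_image W b r phi pi c : spatch W b r phi pi c -> phi @` (ball b r) = S `&` W.
Proof.
move=> [[r0 oW Cphi] H1 H2 _]; apply/seteqP; split=> [y [u bu <-]|y [Sy Wy]].
  by have [] := H1 u bu.
by have [bu E] := H2 y Wy Sy; exists (pi y).
Qed.

Lemma patch_restr W b r phi pi c (M : set pt) (V : set 'rV[R]_m.+1) : spatch W b r phi pi c ->
  open V -> V `<=` ball b r -> phi @` V `<=` M -> C1_patch M V phi.
Proof.
move=> [[r0 oW Cphi] H1 H2 _] oV Vb VM; split=> //.
- exact: C1map_sub Cphi.
- move=> u v; rewrite !inE => /Vb bu /Vb bv E.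
  by have [_ _ <- _] := H1 u bu; have [_ _ <- _] := H1 v bv; rewrite E.
- move=> u /Vb bu; have [_ _ _] := H1 u bu.
  rewrite (_ : jac phi u = \matrix_j 'D_(ee j) phi u) //.
  by apply/row_matrixP => j; rewrite rowK (row_jac j (@ball_open _ _ b r) Cphi bu).
Qed.

Lemma spatch_measurable W b r phi pi c : spatch W b r phi pi c ->
  measurable (S `&` W : set (borelT R n)).
Proof. by move=> [[_ oW _] _ _ _]; apply: measurableI; [exact: surface_borel|exact: open_borel]. Qed.

Lemma spatch_measurable_fun W b r phi pi c : spatch W b r phi pi c ->
  measurable_fun (ball b r : set (borelT R m.+1)) (phi : borelT R m.+1 -> borelT R n).
Proof.
move=> [[r0 _ Cphi] _ _ _]; apply: measurable_fun_on_borel; first exact: ball_open.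
by move=> u bu; exact: C1map_continuous Cphi bu.
Qed.

Lemma vol_measurable p (U : set 'rV[R]_p) (phi : 'rV[R]_p -> pt) : open U -> C1map U phi ->
  measurable_fun (U : set (borelT R p)) (vol_density phi : borelT R p -> R).
Proof.
move=> oU CU; apply: measurable_fun_on => //; first exact: open_borel.
by move=> u Uu; exact: vol_density_continuous oU CU Uu.
Qed.

Lemma leb_int_indic p (V : set (borelT R p)) (w : borelT R p -> R) : measurable V ->
  measurable_fun V w -> (forall u, V u -> 0 <= w u) ->
  leb_int (fun u => (w u * \1_V u)%:E) = (\int[lebm p]_(u in V) (w u)%:E)%E.
Proof.
move=> mV mw w0.
have E : (fun u : 'rV[R]_p => (w u * \1_V u)%:E) = (EFin \o w) \_ V.
  by apply/funext => u; rewrite /patch indicE; case: (u \in V); rewrite /= ?mulr1 ?mulr0.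
rewrite E leb_intE; first by rewrite [RHS]integral_mkcond.
  by apply/(measurable_restrictT _ _).1 => //; exact/measurable_EFinP.
by move=> u; rewrite /patch; case: ifPn => // /set_mem /w0; rewrite lee_fin.
Qed.

Variable s : {measure set (borelT R n) -> \bar R}.
Hypothesis hs : is_riem_measure m.+1 S s.

Lemma spatch_measure W b r phi pi c (A : set (borelT R n)) : spatch W b r phi pi c -> measurable A ->
  s (A `&` (S `&` W)) = (\int[lebm m.+1]_(u in ball b r `&` phi @^-1` A) (vol_density phi u)%:E)%E.
Proof.
move=> sp mA; have [[r0 oW Cphi] _ _ _] := sp.
have pc : C1_patch S (ball b r) phi.
  apply: (patch_restr sp) => //; first exact: ball_open.
  by rewrite (spatch_image sp); exact: subIsetl.
rewrite -(spatch_image sp) (hs.1 _ _ _ pc mA) leb_int_indic //.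
- by apply: spatch_measurable_fun sp _ _ mA; exact: ball_borel.
- by apply: measurable_funS (vol_measurable (@ball_open _ _ b r) Cphi); [exact: ball_borel|exact: subIsetl].
- by move=> u _; exact: sqrtr_ge0.
Qed.

Lemma spatch_integral W b r phi pi c D (g : borelT R n -> \bar R) : spatch W b r phi pi c ->
  measurable D -> measurable_fun D g -> (forall y, D y -> 0 <= g y)%E ->
  (\int[s]_(y in D `&` (S `&` W)) g y =
   \int[lebm m.+1]_(u in ball b r `&` phi @^-1` D) ((vol_density phi u)%:E * g (phi u)))%E.
Proof.
move=> sp mD mg g0; have [[r0 oW Cphi] _ _ _] := sp.
apply: (@ge0_integral_image_density _ _ _ _ _ (lebm m.+1) s (ball b r) (S `&` W) phi) => //.
- exact: ball_borel.
- exact: spatch_measurable sp.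
- exact: spatch_measurable_fun sp.
- exact: vol_measurable (@ball_open _ _ b r) Cphi.
- by move=> u _; exact: sqrtr_ge0.
- by move=> A mA; exact: spatch_measure sp mA.
Qed.

Lemma surface_finite : (s S < +oo)%E.
Proof.
have [|N [W [WP SW]]] := @finite_subcover R n S (fun W => measurable (W : set (borelT R n)) /\ s (S `&` W) < +oo)%E (hyp_compact hS).
  move=> x Sx; have [W [b [r [phi [pi [c [Wx sp]]]]]]] := spatch_exists Sx.
  have [[r0 oW Cphi] H1 H2 H3] := sp; exists W; split=> //; split; first exact: open_borel.
  rewrite -[S `&` W]setTI (spatch_measure sp) // preimage_setT setIT.
  apply: le_lt_trans (_ : (\int[lebm m.+1]_(u in (ball b r : set (borelT R _))) c%:E < +oo)%E).
    apply: ge0_le_integral => //; first exact: ball_borel.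
    - by move=> u _; rewrite lee_fin sqrtr_ge0.
    - by apply/measurable_EFinP; exact: vol_measurable (@ball_open _ _ b r) Cphi.
  rewrite integral_cst; last exact: ball_borel.
  rewrite [X in (_ * X)%E](_ : _ = ((r *+ 2) ^+ m.+1)%:E); last exact: lebm_ball.
  by rewrite -EFinM ltry.
have -> : S = \big[setU/set0]_(i < N) (S `&` W i).
  rewrite -(bigcup_mkord N (fun i => S `&` W i)); apply/seteqP; split=> x; last by move=> [i _ []].
  by move=> Sx; have [i iN Wx] := SW x Sx; exists i.
have mW i : (i < N)%N -> measurable (S `&` W i : set (borelT R n)).
  by move=> /WP[_ [mW _]]; apply: measurableI => //; exact: surface_borel.
apply: le_lt_trans (Boole_inequality s mW) _; apply: lte_sum_pinfty => i _.
by have [_ []] := WP i (ltn_ord i).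
Qed.

(** The inner integral vanishes for all heights but one. *)
Lemma leb_int_null_slice p (g : borelT R p.+1 -> \bar R) (t : R) : measurable_fun setT g ->
  (forall u, 0 <= g u)%E -> (forall u : 'rV[R]_p.+1, u 0 0 != t -> g u = 0%E) -> leb_int g = 0%E.
Proof.
move=> mg g0 gt.
have E : (fun tau : R => leb_int (fun x => g (rowc tau x))) =
    (fun tau => leb_int (fun x => g (rowc tau x))) \_ [set t].
  apply/funext => tau; rewrite /patch; case: ifPn => //; rewrite notin_setE /= => /eqP tt.
  rewrite leb_intE; last 2 first.
    by apply: measurableT_comp mg _; exact: measurable_rowc2.
    by move=> x.
  by apply: integral0_eq => x _; rewrite gt // rowc00.
rewrite /= -[LHS]/(\int[lebesgue_measure]_tau (fun tau => leb_int (fun x => g (rowc tau x))) tau)%E E.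
by rewrite -integral_mkcond integral_set1.
Qed.

Section level_null.
Variables (f : pt -> R) (t : R).
Hypothesis f1 : Ck 1 setT f.
Hypothesis reg : forall x, S x -> f x = t -> row_free (col_mx (nu x) (rgrad f x)).
Local Notation St := (superlevel S f t).
Local Notation Lt := (S `&` [set x | f x = t]).
Local Notation S' := (S `&` [set x | t < f x]).

Lemma gt_open : open [set x | t < f x].
Proof.
have := @open_comp _ _ f [set z | t < z] _ (@open_gt _ t); apply.
by move=> x _; exact: (f_continuous f1).
Qed.

Lemma gt_borel : measurable (S' : set (borelT R n)).
Proof. by apply: measurableI; [exact: surface_borel|exact: (open_borel gt_open)]. Qed.

(** In patches adapted to [f] the level set is a single slice. *)
Lemma level_null : s Lt = 0%E.
Proof.
have cL : compact Lt by apply: level_compact f1; exact: hS.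
have mL : measurable (Lt : set (borelT R n)) by exact: compact_borel.
have [|N [W [WP SW]]] := @finite_subcover R n Lt (fun W => measurable (Lt `&` W : set (borelT R n)) /\ s (Lt `&` W) = 0%E) cL.
  move=> x [Sx fx]; have [W [b [r [phi [pi [c [Wx sp fphi]]]]]]] := adapted_spatch f1 Sx (reg Sx fx).
  have [[r0 oW Cphi] H1 H2 H3] := sp; exists W; split=> //.
  split; first by apply: measurableI => //; exact: open_borel.
  have -> : Lt `&` W = Lt `&` (S `&` W).
    by apply/seteqP; split=> y /=; [move=> [[Sy fy] Wy]|move=> [Ly [_ Wy]]]; split.
  have mV : measurable (ball b r `&` phi @^-1` Lt : set (borelT R m.+1)).
    by apply: spatch_measurable_fun sp _ _ mL; exact: ball_borel.
  have mw := vol_measurable (@ball_open _ _ b r) Cphi.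
  have mw' : measurable_fun (ball b r `&` phi @^-1` Lt : set (borelT R m.+1)) (vol_density phi : borelT R m.+1 -> R).
    by apply: measurable_funS mw; [exact: ball_borel|exact: subIsetl].
  rewrite (spatch_measure sp) // -leb_int_indic //; last by move=> u _; exact: sqrtr_ge0.
  apply: (@leb_int_null_slice m _ t).
  - apply/measurable_EFinP.
    rewrite (_ : (fun u => _) = (vol_density phi) \_ (ball b r `&` phi @^-1` Lt)); last first.
      by apply/funext => u; rewrite /patch indicE; case: (u \in _); rewrite /= ?mulr1 ?mulr0.
    exact/(measurable_restrictT _ _).1.
  - by move=> u; rewrite lee_fin mulr_ge0 ?sqrtr_ge0 ?indicE ?ler0n.
  - move=> u ut; rewrite indicE memNset ?mulr0 // => -[bu [_ /= fu]].
    by move: ut; rewrite -(fphi u bu) fu eqxx.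
apply/eqP; rewrite eq_le measure_ge0 andbT.
have -> : Lt = \big[setU/set0]_(i < N) (Lt `&` W i).
  rewrite -(bigcup_mkord N (fun i => Lt `&` W i)); apply/seteqP; split=> x; last by move=> [i _ []].
  by move=> Lx; have [i iN Wx] := SW x Lx; exists i.
apply: (le_trans (@Boole_inequality _ _ _ s (fun i => Lt `&` W i : set (borelT R n)) N _)).
  by move=> i /WP[_ []].
by rewrite big1 // => i _; have [_ []] := WP i (ltn_ord i).
Qed.

(* At a point of the level set, [f] would have a minimum along the patch. *)
Lemma patch_superlevel U (phi : 'rV[R]_m.+1 -> pt) : C1_patch St U phi -> phi @` U `<=` S'.
Proof.
move=> pS _ [u Uu <-]; have Stu : St (phi u) by apply: (patch_sub pS); exists u.
have [Su fu] := Stu; split=> //=; rewrite lt_neqAle fu andbT; apply/eqP => tf.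
have oU := patch_open pS; have Cphi : C1map U phi := patch_C1 pS.
have [V [F ch]] := surface_chart nm hS S0 Su.
have [[oV F2 F0] Vu SV nuE] := ch; have F1 := CkS F2; have [Fu N1 e0 E] := chart_facts ch Su Vu.
have rfx : row_free (col_mx (grad F (phi u)) (grad f (phi u))).
  rewrite -(row_free_rgrad oV F1 (Ck_sub (@subsetT _ V) f1) Vu) E -[rgrad f _]scale1r.
  by apply: row_free_col_mxZ; rewrite ?oner_eq0 ?gt_eqF //; exact: reg.
have [r [r0 rU rV]] : exists r : R, [/\ 0 < r, ball u r `<=` U & forall v, ball u r v -> V (phi v)].
  have /nbhs_ballP[r1 /= r10 r1U] := open_nbhs_nbhs (conj oU Uu).
  have /nbhs_ballP[r2 /= r20 r2V] := C1map_continuous Cphi Uu (open_nbhs_nbhs (conj oV Vu)).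
  exists (Num.min r1 r2); split; first by rewrite lt_min r10.
    by move=> v bv; apply: r1U; apply: le_ball bv; rewrite ge_min lexx.
  by move=> v bv; apply: r2V; apply: le_ball bv; rewrite ge_min lexx orbT.
have Cb := C1map_sub rU Cphi.
have inV v : ball u r v -> [/\ S (phi v), t <= f (phi v) & F (phi v) = 0].
  move=> bv; have [Sv fv] : St (phi v) by apply: (patch_sub pS); exists v => //; exact: rU.
  have : (S `&` V) (phi v) by split=> //; exact: rV.
  by rewrite SV => -[].
have jac0 g : Ck 1 setT g \/ g = F -> (forall v, ball u r v -> g (phi u) <= g (phi v)) ->
    jac phi u *m (grad g (phi u))^T = 0.
  move=> g1 gmin; have [V' [oV' g1V V'u V'b]] : exists V', [/\ open V', Ck 1 V' g, V' (phi u) &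
      forall v, ball u r v -> V' (phi v)].
    case: g1 => [g1|->]; first by exists setT; split=> //; exact: openT.
    by exists V.
  have bu := ballxx u r0.
  apply/colP => j; rewrite [RHS]mxE -[jac phi u *m _]trmxK trmx_mul trmxK mxE.
  rewrite -(grad_comp (@ball_open _ _ u r) oV' Cb g1V bu V'u) mxE.
  apply: (@min_derive0 R m.+1 (fun v => g (phi v)) u r j r0 _ gmin).
  by apply: (Ck_comp oV' (@ball_open _ _ u r) Cb V'b g1V).
have rj : row_free (jac phi u).
  rewrite (_ : jac phi u = \matrix_j 'D_(ee j) phi u); first exact: (patch_imm pS).
  by apply/row_matrixP => j; rewrite rowK (row_jac j oU Cphi Uu).
apply: (row_free_col_nsub rfx); apply: (kernel_span _ rj).
- by rewrite addn1.
- by apply: row_free_col_mxl rfx.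
- by apply: jac0; [right|move=> v /inV[_ _ ->]; rewrite Fu].
- by apply: jac0; [left|move=> v /inV[_ ? _]; rewrite -tf].
Qed.

Lemma surface_patch_cover : exists N (W : nat -> set pt) b r phi pi c,
  (forall i, (i < N)%N -> spatch (W i) (b i) (r i) (phi i) (pi i) (c i)) /\ S `<=` \bigcup_(i in `I_N) W i.
Proof.
have [x Sx|N [W [WP SW]]] := @finite_subcover R n S (fun W => exists b r phi pi c, spatch W b r phi pi c) (hyp_compact hS).
  have [W [b [r [phi [pi [c [Wx sp]]]]]]] := spatch_exists Sx.
  by exists W; split=> //; [have [[]] := sp|exists b, r, phi, pi, c].
have /choice[q qP] i : exists q : 'rV[R]_m.+1 * R * ('rV[R]_m.+1 -> pt) * (pt -> 'rV[R]_m.+1) * R,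
    (i < N)%N -> spatch (W i) q.1.1.1.1 q.1.1.1.2 q.1.1.2 q.1.2 q.2.
  have [iN|iN] := boolP (i < N)%N; last by exists (0, 0, fun=> 0, fun=> 0, 0).
  by have [_ [b [r [phi [pi [c sp]]]]]] := WP i iN; exists (b, r, phi, pi, c).
exists N, W, (fun i => (q i).1.1.1.1), (fun i => (q i).1.1.1.2), (fun i => (q i).1.1.2), (fun i => (q i).1.2), (fun i => (q i).2).
by split.
Qed.

Lemma superlevel_patch W b r phi pi c : spatch W b r phi pi c ->
  C1_patch St (ball b r `&` phi @^-1` [set x | t < f x]) phi.
Proof.
move=> sp; have [[r0 oW Cphi] H1 H2 H3] := sp; apply: (patch_restr sp).
- rewrite (_ : _ `&` _ = ball b r `&` [set u | 0 < f (phi u) - t]).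
    apply: open_pos; first exact: ball_open.
    move=> u bu; apply: (@continuousB R R); last exact: cst_continuous.
    by apply: (@continuous_comp _ _ _ phi f); [exact: C1map_continuous Cphi bu|exact: (f_continuous f1)].
  by apply/seteqP; split=> u [bu] /=; rewrite ?subr_gt0 // => fu; split=> //=; rewrite -subr_gt0.
- exact: subIsetl.
- move=> _ [u [bu /= fu] <-]; have [Su _ _ _] := H1 u bu; split=> //; exact: ltW.
Qed.

Lemma gt_no_patch (A : set pt) : (forall (U : set 'rV[R]_m.+1) (phi : 'rV[R]_m.+1 -> pt),
  C1_patch St U phi -> A `&` phi @` U = set0) -> A `&` S' = set0.
Proof.
move=> A0; apply/seteqP; split=> // x [Ax [Sx fx]].
have [W [b [r [phi [pi [c [Wx sp]]]]]]] := spatch_exists Sx.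
have [_ H1 H2 _] := sp; have [bx px] := H2 x Wx Sx.
rewrite -(A0 _ _ (superlevel_patch sp)); split=> //; exists (pi x) => //.
by split=> //=; rewrite px.
Qed.

Lemma superlevel_split : St = S' `|` Lt.
Proof.
apply/seteqP; split=> x.
  move=> [Sx /=]; rewrite le_eqVlt => /orP[/eqP <-|fx]; first by right.
  by left.
by move=> [[Sx fx]|[Sx fx]]; split=> //=; [exact: ltW|rewrite fx].
Qed.

Lemma level_borel : measurable (Lt : set (borelT R n)).
Proof. by apply: compact_borel; apply: level_compact f1; exact: hS. Qed.

Lemma superlevel_borel : measurable (St : set (borelT R n)).
Proof. by rewrite superlevel_split; apply: measurableU; [exact: gt_borel|exact: level_borel]. Qed.

Lemma superlevel_measure (A : set (borelT R n)) : measurable A -> s (A `&` St) = s (A `&` S').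
Proof.
move=> mA; rewrite superlevel_split setIUr measureU.
- have H : (s (A `&` Lt) <= s Lt)%E.
    apply: le_measure; rewrite ?inE; [|exact: level_borel|exact: subIsetr].
    by apply: measurableI => //; exact: level_borel.
  rewrite level_null in H.
  rewrite [X in (_ + X)%E](_ : _ = 0%E) ?adde0 //.
  by apply: le_anti; rewrite measure_ge0 andbT; exact: H.
- by apply: measurableI => //; exact: gt_borel.
- by apply: measurableI => //; exact: level_borel.
- by apply/seteqP; split=> // x [[_ [_ /= +]] [_ [_ /= fx]]]; rewrite fx ltxx.
Qed.

(** A patch of [St] is a patch of [S]. Conversely every point with [t < f] lies on a patch of [St],
    so a set missed by all these patches meets [St] in the null level set only. *)
Lemma superlevel_riem : is_riem_measure m.+1 St (mrestr s superlevel_borel).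
Proof.
split=> [U phi A pS mA|A mA A0].
  have sub : phi @` U `<=` St := patch_sub pS.
  have E : A `&` phi @` U `&` St = A `&` phi @` U.
    by apply/seteqP; split=> x; [case|move=> [Ax Ux]; split=> //; exact: sub].
  apply: (etrans (congr1 s E)).
  apply: hs.1 => //; case: pS => *; split=> //; by apply: subset_trans sub _ => x [].
apply: (etrans (superlevel_measure mA)).
by rewrite (gt_no_patch A0) measure0.
Qed.

(** The measure attached to [St] is a chosen one, so uniqueness is required. Patches of [St] do not
    meet the level set, hence any Riemannian measure of [St] vanishes off [S'], and on [S'] it is
    determined by finitely many patches. *)
Lemma superlevel_riem_unique s' (A : set (borelT R n)) : is_riem_measure m.+1 St s' -> measurable A ->
  s' A = s (A `&` St).
Proof.
move=> hs' mA; rewrite superlevel_measure // (measureDI s' mA gt_borel).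
rewrite [X in (X + _)%E](_ : _ = 0%E) ?add0e; last first.
  apply: hs'.2; first exact: measurableD mA gt_borel.
  move=> U phi pS; apply/seteqP; split=> // x [[_ nx] Ux]; exfalso; apply: nx.
  exact: patch_superlevel pS _ Ux.
have [N [W [b [r [phi [pi [c [sp SW]]]]]]]] := surface_patch_cover.
apply: (@finite_cover_measure_eq _ _ R s' s (fun i => S' `&` W i) N).
- move=> i /sp[[_ oW _] _ _ _]; apply: measurableI; [exact: gt_borel|exact: open_borel].
- move=> i B iN mB; have sp' := sp i iN; have pi' := superlevel_patch sp'.
  have -> : S' `&` W i = phi i @` (ball (b i) (r i) `&` phi i @^-1` [set x | t < f x]).
    apply/seteqP; split=> x.
      move=> [[Sx fx] Wx]; have [_ _ H2 _] := sp'; have [bx px] := H2 x Wx Sx.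
      by exists (pi i x) => //; split=> //=; rewrite px.
    move=> [u [bu fu] <-]; have [_ H1 _ _] := sp'; have [Su Wu _ _] := H1 u bu.
    by [].
  rewrite hs'.1 // hs.1 //; case: pi' => o1 o2 o3 o4 o5; split=> //.
  by apply: subset_trans o5 _ => x [].
- by apply: measurableI => //; exact: gt_borel.
- by move=> x [_ [Sx fx]]; have [i iN Wx] := SW x Sx; exists i.
Qed.

End level_null.
End measure.

(** * The coarea formula *)

Lemma indic_measurable d (T : measurableType d) (R : realType) (V : set T) (w : T -> R) :
  measurable V -> measurable_fun V w -> measurable_fun setT (fun u => (w u * \1_V u)%:E).
Proof.
move=> mV mw; apply/measurable_EFinP.
rewrite (_ : (fun u => _) = w \_ V); first exact/(measurable_restrictT _ _).1.
by apply/funext => u; rewrite /patch indicE; case: (u \in V); rewrite /= ?mulr1 ?mulr0.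
Qed.

Lemma integral_indic_fun d (T : measurableType d) (R : realType) (mu : {measure set T -> \bar R})
    (V : set T) (w : T -> R) :
  (\int[mu]_x (w x * \1_V x)%:E = \int[mu]_(x in V) (w x)%:E)%E.
Proof.
rewrite [RHS]integral_mkcond; apply: eq_integral => u _.
by rewrite /patch indicE; case: (u \in V); rewrite /= ?mulr1 ?mulr0.
Qed.

Lemma bigsetU_sub T I (s : seq I) (P : pred I) (F : I -> set T) (A : set T) :
  (forall i, P i -> F i `<=` A) -> \big[setU/set0]_(i <- s | P i) F i `<=` A.
Proof.
move=> FA; elim/big_ind: _ => // [X Y XA YA x [/XA|/YA]//].
Qed.

Section rowc.
Context {R : realType}.

Lemma rowc_C1map m (t : R) (U : set 'rV[R]_m) : C1map U (fun x : 'rV[R]_m => rowc t x).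
Proof.
rewrite /rowc; apply: (@C1map_row_mx R m 1 m U (fun=> t%:M) id).
  by move=> i; exact: Ck_cst.
by move=> i; exact: Ck_coord.
Qed.

Lemma jac_rowc m (t : R) (x : 'rV[R]_m) : jac (fun x : 'rV[R]_m => rowc t x) x = @row_mx R m 1 m 0 1%:M.
Proof.
rewrite /rowc (@jac_row_mx R m 1 m (fun=> t%:M) id) jac_id.
suff -> : jac (fun=> t%:M : 'rV_1) x = 0 by [].
by apply/matrixP => i j; rewrite !mxE derive_cst.
Qed.

Lemma dsubmxE m n (A : 'M[R]_(m.+1, n)) : @dsubmx R 1 m n A = @row_mx R m 1 m 0 1%:M *m A.
Proof. by rewrite -[A in RHS](@vsubmxK R 1 m n A) mul_row_col mul0mx add0r mul1mx. Qed.

End rowc.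

Section coarea.
Context {R : realType} (G : carnot R).
Local Notation n := (cdim G).
Local Notation pt := 'rV[R]_n.
Variables (m : nat) (S : set pt) (nu : pt -> pt).
Hypothesis nm : n = m.+2.
Hypotheses (hS : compact_hypersurface S nu) (S0 : mbd S = set0).

Lemma jac_kill p (u : 'rV[R]_p) (r : R) (phi : 'rV[R]_p -> pt) V g : 0 < r -> C1map (ball u r) phi ->
  open V -> Ck 1 V g -> (forall v, ball u r v -> V (phi v) /\ g (phi v) = 0) ->
  jac phi u *m (grad g (phi u))^T = 0.
Proof.
move=> r0 Cb oV g1 H; have bu := ballxx u r0.
apply/colP => j; rewrite [RHS]mxE -[jac phi u *m _]trmxK trmx_mul trmxK mxE.
rewrite -(grad_comp (@ball_open _ _ u r) oV Cb g1 bu (H u bu).1) mxE.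
apply: (@min_derive0 R p (fun v => g (phi v)) u r j r0).
  by apply: (Ck_comp oV (@ball_open _ _ u r) Cb _ g1) => v /H[].
by move=> v bv; rewrite (H u bu).2 (H v bv).2.
Qed.

(* The rows are the frame coordinates of the coordinate tangent vectors. *)
Definition tjac p (phi : 'rV[R]_p -> pt) u := jac phi u *m invmx (frame (phi u)).

Lemma tjac_row_free p (phi : 'rV[R]_p -> pt) u : row_free (jac phi u) -> row_free (tjac phi u).
Proof. by move=> rf; rewrite /row_free mxrankMfree // row_free_unit unitmx_inv frame_unit. Qed.

Lemma tjac_rgrad p (phi : 'rV[R]_p -> pt) u V g : open V -> Ck 1 V g -> V (phi u) ->
  tjac phi u *m (rgrad g (phi u))^T = jac phi u *m (grad g (phi u))^T.
Proof.
move=> oV g1 Vu; rewrite (rgrad_grad oV g1 Vu) trmx_mul trmxK /tjac -mulmxA.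
by rewrite mulKmx // frame_unit.
Qed.

Lemma spatch_normal W b r phi pi c u : @spatch _ G m S W b r phi pi c -> ball b r u ->
  tjac phi u *m (nu (phi u))^T = 0.
Proof.
move=> [[r0 oW Cphi] H1 _ _] bu; have [Su _ _ _] := H1 u bu.
have [V [F ch]] := surface_chart nm hS S0 Su.
have [[oV F2 F0] Vu SV nuE] := ch; have [_ _ e0 E] := chart_facts ch Su Vu.
have /nbhs_ballP[d1 /= d10 d1b] := open_nbhs_nbhs (conj (@ball_open _ _ b r) bu).
have /nbhs_ballP[d2 /= d20 d2V] := C1map_continuous Cphi bu (open_nbhs_nbhs (conj oV Vu)).
pose d := Num.min d1 d2; have d0 : 0 < d by rewrite lt_min d10.
have db : ball u d `<=` ball b r by move=> v /(le_ball (_ : d <= d1)) H; apply: d1b; apply: H; rewrite ge_min lexx.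
have dV v : ball u d v -> V (phi v) by move=> /(le_ball (_ : d <= d2)) H; apply: d2V; apply: H; rewrite ge_min lexx orbT.
have : tjac phi u *m (rgrad F (phi u))^T = 0.
  rewrite (tjac_rgrad oV (CkS F2) Vu); apply: (jac_kill d0 _ oV (CkS F2)).
    exact: C1map_sub Cphi.
  move=> v bv; have Vv := dV v bv; split=> //; have [Sv _ _ _] := H1 v (db v bv).
  by have : (S `&` V) (phi v) by []; rewrite SV => -[].
rewrite E linearZ /= -scalemxAr => /eqP; rewrite scaler_eq0 gt_eqF //= => /eqP.
by [].
Qed.

Variable f : pt -> R.
Hypothesis f1 : Ck 1 setT f.

Definition tang x := oproj (TS (nu x)) (rgrad f x).

Lemma tangE x : S x -> tang x = rgrad f x - dot (rgrad f x) (nu x) *: nu x.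
Proof. by move=> Sx; rewrite /tang oproj_TS // (nuE_sq nm hS S0 Sx). Qed.

(** As [f] is the first coordinate of the patch, its tangential gradient pairs to 1 with the first
    coordinate tangent vector and to 0 with the others. Being orthogonal to [nu], it lies in their
    span. These are the hypotheses of [gram_slice]. *)
Lemma tang_slice W b r phi pi c u : @spatch _ G m S W b r phi pi c ->
  (forall u, ball b r u -> f (phi u) = u 0 0) -> ball b r u ->
  tjac phi u *m (tang (phi u))^T = delta_mx 0 0 /\ (tang (phi u) <= tjac phi u)%MS.
Proof.
move=> sp fphi bu; have [[r0 oW Cphi] H1 _ _] := sp; have [Su _ _ rj] := H1 u bu.
have D0 := spatch_normal sp bu; have rD := tjac_row_free rj.
have Dg : tjac phi u *m (tang (phi u))^T = delta_mx 0 0.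
  rewrite tangE // linearB linearZ /= mulmxBr -scalemxAr D0 scaler0 subr0.
  rewrite (tjac_rgrad openT f1) //; apply/colP => j.
  rewrite -[jac phi u *m _]trmxK trmx_mul trmxK mxE.
  rewrite -(grad_comp (@ball_open _ _ b r) openT Cphi f1 bu) // mxE.
  transitivity ('D_(ee j) (fun v : 'rV[R]_m.+1 => v 0 0) u).
    apply: near_eq_derive; apply: (open_near_eq (@ball_open _ _ b r) bu) => v bv; exact: fphi.
  by have [_ ->] := is_derive_coord 0 u (ee j); rewrite !mxE eqxx andbT eq_sym.
split=> //; apply: (@kernel_span _ 1 m.+1 1 n (nu (phi u))).
- by rewrite add1n.
- by rewrite row_free_rV -dot_eq0 (nuE_sq nm hS S0 Su) oner_eq0.
- exact: rD.
- by rewrite -[LHS]trmxK trmx_mul trmxK D0 trmx0.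
- by rewrite [LHS]mx11_scalar -/(dot _ _) tangE // dotBr dotZr (nuE_sq nm hS S0 Su) mulr1 dotC subrr raddf0.
Qed.

(** The pointwise coarea factor: the quotient of the Gram determinants of the slice and of the
    patch. *)
Lemma vol_slice W b r phi pi c (t : R) (x : 'rV[R]_m) : @spatch _ G m S W b r phi pi c ->
  (forall u, ball b r u -> f (phi u) = u 0 0) -> ball b r (rowc t x) ->
  vol_density (fun x => phi (rowc t x)) x = enorm (tang (phi (rowc t x))) * vol_density phi (rowc t x).
Proof.
move=> sp fphi bu; have [[r0 oW Cphi] H1 _ _] := sp.
have /ball_rowc[bt bx] := bu.
have oB : open (ball (@rsubmx _ 1 1 m b) r) by exact: ball_open.
have sub y : ball (@rsubmx _ 1 1 m b) r y -> ball b r (rowc t y) by move=> ?; apply/ball_rowc.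
have Ct := C1map_comp oB (@ball_open _ _ b r) (rowc_C1map t _) Cphi sub.
rewrite (vol_densityE oB Ct bx) (vol_densityE (@ball_open _ _ b r) Cphi bu).
rewrite (jac_comp oB (@ball_open _ _ b r) (rowc_C1map t _) Cphi bx bu) jac_rowc -mulmxA -dsubmxE.
have [Dg gD] := tang_slice sp fphi bu.
by rewrite (gram_slice gD Dg) sqrtrM ?dot_ge0.
Qed.

Local Notation Lt t := (S `&` [set x | f x = t]).

Lemma slice_patch W b r phi pi c (t : R) : @spatch _ G m S W b r phi pi c ->
  (forall u, ball b r u -> f (phi u) = u 0 0) -> ball (b 0 0) r t ->
  C1_patch (Lt t) (ball (@rsubmx _ 1 1 m b) r) (fun x => phi (rowc t x)) /\
  (fun x => phi (rowc t x)) @` ball (@rsubmx _ 1 1 m b) r = Lt t `&` W.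
Proof.
move=> sp fphi bt; have [[r0 oW Cphi] H1 H2 _] := sp.
have oB : open (ball (@rsubmx _ 1 1 m b) r) by exact: ball_open.
have sub y : ball (@rsubmx _ 1 1 m b) r y -> ball b r (rowc t y) by move=> ?; apply/ball_rowc.
have Ct := C1map_comp oB (@ball_open _ _ b r) (rowc_C1map t _) Cphi sub.
have im : (fun x => phi (rowc t x)) @` ball (@rsubmx _ 1 1 m b) r = Lt t `&` W.
  apply/seteqP; split=> [_ [x bx <-]|y [[Sy fy] Wy]].
    have [Sx Wx _ _] := H1 _ (sub x bx); split=> //; split=> //=.
    by rewrite fphi ?rowc00 //; exact: sub.
  have [by_ py] := H2 y Wy Sy; move: by_ py; rewrite (rowcE (pi y)).
  have -> : pi y 0 0 = t by have [by_ py] := H2 y Wy Sy; rewrite -fphi // py.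
  by move=> /ball_rowc[_ bx] py; exists (@rsubmx _ 1 1 m (pi y)).
split=> //; split=> //.
- move=> x y; rewrite !inE => /sub bx /sub by_ E.
  have : rowc t x = rowc t y.
    by have [_ _ <- _] := H1 _ bx; have [_ _ <- _] := H1 _ by_; rewrite E.
  by move/(congr1 (@rsubmx _ 1 1 m)); rewrite !rowcR.
- move=> x bx; have [_ _ _ rj] := H1 _ (sub x bx).
  rewrite (_ : \matrix_j _ = @dsubmx R 1 m n (jac phi (rowc t x))).
    by apply: (@row_free_col_mxr R 1 m n (@usubmx R 1 m n (jac phi (rowc t x)))); rewrite vsubmxK.
  rewrite dsubmxE -(jac_rowc t x) -(jac_comp oB (@ball_open _ _ b r) (rowc_C1map t _) Cphi bx (sub x bx)).
  by apply/row_matrixP => j; rewrite rowK (row_jac j oB Ct bx).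
- by rewrite im; exact: subIsetl.
Qed.

Lemma adapted_cover (K : set pt) : compact K -> K `<=` S ->
  (forall x, K x -> row_free (col_mx (nu x) (rgrad f x))) ->
  exists N (W : nat -> set pt) b r phi pi c,
  (forall i, (i < N)%N -> @spatch _ G m S (W i) (b i) (r i) (phi i) (pi i) (c i) /\
     forall u, ball (b i) (r i) u -> f (phi i u) = u 0 0) /\ K `<=` \bigcup_(i in `I_N) W i.
Proof.
move=> cK KS reg.
have [x Kx|N [W [WP SW]]] := @finite_subcover R n K (fun W => exists b r phi pi c, @spatch _ G m S W b r phi pi c /\
  forall u, ball b r u -> f (phi u) = u 0 0) cK.
  have [W [b [r [phi [pi [c [Wx sp fphi]]]]]]] := adapted_spatch nm hS S0 f1 (KS x Kx) (reg x Kx).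
  by exists W; split=> //; [have [[]] := sp|exists b, r, phi, pi, c].
have /choice[q qP] i : exists q : 'rV[R]_m.+1 * R * ('rV[R]_m.+1 -> pt) * (pt -> 'rV[R]_m.+1) * R,
    (i < N)%N -> @spatch _ G m S (W i) q.1.1.1.1 q.1.1.1.2 q.1.1.2 q.1.2 q.2 /\
     forall u, ball q.1.1.1.1 q.1.1.1.2 u -> f (q.1.1.2 u) = u 0 0.
  have [iN|iN] := boolP (i < N)%N; last by exists (0, 0, fun=> 0, fun=> 0, 0).
  by have [_ [b [r [phi [pi [c sp]]]]]] := WP i iN; exists (b, r, phi, pi, c).
by exists N, W, (fun i => (q i).1.1.1.1), (fun i => (q i).1.1.1.2), (fun i => (q i).1.1.2), (fun i => (q i).1.2), (fun i => (q i).2).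
Qed.

Variable s : {measure set (borelT R n) -> \bar R}.
Hypothesis hs : is_riem_measure m.+1 S s.

(* As [f] is the first coordinate of the patches, [leb_int] over a patch
   integrates first over its slices by the level sets of [f]. *)
Lemma coarea (K : set pt) (q : pt -> R) : compact K -> K `<=` S ->
  (forall x, K x -> row_free (col_mx (nu x) (rgrad f x))) ->
  measurable_fun (S : set (borelT R n)) (q : borelT R n -> R) -> (forall x, S x -> 0 <= q x) ->
  exists B : measurableTypeR R -> \bar R, [/\ measurable_fun setT B, forall t, (0 <= B t)%E,
    (\int[@lebesgue_measure R]_t B t <= \int[s]_(x in (S : set (borelT R n))) (q x)%:E)%E &
    forall (t : R) (h : pt -> R) (s' : {measure set (borelT R n) -> \bar R}), Lt t `<=` K ->
      is_riem_measure m (Lt t) s' ->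
      measurable_fun (Lt t : set (borelT R n)) (h : borelT R n -> R) ->
      (forall x, Lt t x -> 0 <= h x /\ h x * enorm (tang x) = q x) ->
      (\int[s']_(x in (Lt t : set (borelT R n))) (h x)%:E <= B t)%E].
Proof.
move=> cK KS reg mq q0.
have [N [W [b [r [phi [pi [c [sp KW]]]]]]]] := adapted_cover cK KS reg.
pose F i := if (i < N)%N then K `&` W i else set0.
(* The pieces are made disjoint so that no point is counted twice when the patches are summed. *)
pose E (i : 'I_N) : set (borelT R n) := seqDU F i.
pose V (i : 'I_N) : set (borelT R m.+1) := ball (b i) (r i) `&` phi i @^-1` E i.
pose w (i : 'I_N) (u : 'rV[R]_m.+1) := vol_density (phi i) u * q (phi i u).
pose g (i : 'I_N) (u : borelT R m.+1) : \bar R := (w i u * \1_(V i) u)%:E.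
have mF i : measurable (F i : set (borelT R n)).
  rewrite /F; case: ifP => // iN; have [[[_ oW _] _ _ _] _] := sp i iN.
  by apply: measurableI; [exact: compact_borel|exact: open_borel].
have mE i : measurable (E i).
  rewrite /E /seqDU; apply: measurableD => //; apply: bigsetU_measurable => j _; exact: mF.
have ES i : E i `<=` S `&` W i.
  move=> x [+ _]; rewrite /F ltn_ord => -[Kx Wx]; split=> //; exact: KS.
have mV i : measurable (V i).
  have [sp' _] := sp i (ltn_ord i).
  by apply: (spatch_measurable_fun sp') (mE i); exact: ball_borel.
have mw i : measurable_fun (V i) (w i : borelT R m.+1 -> R).
  have [sp' _] := sp i (ltn_ord i); have [[r0 oW Cphi] H1 _ _] := sp'.
  apply: measurable_funM.
    by apply: measurable_funS (vol_measurable (@ball_open _ _ _ _) Cphi); [exact: ball_borel|exact: subIsetl].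
  apply: (@measurable_comp _ _ _ _ _ _ (S : set (borelT R n))) => //.
  - exact: surface_borel hS.
  - by move=> _ [u [bu _] <-]; case: (H1 u bu).
  - by apply: measurable_funS (spatch_measurable_fun sp'); [exact: ball_borel|exact: subIsetl].
have w0 i u : V i u -> 0 <= w i u.
  move=> [_ Eu]; apply: mulr_ge0; first exact: sqrtr_ge0.
  by apply: q0; have [] := ES i _ Eu.
have mg i : measurable_fun setT (g i) by exact: indic_measurable.
have g0 i u : (0 <= g i u)%E.
  rewrite /g lee_fin indicE; have [/set_mem/w0 ?|_] := boolP (u \in V i); by rewrite ?mulr1 ?mulr0.
have tE : trivIset setT E.
  by move=> i j _ _ xij; apply: val_inj; apply: (@trivIset_seqDU _ F).
(* [B t] sums the integrals over the slices at height [t]. It is defined for every [t], also when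
   the level is not regular or carries no Riemannian measure, and its integral is at most that of
   [q] by construction. *)
exists (fun t => \sum_i leb_int (fun x => g i (rowc t x)))%E; split.
- by apply: emeasurable_sum => i; exact: measurable_leb_int_rowc.
- move=> t; apply: sume_ge0 => i _; rewrite leb_intE; first exact: integral_ge0.
    by apply: measurableT_comp (mg i) _; exact: measurable_rowc2.
  by move=> x.
- rewrite ge0_integral_sum //; last 2 first.
  + by move=> i; exact: measurable_leb_int_rowc.
  + move=> i t _; rewrite leb_intE; first exact: integral_ge0.
      by apply: measurableT_comp (mg i) _; exact: measurable_rowc2.
    by move=> x.
  have int i : (\int[@lebesgue_measure R]_t leb_int (fun x => g i (rowc t x)) = \int[s]_(x in E i) (q x)%:E)%E.
    have [sp' _] := sp i (ltn_ord i).
    rewrite -[LHS]/(leb_int (g i)) leb_intE // integral_indic_fun.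
    have -> : E i = E i `&` (S `&` W i) by apply/seteqP; split=> x; [move=> Ex; split=> //; exact: ES|case].
    rewrite (spatch_integral hS hs sp' (mE i)) //.
    + apply/measurable_EFinP; apply: measurable_funS mq; first exact: surface_borel hS.
      by move=> x /ES[].
    + by move=> x /ES[Sx _]; rewrite lee_fin q0.
  rewrite (eq_bigr _ (fun i _ => int i)).
  rewrite -(@ge0_integral_bigsetU _ _ _ _ _ E (fun x => (q x)%:E) (index_enum 'I_N)) //.
  + apply: ge0_subset_integral; [|exact: surface_borel hS|exact/measurable_EFinP| |].
    * exact: bigsetU_measurable.
    * by move=> x Sx; rewrite lee_fin q0.
    * by apply: bigsetU_sub => i _ x /ES[].
  + exact: index_enum_uniq.
  + exact: sub_trivIset tE.
  + apply/measurable_EFinP; apply: measurable_funS mq; first exact: surface_borel hS.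
    by apply: bigsetU_sub => i _ x /ES[].
  + move=> x; rewrite lee_fin => H; apply: q0; move: x H.
    by apply: bigsetU_sub => i _ x /ES[].
- move=> t h s' LK hs' mh hq.
  have mL : measurable (Lt t : set (borelT R n)) by apply: compact_borel; apply: level_compact f1; exact: hS.
  have LE : Lt t = \big[setU/set0]_(i <- index_enum 'I_N) (Lt t `&` E i).
    apply/seteqP; split=> x; last first.
      by move: x; apply: bigsetU_sub => i _ x [].
    move=> Lx; have Kx := LK x Lx; have [j /= jN Wx] := KW x Kx.
    have exF : exists i, `[< (i < N)%N /\ F i x >].
      by exists j; apply/asboolP; split=> //; rewrite /F; case: ifP => [_|]; [split|move/negbT; rewrite jN].
    have [i /asboolP[iN Fi] imin] := ex_minnP exF.
    have Ex : seqDU F i x.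
      split=> //; suff /[apply] : \big[setU/set0]_(k < i) F k `<=` ~` [set x] by exact.
      apply: bigsetU_sub => k _ y Fy /= yx; rewrite yx in Fy.
      have ik : (i <= k)%N by apply: imin; apply/asboolP; split=> //; exact: ltn_trans (ltn_ord k) iN.
      by rewrite leqNgt ltn_ord in ik.
    by rewrite (bigD1 (Ordinal iN)) //=; left; split.
  rewrite [X in (\int[_]_(x in X) _)%E]LE ge0_integral_bigsetU.
  + apply: lee_sum => i _; have [sp' fphi] := sp i (ltn_ord i); have [[r0 oW Cphi] H1 H2 _] := sp'.
    have mgt : measurable_fun setT (fun x : borelT R m => g i (rowc t x)).
      by apply: measurableT_comp (mg i) _; exact: measurable_rowc2.
    have [bt|bt] := pselect (ball (b i 0 0) (r i) t); last first.
      rewrite (_ : Lt t `&` E i = set0) ?integral_set0.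
        by rewrite leb_intE //; exact: integral_ge0.
      apply/seteqP; split=> // x [[Sx fx] /ES[_ Wx]]; apply: bt.
      have [by_ px] := H2 x Wx Sx; have := fphi _ by_; rewrite px => pit.
      have -> : t = pi i x 0 0 by rewrite -pit; exact: esym.
      by move: by_; rewrite {1}(rowcE (pi i x)) => /ball_rowc[].
    have [pt_ im] := slice_patch sp' fphi bt.
    have oB : open (ball (@rsubmx _ 1 1 m (b i)) (r i)) by exact: ball_open.
    have sub y : ball (@rsubmx _ 1 1 m (b i)) (r i) y -> ball (b i) (r i) (rowc t y) by move=> ?; apply/ball_rowc.
    have Ct := C1map_comp oB (@ball_open _ _ (b i) (r i)) (rowc_C1map t _) Cphi sub.
    have mD : measurable (Lt t `&` E i : set (borelT R n)) by exact: measurableI.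
    have -> : Lt t `&` E i = (Lt t `&` E i) `&` ((fun x => phi i (rowc t x)) @` ball (@rsubmx _ 1 1 m (b i)) (r i)).
      by rewrite im; apply/seteqP; split=> x; [move=> [Lx Ex]; split=> //; split=> //; case: (ES _ _ Ex)|case].
    have mphi : measurable_fun (ball (@rsubmx _ 1 1 m (b i)) (r i) : set (borelT R m))
        ((fun x => phi i (rowc t x)) : borelT R m -> borelT R n).
      by apply: measurable_fun_on_borel => // x bx; exact: C1map_continuous Ct bx.
    have mvol := vol_measurable oB Ct.
    rewrite (@ge0_integral_image_density _ _ _ _ _ (lebm m) s' (ball (@rsubmx _ 1 1 m (b i)) (r i)) _ (fun x => phi i (rowc t x)) (vol_density (fun x => phi i (rowc t x)))) //.
    * rewrite leb_intE // integral_mkcond.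
      apply: ge0_le_integral => //.
      - move=> x _; rewrite /patch; case: ifPn => // /set_mem [_ [Lx _]].
        by rewrite -EFinM lee_fin mulr_ge0 ?sqrtr_ge0 //; case: (hq _ Lx).
      - have mUD : measurable (ball (@rsubmx _ 1 1 m (b i)) (r i) `&` (fun x => phi i (rowc t x)) @^-1` (Lt t `&` E i) : set (borelT R m)).
          by apply: mphi mD; exact: ball_borel.
        apply: (measurable_restrictT _ mUD).1; apply: emeasurable_funM; apply/measurable_EFinP.
          by apply: measurable_funS mvol; [exact: ball_borel|exact: subIsetl].
        apply: (@measurable_comp _ _ _ (borelT R m) (borelT R n) R (Lt t `&` E i) (h : borelT R n -> R) _ (fun x => phi i (rowc t x) : borelT R n)) => //.
        + by move=> _ [x [_ Dx] <-].
        + by apply: measurable_funS mh; [exact: mL|exact: subIsetl].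
        + by apply: measurable_funS mphi; [exact: ball_borel|exact: subIsetl].
      - move=> x _; rewrite /patch; case: ifPn => [/set_mem [bx [Lx Ex]]|_]; last exact: g0.
        rewrite /g indicE mem_set ?mulr1; last by split=> //; exact: sub.
        rewrite -EFinM lee_fin /w (vol_slice sp' fphi (sub x bx)).
        by have [_ <-] := hq _ Lx; rewrite le_eqVlt; apply/orP; left; apply/eqP; ring.
    * exact: ball_borel.
    * by rewrite im; apply: measurableI => //; exact: open_borel.
    * by move=> x _; exact: sqrtr_ge0.
    * move=> A mA; rewrite hs'.1 // leb_int_indic //.
      - by apply: mphi mA; exact: ball_borel.
      - by apply: measurable_funS mvol; [exact: ball_borel|exact: subIsetl].
      - by move=> u _; exact: sqrtr_ge0.
    * apply/measurable_EFinP; apply: measurable_funS mh => //; exact: subIsetl.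
    * by move=> x [Lx _]; rewrite lee_fin; case: (hq _ Lx).
  + by move=> i; exact: measurableI.
  + exact: index_enum_uniq.
  + by move=> i j _ _ [x [[_ Ei] [_ Ej]]]; apply: tE => //; exists x.
  + by rewrite -LE; exact/measurable_EFinP.
  + by rewrite -LE => x Lx; rewrite lee_fin; case: (hq _ Lx).
Qed.

End coarea.

(** * The layer cake inequality *)

Section level_sets.
Local Open Scope ereal_scope.
Context d (T : measurableType d) (R : realType).

(** Hoelder with exponents [1 / th] and [1 / (1 - th)]. The weight is split as
    [w ^ th * w ^ (1 - th)], and [(1 / th - 1) / (1 - th) = 1 / th] makes the second factor an
    integral of [f ^ (1 / th) * w]. *)
Lemma holder_level (mu : {measure set T -> \bar R}) (S St : set T) (f w : T -> R) (th : R) :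
  (0 < th < 1)%R -> measurable S -> measurable St -> St `<=` S ->
  measurable_fun S f -> measurable_fun S w -> (forall x, S x -> 0 <= f x)%R ->
  (forall x, S x -> 0 <= w x)%R ->
  \int[mu]_(x in St) (f x `^ (th^-1 - 1) * w x)%:E <=
  (\int[mu]_(x in St) (w x)%:E) `^ th * (\int[mu]_(x in S) (f x `^ th^-1 * w x)%:E) `^ (1 - th).
Proof.
move=> /andP[th0 th1] mS mSt sub mf mw f0 w0.
have th'0 : (0 < 1 - th)%R by rewrite subr_gt0.
have mpow a (h : T -> R) D : measurable_fun D h -> measurable_fun D (fun x => h x `^ a)%R.
  by move=> mh; apply: (@measurable_comp _ _ _ _ _ _ setT) (measurable_powR a) mh.
have mwSt := measurable_funS mS sub mw.
pose F := (fun x => w x `^ th)%R \_ St.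
pose H := (fun x => f x `^ (th^-1 - 1) * w x `^ (1 - th))%R \_ S.
have mF : measurable_fun setT F by apply/(measurable_restrictT _ mSt).1/mpow.
have mH : measurable_fun setT H.
  by apply/(measurable_restrictT _ mS).1/measurable_funM; exact: mpow.
have := @hoelder _ T R mu F H th^-1 (1 - th)^-1 mF mH.
rewrite !invr_gt0 !invrK => /(_ th0 th'0); rewrite addrCA subrr addr0 => /(_ erefl).
rewrite Lnorm1 unlock /= !invrK.
have -> : \int[mu]_x `|(F x * H x)%:E| = \int[mu]_(x in St) (f x `^ (th^-1 - 1) * w x)%:E.
  rewrite [RHS]integral_mkcond; apply: eq_integral => x _.
  rewrite /F /H /patch; case: ifPn => [/set_mem Sx|_]; last by rewrite mul0r /= normr0.
  rewrite (mem_set (sub x Sx)) /= mulrCA -powRD; last by rewrite subrKC oner_eq0.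
  rewrite subrKC powRr1 ?w0 //; last exact: sub.
  by rewrite ger0_norm // mulr_ge0 ?powR_ge0 ?w0 //; exact: sub.
have -> : \int[mu]_x `|(F x)%:E| `^ th^-1 = \int[mu]_(x in St) (w x)%:E.
  rewrite [RHS]integral_mkcond; apply: eq_integral => x _.
  rewrite /F /patch; case: ifPn => [/set_mem Sx|_].
    by rewrite /= ger0_norm ?powR_ge0 // -powRrM mulfV ?gt_eqF // powRr1 // w0 //; exact: sub.
  by rewrite /= normr0 powR0 // invr_eq0 gt_eqF.
have -> : \int[mu]_x `|(H x)%:E| `^ (1 - th)^-1 = \int[mu]_(x in S) (f x `^ th^-1 * w x)%:E.
  rewrite [RHS]integral_mkcond; apply: eq_integral => x _.
  rewrite /H /patch; case: ifPn => [/set_mem Sx|_].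
    rewrite /= ger0_norm ?mulr_ge0 ?powR_ge0 // powRM ?powR_ge0 // -!powRrM.
    rewrite divff ?gt_eqF // powRr1 ?w0 //; congr ((_ `^ _ * _)%R)%:E.
    by field; rewrite !gt_eqF.
  by rewrite /= normr0 powR0 // invr_eq0 gt_eqF.
by [].
Qed.

Section tonelli.
Variable s : {sigma_finite_measure set T -> \bar R}.
Variables (S : set T) (f : T -> R).
Hypotheses (mS : measurable S) (mf : measurable_fun setT f) (f0 : forall x, S x -> (0 <= f x)%R).
Local Notation leb := (@lebesgue_measure R).
Local Notation Sf t := (S `&` [set x | (t <= f x)%R]).

Definition under_graph : set (T * measurableTypeR R) :=
  [set z | S z.1 /\ (0 < (z.2 : R) <= f z.1)%R].

Lemma under_graph_measurable : measurable under_graph.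
Proof.
have -> : under_graph = (fst @^-1` S) `&` (snd @^-1` `]0%R, +oo[%classic) `&`
    ((fun z : T * measurableTypeR R => f z.1 - (z.2 : R))%R @^-1` `[0%R, +oo[%classic).
  apply/seteqP; split=> -[x t] /=; rewrite !in_itv /= !andbT subr_ge0.
    by move=> [Sx /andP[]].
  by move=> [[Sx t0] tf]; split=> //=; rewrite t0.
have m1 : measurable_fun setT (fst : T * measurableTypeR R -> T) by exact: measurable_fst.
have m2 : measurable_fun setT (snd : T * measurableTypeR R -> measurableTypeR R) by exact: measurable_snd.
apply: measurableI; first apply: measurableI.
- by rewrite -[_ @^-1` _]setTI; exact: m1.
- by rewrite -[_ @^-1` _]setTI; apply: m2 => //; exact: measurable_itv.
- have m3 : measurable_fun setT (fun z : T * measurableTypeR R => f z.1 - (z.2 : R))%R.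
    by apply: measurable_funB; [exact: measurableT_comp mf m1|exact: m2].
  by rewrite -[_ @^-1` _]setTI; apply: m3 => //; exact: measurable_itv.
Qed.

Lemma level_borel_set t : measurable (Sf t).
Proof.
apply: measurableI => //; rewrite -[X in measurable X]setTI.
rewrite (_ : [set x | _] = f @^-1` `[t, +oo[%classic); first by apply: mf => //; exact: measurable_itv.
by apply/seteqP; split=> x /=; rewrite in_itv /= andbT.
Qed.

Variable g : T -> R.
Hypotheses (mg : measurable_fun S g) (g0 : forall x, S x -> (0 <= g x)%R).

Let k (z : T * measurableTypeR R) := (g z.1 * \1_under_graph z)%:E.

Let mk : measurable_fun setT k.
Proof.
apply: (@indic_measurable _ _ _ under_graph (fun z => g z.1)); first exact: under_graph_measurable.
apply: (@measurable_comp _ _ _ _ _ _ S) => //; first by move=> _ [z [Sz _] <-].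
by apply: measurable_funS (@measurable_fst _ _ _ _); last exact: subsetT.
Qed.

Let k0 z : 0 <= k z.
Proof.
rewrite /k lee_fin indicE; have [/set_mem[Sz _]|_] := boolP (z \in _); last by rewrite mulr0.
by rewrite mulr1 g0.
Qed.

Lemma k_fiber t : \int[s]_x k (x, t) = (if (0 < (t : R))%R then \int[s]_(x in Sf t) (g x)%:E else 0).
Proof.
case: ifPn => t0.
  rewrite [RHS]integral_mkcond; apply: eq_integral => x _; rewrite /k /patch indicE.
  have -> : ((x, t) \in under_graph) = (x \in Sf t).
    by apply/idP/idP => /set_mem => -[Sx H]; apply/mem_set; split=> //; move: H; rewrite /= t0.
  by case: (x \in _); rewrite /= ?mulr1 ?mulr0.
apply: integral0_eq => x _; rewrite /k indicE memNset ?mulr0 // => -[_ /=].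
by rewrite (negPf t0).
Qed.

Lemma level_integral_measurable :
  measurable_fun (`]0%R, +oo[%classic : set (measurableTypeR R)) (fun t : R => \int[s]_(x in Sf t) (g x)%:E).
Proof.
have H := measurable_fun_fubini_tonelli_G (m1 := s) k mk k0.
apply: eq_measurable_fun (measurable_funS _ (subsetT _) H) => //.
by move=> t; rewrite inE /= in_itv /= andbT => t0; rewrite /fubini_G k_fiber t0.
Qed.

Lemma tonelli_level :
  \int[s]_(x in S) (f x * g x)%:E = \int[leb]_(t in `]0%R, +oo[%classic) \int[s]_(x in Sf t) (g x)%:E.
Proof.
have := fubini_tonelli (m1 := s) (m2 := leb) k mk k0.
have -> : \int[leb]_y \int[s]_x k (x, y) = \int[leb]_(t in `]0%R, +oo[%classic) \int[s]_(x in Sf t) (g x)%:E.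
  rewrite [RHS]integral_mkcond; apply: eq_integral => t _; rewrite k_fiber /patch.
  by rewrite (_ : (t \in _) = (0 < (t : R))%R) //; apply/idP/idP => [/set_mem|?]; rewrite ?inE /= in_itv /= andbT.
move=> <-; rewrite [LHS]integral_mkcond; apply: eq_integral => x _; rewrite /patch.
case: ifPn => [/set_mem Sx|xS]; last first.
  rewrite integral0_eq // => t _; rewrite /k indicE memNset ?mulr0 // => -[/= Sx _].
  by rewrite mem_set in xS.
have -> : (fun y => k (x, y)) = (fun y => (g x * \1_(`]0%R, f x]%classic : set (measurableTypeR R)) y)%:E).
  apply/funext => t; rewrite /k !indicE; congr (_ * _%:R)%:E.
  rewrite (_ : ((x, t) \in _) = ((t : R) \in (`]0%R, f x]%classic : set R))) //.
  by apply/idP/idP => /set_mem H; apply/mem_set; move: H; rewrite /under_graph /= in_itv /= => // -[].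
rewrite (@integral_indic_fun _ _ _ leb (`]0%R, f x]%classic) (fun=> g x)) integral_cst; last exact: measurable_itv.
rewrite [X in _ * X](_ : _ = (f x)%:E); first by rewrite -EFinM mulrC.
apply: (etrans (lebesgue_measure_itv `]0%R, (f x)%R])); rewrite /= lte_fin.
case: ltP => fx; first by rewrite -EFinB subr0.
by congr EFin; apply/eqP; rewrite eq_le fx f0.
Qed.

End tonelli.

(** Write the integral [I] as that of [f * g] with [g = f ^ (1 / th - 1) * w] and integrate [g] over
    the superlevels. [holder_level] on each of them gives [I <= I ^ (1 - th) * J], and finiteness of
    [I] allows the division by [I ^ (1 - th)]. *)
Lemma layer_cake (s : {sigma_finite_measure set T -> \bar R}) (S : set T) (f w : T -> R) (th : R) :
  (0 < th < 1)%R -> measurable S -> measurable_fun setT f -> measurable_fun S w ->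
  (forall x, S x -> 0 < f x)%R -> (forall x, S x -> 0 <= w x)%R ->
  \int[s]_(x in S) (f x `^ th^-1 * w x)%:E < +oo ->
  (\int[s]_(x in S) (f x `^ th^-1 * w x)%:E) `^ th <=
  \int[@lebesgue_measure R]_(t in `]0%R, +oo[%classic)
    (\int[s]_(x in S `&` [set x | (t <= f x)%R]) (w x)%:E) `^ th.
Proof.
move=> /andP[th0 th1] mS mf mw f0 w0.
set I := \int[s]_(x in S) _ => Ifin.
have I0 : 0 <= I by apply: integral_ge0 => x Sx; rewrite lee_fin mulr_ge0 ?powR_ge0 ?w0.
have f0' x : S x -> (0 <= f x)%R by move=> /f0/ltW.
have mfS := measurable_funS measurableT (@subsetT _ S) mf.
have mpow a (h : T -> R) D : measurable_fun D h -> measurable_fun D (fun x => h x `^ a)%R.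
  by move=> mh; apply: (@measurable_comp _ _ _ _ _ _ setT) (measurable_powR a) mh.
pose g x := (f x `^ (th^-1 - 1) * w x)%R.
have mg : measurable_fun S g by apply: measurable_funM => //; exact: mpow.
have g0 x : S x -> (0 <= g x)%R by move=> Sx; rewrite mulr_ge0 ?powR_ge0 ?w0.
have IE : I = \int[s]_(x in S) (f x * g x)%:E.
  apply: eq_integral => x /set_mem Sx; congr EFin; rewrite /g mulrA; congr (_ * _)%R.
  rewrite -{2}[f x]powRr1 ?f0' // -powRD; last by apply/implyP => _; rewrite gt_eqF ?f0.
  by congr (_ `^ _)%R; ring.
have [I00|I00] := eqVneq I 0; first by rewrite I00 poweR0r ?gt_eqF // integral_ge0 // => t _; exact: poweR_ge0.
have Igt : 0 < I by rewrite lt0e I00.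
pose J := \int[@lebesgue_measure R]_(t in `]0%R, +oo[%classic)
    (\int[s]_(x in S `&` [set x | (t <= f x)%R]) (w x)%:E) `^ th.
have mM := level_integral_measurable s mS mf mw w0.
have H : I <= I `^ (1 - th) * J.
  rewrite {1}IE (tonelli_level s mS mf f0' mg g0) /J.
  have IP : 0 <= I `^ (1 - th) by exact: poweR_ge0.
  have -> : I `^ (1 - th) = (fine (I `^ (1 - th)))%:E by rewrite fineK // fin_num_poweR // ge0_fin_numE.
  have mI := level_integral_measurable s mS mf mg g0.
  have mMt : measurable_fun (`]0%R, +oo[%classic : set (measurableTypeR R))
      (fun t : R => (\int[s]_(x in S `&` [set x | (t <= f x)%R]) (w x)%:E) `^ th).
    by apply: (@measurable_comp _ _ _ _ _ _ setT) (measurable_poweR th) mM.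
  rewrite -ge0_integralZl ?fine_ge0 //; try exact: measurable_itv.
  apply: ge0_le_integral.
  - exact: measurable_itv.
  - by move=> t _; apply: integral_ge0 => x [Sx _]; rewrite lee_fin g0.
  - exact: mI.
  - by apply: emeasurable_funM; first exact: measurable_cst.
  - move=> t _; rewrite fineK ?fin_num_poweR ?ge0_fin_numE // muleC.
    apply: holder_level => //; [by rewrite th0|exact: level_borel_set].
  by move=> t _; exact: poweR_ge0.
  by rewrite lee_fin fine_ge0.
have Ipow : I = I `^ th * I `^ (1 - th).
  move: Igt Ifin; case: (I) => // r; rewrite lte_fin => r0 _.
  by rewrite !poweR_EFin -EFinM -powRD ?subrKC ?powRr1 ?oner_eq0 // ltW.
move: H; rewrite {1}Ipow muleC lee_pmul2l //.
  by rewrite fin_num_poweR // ge0_fin_numE.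
by rewrite poweR_gt0.
Qed.

End level_sets.

(** * The isoperimetric inequality on superlevels *)

Section dimensions.
Context {R : realType} (G : carnot R).
Local Notation n := (cdim G).

(** Without vectors of degree 1 no brackets would generate the top layer, which is nonzero by
    [cdeg_top]. *)
Lemma ex_deg1 : exists a : 'I_n, cdeg a = 1%N.
Proof.
apply: contrapT => H; have [j jk] := cdeg_top G.
have := @cstrat R G (cstep G); rewrite cstep_ge2 leqnn => /(_ isT)/andP[_ sub].
have := submx_trans (layer_delta jk) sub; rewrite big_pred0.
  rewrite submx0 => /eqP /rowP /(_ j); rewrite !mxE !eqxx => /eqP.
  by rewrite oner_eq0.
by move=> p; apply/negbTE; rewrite negb_and; apply/orP; left; apply/eqP => p1; apply: H; exists p.1.
Qed.

Lemma cdim_ge2 : exists m, n = m.+2.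
Proof.
have [a a1] := ex_deg1; have [j jk] := cdeg_top G.
have aj : a != j by apply/eqP => aj; have := cstep_ge2 G; rewrite -jk -aj a1.
have : (1 < #|'I_n|)%N by apply/card_gt1P; exists a, j.
by rewrite card_ord; case: (n) => [|[|m]] // _; exists m.
Qed.

(** There is a direction of degree 1 and one of degree [cstep >= 2]. So [Q - 2] and [Q - 1] are
    positive and the exponent lies strictly between 0 and 1. *)
Lemma homdim_ge3 : (3 <= homdim G)%N.
Proof.
have [a a1] := ex_deg1; have [j jk] := cdeg_top G; have k2 := cstep_ge2 G.
have p1 : (0 < #|[pred j | @cdeg R G j == 1%N]|)%N by apply/card_gt0P; exists a; rewrite inE a1.
have pk : (0 < #|[pred j | @cdeg R G j == cstep G]|)%N by apply/card_gt0P; exists j; rewrite inE jk.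
rewrite /homdim big_ltn; last by rewrite ltnS ltnW.
suff p2 : (2 <= \sum_(2 <= i < (cstep G).+1) i * #|[pred j | @cdeg R G j == i]|)%N.
  by rewrite mul1n; exact: leq_add p1 p2.
rewrite big_nat_recr //= (leq_trans _ (leq_addl _ _)) // (leq_trans k2) //.
by rewrite -{1}[cstep G]muln1 leq_mul2l pk orbT.
Qed.

Definition hexp : R := ((homdim G)%:R - 2) / ((homdim G)%:R - 1).

Lemma hexp01 : 0 < hexp < 1.
Proof.
have Q3 : (3 : R) <= (homdim G)%:R by rewrite ler_nat homdim_ge3.
rewrite /hexp; move: ((homdim G)%:R : R) Q3 => Q Q3; apply/andP; split.
  by apply: divr_gt0; lra.
by rewrite ltr_pdivrMr; lra.
Qed.

Lemma hexpV : hexp^-1 = ((homdim G)%:R - 1) / ((homdim G)%:R - 2).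
Proof. by rewrite /hexp invf_div. Qed.

End dimensions.

Lemma riem_measureP (R : realType) (G : carnot R) k (M : set 'rV[R]_(cdim G)) :
  (exists s, is_riem_measure k M s) -> is_riem_measure k M (riem_measure k M).
Proof. by rewrite /riem_measure; case: pselect => // e _; case: (cid e). Qed.

Lemma riem_measure0 (R : realType) (G : carnot R) k (M : set 'rV[R]_(cdim G)) :
  ~ (exists s, is_riem_measure k M s) -> riem_measure k M = mzero.
Proof. by rewrite /riem_measure; case: pselect. Qed.

Section vector_measurable.
Context d (T : measurableType d) (R : realType) (D : set T).

Definition rv_measurable n (v : T -> 'rV[R]_n) := forall j, measurable_fun D (fun x => v x 0 j).

Lemma dot_measurable n (u v : T -> 'rV[R]_n) : rv_measurable u -> rv_measurable v ->
  measurable_fun D (fun x => dot (u x) (v x)).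
Proof.
move=> mu mv; rewrite (_ : (fun x => _) = fun x => \sum_j u x 0 j * v x 0 j).
  by apply: measurable_sum => j; exact: measurable_funM.
by apply/funext => x; rewrite dotE.
Qed.

Lemma powR_measurable (a : R) (h : T -> R) : measurable_fun D h ->
  measurable_fun D (fun x => h x `^ a).
Proof. by move=> mh; apply: (@measurable_comp _ _ _ _ _ _ setT) (measurable_powR a) mh. Qed.

Lemma inv_measurable (h : T -> R) : measurable_fun D h -> (forall x, 0 <= h x) ->
  measurable_fun D (fun x => (h x)^-1).
Proof.
move=> mh h0; rewrite (_ : (fun x => _) = fun x => h x `^ (-1)); first exact: powR_measurable.
by apply/funext => x; rewrite powR_inv1.
Qed.

Lemma enorm_measurable n (u : T -> 'rV[R]_n) : rv_measurable u ->
  measurable_fun D (fun x => enorm (u x)).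
Proof.
move=> mu; rewrite (_ : (fun x => _) = fun x => dot (u x) (u x) `^ 2^-1).
  by apply: powR_measurable; exact: dot_measurable.
by apply/funext => x; rewrite powR12_sqrt ?dot_ge0.
Qed.

Lemma mulmx_rv_measurable n p (A : 'M[R]_(n, p)) (u : T -> 'rV[R]_n) : rv_measurable u ->
  rv_measurable (fun x => u x *m A).
Proof.
move=> mu j; rewrite (_ : (fun x => _) = fun x => \sum_i u x 0 i * A i j).
  by apply: measurable_sum => i; apply: measurable_funM => //; exact: measurable_cst.
by apply/funext => x; rewrite mxE.
Qed.

Lemma rvB_measurable n (u v : T -> 'rV[R]_n) : rv_measurable u -> rv_measurable v ->
  rv_measurable (fun x => u x - v x).
Proof.
move=> mu mv j; rewrite (_ : (fun x => _) = fun x => u x 0 j - v x 0 j).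
  exact: measurable_funB.
by apply/funext => x; rewrite !mxE.
Qed.

Lemma rvZ_measurable n (a : T -> R) (v : T -> 'rV[R]_n) : measurable_fun D a -> rv_measurable v ->
  rv_measurable (fun x => a x *: v x).
Proof.
move=> ma mv j; rewrite (_ : (fun x => _) = fun x => a x * v x 0 j).
  exact: measurable_funM.
by apply/funext => x; rewrite !mxE.
Qed.

Lemma flag_proj_measurable (G : carnot R) i (N v : T -> 'rV[R]_(cdim G)) : rv_measurable N ->
  rv_measurable v -> rv_measurable (fun x => flag_proj i (N x) (v x)).
Proof.
move=> mN mv; have mNi := mulmx_rv_measurable (flag G i) mN.
apply: rvB_measurable; first exact: mulmx_rv_measurable.
apply: rvZ_measurable => //; apply: measurable_funM; first exact: dot_measurable.
by apply: inv_measurable; [exact: dot_measurable|move=> x; exact: dot_ge0].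
Qed.

End vector_measurable.

Section isop.
Context {R : realType} (G : carnot R).
Local Notation n := (cdim G).
Local Notation pt := 'rV[R]_n.
Variables (m : nat) (S : set pt) (nu : pt -> pt).
Hypothesis nm : n = m.+2.
Hypotheses (hS : compact_hypersurface S nu) (S0 : mbd S = set0).

Lemma nu_measurable : rv_measurable (S : set (borelT R n)) (nu : borelT R n -> pt).
Proof.
move=> j; apply: measurable_fun_locally; first exact: surface_borel hS.
move=> x Sx; have [U [F ch]] := surface_chart nm hS S0 Sx.
have [[oU F2 F0] Ux SU nuE] := ch.
exists U, (fun y => (enorm (rgrad F y))^-1 * rgrad F y 0 j); split=> //.
  move=> y Uy; apply: continuousM; last exact: rgrad_continuous (CkS F2) Uy j.
  apply: continuousV; first by rewrite enorm_eq0 F0.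
  apply: (@continuous_comp _ _ _ (fun y => dot (rgrad F y) (rgrad F y)) (@Num.sqrt R)); last exact: sqrt_continuous.
  by apply: dot_continuous => i; exact: rgrad_continuous (CkS F2) Uy i.
by move=> y Sy Uy; rewrite nuE // mxE.
Qed.

Definition hweight x := enorm (P_H (nu x)).

Lemma hweight_ge0 x : 0 <= hweight x. Proof. exact: enorm_ge0. Qed.

Lemma hweight_measurable : measurable_fun (S : set (borelT R n)) (hweight : borelT R n -> R).
Proof.
rewrite (_ : (hweight : borelT R n -> R) = fun x : borelT R n => enorm (nu x *m flag G 1)); last first.
  by apply/funext => x; rewrite /hweight P_HE.
by apply: enorm_measurable; apply: mulmx_rv_measurable; exact: nu_measurable.
Qed.

Lemma hweight_le1 x : S x -> hweight x <= 1.
Proof.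
move=> Sx; rewrite /hweight (le_trans (oproj_enorm_le _ _)) //.
by rewrite /enorm (nuE_sq nm hS S0 Sx) sqrtr1.
Qed.

Section function.
Variable f : pt -> R.
Hypothesis f1 : Ck 1 setT f.

Lemma rgrad_measurable (D : set (borelT R n)) : measurable D ->
  rv_measurable D (rgrad f : borelT R n -> pt).
Proof.
move=> mD j; apply: measurable_funS (@measurableT _ _) (subsetT _) _.
apply: measurable_fun_on => //; last exact: openT.
by move=> x _; exact: (rgrad_continuous openT f1).
Qed.

(** The integrands that the boundary terms become after the coarea formula. The horizontal one,
    which carries the density of the horizontal measure, sits at index 1. *)
Definition tterm i x : R :=
  if i == 1%N then hweight x * enorm (oproj (HS (nu x)) (rgrad f x))
  else enorm (oproj (HiS i (nu x)) (rgrad f x)).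

Lemma tterm_ge0 i x : 0 <= tterm i x.
Proof. by rewrite /tterm; case: ifP => _; rewrite ?mulr_ge0 ?enorm_ge0. Qed.

Lemma tterm_measurable i : (0 < i)%N -> measurable_fun (S : set (borelT R n)) (tterm i : borelT R n -> R).
Proof.
move=> i0; have mS := surface_borel hS; have mr := rgrad_measurable mS; have mN := nu_measurable.
case E : (i == 1%N).
  rewrite (_ : (tterm i : borelT R n -> R) = fun x : borelT R n =>
      hweight x * enorm (flag_proj 1 (nu x) (rgrad f x))); last first.
    by apply/funext => x; rewrite /tterm E oproj_HS.
  apply: measurable_funM; first exact: hweight_measurable.
  by apply: enorm_measurable; exact: flag_proj_measurable.
rewrite (_ : (tterm i : borelT R n -> R) = fun x : borelT R n =>
    enorm (flag_proj i (nu x) (rgrad f x) - flag_proj i.-1 (nu x) (rgrad f x))); last first.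
  by apply/funext => x; rewrite /tterm E oproj_HiS.
by apply: enorm_measurable; apply: rvB_measurable; exact: flag_proj_measurable.
Qed.

Lemma tang_measurable : measurable_fun (S : set (borelT R n)) (fun x : borelT R n => enorm (tang nu f x)).
Proof.
have mS := surface_borel hS; have mr := rgrad_measurable mS; have mN := nu_measurable.
apply: (@eq_measurable_fun _ _ _ _ _ (fun x : borelT R n => enorm (rgrad f x - dot (rgrad f x) (nu x) *: nu x))).
  by move=> x /set_mem Sx; rewrite (tangE nm hS S0).
apply: enorm_measurable; apply: rvB_measurable => //; apply: rvZ_measurable => //.
exact: dot_measurable.
Qed.

Lemma proj_tang_HS x : S x -> oproj (HS (nu x)) (tang nu f x) = oproj (HS (nu x)) (rgrad f x).
Proof. by move=> Sx; apply: orthc_TS_tangent; [exact: (nuE_sq nm hS S0)|exact: HS_TS]. Qed.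

Lemma proj_tang_HiS i x : S x -> oproj (HiS i (nu x)) (tang nu f x) = oproj (HiS i (nu x)) (rgrad f x).
Proof. by move=> Sx; apply: orthc_TS_tangent; [exact: (nuE_sq nm hS S0)|exact: HiS_TS]. Qed.

End function.

Lemma expe_le (x y : \bar R) k : (0 <= x)%E -> (x <= y)%E -> (x ^+ k <= y ^+ k)%E.
Proof.
move=> x0 xy; elim: k => [|k IH] //; rewrite !expeS; apply: lee_pmul => //; exact: expe_ge0.
Qed.

Lemma poweR_le (x y : \bar R) (a : R) : 0 <= a -> (0 <= x)%E -> (x <= y)%E -> (x `^ a <= y `^ a)%E.
Proof.
move=> a0 x0 xy; apply: gt0_ler_poweR => //; rewrite in_itv /= ?leey ?andbT //.
exact: le_trans xy.
Qed.

Variables (rho : pt -> pt -> R) (C : R).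
Hypothesis hC : isoperimetric_constant rho C.
Hypothesis hL1 : hmean_curv_L1 S nu.
Hypothesis hs0 : is_riem_measure m.+1 S (riem_measure n.-1 S).
Local Notation s := (riem_measure n.-1 S).

Lemma sigmaHE : sigmaH S nu S = (\int[s]_(x in (S : set (borelT R n))) (hweight x)%:E)%E.
Proof. by rewrite /sigmaH /int_sigmaH; apply: eq_integral => x _; rewrite mul1r. Qed.

Lemma sigmaH_lty : (sigmaH S nu S < +oo)%E.
Proof.
rewrite sigmaHE; apply: le_lt_trans (_ : (\int[s]_(x in (S : set (borelT R n))) 1%:E < +oo)%E).
  apply: ge0_le_integral.
  - exact: surface_borel hS.
  - by move=> x _; rewrite lee_fin hweight_ge0.
  - by apply/measurable_EFinP; exact: hweight_measurable.
  - exact: measurable_cst.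
  - by move=> x Sx; rewrite lee_fin hweight_le1.
rewrite integral_cst; last exact: surface_borel hS.
by rewrite mul1e; exact: (surface_finite nm hS S0 hs0).
Qed.

Section level.
Variables (f : pt -> R) (t : R).
Hypothesis f1 : Ck 1 setT f.
Hypothesis reg : forall x, S x -> f x = t -> row_free (col_mx (nu x) (rgrad f x)).
Local Notation St := (superlevel S f t).

Lemma dim_pred : n.-1 = m.+1. Proof. by rewrite nm. Qed.
Lemma dim_pred2 : n.-2 = m. Proof. by rewrite nm. Qed.

Lemma St_measure (A : set (borelT R n)) : measurable A -> A `<=` St ->
  riem_measure n.-1 St A = s A.
Proof.
move=> mA ASt; have mSt := superlevel_riem nm hS S0 hs0 f1 reg.
have hs' : is_riem_measure m.+1 St (riem_measure n.-1 St).
  by rewrite dim_pred; apply: riem_measureP; eexists; exact: mSt.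
rewrite (superlevel_riem_unique nm hS S0 hs0 f1 reg hs' mA).
by congr (s _); apply/seteqP; split=> x; [case|move=> Ax; split=> //; exact: ASt].
Qed.

Lemma St_integral (D : set (borelT R n)) (h : pt -> \bar R) : D `<=` St ->
  (\int[riem_measure n.-1 St]_(x in D) h x = \int[s]_(x in D) h x)%E.
Proof.
move=> DS; apply: eq_measure_integral => A mA AD.
by apply: St_measure => //; exact: subset_trans DS.
Qed.

Lemma St_borel : measurable (St : set (borelT R n)).
Proof. by eapply superlevel_borel; eassumption. Qed.

Lemma St_hmean_L1 : hmean_curv_L1 St nu.
Proof.
rewrite /hmean_curv_L1 (superlevel_char S nu f t).
have [mh ih] := integrableP _ _ _ hL1.
have mD : measurable (S `\` char_set S nu : set (borelT R n)).
  rewrite (_ : _ `\` _ = S `&` hweight @^-1` (~` [set 0])).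
    apply: hweight_measurable; first exact: surface_borel hS.
    by apply: measurableC; exact: measurable_set1.
  apply/seteqP; split=> x /=.
    by move=> [Sx cx]; split=> // w0; apply: cx.
  by move=> [Sx w0]; split=> // -[_ c]; apply: w0.
have mD' : measurable (St `&` (S `\` char_set S nu) : set (borelT R n)).
  by apply: measurableI => //; exact: St_borel.
have E x : x \in (St `&` (S `\` char_set S nu)) -> hmean_curv S nu x = hmean_curv St nu x.
  by move=> /set_mem [Stx [Sx cx]]; rewrite (superlevel_hmean nm hS S0 f1 reg Stx) // => -[_ c]; apply: cx.
have mh' : measurable_fun (St `&` (S `\` char_set S nu) : set (borelT R n)) (fun x => (hmean_curv S nu x)%:E).
  by apply: measurable_funS mh => // x [].
apply/integrableP; split.
  by apply: eq_measurable_fun mh' => x xD; rewrite E.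
rewrite St_integral; last by move=> x [].
rewrite (eq_integral (fun x : borelT R n => `|(hmean_curv S nu x)%:E|%E)); last by move=> x xD; rewrite -E.
apply: le_lt_trans ih; apply: ge0_subset_integral; [exact: mD'|exact: mD|exact: measurableT_comp|by move=> x _; exact: abse_ge0|by move=> x []].
Qed.

End level.
End isop.

Section isop.
Context {R : realType} (G : carnot R).
Local Notation n := (cdim G).
Local Notation pt := 'rV[R]_n.
Local Notation k := (cstep G).
Variables (m : nat) (S : set pt) (nu : pt -> pt).
Hypothesis nm : n = m.+2.
Hypotheses (hS : compact_hypersurface S nu) (S0 : mbd S = set0).
Variables (rho : pt -> pt -> R) (C : R).
Hypothesis hC : isoperimetric_constant rho C.
Hypothesis hL1 : hmean_curv_L1 S nu.
Hypothesis hs0 : is_riem_measure m.+1 S (riem_measure n.-1 S).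
Local Notation s := (riem_measure n.-1 S).
Local Notation w := (hweight nu).
Local Notation rS := (max_radius rho S nu).

(** The hypothesis on the curvature controls it off the characteristic set; on that set the weight
    [w] is 0. *)
Lemma hmean_measurable : measurable_fun (S : set (borelT R n))
  (fun x : borelT R n => `|hmean_curv S nu x| * w x).
Proof.
have mS := surface_borel hS; have mw := hweight_measurable nm hS S0.
have mC : measurable (S `&` w @^-1` [set 0] : set (borelT R n)).
  by apply: mw => //; exact: measurable_set1.
have SU : S = (S `\` char_set S nu) `|` (S `&` w @^-1` [set 0]).
  apply/seteqP; split=> x; last by move=> [[]|[]].
  by move=> Sx; have [cx|cx] := pselect (w x = 0); [right|left; split=> // -[_ c]; apply: cx].
have mD : measurable (S `\` char_set S nu : set (borelT R n)).
  rewrite (_ : _ `\` _ = S `\` (S `&` w @^-1` [set 0])); first exact: measurableD.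
  by apply/seteqP; split=> x [Sx cx]; split.
rewrite {1}SU; apply/measurable_funU => //; split.
  apply: measurable_funM; last by apply: measurable_funS mw => // x [].
  have [/measurable_EFinP mh _] := integrableP _ _ _ hL1.
  by apply: (measurableT_comp (@normr_measurable R setT) mh).
apply: (@eq_measurable_fun _ _ (borelT R n) R (S `&` w @^-1` [set 0]) (fun=> 0 : R)); last exact: measurable_cst.
by move=> x /set_mem [_ /= ->]; rewrite mulr0.
Qed.

Hypothesis rS0 : (0 <= rS)%E.

(** At a given point the metric factor is the same for both surfaces, so the radii compare as the
    areas do. *)
Lemma radius_le (S1 S2 : set pt) x : (0 <= sigmaH S1 nu S1)%E -> (sigmaH S1 nu S1 <= sigmaH S2 nu S2)%E ->
  (0 <= radius_at rho S1 nu x <= radius_at rho S2 nu x)%E.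
Proof.
move=> s0 s12; have k0 : (0 <= metric_factor rho nu x)%E.
  by apply: integral_ge0 => y _; rewrite lee_fin mulr_ge0 ?enorm_ge0.
have e0 : (0 : R) <= ((homdim G)%:R - 1)^-1.
  have : (3 : R) <= (homdim G)%:R by rewrite ler_nat homdim_ge3.
  by move=> h; rewrite invr_ge0; lra.
rewrite /radius_at; apply/andP; split.
  by apply: mule_ge0 => //; exact: poweR_ge0.
apply: lee_wpmul2l => //; apply: poweR_le => //.
  by apply: mule_ge0 => //; rewrite inve_ge0.
by apply: lee_wpmul2r => //; rewrite inve_ge0.
Qed.

Section level.
Variables (f : pt -> R) (t : R) (B : nat -> \bar R).
Hypothesis f1 : Ck 1 setT f.
Hypothesis reg : forall x, S x -> f x = t -> row_free (col_mx (nu x) (rgrad f x)).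
Local Notation St := (superlevel S f t).
Local Notation Lt := (S `&` [set x | f x = t]).
Hypothesis B0 : forall i, (0 <= B i)%E.
Hypothesis BP : forall i (h : pt -> R) (s' : {measure set (borelT R n) -> \bar R}), (0 < i)%N ->
  is_riem_measure m Lt s' -> measurable_fun (Lt : set (borelT R n)) (h : borelT R n -> R) ->
  (forall x, Lt x -> 0 <= h x /\ h x * enorm (tang nu f x) = tterm nu f i x) ->
  (\int[s']_(x in (Lt : set (borelT R n))) (h x)%:E <= B i)%E.

Lemma int_bd_level i (h : pt -> R) : (0 < i)%N ->
  (forall x, Lt x -> [/\ 0 <= h x, enorm (tang nu f x) != 0 & h x * enorm (tang nu f x) = tterm nu f i x]) ->
  (int_bd St h <= B i)%E.
Proof.
move=> i0 hq; rewrite /int_bd (mbd_superlevel nm hS S0 f1 reg) (dim_pred2 nm).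
have mL : measurable (Lt : set (borelT R n)) by eapply level_borel; eassumption.
have mS := surface_borel hS; have LS : Lt `<=` S by move=> x [].
(* If the level set has no Riemannian measure, the boundary integral is taken with [mzero] and is
   0. *)
have [es|es] := pselect (exists s', is_riem_measure m Lt s'); last first.
  by rewrite (riem_measure0 es) integral_measure_zero.
apply: (BP i0 (riem_measureP es)) => [|x /hq[]//].
(* [h] involves the chosen conormal, about which no measurability is known; on the level set it
   equals this quotient of measurable functions. *)
apply: (@eq_measurable_fun _ _ _ _ _ (fun x : borelT R n => tterm nu f i x * (enorm (tang nu f x))^-1)).
  by move=> x /set_mem /hq [_ e0 <-]; rewrite mulfK.
apply: measurable_funM.
  by apply: measurable_funS (tterm_measurable nm hS S0 f1 i0).
apply: inv_measurable; last by move=> x; exact: enorm_ge0.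
by apply: measurable_funS (tang_measurable nm hS S0 f1).
Qed.

Lemma isop_level :
  ((\int[s]_(x in (St : set (borelT R n))) (w x)%:E) `^ hexp G <=
   C%:E * (\int[s]_(x in (St : set (borelT R n))) (`|hmean_curv S nu x| * w x)%:E + B 1%N +
           \sum_(2 <= i < k.+1) rS ^+ i.-1 * B i))%E.
Proof.
have mS := surface_borel hS; have mw := hweight_measurable nm hS S0.
have mSt : measurable (St : set (borelT R n)) by eapply St_borel; eassumption.
have mL : measurable (Lt : set (borelT R n)) by eapply level_borel; eassumption.
have mG : measurable (S `&` [set x | t < f x] : set (borelT R n)) by eapply gt_borel; eassumption.
have LS : Lt `<=` S by move=> x [].
have StS : St `<=` S by move=> x [].
have [C0 hCS] := hC; have C0' := ltW C0.
set M := (\int[s]_(x in _) (w x)%:E)%E.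
have M0 : (0 <= M)%E by apply: integral_ge0 => x _; rewrite lee_fin hweight_ge0.
have th0 : 0 < hexp G by case/andP: (hexp01 G).
(* For [M = 0] the superlevel may have no noncharacteristic interior point, and its maximal radius
   would be the supremum of the empty set, minus infinity. The left side is then 0. *)
have [M00|M00] := eqVneq M 0%E.
  rewrite M00 poweR0r ?gt_eqF // mule_ge0 ?lee_fin // adde_ge0 //.
    by rewrite adde_ge0 // integral_ge0 // => x _; rewrite lee_fin mulr_ge0 ?hweight_ge0.
  by apply: sume_ge0 => i _; apply: mule_ge0 => //; exact: expe_ge0.
have ME : sigmaH St nu St = M.
  rewrite /sigmaH /int_sigmaH (St_integral nm hS S0 hs0 f1 reg) //.
  by apply: eq_integral => x _; rewrite mul1r.
(* The level set is null, so a positive [M] yields an interior point of positive weight, which makes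
   the radius of the superlevel nonnegative. *)
have [x [Sx fx wx]] : exists x, [/\ S x, t < f x & w x != 0].
  apply: contrapT => H; move/eqP: M00; apply.
  have w0 x : S x -> t < f x -> w x = 0.
    by move=> Sx fx; apply/eqP; apply: contrapT => wx; apply: H; exists x; split=> //; exact/negP.
  rewrite /M (superlevel_split S f t) ge0_integral_setU //.
  - rewrite integral0_eq; last by move=> x [Sx fx]; rewrite w0.
    rewrite add0e; apply: le_anti; apply/andP; split; last first.
      by apply: integral_ge0 => x _; rewrite lee_fin hweight_ge0.
    apply: le_trans (_ : (\int[s]_(x in (Lt : set (borelT R n))) 1%:E <= _)%E).
      apply: ge0_le_integral => //.
      + by move=> x _; rewrite lee_fin hweight_ge0.
      + by apply/measurable_EFinP; apply: measurable_funS mw.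
      + by move=> x /LS Sx; rewrite lee_fin (hweight_le1 nm hS S0).
    by rewrite integral_cst // mul1e (level_null nm hS S0 hs0 f1 reg).
  - rewrite -(superlevel_split S f t); apply/measurable_EFinP; exact: measurable_funS mw.
  - by move=> x _; rewrite lee_fin hweight_ge0.
  - by apply/eqP/seteqP; split=> // x [[_ /= +] [_ /= fx]]; rewrite fx ltxx.
have Msig : (M <= sigmaH S nu S)%E.
  rewrite sigmaHE; apply: ge0_subset_integral => //.
    exact/measurable_EFinP.
  by move=> y _; rewrite lee_fin hweight_ge0.
have mintx : (mint St `\` char_set St nu) x.
  rewrite (mint_superlevel nm hS S0 f1 reg); split=> // -[_ c].
  by move/eqP: wx; apply.
have rle y : (0 <= radius_at rho St nu y <= radius_at rho S nu y)%E.
  by apply: radius_le; rewrite ME.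
have r0 : (0 <= max_radius rho St nu)%E.
  have /andP[rx _] := rle x; apply: le_trans rx _; apply: ereal_sup_ubound.
  by exists x.
have r12 : (max_radius rho St nu <= rS)%E.
  apply: ge_ereal_sup => _ [y [my cy] <-]; have /andP[_ ry] := rle y; apply: le_trans ry _.
  apply: ereal_sup_ubound; exists y => //; move: my; rewrite (mint_superlevel nm hS S0 f1 reg) => -[Sy fy].
  split; first exact: (mint_surface S0 Sy).
  by move=> [_ c]; apply: cy; split=> //; split=> //=; exact: ltW.
have tcon y : Lt y -> exists a, [/\ conormal St y = a *: tang nu f y & `|a| * enorm (tang nu f y) = 1].
  by move=> [Sy fy]; have [a [E1 E2]] := superlevel_conormal nm hS S0 f1 reg Sy fy; exists a.
have := hCS St nu (superlevel_hypersurface nm hS S0 f1 reg) (St_hmean_L1 nm hS S0 hL1 hs0 f1 reg).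
rewrite ME -/(hexp G) => /le_trans; apply; apply: lee_wpmul2l; first by rewrite lee_fin.
apply: leeD; first apply: leeD.
- rewrite le_eqVlt; apply/orP; left; apply/eqP.
  apply: (etrans (St_integral nm hS S0 hs0 f1 reg _ (@subset_refl _ _))).
  apply: eq_integral.
  (* On the characteristic set the curvatures of [S] and of the superlevel are unrelated choices,
     but the weight vanishes there. *)
  move=> y /set_mem Sty; have [wy|wy] := eqVneq (w y) 0; first by rewrite -/(w y) wy !mulr0.
  rewrite (superlevel_hmean nm hS S0 f1 reg Sty) // => -[_ c].
  by move/eqP: wy; apply.
- apply: int_bd_level => // y Ly; have [a [-> E]] := tcon y Ly; have [Sy _] := Ly.
  split.
  + by rewrite mulr_ge0 ?enorm_ge0.
  + by apply/eqP => e0; move: E; rewrite e0 mulr0 => /eqP; rewrite eq_sym oner_eq0.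
  + rewrite oprojZ enormZ /tterm /= -(proj_tang_HS nm hS S0 f Sy) -/(w y).
    by rewrite -mulrA; congr (_ * _); rewrite mulrAC E mul1r.
- rewrite big_nat_cond [leRHS]big_nat_cond; apply: lee_sum => i /andP[/andP[i2 _] _].
  apply: lee_pmul.
  + exact: (expe_ge0 i.-1 r0).
  + by apply: integral_ge0 => y _; rewrite lee_fin enorm_ge0.
  + exact: (expe_le i.-1 r0 r12).
  + apply: int_bd_level; first exact: ltnW.
    move=> y Ly; have [a [-> E]] := tcon y Ly; have [Sy _] := Ly; split.
    * exact: enorm_ge0.
    * by apply/eqP => e0; move: E; rewrite e0 mulr0 => /eqP; rewrite eq_sym oner_eq0.
    * rewrite oprojZ enormZ /tterm; case: eqP i2 => [->//|_ _].
      by rewrite -(proj_tang_HiS nm hS S0 f i Sy) mulrAC E mul1r.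
Qed.

End level.
End isop.

Section isop.
Context {R : realType} (G : carnot R).
Local Notation n := (cdim G).
Local Notation pt := 'rV[R]_n.
Local Notation k := (cstep G).
Variables (m : nat) (S : set pt) (nu : pt -> pt).
Hypothesis nm : n = m.+2.
Hypotheses (hS : compact_hypersurface S nu) (S0 : mbd S = set0).
Variables (rho : pt -> pt -> R) (C : R).
Hypothesis hC : isoperimetric_constant rho C.
Hypothesis hL1 : hmean_curv_L1 S nu.
Hypothesis hs0 : is_riem_measure m.+1 S (riem_measure n.-1 S).
Local Notation s := (riem_measure n.-1 S).
Local Notation w := (hweight nu).
Local Notation rS := (max_radius rho S nu).
Hypothesis rS0 : (0 <= rS)%E.

(** The integration over levels uses Tonelli, which asks for a sigma-finite measure; the restriction
    to [S] is finite. *)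
Lemma riem_sigma_finite : exists s' : {sigma_finite_measure set (borelT R n) -> \bar R},
  forall (A : set (borelT R n)) (h : borelT R n -> \bar R), measurable A -> A `<=` S ->
    (\int[s]_(x in A) h x = \int[s']_(x in A) h x)%E.
Proof.
have mS : measurable (S : set (borelT R n)) := surface_borel hS.
pose t : {measure set (borelT R n) -> \bar R} := mrestr s mS.
have sfin : sigma_finite setT (t : set (borelT R n) -> \bar R).
  exists (fun=> setT); first by rewrite bigcup_const.
  move=> i; split; first exact: measurableT.
  by rewrite /= /mrestr setTI; exact: (surface_finite nm hS S0 hs0).
exists (HB.pack_for {sigma_finite_measure set (borelT R n) -> \bar R} (t : set (borelT R n) -> \bar R) t
  (Measure_isSigmaFinite.Build _ _ _ (t : set (borelT R n) -> \bar R) sfin)).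
move=> A h mA AS; apply: eq_measure_integral => B mB BA /=.
by rewrite /mrestr setIidl //; exact: subset_trans AS.
Qed.

Section regular.
Variables (f : pt -> R) (D : set R) (e : R).
Hypothesis f1 : Ck 1 setT f.
Hypothesis f0 : forall x, S x -> 0 < f x.
Hypotheses (oD : open D) (De : (@lebesgue_measure R D <= e%:E)%E).
Hypothesis reg : forall x, S x -> ~ D (f x) -> row_free (col_mx (nu x) (rgrad f x)).
Local Notation leb := (@lebesgue_measure R).

Lemma regular_measurable : measurable_fun setT (f : borelT R n -> R).
Proof. by apply: measurable_fun_on => //; [move=> x _; exact: f_continuous|exact: openT]. Qed.

Lemma regular_compact : compact (S `&` [set x | ~ D (f x)]).
Proof.
apply: compact_closedI; first exact: (hyp_compact hS).
rewrite (_ : [set x | _] = f @^-1` (~` D)) //.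
by apply: closed_comp; [move=> x _; exact: f_continuous|exact: open_closedC].
Qed.

Lemma power_integral_lty : (\int[s]_(x in (S : set (borelT R n))) (f x `^ (hexp G)^-1 * w x)%:E < +oo)%E.
Proof.
have mS := surface_borel hS; have mw := hweight_measurable nm hS S0.
have mf : measurable_fun (S : set (borelT R n)) (f : borelT R n -> R) by apply: measurable_funS regular_measurable.
have [N fN] : exists N : R, forall x, S x -> f x <= N.
  have cf : {within S, continuous f} by apply: continuous_subspaceT => x; exact: f_continuous.
  have /compact_bounded [N [_ /(_ (N + 1))]] := continuous_compact cf (hyp_compact hS).
  rewrite ltrDl ltr01 => /(_ isT) H; exists (N + 1) => x Sx.
  by apply: le_trans (H (f x) _); [exact: ler_norm|exists x].
apply: le_lt_trans (_ : (\int[s]_(x in (S : set (borelT R n))) (N `^ (hexp G)^-1)%:E < +oo)%E).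
  have h0 : 0 <= (hexp G)^-1 by rewrite invr_ge0 ltW //; case/andP: (hexp01 G).
  apply: ge0_le_integral => //.
  - by move=> x Sx; rewrite lee_fin mulr_ge0 ?powR_ge0 ?hweight_ge0.
  - by apply/measurable_EFinP; apply: measurable_funM => //; exact: powR_measurable.
  - move=> x Sx; rewrite lee_fin -[leRHS]mulr1; apply: ler_pM; rewrite ?powR_ge0 ?hweight_ge0 //.
      by apply: ge0_ler_powR; rewrite ?nnegrE ?(ltW (f0 Sx)) ?fN //; apply: le_trans (fN _ Sx); exact/ltW/f0.
    exact: (hweight_le1 nm hS S0).
rewrite integral_cst // lte_mul_pinfty ?lee_fin ?powR_ge0 //.
exact: (surface_finite nm hS S0 hs0).
Qed.

Lemma isop_sobolev_regular :
  ((\int[s]_(x in (S : set (borelT R n))) (f x `^ (hexp G)^-1 * w x)%:E) `^ hexp G <=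
   C%:E * (\int[s]_(x in (S : set (borelT R n))) (f x * (`|hmean_curv S nu x| * w x))%:E
           + \int[s]_(x in (S : set (borelT R n))) (tterm nu f 1 x)%:E
           + \sum_(2 <= i < k.+1) rS ^+ i.-1 * \int[s]_(x in (S : set (borelT R n))) (tterm nu f i x)%:E)
   + e%:E * sigmaH S nu S `^ hexp G)%E.
Proof.
have mS := surface_borel hS; have mw := hweight_measurable nm hS S0.
have mH := hmean_measurable nm hS S0 hL1; have mf := regular_measurable.
have w0 x : 0 <= w x := hweight_ge0 nu x.
have H0 x : 0 <= `|hmean_curv S nu x| * w x by rewrite mulr_ge0.
have [[C0 _] th] := (hC, hexp01 G); have th0 : 0 <= hexp G by case/andP: th => /ltW.
have [s' ss'] := riem_sigma_finite.
have KS : S `&` [set x | ~ D (f x)] `<=` S by move=> x [].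
have regK x : (S `&` [set x | ~ D (f x)]) x -> row_free (col_mx (nu x) (rgrad f x)) by move=> [Sx]; exact: reg.
(* [B i] bounds the term of index [i.+1], because terms are measurable for positive indices; hence
   the shifts [i.-1] below. *)
have [B HB] := choice (fun i => coarea nm hS S0 f1 hs0 regular_compact KS regK
  (tterm_measurable nm hS S0 f1 (ltn0Sn i)) (fun x _ => tterm_ge0 nu f i.+1 x)).
have mB i : measurable_fun setT (B i) by case: (HB i).
have B0 i t : (0 <= B i t)%E by case: (HB i).
have BI i : (\int[leb]_(t in `]0%R, +oo[%classic) B i t <= \int[s]_(x in (S : set (borelT R n))) (tterm nu f i.+1 x)%:E)%E.
  have [_ _ + _] := HB i; apply: le_trans; apply: ge0_subset_integral => //; exact: measurable_itv.
pose M (g : pt -> R) (t : R) := (\int[s]_(x in (superlevel S f t : set (borelT R n))) (g x)%:E)%E.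
have mSt t : measurable (superlevel S f t : set (borelT R n)).
  by eapply superlevel_borel; eassumption.
have ME g t : M g t = (\int[s']_(x in (S : set (borelT R n)) `&` [set x | (t <= f x)%R]) (g x)%:E)%E.
  by apply: ss' => // x [].
have mM g : measurable_fun (S : set (borelT R n)) (g : borelT R n -> R) -> (forall x, 0 <= g x) ->
    measurable_fun (`]0, +oo[%classic : set (measurableTypeR R)) (M g).
  move=> mg g0; have -> : M g = (fun t => \int[s']_(x in (S : set (borelT R n)) `&` [set x | (t <= f x)%R]) (g x)%:E)%E by apply/funext => t; exact: ME.
  by apply: level_integral_measurable => //; exact: mS.
have tM g : measurable_fun (S : set (borelT R n)) (g : borelT R n -> R) -> (forall x, 0 <= g x) ->
    (\int[s]_(x in (S : set (borelT R n))) (f x * g x)%:E = \int[leb]_(t in `]0%R, +oo[%classic) M g t)%E.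
  move=> mg g0; rewrite ss' // tonelli_level //; last by move=> x /f0/ltW.
  by apply: eq_integral => t _; rewrite ME.
have M0 g t : (forall x, 0 <= g x) -> (0 <= M g t)%E by move=> g0; apply: integral_ge0 => x _; rewrite lee_fin.
apply: le_trans (_ : (\int[leb]_(t in `]0%R, +oo[%classic) M w t `^ hexp G <= _)%E).
  have := power_integral_lty; rewrite ss' // => fin.
  apply: le_trans (layer_cake th mS mf mw f0 (fun x _ => w0 x) fin) _.
  by rewrite le_eqVlt; apply/orP; left; apply/eqP; apply: eq_integral => t _; rewrite ME.
have s0 : (0 <= sigmaH S nu S)%E by rewrite sigmaHE; apply: integral_ge0 => x _; rewrite lee_fin.
have mD : measurable (D : set (measurableTypeR R)) by exact: open_measurable.
have mI := @measurable_itv R `]0%R, +oo[.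
(* [h1] pays for the levels in [D], where the area of the superlevel is simply bounded by that of
   [S]. Outside [D] the isoperimetric bound [C * (h2 + h3)] applies. All three are defined for every
   [t], so one integral covers both cases. *)
pose h1 (t : R) := (sigmaH S nu S `^ hexp G * (\1_D t)%:E)%E.
pose h2 (t : R) := (M (fun x => `|hmean_curv S nu x| * w x)%R t + B 0%N t)%E.
pose h3 (t : R) := (\sum_(2 <= i < k.+1) rS ^+ i.-1 * B i.-1 t)%E.
have h10 t : (0 <= h1 t)%E by apply: mule_ge0; rewrite ?poweR_ge0 ?lee_fin.
have h20 t : (0 <= h2 t)%E by apply: adde_ge0 => //; exact: M0.
have h3i i t : (0 <= rS ^+ i.-1 * B i.-1 t)%E by apply: mule_ge0 => //; exact: expe_ge0.
have h30 t : (0 <= h3 t)%E by apply: sume_ge0.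
have m1 : measurable_fun (`]0, +oo[%classic : set (measurableTypeR R)) h1.
  by apply: emeasurable_funM; [exact: measurable_cst|apply/measurable_EFinP; exact: measurable_indic].
have mBI i : measurable_fun (`]0, +oo[%classic : set (measurableTypeR R)) (B i) by exact: measurable_funS (mB i).
have m2 : measurable_fun (`]0, +oo[%classic : set (measurableTypeR R)) h2.
  by apply: emeasurable_funD => //; exact: mM.
have m3i i : measurable_fun (`]0, +oo[%classic : set (measurableTypeR R)) (fun t => rS ^+ i.-1 * B i.-1 t)%E.
  by apply: emeasurable_funM => //; exact: measurable_cst.
have m3 : measurable_fun (`]0, +oo[%classic : set (measurableTypeR R)) h3 by exact: emeasurable_sum.
apply: le_trans (_ : (\int[leb]_(t in `]0%R, +oo[%classic) (C%:E * (h2 t + h3 t) + h1 t) <= _)%E).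
  apply: ge0_le_integral => //.
  - by move=> t _; exact: poweR_ge0.
  - by apply: (@measurable_comp _ _ _ _ _ _ setT) (measurable_poweR _) _ => //; exact: mM.
  - by apply: emeasurable_funD => //; apply: emeasurable_funM; [exact: measurable_cst|exact: emeasurable_funD].
  move=> t _; have [Dt|Dt] := pselect (D t).
    apply: le_trans (_ : (h1 t <= _)%E); last first.
      by rewrite leeDr // mule_ge0 ?lee_fin ?(ltW C0) // adde_ge0.
    rewrite /h1 indicE mem_set // mule1; apply: poweR_le => //; first exact: M0.
    rewrite sigmaHE; apply: ge0_subset_integral => //; first exact/measurable_EFinP.
      by move=> x _; rewrite lee_fin.
    by move=> x [].
  rewrite /h1 indicE memNset // mule0 adde0.
  apply: (isop_level nm hS S0 hC hL1 hs0 rS0 (B := fun i => B i.-1 t) f1) => //.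
    by move=> x Sx fx; apply: reg => //; rewrite fx.
  move=> [//|i] g s1 _ hs1 mg gq; have [_ _ _ H] := HB i; apply: H => //.
  by move=> x [Sx fx]; split=> //=; rewrite fx.
rewrite ge0_integralD //; last 2 first.
- by move=> t _; rewrite mule_ge0 ?lee_fin ?(ltW C0) // adde_ge0.
- by apply: emeasurable_funM; [exact: measurable_cst|exact: emeasurable_funD].
apply: leeD; last first.
  rewrite ge0_integralZl //; [|by apply/measurable_EFinP; exact: measurable_indic|exact: poweR_ge0].
  rewrite muleC; apply: lee_wpmul2r; first exact: poweR_ge0.
  rewrite integral_indic //; apply: le_trans De; apply: le_measure; rewrite ?inE //.
  by apply: measurableI => //; exact: mI.
rewrite ge0_integralZl ?lee_fin ?(ltW C0) //; last 2 first.
- exact: emeasurable_funD.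
- by move=> t _; exact: adde_ge0.
apply: lee_wpmul2l; first by rewrite lee_fin ltW.
rewrite ge0_integralD //; apply: leeD.
  rewrite (tM (fun x => `|hmean_curv S nu x| * w x) mH H0).
  have mMH := mM (fun x => `|hmean_curv S nu x| * w x) mH H0.
  rewrite (@ge0_integralD _ _ _ leb _ mI (M (fun x => `|hmean_curv S nu x| * w x)) (B 0%N) _ mMH _ (mBI 0%N)).
  - exact: leeD (lexx _) (BI 0%N).
  - by move=> t _; exact: M0.
  - by move=> t _; exact: B0.
rewrite ge0_integral_sum // big_nat_cond [leRHS]big_nat_cond; apply: lee_sum => i /andP[/andP[i2 _] _].
rewrite ge0_integralZl //; last exact: expe_ge0.
apply: lee_wpmul2l; first exact: expe_ge0.
by apply: le_trans (BI i.-1) _; rewrite prednK // ltnW.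
Qed.

End regular.
End isop.

(** * Smallness of the set of critical levels *)

Section counting.
Context {R : realType}.

Lemma grid_cell (K : nat) (s y : R) : (0 < K)%N -> 0 <= y <= K%:R * s ->
  exists i : 'I_K, i%:R * s <= y <= i.+1%:R * s.
Proof.
case: K => // K _; elim: K => [|K IH] /andP[y0 yK].
  by exists ord0; rewrite mul0r y0.
have [yK'|yK'] := leP y (K.+1%:R * s).
  have [|i H] := IH; first by rewrite y0.
  by exists (widen_ord (leqnSn _) i).
by exists ord_max; rewrite yK (ltW yK').
Qed.

Lemma small_open_cover (ts : seq R) (r : R) : 0 < r -> exists D : set R,
  [/\ open D, (@lebesgue_measure R D <= ((size ts)%:R * (r *+ 2))%:E)%E
    & forall t u, t \in ts -> `|t - u| < r -> D u].
Proof.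
move=> r0; elim: ts => [|t ts [D [oD lD HD]]].
  by exists set0; split; [exact: open0|by rewrite measure0 mul0r|].
exists (ball t r `|` D); split.
- by apply: openU => //; exact: ball_open.
- have mb : measurable (ball t r : set (measurableTypeR R)) by apply: open_measurable; exact: ball_open.
  have mD : measurable (D : set (measurableTypeR R)) by exact: open_measurable.
  have := @measureU2 _ _ _ (@lebesgue_measure R) _ _ mb mD; move=> /le_trans; apply.
  rewrite /= -natr1 mulrDl mul1r addrC EFinD; apply: leeD => //.
  by rewrite lebesgue_measure_ball // ltW.
- move=> t' u; rewrite inE => /orP[/eqP -> H|tts H]; [by left|by right; apply: HD tts H].
Qed.

(** Double counting: each [i] is hit by at most one [p], so the counts cannot all exceed [b]. *)
Lemma pigeonhole (P I : finType) (h : P -> I -> bool) (b : nat) :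
  (forall i p p', h p i -> h p' i -> p = p') -> (0 < #|P|)%N -> (#|I| <= #|P| * b)%N ->
  exists p, (#|[pred i | h p i]| <= b)%N.
Proof.
move=> inj P0 Ib; apply: contrapT => H.
have {}H p : (b < #|[pred i | h p i]|)%N.
  by rewrite ltnNge; apply/negP => Hp; apply: H; exists p.
have : (\sum_(p : P) #|[pred i | h p i]| <= #|I|)%N.
  under eq_bigr => p _ do rewrite -sum1_card.
  rewrite (exchange_big_dep predT) //= -sum1_card; apply: leq_sum => i _.
  rewrite sum1_card; apply/card_le1_eqP => p p' hp hp'; exact: (inj i p' p hp' hp).
apply/negP; rewrite -ltnNge; apply: leq_ltn_trans Ib _.
apply: leq_trans (_ : (\sum_(p : P) b.+1 <= _)%N); last by apply: leq_sum => p _; exact: H.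
by rewrite sum_nat_const mulnS -[X in (X < _)%N]add0n ltn_add2r.
Qed.

(* Grid counting replaces Sard's theorem: the graphs of the pairs (a, t) = (T z, tau z) form a
   finite union of Lipschitz images of n-dimensional boxes in an (n+1)-dimensional space, so of the
   q^n values of a on a grid of mesh eps/q some value is hit by a number of cells
   that does not depend on q. *)
Lemma lipschitz_slices_small p n N (T : 'I_N -> 'rV[R]_p -> 'rV[R]_n) (tau : 'I_N -> 'rV[R]_p -> R) (rho L eps : R) :
  p = n -> 0 < rho -> 0 < L -> 0 < eps ->
  (forall c z z', `|z| <= rho -> `|z'| <= rho -> `|T c z - T c z'| <= L * `|z - z'| /\ `|tau c z - tau c z'| <= L * `|z - z'|) ->
  exists (a : 'rV[R]_n) (D : set R), [/\ `|a| <= eps, open D, (@lebesgue_measure R D <= eps%:E)%E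
    & forall c z, `|z| <= rho -> T c z = a -> D (tau c z)].
Proof.
move=> pn; subst p => rho0 L0 eps0 lip.
(* [M] makes the cells so small that the image of a cell has diameter less than the mesh [eps / q]
   of the candidate values of [a]; thus a cell hits at most one candidate. *)
pose M := (Num.Def.archi_bound (2 * rho * L / eps)).+1.
have HM : 2 * rho * L / eps < M%:R.
  apply: lt_le_trans (_ : (Num.Def.archi_bound (2 * rho * L / eps))%:R <= _); last by rewrite ler_nat.
  by apply: archi_boundP; rewrite divr_ge0 ?mulr_ge0 // ltW.
(* There are [N * (M * q) ^ n] cells and [q ^ n] candidates, so some candidate is hit by at most [b]
   cells, independently of [q]. Each of these cells costs an interval of length [2 * eps / q], and
   [q > 2 * b] keeps the total below [eps]. *)
pose b := (N * M ^ n)%N; pose q := (2 * b).+1.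
have q0 : 0 < q%:R :> R by rewrite ltr0n.
have Mq0 : 0 < (M * q)%:R :> R by rewrite ltr0n.
pose sd : R := 2 * rho / (M * q)%:R.
have sd0 : 0 <= sd by rewrite divr_ge0 ?mulr_ge0 // ltW.
have Ls : L * sd < eps / q%:R.
  rewrite /sd natrM invfM !mulrA ltr_pM2r ?invr_gt0 //.
  rewrite ltr_pdivrMr ?ltr0n //; move: HM; rewrite ltr_pdivrMr // => HM.
  by rewrite [L * 2]mulrC mulrAC [eps * _]mulrC.
pose cell (k : {ffun 'I_n -> 'I_(M * q)}) (z : 'rV[R]_n) :=
  forall j, (k j)%:R * sd <= z 0 j + rho <= (k j).+1%:R * sd.
have cellP z : `|z| <= rho -> exists k, cell k z.
  move=> zr; have H j : exists i : 'I_(M * q), i%:R * sd <= z 0 j + rho <= i.+1%:R * sd.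
    apply: grid_cell => //; have := le_trans (rV_coord_le z j) zr; rewrite ler_norml => /andP[h1 h2].
    by rewrite /sd mulrC divfK ?gt_eqF //; apply/andP; split; lra.
  have [k Hk] := choice H; exists [ffun j => k j] => j; rewrite ffunE; exact: Hk.
have cell_near k z z' : cell k z -> cell k z' -> `|z - z'| <= sd.
  move=> cz cz'; apply: rV_norm_le => // j; rewrite !mxE ler_norml.
  have /andP[h1 h2] := cz j; have /andP[h3 h4] := cz' j.
  by move: h2 h4; rewrite -natr1 mulrDl mul1r => h2 h4; apply/andP; split; lra.
pose cand (p : {ffun 'I_n -> 'I_q}) : 'rV[R]_n := \row_j (eps / q%:R * (p j)%:R).
pose hit p (i : 'I_N * {ffun 'I_n -> 'I_(M * q)}) z :=
  [/\ `|z| <= rho, cell i.2 z & T i.1 z = cand p].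
have e0 : 0 < eps / q%:R by rewrite divr_gt0.
have inj i p p' : `[< exists z, hit p i z >] -> `[< exists z, hit p' i z >] -> p = p'.
  move=> /asboolP[z [zr cz Tz]] /asboolP[z' [zr' cz' Tz']].
  have d : `|cand p - cand p'| < eps / q%:R.
    rewrite -Tz -Tz'; have [H _] := lip i.1 z z' zr zr'; apply: le_lt_trans H _.
    by apply: le_lt_trans Ls; apply: ler_wpM2l (cell_near _ _ _ cz cz'); exact: ltW.
  apply/ffunP => j; apply/val_inj/eqP; rewrite -(eqr_nat R) -subr_eq0 -normr_eq0.
  have := le_lt_trans (rV_coord_le (cand p - cand p') j) d.
  rewrite !mxE -mulrBr normrM (gtr0_norm e0) -[X in _ < X]mulr1 ltr_pM2l //.
  rewrite ltr_norml normr_eq0 subr_eq0 eqr_nat => /andP[h1 h2].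
  case: (ltngtP (p j) (p' j)) => // lt; exfalso;
    by move: lt h1 h2; rewrite -(ler_nat R) -natr1 => ? ? ?; lra.
have [p Hp] : exists p, (#|[pred i | `[< exists z, hit p i z >]]| <= b)%N.
  apply: pigeonhole => //; first by rewrite card_ffun !card_ord expn_gt0.
  by rewrite card_prod !card_ffun !card_ord expnMn /b [X in (X <= _)%N]mulnA [X in (_ <= X)%N]mulnC.
(* One representative per hit cell suffices, as [tau] varies by less than [eps / q] on a cell. *)
have [zz Hzz] : exists zz, forall i, (exists z, hit p i z) -> hit p i (zz i).
  suff H i : exists z, (exists z, hit p i z) -> hit p i z by have [zz] := choice H; exists zz.
  by have [[z Hz]|nz] := pselect (exists z, hit p i z); [exists z|exists 0].
have [D [oD lD HD]] := small_open_cover [seq tau i.1 (zz i) | i in [pred i | `[< exists z, hit p i z >]]] e0.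
exists (cand p), D; split=> //.
- apply: rV_norm_le => [|j]; first exact: ltW.
  rewrite mxE normrM (gtr0_norm e0) normr_nat -mulrA ler_piMr ?(ltW eps0) //.
  by rewrite mulrC ler_pdivrMr // mul1r ler_nat ltnW.
- apply: le_trans lD _; rewrite lee_fin size_map -cardE.
  apply: le_trans (_ : b%:R * (eps / q%:R *+ 2) <= _).
    by rewrite ler_wpM2r ?ler_nat // mulrn_wge0 // ltW.
  rewrite (_ : b%:R * _ = eps * ((2 * b)%:R / q%:R)).
    by rewrite ler_piMr ?(ltW eps0) // ler_pdivrMr // mul1r ler_nat.
  by rewrite natrM -mulr_natr; field; rewrite gt_eqF.
- move=> c z zr Tz; have [k ck] := cellP z zr.
  have hz : hit p (c, k) z by [].
  have [zr' ck' Tz'] := Hzz (c, k) (ex_intro _ z hz).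
  apply: (HD (tau c (zz (c, k)))).
    by apply/mapP; exists (c, k) => //; rewrite mem_enum; exact: (asboolT (ex_intro (hit p (c, k)) z hz)).
  have [_ H] := lip c _ _ zr' zr; apply: le_lt_trans H _; apply: le_lt_trans Ls.
  by apply: ler_wpM2l (cell_near _ _ _ ck' ck); exact: ltW.
Qed.

End counting.

Section bounded_lipschitz.
Context {R : realType} {p : nat}.
Implicit Types h k : 'rV[R]_p -> R.

(** Lipschitz on the unit ball: all parameters are rescaled to this ball so that finitely many
    parametrisations share one domain. *)
Definition blip h := exists2 L : R, 0 <= L &
  forall z z', `|z| <= 1 -> `|z'| <= 1 -> `|h z - h z'| <= L * `|z - z'|.

Lemma blip_cst (c : R) : blip (fun=> c).
Proof. by exists 0 => // z z' _ _; rewrite subrr normr0 mul0r. Qed.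

Lemma blip_coord i : blip (fun z => z 0 i).
Proof.
exists 1 => // z z' _ _; rewrite mul1r; apply: le_trans (rV_coord_le (z - z') i).
by rewrite !mxE.
Qed.

Lemma blipD h k : blip h -> blip k -> blip (fun z => h z + k z).
Proof.
move=> [L L0 hL] [K K0 kK]; exists (L + K) => [|z z' z1 z'1]; first exact: addr_ge0.
rewrite opprD addrACA mulrDl; apply: le_trans (ler_normD _ _) _.
by apply: lerD; [exact: hL|exact: kK].
Qed.

Lemma blip_bounded h : blip h -> exists2 K : R, 0 <= K & forall z, `|z| <= 1 -> `|h z| <= K.
Proof.
move=> [L L0 hL]; exists (`|h 0| + L) => [|z z1]; first by rewrite addr_ge0.
rewrite -[h z](subrK (h 0)) addrC; apply: le_trans (ler_normD _ _) _; rewrite lerD2l.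
apply: le_trans (hL z 0 z1 _) _; first by rewrite normr0.
by rewrite subr0 ler_piMr.
Qed.

Lemma blipM h k : blip h -> blip k -> blip (fun z => h z * k z).
Proof.
move=> bh bk; have [H H0 hH] := blip_bounded bh; have [K K0 kK] := blip_bounded bk.
have [L L0 hL] := bh; have [M M0 kM] := bk.
exists (H * M + K * L) => [|z z' z1 z'1]; first by rewrite addr_ge0 ?mulr_ge0.
rewrite (_ : _ - _ = h z * (k z - k z') + k z' * (h z - h z')); last by ring.
apply: le_trans (ler_normD _ _) _; rewrite !normrM mulrDl -!mulrA.
by apply: lerD; apply: ler_pM => //; [exact: hH|exact: kM|exact: kK|exact: hL].
Qed.

Lemma blipB h k : blip h -> blip k -> blip (fun z => h z - k z).
Proof.
move=> bh bk; have := blipD bh (blipM (blip_cst (-1)) bk).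
by under eq_fun do rewrite mulN1r.
Qed.

Lemma blip_sum (I : finType) (h : I -> 'rV[R]_p -> R) : (forall i, blip (h i)) -> blip (fun z => \sum_i h i z).
Proof.
move=> H; have [L HL] := choice (fun i => let: ex_intro2 L L0 hL := H i in ex_intro (fun L => 0 <= L /\ _) L (conj L0 hL)).
exists (\sum_i L i) => [|z z' z1 z'1]; first by apply: sumr_ge0 => i _; case: (HL i).
rewrite -sumrB mulr_suml; apply: le_trans (ler_norm_sum _ _ _) _.
by apply: ler_sum => i _; have [_] := HL i; apply.
Qed.
End bounded_lipschitz.

Lemma open_setI_preimage (T U : topologicalType) (A : set T) (f : T -> U) (B : set U) :
  open A -> (forall x, A x -> {for x, continuous f}) -> open B -> open (A `&` f @^-1` B).
Proof.
move=> oA cf oB; rewrite openE => x [Ax Bfx]; apply: filterI; first exact: open_nbhs_nbhs.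
by apply: (cf x Ax); exact: open_nbhs_nbhs.
Qed.

Lemma C1_lipschitz (R : realType) q (h : 'rV[R]_q -> R) b (r : R) : 0 < r -> Ck 1 (ball b r) h ->
  exists r' : R, [/\ 0 < r', r' <= r & exists2 L : R, 0 <= L &
    forall y z, ball b r' y -> ball b r' z -> `|h y - h z| <= L * `|y - z|].
Proof.
move=> r0 h1; have bb : ball b r b by exact: ballxx.
have [r' [r'0 r'r H]] := C1_strict (@ball_open _ _ b r) h1 bb (@ltr01 R).
exists (Num.min r' r); rewrite lt_min r'0 r0 ge_min lexx orbT; split=> //.
exists (1 + \sum_j `|'D_(ee j) h b|) => [|y z yb zb]; first by rewrite addr_ge0 // sumr_ge0.
have sub : ball b (Num.min r' r) `<=` ball b r' by apply: le_ball; rewrite ge_min lexx.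
have := H y z (sub _ yb) (sub _ zb); rewrite mul1r => H1.
rewrite -[h y - h z](subrK (\sum_j (y - z) 0 j * 'D_(ee j) h b)).
apply: le_trans (ler_normD _ _) _; rewrite mulrDl mul1r; apply: lerD => //.
apply: le_trans (ler_norm_sum _ _ _) _; rewrite mulr_suml; apply: ler_sum => j _.
by rewrite normrM mulrC ler_wpM2l // rV_coord_le.
Qed.

Lemma rsubmx_norm (R : realType) q (z : 'rV[R]_(1 + q)) : `|rsubmx z| <= `|z|.
Proof. by apply: rV_norm_le => // i; rewrite mxE rV_coord_le. Qed.

(** The first coordinate of [z] is reserved for the multiplier; the others, scaled by [s], run
    inside the parameter ball of the patch. *)
Lemma blip_ball (R : realType) q (h : 'rV[R]_q -> R) b (r s : R) : 0 <= s < r ->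
  (exists2 L : R, 0 <= L & forall y z, ball b r y -> ball b r z -> `|h y - h z| <= L * `|y - z|) ->
  blip (fun z : 'rV[R]_q.+1 => h (b + s *: @rsubmx _ 1 1 q z)).
Proof.
move=> /andP[s0 sr] [L L0 hL]; have bz (z : 'rV[R]_q.+1) : `|z| <= 1 -> ball b r (b + s *: @rsubmx _ 1 1 q z).
  move=> z1; apply/ballN; rewrite opprD addNKr normrN normrZ ger0_norm //; apply: le_lt_trans sr.
  by rewrite ler_piMr // (le_trans (@rsubmx_norm R q z)).
exists (L * s) => [|z z' z1 z'1]; first exact: mulr_ge0.
apply: le_trans (hL _ _ (bz _ z1) (bz _ z'1)) _; rewrite -mulrA ler_wpM2l //.
rewrite opprD addrACA subrr add0r -scalerBr normrZ ger0_norm // ler_wpM2l //.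
by rewrite -linearB; exact: (@rsubmx_norm R q).
Qed.

Lemma row_free_col (K : fieldType) n (u v : 'rV[K]_n) : u != 0 -> ~ (v <= u)%MS -> row_free (col_mx u v).
Proof.
move=> u0 vu; have lt : (u < col_mx u v)%MS.
  rewrite ltmxE -[X in _ && ~~ X]/(_ <= _)%MS; apply/andP; split.
    by rewrite -addsmxE addsmxSl.
  apply/negP => H; apply: vu; apply: submx_trans H; by rewrite -addsmxE addsmxSr.
have := rank_ltmx lt; rewrite rank_rV u0 => H; rewrite /row_free eqn_leq rank_leq_row /=.
by rewrite (leq_trans _ H).
Qed.

Lemma grad_dot (R : realType) n (a x : 'rV[R]_n) : grad (fun y => dot y a) x = a.
Proof.
apply/rowP => j; rewrite mxE.
by have := congr1 (fun M : 'cV[R]_n => M j 0) (jac_mulmxr a^T x); rewrite [LHS]mxE => ->; rewrite mxE.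
Qed.

Lemma Ck_dot (R : realType) n r (U : set 'rV[R]_n) a : open U -> Ck r U (fun y => dot y a).
Proof. by move=> oU; exact: (Ck_mulmxr r a^T 0 oU). Qed.

Section slices.
Context {R : realType} (G : carnot R).
Local Notation n := (cdim G).
Local Notation pt := 'rV[R]_n.
Variables (m : nat) (S : set pt) (nu : pt -> pt).
Hypothesis nm : n = m.+2.
Hypotheses (hS : compact_hypersurface S nu) (S0 : mbd S = set0).
Variable g : pt -> R.
Hypothesis g2 : Ck 2 setT g.
Local Notation pert a := (fun y : pt => g y + dot y a).

Lemma pert_C2 a : Ck 2 setT (pert a).
Proof. exact: (CkD openT g2 (Ck_dot 2 a openT)). Qed.

Lemma grad_pert a x : grad (pert a) x = grad g x + a.
Proof.
apply/rowP => j; rewrite [LHS]mxE [RHS]mxE -[X in _ = _ + X]/(a 0 j) -[in RHS](grad_dot a x) !mxE.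
apply: deriveD; apply: (C1_derivable openT) => //; first exact: CkS.
by apply: Ck_dot; exact: openT.
Qed.

(** Lagrange multipliers: at a critical point of the perturbed function on [S], the perturbation [a]
    is determined by the point and one scalar. *)
Lemma critical_gradient x U F a : chart S nu x U F -> S x -> U x ->
  ~ row_free (col_mx (nu x) (rgrad (pert a) x)) -> exists l : R, a = l *: grad F x - grad g x.
Proof.
move=> ch Sx Ux nrf; have [[oU F2 F0] _ SU nuE] := ch; have F1 := CkS F2.
have [Fx N1 e0 E] := chart_facts ch Sx Ux.
have N0 : nu x != 0 by rewrite -dot_eq0 N1 oner_eq0.
have /sub_rVP[c rE] : (rgrad (pert a) x <= nu x)%MS.
  by apply: contrapT => H; apply: nrf; apply: row_free_col => //; exact/negP.
exists (c / enorm (rgrad F x)); apply/eqP; rewrite eq_sym subr_eq addrC -grad_pert; apply/eqP.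
rewrite (grad_rgrad openT (CkS (pert_C2 a))) // rE (grad_rgrad oU F1 Ux) -scalemxAl.
by rewrite scalemxAl {2}E scalerA divfK ?gt_eqF // -scalemxAl.
Qed.

(** The critical pairs ([a], level) near [x0] are parametrised by the [n-1] coordinates of a patch
    and the multiplier, that is, by [n] parameters. The parametrisation involves the gradients of
    [F] and [g], which are C^1 as [F] and [g] are C^2, hence Lipschitz on small balls. *)
Lemma local_slices x0 : S x0 -> exists W : set pt, [/\ open W, W x0 &
  exists (T : 'rV[R]_m.+2 -> pt) (tau : 'rV[R]_m.+2 -> R), [/\ forall j, blip (fun z => T z 0 j), blip tau &
    forall x a, S x -> W x -> `|a| <= 1 -> ~ row_free (col_mx (nu x) (rgrad (pert a) x)) ->
      exists2 z, `|z| <= 1 & T z = a /\ tau z = pert a x]].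
Proof.
move=> Sx0; have [U [F ch]] := surface_chart nm hS S0 Sx0.
have [[oU F2 F0] Ux SU nuE] := ch; have F1 := CkS F2; have [Fx _ _ _] := chart_facts ch Sx0 Ux.
have gF0 : grad F x0 != 0 by exact: (grad_neq0 oU F1 Ux (F0 _ Ux)).
have [j0 rf] := ex_row_free nm gF0.
rewrite -(grad_coord j0 x0) in rf.
have [W [b [r [phi [pi pt_]]]]] := patch_at_exists nm oU F1 (Ck_coord 1 U j0) Ux Fx rf.
have r0 := pa_r pt_; have oW := pa_open pt_; have Cphi := pa_phi pt_.
have [i Fi] : exists i, grad F x0 0 i != 0.
  apply/existsP; apply: contraNT gF0; rewrite negb_exists => /forallP H.
  by apply/eqP/rowP => i; rewrite [RHS]mxE; apply/eqP; have := H i; rewrite negbK.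
have phiU u : ball b r u -> U (phi u) by move=> /(pa_ball pt_)[/(pa_sub pt_)].
have oB : open (ball b r) by exact: ball_open.
have C1F j : Ck 1 (ball b r) (fun u => 'D_(ee j) F (phi u)).
  by apply: (Ck_comp (f := fun x => 'D_(ee j) F x) oU oB Cphi phiU); case: F2 => _ /(_ j)[].
have C1G j : Ck 1 (ball b r) (fun u => 'D_(ee j) g (phi u)).
  by apply: (Ck_comp (f := fun x => 'D_(ee j) g x) openT oB Cphi) => //; case: g2 => _ /(_ j)[].
have C1g : Ck 1 (ball b r) (fun u => g (phi u)) by exact: (Ck_comp openT oB Cphi (fun _ _ => I) (CkS g2)).
have [rF HF] := choice (fun j => C1_lipschitz r0 (C1F j)).
have [rG HG] := choice (fun j => C1_lipschitz r0 (C1G j)).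
have [rP HP] := choice (fun j => C1_lipschitz r0 (Cphi j)).
have [rg [rg0 _ Hg]] := C1_lipschitz r0 C1g.
have [sF sF0 HsF] := @fin_min_gt0 R _ rF (fun j => let: And3 h _ _ := HF j in h).
have [sG sG0 HsG] := @fin_min_gt0 R _ rG (fun j => let: And3 h _ _ := HG j in h).
have [sP sP0 HsP] := @fin_min_gt0 R _ rP (fun j => let: And3 h _ _ := HP j in h).
pose s1 := Num.min (Num.min sF sG) (Num.min sP rg); pose s := s1 / 2.
have s10 : 0 < s1 by rewrite !lt_min sF0 sG0 sP0.
have s0 : 0 < s by rewrite divr_gt0.
have ss1 : s < s1 by rewrite /s ltr_pdivrMr // ltr_pMr // ltr1n.
have le1 : [/\ s1 <= sF, s1 <= sG, s1 <= sP & s1 <= rg] by rewrite !ge_min !lexx !orbT.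
have [l1 l2 l3 l4] := le1.
have sr (t : R) : s1 <= t -> 0 <= s < t by move=> h; rewrite (ltW s0) (lt_le_trans ss1 h).
pose K : R := `|'D_(ee i) g x0| + 1; pose c : R := `|'D_(ee i) F x0| / 2.
have c0 : 0 < c by rewrite divr_gt0 // normr_gt0; move: Fi; rewrite mxE.
have K0 : 0 < K by rewrite ltr_wpDl.
(* On [W2] one component of [grad F] exceeds [c] and the same component of [grad g] is below [K] in
   absolute value. So [|a| <= 1] and [a = l *: grad F - grad g] give [|l| <= La], and [l / La] is a
   parameter in the unit ball. *)
pose La : R := (1 + K) / c; have La0 : 0 < La by rewrite divr_gt0 // addr_gt0.
have W0U y : W y -> U y := pa_sub pt_ (t := y).
pose W1 := (W `&` pi @^-1` ball b s) `&` [set y | 0 < `|'D_(ee i) F y| - c].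
pose W2 := W1 `&` [set y | 0 < K - `|'D_(ee i) g y|].
have oW0 : open (W `&` pi @^-1` ball b s).
  apply: open_setI_preimage => //; last exact: ball_open.
  by move=> y Wy; exact: C1map_continuous (pa_pi pt_) Wy.
have oW1 : open W1.
  apply: (@open_pos R _ _ (fun y => `|'D_(ee i) F y| - c)) => // y [Wy _].
  apply: continuousB; last exact: cst_continuous.
  have cF : {for y, continuous (fun y => 'D_(ee i) F y)}.
    by case: F2 => _ /(_ i)[_ [+ _]]; apply; exact: W0U.
  exact: (continuous_comp cF (@norm_continuous _ _ _)).
have oW2 : open W2.
  apply: (@open_pos R _ _ (fun y => K - `|'D_(ee i) g y|)) => // y _.
  apply: continuousB; first exact: cst_continuous.
  have cg : {for y, continuous (fun y => 'D_(ee i) g y)} by case: g2 => _ /(_ i)[_ [+ _]]; apply.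
  exact: (continuous_comp cg (@norm_continuous _ _ _)).
have pib : pi x0 = b.
  have [H1 _] := pa_ball pt_ (ballxx b r0).
  by have [_ _ _ <- _] := pa_ball pt_ (ballxx b r0); rewrite (pa_b pt_).
pose u (z : 'rV[R]_m.+2) := b + s *: @rsubmx _ 1 1 m.+1 z.
pose T (z : 'rV[R]_m.+2) : pt := \row_j (La * z 0 0 * 'D_(ee j) F (phi (u z)) - 'D_(ee j) g (phi (u z))).
pose tau (z : 'rV[R]_m.+2) : R := g (phi (u z)) + \sum_j phi (u z) 0 j * T z 0 j.
have bF j : blip (fun z => 'D_(ee j) F (phi (u z))).
  have [_ _ H] := HF j; apply: blip_ball H; apply: sr; exact: le_trans l1 (HsF j).
have bG j : blip (fun z => 'D_(ee j) g (phi (u z))).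
  have [_ _ H] := HG j; apply: blip_ball H; apply: sr; exact: le_trans l2 (HsG j).
have bP j : blip (fun z => phi (u z) 0 j).
  have [_ _ H] := HP j; apply: blip_ball H; apply: sr; exact: le_trans l3 (HsP j).
have bg : blip (fun z => g (phi (u z))) by apply: blip_ball Hg; apply: sr.
have bT j : blip (fun z => T z 0 j).
  have -> : (fun z : 'rV[R]_m.+2 => T z 0 j) =
      (fun z => La * z 0 0 * 'D_(ee j) F (phi (u z)) - 'D_(ee j) g (phi (u z))).
    by apply/funext => z; rewrite mxE.
  by apply: blipB => //; apply: blipM => //; apply: blipM; [exact: blip_cst|exact: blip_coord].
exists W2; split=> //.
  split; last by rewrite /= /K addrAC subrr add0r.
  split; first by split; [exact: (pa_x pt_)|rewrite /= pib; exact: ballxx].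
  by rewrite /= subr_gt0 /c ltr_pdivrMr // ltr_pMr ?ltr1n // normr_gt0; move: Fi; rewrite mxE.
exists T, tau; split=> //.
  by apply: blipD => //; apply: blip_sum => j; exact: blipM.
move=> x a Sx [[[Wx bx] Fx'] gx] a1 nrf; rewrite /= subr_gt0 in Fx'; rewrite /= subr_gt0 in gx.
have Ux' := W0U _ Wx; have chx : chart S nu x U F by split.
have [l aE] := critical_gradient chx Sx Ux' nrf.
have [Fxx _ _ _] := chart_facts chx Sx Ux'; have [_ phx] := pa_inv pt_ Wx Fxx.
have lLa : `|l| <= La.
  rewrite ler_pdivlMr //; apply: le_trans (_ : `|l| * `|'D_(ee i) F x| <= _).
    by rewrite ler_wpM2l // ltW.
  rewrite -normrM (_ : l * _ = a 0 i + 'D_(ee i) g x); last first.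
    by rewrite aE !mxE subrK.
  apply: le_trans (ler_normD _ _) _; apply: lerD; last exact: ltW.
  exact: le_trans (rV_coord_le _ _) a1.
pose z : 'rV[R]_m.+2 := rowc (l / La) (s^-1 *: (pi x - b)).
have zr : @rsubmx _ 1 1 m.+1 z = s^-1 *: (pi x - b) by exact: rowcR.
have z00 : z 0 0 = l / La by exact: rowc00.
have uz : phi (u z) = x by rewrite /u zr scalerA divff ?gt_eqF // scale1r addrC subrK.
have Tz : T z = a.
  by apply/rowP => j; rewrite mxE z00 uz (mulrC La) divfK ?gt_eqF // aE !mxE.
exists z; last by split=> //; rewrite /tau uz Tz dotE.
have : ball (0 : 'rV[R]_m.+2) (1 + 1) z -> True by [].
move=> _; apply: rV_norm_le => // j; rewrite /z mxE.
case: splitP => k _.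
  by rewrite mxE ord1 eqxx mulr1n normrM normfV (gtr0_norm La0) ler_pdivrMr // mul1r.
apply: le_trans (rV_coord_le _ _) _; rewrite normrZ normfV (gtr0_norm s0) ler_pdivrMl // mulr1.
by move: bx => /ballN; rewrite distrC => /ltW.
Qed.

Lemma small_bad_levels (eps : R) : 0 < eps -> exists (a : pt) (D : set R),
  [/\ `|a| <= eps, open D, (@lebesgue_measure R D <= eps%:E)%E &
    forall x, S x -> ~ D (pert a x) -> row_free (col_mx (nu x) (rgrad (pert a) x))].
Proof.
move=> eps0; pose P (W : set pt) := 
  exists (T : 'rV[R]_m.+2 -> pt) (tau : 'rV[R]_m.+2 -> R), [/\ forall j, blip (fun z => T z 0 j), blip tau &
    forall x a, S x -> W x -> `|a| <= 1 -> ~ row_free (col_mx (nu x) (rgrad (pert a) x)) ->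
      exists2 z, `|z| <= 1 & T z = a /\ tau z = pert a x].
have [N [W [HW SW]]] := @finite_subcover R n S P (hyp_compact hS) local_slices.
have [T HT] := choice (fun i : 'I_N => (HW i (ltn_ord i)).2).
have [tau Htau] := choice HT.
have lip i : exists L : R, 0 <= L /\ forall z z', `|z| <= 1 -> `|z'| <= 1 ->
    `|T i z - T i z'| <= L * `|z - z'| /\ `|tau i z - tau i z'| <= L * `|z - z'|.
  have [bT [K K0 kK] _] := Htau i.
  have [L HL] := choice (fun j => let: ex_intro2 L L0 hL := bT j in ex_intro (fun L => 0 <= L /\ _) L (conj L0 hL)).
  have sL j : L j <= \sum_k L k.
    by rewrite (bigD1 j) //= lerDl; apply: sumr_ge0 => k _; case: (HL k).
  have sL0 : 0 <= \sum_k L k by apply: sumr_ge0 => k _; case: (HL k).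
  exists (\sum_j L j + K); split=> [|z z' z1 z'1]; first exact: addr_ge0.
  split; last by apply: le_trans (kK _ _ z1 z'1) _; rewrite ler_wpM2r // lerDr.
  apply: rV_norm_le => [|j]; first by rewrite mulr_ge0 // addr_ge0.
  rewrite !mxE; have [_ H] := HL j; apply: le_trans (H _ _ z1 z'1) _.
  by rewrite ler_wpM2r // (le_trans (sL j)) // lerDl.
have [L HL] := choice lip.
have L0 : 0 <= \sum_i L i by apply: sumr_ge0 => i _; case: (HL i).
(* The cap 1 is the bound on [|a|] under which the local parametrisations capture all critical
   points. *)
have e0 : 0 < Num.min eps 1 by rewrite lt_min eps0 ltr01.
have [||a [D [ae oD lD HD]]] := @lipschitz_slices_small R m.+2 n N T tau 1 (\sum_i L i + 1) (Num.min eps 1) (esym nm) ltr01 _ e0 _.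
- by rewrite ltr_wpDl.
- move=> i z z' z1 z'1; have [_ /(_ z z' z1 z'1)[h1 h2]] := HL i.
  have le : L i * `|z - z'| <= (\sum_k L k + 1) * `|z - z'|.
    apply: ler_wpM2r => //; rewrite (bigD1 i) //= -addrA lerDl addr_ge0 //.
    by apply: sumr_ge0 => k _; case: (HL k).
  by split; [exact: le_trans h1 le|exact: le_trans h2 le].
exists a, D; split=> //.
- by apply: le_trans ae _; rewrite ge_min lexx.
- by apply: le_trans lD _; rewrite lee_fin ge_min lexx.
move=> x Sx nD; apply: contrapT => nrf; apply: nD; have [i /= iN Wx] := SW x Sx.
have [_ _ H] := Htau (Ordinal iN).
have a1 : `|a| <= 1 by apply: le_trans ae _; rewrite ge_min lexx orbT.
by have [z z1 [Tz <-]] := H x a Sx Wx a1 nrf; exact: HD z1 Tz.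
Qed.

End slices.

(** * Change of variables *)

Lemma gram_unit (R : realType) p q (D : 'M[R]_(p, q)) : row_free D -> D *m D^T \in unitmx.
Proof.
move=> fD; rewrite -row_free_unit; apply: inj_row_free => v vD.
have : dot (v *m D) (v *m D) = 0 by rewrite /dot trmx_mul mulmxA -(mulmxA v) vD mul0mx mxE.
move=> /eqP; rewrite dot_eq0 => /eqP vD0; apply: (row_free_inj fD); by rewrite vD0 mul0mx.
Qed.

(** Induction on the rows by [gram_slice]: [g] is the vector of the row space dual to the first row,
    computed with the inverse Gram matrix. *)
Lemma gram_gt0 (R : realType) p q (D : 'M[R]_(p, q)) : row_free D -> 0 < gram D.
Proof.
elim: p D => [D _|p IH D fD]; first by rewrite /gram det_mx00.
have U := gram_unit fD; pose g := (delta_mx 0 0 : 'rV[R]_p.+1) *m invmx (D *m D^T) *m D.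
have gD : (g <= D)%MS by exact: submxMl.
have Dg : D *m g^T = delta_mx 0 0.
  rewrite /g !trmx_mul trmx_inv trmx_mul trmxK trmx_delta !mulmxA.
  by rewrite mulmxV // mul1mx.
have g0 : 0 < dot g g.
  rewrite lt_def dot_ge0 andbT dot_eq0; apply/eqP => E; move: Dg; rewrite E trmx0 mulmx0.
  by move=> /(congr1 (fun M : 'cV[R]_p.+1 => M 0 0)) /eqP; rewrite !mxE eqxx eq_sym oner_eq0.
have := gram_slice gD Dg; have /IH fS : row_free (@dsubmx _ 1 p q D).
  rewrite dsubmxE /row_free mxrankMfree // -/(row_free _); apply: inj_row_free => v.
  by rewrite mul_mx_row mulmx0 mulmx1 => /(congr1 (@rsubmx _ 1 1 p)); rewrite row_mxKr linear0.
by move=> E; rewrite E in fS; move: fS; rewrite pmulr_rgt0.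
Qed.

Section vol.
Context {R : realType} (G : carnot R).
Local Notation n := (cdim G).
Local Notation pt := 'rV[R]_n.

Lemma vol_comp p (U V : set 'rV[R]_p) (th : 'rV[R]_p -> 'rV[R]_p) (phi : 'rV[R]_p -> pt) u :
  open U -> open V -> C1map U th -> C1map V phi -> (forall v, U v -> V (th v)) -> U u ->
  vol_density (fun v => phi (th v)) u = `|\det (jac th u)| * vol_density phi (th u).
Proof.
move=> oU oV Cth Cphi UV Uu; have CC := C1map_comp oU oV Cth Cphi UV.
rewrite (vol_densityE oU CC Uu) (vol_densityE oV Cphi (UV u Uu)).
rewrite (jac_comp oU oV Cth Cphi Uu (UV u Uu)) -mulmxA gram_mull.
by rewrite sqrtrM ?sqr_ge0 // sqrtr_sqr.
Qed.

Lemma vol_gt0 p (U : set 'rV[R]_p) (phi : 'rV[R]_p -> pt) u : open U -> C1map U phi -> U u ->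
  row_free (jac phi u) -> 0 < vol_density phi u.
Proof.
move=> oU Cphi Uu rf; rewrite (vol_densityE oU Cphi Uu) sqrtr_gt0 gram_gt0 //.
by rewrite /row_free mxrankMfree // row_free_unit unitmx_inv frame_unit.
Qed.
End vol.

Lemma image_open (R : realType) n (U : set 'rV[R]_n) (th : 'rV[R]_n -> 'rV[R]_n) : open U -> C1map U th ->
  (forall u, U u -> jac th u \in unitmx) -> open (th @` U).
Proof.
move=> oU Cth J; rewrite openE => _ [u Uu <-].
have [W [Y [g [[oW Wu WU _] oY _ H1 H2]]]] := inverse_function oU Cth Uu (J u Uu).
have [Yu _] := H1 u Wu; have FF := nbhs_filter (th u).
apply: (@filterS _ _ FF Y); last exact: open_nbhs_nbhs.
by move=> y /H2[Wg <-]; exists (g y) => //; exact: WU.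
Qed.

Lemma jac_scale (R : realType) p (b : 'rV[R]_p) (t : R) u : jac (fun v => b + t *: v) u = t%:M.
Proof.
apply/matrixP => i j; rewrite mxE.
rewrite (_ : (fun v : 'rV[R]_p => _) = fun v => (b + t *: v) 0 j) //.
have Hd : is_derive u (ee i) (fun v : 'rV[R]_p => (b + t *: v) 0 j) (t * (i == j)%:R).
  rewrite (_ : (fun v : 'rV[R]_p => _) = (fun=> b 0 j) + t \*: (fun v : 'rV[R]_p => v 0 j)); last first.
    by apply/funext => v; rewrite !mxE.
  have H1 := is_derive_coord j u (ee i : 'rV[R]_p).
  have := is_deriveD (is_derive_cst (b 0 j) u (ee i : 'rV[R]_p)) (is_deriveZ t H1).
  by rewrite add0r mxE eqxx /= eq_sym; apply.
by rewrite (derive_val (is_derive := Hd)) !mxE; case: eqP => _; rewrite ?mulr1n ?mulr1 ?mulr0.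
Qed.

Lemma C1map_scale (R : realType) p (b : 'rV[R]_p) (t : R) (U : set 'rV[R]_p) : open U ->
  C1map U (fun v : 'rV[R]_p => b + t *: v).
Proof.
move=> oU j; rewrite (_ : (fun x => _) = fun v : 'rV[R]_p => b 0 j + t * v 0 j).
  by apply: CkD => //; [exact: Ck_cst|apply: CkZ => //; exact: Ck_coord].
by apply/funext => v; rewrite !mxE.
Qed.

Section cov.
Context {R : realType} (G : carnot R).
Local Notation n := (cdim G).
Local Notation pt := 'rV[R]_n.
Variables (m : nat) (S : set pt) (nu : pt -> pt).
Hypothesis nm : n = m.+2.
Hypotheses (hS : compact_hypersurface S nu) (S0 : mbd S = set0).
Variable s : {measure set (borelT R n) -> \bar R}.
Hypothesis hs : is_riem_measure m.+1 S s.
Variable x0 : pt.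
Hypothesis Sx0 : S x0.
Local Notation bo p := (borelT R p).

(** The parameter ball can be centred at 0 with any radius, so every bounded part of R^(m+1) can be
    placed on [S]. *)
Lemma scaled_patch (k : R) : 0 < k ->
  exists W phi pi c, @spatch _ G m S W 0 k phi pi c /\ C1map W pi.
Proof.
move=> k0; have [W [b [r [phi [pi [c [_ sp Cpi]]]]]]] := spatch_exists_C1 nm hS S0 Sx0.
have [[r0 oW Cphi] H1 H2 H3] := sp.
have rk0 : 0 < r / k by rewrite divr_gt0.
have rk : r / k != 0 by rewrite gt_eqF.
have sub v : ball 0 k v -> ball b r (b + (r / k) *: v).
  move=> /ballN; rewrite sub0r normrN => vk; apply/ballN.
  by rewrite opprD addNKr normrN normrZ gtr0_norm // mulrAC ltr_pdivrMr // ltr_pM2l.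
have oB : open (ball (0 : 'rV[R]_m.+1) k) by exact: ball_open.
have Csc := C1map_scale b (r / k) oB.
have Cc := C1map_comp oB (@ball_open _ _ b r) Csc Cphi sub.
exists W, (fun v => phi (b + (r / k) *: v)), (fun y => (r / k)^-1 *: (pi y - b)), (`|\det ((r / k)%:M : 'M[R]_m.+1)| * c).
split; last first.
  move=> j; rewrite (_ : (fun x => _) = fun y => (r / k)^-1 * (pi y 0 j - b 0 j)); last first.
    by apply/funext => y; rewrite !mxE.
  by apply: CkZ => //; apply: CkB => //; exact: Ck_cst.
split=> //.
- move=> u /[dup] bu /sub bu'; have [Sp Wp pip rf] := H1 _ bu'; split=> //.
    by rewrite pip addrC addKr scalerA mulVf // scale1r.
  rewrite (jac_comp oB (@ball_open _ _ b r) Csc Cphi bu bu') jac_scale mul_scalar_mx.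
  by rewrite /row_free mxrank_scale_nz.
- move=> y Wy Sy; have [by_ py] := H2 y Wy Sy; split; last first.
    by rewrite scalerA mulfV // scale1r addrC subrK.
  apply/ballN; rewrite sub0r normrN normrZ normfV (gtr0_norm rk0) invf_div mulrC mulrA ltr_pdivrMr //.
  by move: by_ => /ballN; rewrite distrC mulrC ltr_pM2l.
- move=> u bu; rewrite (vol_comp oB (@ball_open _ _ b r) Csc Cphi sub bu) jac_scale.
  by apply: ler_wpM2l => //; apply: H3; exact: sub.
Qed.

(** Both [phi] and [phi \o th] are patches of [S]. The function [g], the inverse volume density of
    [phi] transported to [S], is integrated over the same piece of [S] in the two patches. In the
    first the densities cancel and leave the Lebesgue measure; in the second the quotient of the
    densities is the Jacobian of [th]. *)
Lemma change_of_variables_ball (k : R) (U : set 'rV[R]_m.+1) (th : 'rV[R]_m.+1 -> 'rV[R]_m.+1)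
    (B : set (bo m.+1)) : 0 < k -> open U -> C1map U th -> {in U &, injective th} ->
  (forall u, U u -> jac th u \in unitmx) -> (forall u, U u -> ball 0 k (th u)) -> measurable B ->
  lebm m.+1 (B `&` th @` U) = (\int[lebm m.+1]_(u in (U : set (bo m.+1)) `&` th @^-1` B) (`|\det (jac th u)|)%:E)%E.
Proof.
move=> k0 oU Cth inj J Uk mB; have [W [phi [pi [c [sp Cpi]]]]] := scaled_patch k0.
have [[_ oW Cphi] H1 H2 _] := sp; have oB : open (ball (0 : 'rV[R]_m.+1) k) by exact: ball_open.
have oI := image_open oU Cth J.
have mS : measurable (S : set (bo n)) by exact: surface_borel hS.
have mpi : measurable_fun (W : set (bo n)) (pi : bo n -> bo m.+1).
  by apply: measurable_fun_on_borel => // y Wy; exact: C1map_continuous Cpi Wy.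
have mWpi (A : set (bo m.+1)) : measurable A -> measurable (S `&` (W `&` pi @^-1` A) : set (bo n)).
  by move=> mA; apply: measurableI => //; apply: mpi => //; exact: open_borel.
pose Z : set (bo m.+1) := B `&` th @` U.
have mZ : measurable Z by apply: measurableI => //; exact: open_borel.
pose D : set (bo n) := S `&` (W `&` pi @^-1` Z).
have mD : measurable D by exact: mWpi.
pose v (u : bo m.+1) : R := vol_density phi u.
have v0 u : ball 0 k u -> 0 < v u.
  by move=> bu; have [_ _ _ rf] := H1 u bu; exact: (vol_gt0 oB Cphi bu rf).
have mv : measurable_fun (ball (0 : 'rV[R]_m.+1) k : set (bo m.+1)) v := vol_measurable oB Cphi.
pose g (y : bo n) : \bar R := ((v (pi y))^-1)%:E.
have Zk u : Z u -> ball 0 k u by move=> [_ [w Uw <-]]; exact: Uk.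
have mg : measurable_fun D g.
  apply/measurable_EFinP; apply: (@inv_measurable _ _ _ D) => [|y]; last exact: sqrtr_ge0.
  apply: (@measurable_comp _ _ _ (bo n) (bo m.+1) R (ball (0 : 'rV[R]_m.+1) k : set (bo m.+1)) v D pi).
  - exact: ball_borel.
  - by move=> _ [y [_ [_ Zy]] <-]; exact: Zk.
  - exact: mv.
  - by apply: measurable_funS mpi; [exact: open_borel|move=> y [_ []]].
have g0 y : D y -> (0 <= g y)%E by move=> _; rewrite lee_fin invr_ge0; exact: sqrtr_ge0.
have E1 : (\int[s]_(y in D) g y)%E = lebm m.+1 Z.
  rewrite [in LHS](_ : D = D `&` (S `&` W)); last first.
    by apply/seteqP; split=> y; [move=> [Sy [Wy Zy]]; split=> //; split|case].
  rewrite (spatch_integral hS hs sp mD mg g0).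
  have -> : (ball (0 : 'rV[R]_m.+1) k : set (bo m.+1)) `&` phi @^-1` D = Z.
    apply/seteqP; split=> u.
      by move=> [bu [_ [_ /=]]]; have [_ _ -> _] := H1 u bu.
    move=> Zu; have bu := Zk u Zu; have [Sp Wp pip _] := H1 u bu; split=> //; split=> //; split=> //=.
    by rewrite pip.
  rewrite (eq_integral (cst 1%E)); first by rewrite integral_cst // mul1e.
  move=> u /set_mem /Zk bu; have [_ _ pip _] := H1 u bu.
  by rewrite /g pip -EFinM mulfV // gt_eqF // v0.
pose psi (u : 'rV[R]_m.+1) := phi (th u).
have Cpsi : C1map U psi := C1map_comp oU oB Cth Cphi Uk.
have psiU : psi @` U = S `&` (W `&` pi @^-1` (th @` U)).
  apply/seteqP; split=> y.
    move=> [u Uu <-]; have [Sp Wp pip _] := H1 _ (Uk u Uu); split=> //; split=> //=; rewrite pip.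
    by exists u.
  move=> [Sy [Wy /= [u Uu E]]]; exists u => //; rewrite /psi E.
  by have [_ ->] := H2 y Wy Sy.
have pp : C1_patch S U psi.
  split=> //.
  - move=> u u' /set_mem Uu /set_mem Uu' E; apply: inj; rewrite ?inE //.
    have [_ _ <- _] := H1 _ (Uk u Uu); have [_ _ <- _] := H1 _ (Uk u' Uu').
    by rewrite -/(psi u) -/(psi u') E.
  - move=> u Uu; rewrite (_ : \matrix_j _ = jac psi u); last first.
      by apply/row_matrixP => j; rewrite rowK (row_jac j oU Cpsi Uu).
    rewrite (jac_comp oU oB Cth Cphi Uu (Uk u Uu)) /row_free mxrankMfree.
      by rewrite mxrank_unit ?J.
    by have [] := H1 _ (Uk u Uu).
  - by rewrite psiU => y [].
have mpsi : measurable_fun (U : set (bo m.+1)) (psi : bo m.+1 -> bo n).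
  by apply: measurable_fun_on_borel => // u Uu; exact: C1map_continuous Cpsi Uu.
have mvpsi : measurable_fun (U : set (bo m.+1)) (vol_density psi : bo m.+1 -> R) := vol_measurable oU Cpsi.
have mU : measurable (U : set (bo m.+1)) by exact: open_borel.
have mP : measurable (psi @` U : set (bo n)) by rewrite psiU; apply: mWpi; exact: open_borel.
have hpsi (A : set (bo n)) : measurable A ->
    s (A `&` psi @` U) = (\int[lebm m.+1]_(u in (U : set (bo m.+1)) `&` psi @^-1` A) (vol_density psi u)%:E)%E.
  move=> mA; have mUA : measurable ((U : set (bo m.+1)) `&` psi @^-1` A) by exact: mpsi.
  have [h1 _] := hs; rewrite (h1 U psi A pp mA).
  apply: (leb_int_indic mUA (w := vol_density psi)); last by move=> u _; exact: sqrtr_ge0.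
  by apply: measurable_funS mvpsi => // u [].
have E2 := ge0_integral_image_density mU mP mpsi mvpsi (fun u _ => sqrtr_ge0 _) hpsi mD mg g0.
rewrite -/Z -E1 [in LHS](_ : D = D `&` psi @` U); last first.
  rewrite psiU; apply/seteqP; split=> y; last by case.
  by move=> [Sy [Wy [By Iy]]]; split.
rewrite E2; have -> : (U : set (bo m.+1)) `&` psi @^-1` D = (U : set (bo m.+1)) `&` th @^-1` B.
  apply/seteqP; split=> u [Uu].
    by move=> [_ [_ [/=]]]; have [_ _ -> _] := H1 _ (Uk u Uu).
  move=> Bu; have [Sp Wp pip _] := H1 _ (Uk u Uu); split=> //; split=> //; split=> //=.
  by rewrite pip; split=> //; exists u.
apply: eq_integral => u /set_mem[Uu _].
have [_ _ pip _] := H1 _ (Uk u Uu).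
rewrite /g pip -EFinM (vol_comp oU oB Cth Cphi Uk Uu) mulfK // gt_eqF //; exact: v0 (Uk u Uu).
Qed.

(** The target is cut into disjoint shells, each inside a ball to which the bounded case applies. *)
Lemma change_of_variables (U : set 'rV[R]_m.+1) (th : 'rV[R]_m.+1 -> 'rV[R]_m.+1)
    (B : set (bo m.+1)) : open U -> C1map U th -> {in U &, injective th} ->
  (forall u, U u -> jac th u \in unitmx) -> measurable B ->
  lebm m.+1 (B `&` th @` U) = (\int[lebm m.+1]_(u in (U : set (bo m.+1)) `&` th @^-1` B) (`|\det (jac th u)|)%:E)%E.
Proof.
move=> oU Cth inj J mB.
pose F (k : nat) : set (bo m.+1) := seqDU (fun k => ball (0 : 'rV[R]_m.+1) k.+1%:R) k.
have FT : \bigcup_k F k = setT.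
  rewrite -seqDU_bigcup_eq; apply/seteqP; split=> // u _.
  exists (Num.Def.archi_bound `|u|) => //; apply/ballN; rewrite sub0r normrN.
  by apply: lt_trans (archi_boundP (normr_ge0 u)) _; rewrite ltr_nat.
have mF k : measurable (F k).
  apply: measurableD; first exact: ball_borel.
  by apply: bigsetU_measurable => j _; exact: ball_borel.
have tF : trivIset setT F by exact: trivIset_seqDU.
have oI := image_open oU Cth J.
have mI : measurable (th @` U : set (bo m.+1)) by exact: open_borel.
have mth : measurable_fun (U : set (bo m.+1)) (th : bo m.+1 -> bo m.+1).
  by apply: measurable_fun_on_borel => // u Uu; exact: C1map_continuous Cth Uu.
have mU : measurable (U : set (bo m.+1)) by exact: open_borel.
have mdet : measurable_fun (U : set (bo m.+1)) (fun u : bo m.+1 => `|\det (jac th u)|).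
  apply: (measurableT_comp (@normr_measurable R setT)).
  apply: measurable_fun_on => // u Uu; apply: continuous_det => i j.
  exact: jac_continuous Cth Uu.
have tI (A : nat -> set (bo m.+1)) (C : set (bo m.+1)) : trivIset setT A -> trivIset setT (fun k => C `&` A k).
  by move=> tA; exact: trivIset_setIl.
rewrite (_ : B `&` th @` U = \bigcup_k ((B `&` th @` U) `&` F k)); last by rewrite -setI_bigcupr FT setIT.
rewrite measure_semi_bigcup //; last 2 first.
- exact: tI.
- by rewrite -setI_bigcupr FT setIT; exact: measurableI.
  rewrite (_ : (U : set (bo m.+1)) `&` th @^-1` B = \bigcup_k ((U : set (bo m.+1)) `&` th @^-1` (B `&` F k))); last first.
    by rewrite -setI_bigcupr -preimage_bigcup -setI_bigcupr FT setIT.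
  rewrite ge0_integral_bigcup //.
  - apply: eq_eseriesr => k _.
    pose Uk := U `&` th @^-1` ball (0 : 'rV[R]_m.+1) k.+1%:R.
    have oUk : open Uk.
      by apply: open_setI_preimage => //; [move=> u Uu; exact: C1map_continuous Cth Uu|exact: ball_open].
    have UkU : Uk `<=` U by move=> u [].
    have Fk u : F k u -> ball 0 k.+1%:R u by case.
    have := @change_of_variables_ball k.+1%:R Uk th (B `&` F k) (ltr0Sn _ _) oUk (C1map_sub UkU Cth) _ (fun u Hu => J u (UkU u Hu)) (fun u Hu => Hu.2) (measurableI _ _ mB (mF k)).
    rewrite (_ : (B `&` F k) `&` th @` Uk = (B `&` th @` U) `&` F k); last first.
      apply/seteqP; split=> u; first by move=> [[Bu Fu] [w [Uw _] E]]; exact: (conj (conj Bu (ex_intro2 _ _ w Uw E)) Fu).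
      move=> [[Bu [w Uw E]] Fu]; apply: (conj (conj Bu Fu)); exists w => //; split=> //=; rewrite E; exact: Fk.
    have injk : {in Uk &, injective th}.
      by move=> u w /set_mem/UkU Uu /set_mem/UkU Uw; apply: inj; rewrite inE.
    move=> /(_ injk) H; apply: (etrans H).
    apply: (congr1 (fun D : set (bo m.+1) => \int[lebm m.+1]_(u in D) (`|\det (jac th u)|)%:E)%E); apply/seteqP; split=> u; first by move=> [[]].
    by move=> [Uu [Bu Fu]]; split=> //; split=> //=; exact: Fk.
  - by move=> k; apply: mth => //; exact: measurableI.
  - by apply/measurable_EFinP; apply: measurable_funS mdet => // u [k _ []].
  - by apply/trivIsetP => i j _ _ ij; apply/seteqP; split=> // u [[_ [_ Fi]] [_ [_ Fj]]];
       have /trivIsetP /(_ i j I I ij) := tF; move=> E; have : (F i `&` F j) (th u) by []; rewrite E.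
- by move=> k; apply: measurableI => //; exact: measurableI.
Qed.

End cov.

(** * Finiteness of the maximal radius *)

(* The last rows of a Householder reflection exchanging N and a coordinate vector. *)
Lemma orthonormal_complement (R : realType) n p (N : 'rV[R]_n) : n = (p + 1)%N -> dot N N = 1 ->
  exists E : 'M[R]_(p, n), [/\ E *m E^T = 1%:M, E *m N^T = 0 & E^T *m E + N^T *m N = 1%:M].
Proof.
move=> np; subst n => NN; pose e : 'rV[R]_(p + 1) := row_mx 0 1%:M.
suff [H [Hsym HH eH]] : exists H : 'M[R]_(p + 1), [/\ H^T = H, H *m H = 1%:M & e *m H = N].
  have HE : H = col_mx (usubmx H) N.
    rewrite -[LHS]vsubmxK; congr col_mx; rewrite -eH /e -[in RHS](vsubmxK H) mul_row_col mul0mx add0r.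
    by rewrite mul1mx.
  move: HE; move: (usubmx H) => E HE; exists E.
  have E3 : (col_mx E N)^T *m col_mx E N = 1%:M by rewrite -HE Hsym.
  have E4 : col_mx E N *m (col_mx E N)^T = 1%:M by rewrite -HE Hsym.
  move: E3 E4; rewrite tr_col_mx mul_row_col mul_col_row => E3.
  move=> E4; have /eq_block_mx[E1 E2 _ _] : block_mx (E *m E^T) (E *m N^T) (N *m E^T) (N *m N^T) =
    block_mx 1%:M 0 0 1%:M by rewrite E4 (scalar_mx_block p 1 1).
  by [].
have ee1 : dot e e = 1 by rewrite /dot tr_row_mx mul_row_col trmx0 mulmx0 add0r trmx1 mulmx1 mxE eqxx.
have [->|Ne] := eqVneq N e.
  by exists 1%:M; rewrite trmx1 !mulmx1.
pose c := 1 - dot N e; have [u uE] : exists u, u = N - e by exists (N - e).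
have uu : dot u u = 2 * c.
  by rewrite uE dotBl !dotBr NN ee1 (dotC e N) /c; ring.
have c0 : c != 0.
  have : dot u u != 0 by rewrite dot_eq0 uE subr_eq0.
  by rewrite uu mulf_eq0 negb_or => /andP[].
exists (1%:M - c^-1 *: (u^T *m u)); split.
- by rewrite linearB linearZ /= trmx_mul trmxK trmx1.
- rewrite mulmxBl mul1mx -scalemxAl mulmxBr mulmx1 -scalemxAr -!mulmxA (mulmxA u u^T).
  rewrite [u *m u^T]mx11_scalar -/(dot u u) uu mul_scalar_mx -scalemxAr !scalerA.
  rewrite scalerBr scalerA -addrA -[X in _ = X]addr0; congr (_ + _).
  rewrite (_ : c^-1 * (c^-1 * (2 * c)) = c^-1 + c^-1); last by field.
  by rewrite scalerDl opprB addrK addNr.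
- rewrite mulmxBr mulmx1 -scalemxAr mulmxA [e *m u^T]mx11_scalar -/(dot e u) mul_scalar_mx scalerA.
  rewrite (_ : c^-1 * dot e u = -1); first by rewrite scaleN1r opprK uE addrC subrK.
  by rewrite uE dotBr ee1 (dotC e N) -opprB -/c mulrN mulVf.
Qed.

(** As [A] fixes the normal, [E *m invmx A] is orthogonal to [N]. Stacking [N] below it gives a
    unitriangular matrix times an orthogonal one times [invmx A], and [gram_normal] reads off the
    determinant. *)
Lemma gram_orthonormal (R : realType) n p (E : 'M[R]_(p, n)) (N : 'rV[R]_n) (A : 'M[R]_n) :
  n = (p + 1)%N -> dot N N = 1 -> E *m E^T = 1%:M -> E *m N^T = 0 -> E^T *m E + N^T *m N = 1%:M ->
  A \in unitmx -> A *m N^T = N^T -> gram (E *m invmx A) = (\det A) ^- 2.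
Proof.
move=> np; subst n => NN EE EN ENs uA AN.
have dN : (E *m invmx A) *m N^T = 0 by rewrite -mulmxA -{1}AN mulKmx.
have NE : N *m E^T = 0 by rewrite -[LHS]trmxK trmx_mul trmxK EN trmx0.
have NNm : N *m N^T = 1%:M by rewrite [LHS]mx11_scalar -/(dot N N) NN.
have := gram_normal dN; rewrite NN mulr1 => <-.
have -> : col_mx (E *m invmx A) N = block_mx 1%:M 0 (N *m A *m E^T) 1%:M *m col_mx E N *m invmx A.
  rewrite mul_block_col mul1mx mul0mx addr0 mul1mx mul_col_mx; congr col_mx.
  apply: (canRL (mulmxK uA)); rewrite -mulmxA -[N in LHS]mul1mx.
  rewrite -[LHS]mulmx1 -ENs mulmxDr !mulmxA mul1mx; congr (_ + _).
  by rewrite -(mulmxA _ A) AN NNm mul1mx.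
have dd : \det (col_mx E N) ^+ 2 = 1.
  rewrite expr2 -[X in _ * X]det_tr -det_mulmx tr_col_mx mul_col_row EE EN NE NNm.
  by rewrite -(scalar_mx_block p 1 1) det1.
by rewrite !det_mulmx det_lblock !det1 !mul1r exprMn dd mul1r det_inv exprVn.
Qed.

Lemma density_measure d (T : measurableType d) (R : realType) (l : {measure set T -> \bar R}) (f : T -> \bar R) :
  measurable_fun setT f -> (forall x, 0 <= f x)%E ->
  exists mu : {measure set T -> \bar R}, forall A, mu A = (\int[l]_(x in A) f x)%E.
Proof.
move=> mf f0; pose g (A : set T) := (\int[l]_(x in A) f x)%E.
have h0 : g set0 = 0%E by exact: integral_set0.
have h1 A : (0 <= g A)%E by exact: integral_ge0.
exists (HB.pack_for {measure set T -> \bar R} g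
  (isMeasure.Build _ _ _ g h0 h1 (semi_sigma_additive_nng_induced (mu := l) mf f0))).
by [].
Qed.

Section plane.
Context {R : realType} (G : carnot R).
Local Notation n := (cdim G).
Local Notation pt := 'rV[R]_n.
Variables (m : nat) (S : set pt) (nu : pt -> pt).
Hypothesis nm : n = m.+2.
Hypotheses (hS : compact_hypersurface S nu) (S0 : mbd S = set0).
Variable s : {measure set (borelT R n) -> \bar R}.
Hypothesis hs : is_riem_measure m.+1 S s.
Variable x0 : pt.
Hypothesis Sx0 : S x0.
Local Notation bo p := (borelT R p).

Section chart.
Variables (x N : pt).
Hypotheses (HN : P_H N = N) (NN : dot N N = 1).

Lemma horizontal_coord j : cdeg j != 1%N -> N 0 j = 0.
Proof.
rewrite -HN P_HE /flag mul_mx_diag !mxE; have /andP[] := cdeg_bounds j.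
by case: (cdeg j) => [|[|d]] // _ _ _; rewrite mulr0.
Qed.

(** [N] is supported on the coordinates of degree 1, where the columns of the frame are those of the
    identity by [frame_H]. *)
Lemma frame_horizontal y : frame y *m N^T = N^T.
Proof.
apply/matrixP => i j; rewrite [LHS]mxE ord1.
rewrite (eq_bigr (fun k => (i == k)%:R * N 0 k)) => [|k _].
  rewrite (bigD1 i) //= big1 ?addr0 => [|k ki]; first by rewrite eqxx mul1r [RHS]mxE.
  by rewrite eq_sym (negPf ki) mul0r.
rewrite [N^T k 0]mxE; have [dk|dk] := eqVneq (cdeg k) 1%N; first by rewrite frame_H.
by rewrite horizontal_coord // !mulr0.
Qed.

Lemma vplane_funE y : vplane_fun x N y = dot (y - x) N.
Proof.
rewrite /vplane_fun P_HE -[in RHS]HN P_HE /dot trmx_mul -mulmxA; congr ((_ *m (_ *m _)) 0 0).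
by rewrite /flag tr_diag_mx.
Qed.

(** The vertical plane has the constant unit normal [N], which is horizontal; so its horizontal
    measure is its Riemannian measure. *)
Lemma rgrad_vplane y : rgrad (vplane_fun x N) y = N.
Proof.
have E : vplane_fun x N = fun y => dot y N + - dot x N.
  by apply/funext => z; rewrite vplane_funE dotBl.
have C1 : Ck 1 setT (fun y => dot y N + - dot x N).
  by apply: CkD => //; [exact: openT|apply: Ck_dot; exact: openT|exact: Ck_cst].
rewrite E (rgrad_grad openT C1) // (_ : grad _ y = N).
  by rewrite -[LHS]trmxK trmx_mul trmxK frame_horizontal trmxK.
rewrite -[RHS](grad_dot N y); apply/rowP => j; rewrite !mxE.
rewrite [LHS](_ : _ = 'D_(ee j) (fun z => dot z N) y + 'D_(ee j) (fun=> - dot x N) y).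
  by rewrite derive_cst addr0.
by apply: deriveD => //; apply: (C1_derivable openT) => //; apply: Ck_dot; exact: openT.
Qed.

Variable E : 'M[R]_(m.+1, n).
Hypotheses (EE : E *m E^T = 1%:M) (EN : E *m N^T = 0) (EsN : E^T *m E + N^T *m N = 1%:M).
Local Notation Phi := (fun v : 'rV[R]_m.+1 => x + v *m E).
Local Notation M := (vplane x N).

Lemma vplane_chartK v : (x + v *m E - x) *m E^T = v.
Proof. by rewrite addrC addKr -mulmxA EE mulmx1. Qed.

Lemma vplane_invK y : M y -> x + ((y - x) *m E^T) *m E = y.
Proof.
rewrite /vplane /= vplane_funE => My; rewrite -mulmxA -[E^T *m E](addrK (N^T *m N)) EsN mulmxBr mulmx1.
by rewrite mulmxA [(y - x) *m N^T]mx11_scalar -/(dot _ _) My mul_scalar_mx scale0r subr0 addrC subrK.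
Qed.

Lemma vplane_chart v : M (x + v *m E).
Proof. by rewrite /vplane /= vplane_funE /dot addrC addKr -mulmxA EN mulmx0 mxE. Qed.

Lemma vplane_chart_C1 : C1map setT Phi.
Proof.
move=> j; rewrite (_ : (fun v => _) = fun v => x 0 j + (v *m E) 0 j); last by apply/funext => v; rewrite mxE.
by apply: CkD => //; [exact: openT|exact: Ck_cst|apply: Ck_mulmxr; exact: openT].
Qed.

Lemma jac_vplane_chart v : jac Phi v = E.
Proof.
apply/matrixP => i j; rewrite mxE -[in RHS](jac_mulmxr E v) [in RHS]mxE.
rewrite (_ : (fun v : 'rV[R]_m.+1 => _) = fun v => x 0 j + (v *m E) 0 j); last by apply/funext => w; rewrite mxE.
rewrite [LHS](_ : _ = 'D_(ee i) (fun=> x 0 j) v + 'D_(ee i) (fun w => (w *m E) 0 j) v).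
  by rewrite derive_cst add0r.
apply: deriveD => //; apply: (C1_derivable openT) => //; apply: Ck_mulmxr; exact: openT.
Qed.

Lemma E_free : row_free E.
Proof. by apply/row_freeP; exists E^T. Qed.

Lemma vol_vplane_chart v : vol_density Phi v = `|\det (frame (x + v *m E))|^-1.
Proof.
rewrite (vol_densityE openT vplane_chart_C1) // jac_vplane_chart (@gram_orthonormal _ _ _ _ N) //.
- by rewrite -exprVn sqrtr_sqr normfV.
- by rewrite nm addn1.
- exact: frame_unit.
- exact: frame_horizontal.
Qed.

Lemma vplane_patch (V : set 'rV[R]_m.+1) : open V -> C1_patch M V Phi.
Proof.
move=> oV; have CV := C1map_sub (@subsetT _ V) vplane_chart_C1; split=> //.
- by move=> v w _ _ Ev; rewrite -(vplane_chartK v) -(vplane_chartK w) Ev.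
- move=> v Vv; rewrite (_ : \matrix_j _ = jac Phi v); first by rewrite jac_vplane_chart E_free.
  by apply/row_matrixP => j; rewrite rowK (row_jac j oV CV Vv).
- by move=> _ [v _ <-]; exact: vplane_chart.
Qed.

(** The affine chart covers the whole plane, and the measure is the push-forward of its volume
    density. Any other patch is the affine chart after a reparametrisation [th], so it obeys the
    defining formula by [change_of_variables]. Without existence the metric factor would be computed
    with [mzero]. *)
Lemma vplane_riem : exists s' : {measure set (bo n) -> \bar R}, is_riem_measure m.+1 M s'.
Proof.
have C1P := vplane_chart_C1.
pose v (u : bo m.+1) : R := vol_density Phi u.
have mv : measurable_fun setT v := vol_measurable openT C1P.
have v0 u : 0 <= v u by exact: sqrtr_ge0.
have mv' : measurable_fun setT (fun u => (v u)%:E) by exact/measurable_EFinP.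
have [mu muE] := density_measure (lebm m.+1) mv' v0.
have mP : measurable_fun setT (Phi : bo m.+1 -> bo n).
  by apply: measurable_fun_on_borel; [exact: openT|move=> u _; exact: C1map_continuous C1P _].
exists (measure_function_pushforward__canonical__measure_function_Measure mu mP); split=> [U phi A pp mA|A mA AU]; last first.
  apply: (etrans (muE (Phi @^-1` A))); rewrite (_ : Phi @^-1` A = set0) ?integral_set0 //.
  apply/seteqP; split=> // u Au; have := AU setT _ (vplane_patch openT).
  by move=> /seteqP[H _]; apply: (H (Phi u)); split=> //; exists u.
have [oU Cphi iphi immphi subphi] := pp.
have Mphi u : U u -> M (phi u) by move=> Uu; apply: subphi; exists u.
have [th thE] : exists th : 'rV[R]_m.+1 -> 'rV[R]_m.+1, forall u, th u = (phi u - x) *m E^T.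
  by exists (fun u => (phi u - x) *m E^T).
have Cth : C1map U th.
  move=> j; rewrite (_ : (fun u => _) = fun u => (phi u *m E^T) 0 j - (x *m E^T) 0 j); last first.
    by apply/funext => u; rewrite thE mulmxBl mxE [X in _ + X]mxE.
  apply: CkB => //; last exact: Ck_cst.
  exact: (Ck_comp (f := fun y => (y *m E^T) 0 j) openT oU Cphi (fun _ _ => I) (Ck_mulmxr 1 _ _ openT)).
have phth u : U u -> Phi (th u) = phi u by move=> Uu; rewrite thE; exact: vplane_invK (Mphi u Uu).
have near_jac u : U u -> jac phi u = jac (fun y => x + th y *m E) u.
  move=> Uu; apply: jac_near_eq; have FF := nbhs_filter u; apply: (@filterS _ _ FF U); last exact: open_nbhs_nbhs.
  by move=> w Uw; rewrite phth.
have jphi u : U u -> jac phi u = jac th u *m E.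
  move=> Uu; rewrite -(jac_vplane_chart (th u)) -(jac_comp oU openT Cth C1P Uu I).
  exact: near_jac.
have J u : U u -> jac th u \in unitmx.
  move=> Uu; rewrite -row_free_unit /row_free -(mxrankMfree _ E_free) -jphi //.
  have := immphi u Uu; rewrite (_ : \matrix_j _ = jac phi u) //.
  by apply/row_matrixP => j; rewrite rowK (row_jac j oU Cphi Uu).
have ith : {in U &, injective th}.
  by move=> u w /[dup] iu /set_mem Uu /[dup] iw /set_mem Uw Eth; apply: iphi => //; rewrite -phth // Eth phth.
have mU : measurable (U : set (bo m.+1)) by exact: open_borel.
have mth : measurable_fun (U : set (bo m.+1)) (th : bo m.+1 -> bo m.+1).
  by apply: measurable_fun_on_borel => // u Uu; exact: C1map_continuous Cth Uu.
have oI := image_open oU Cth J.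
have mI : measurable (th @` U : set (bo m.+1)) by exact: open_borel.
have mdet : measurable_fun (U : set (bo m.+1)) (fun u : bo m.+1 => `|\det (jac th u)|).
  apply: (measurableT_comp (@normr_measurable R setT)).
  apply: measurable_fun_on => // u Uu; apply: continuous_det => i j.
  exact: jac_continuous Cth Uu.
have mphi : measurable_fun (U : set (bo m.+1)) (phi : bo m.+1 -> bo n).
  by apply: measurable_fun_on_borel => // u Uu; exact: C1map_continuous Cphi Uu.
have mUA : measurable ((U : set (bo m.+1)) `&` phi @^-1` A) by exact: mphi.
have mvp : measurable_fun (U : set (bo m.+1)) (vol_density phi : bo m.+1 -> R) := vol_measurable oU Cphi.
pose D : set (bo m.+1) := Phi @^-1` A.
have mD : measurable D by rewrite -[D]setTI; exact: mP.
have cov B (mB : measurable B) := change_of_variables nm hS S0 hs Sx0 oU Cth ith J mB.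
have := ge0_integral_image_density mU mI mth mdet (fun u _ => normr_ge0 _) cov mD
  (measurable_funS measurableT (@subsetT _ D) mv') (fun u _ => v0 u).
have -> : D `&` th @` U = Phi @^-1` (A `&` phi @` U).
  apply/seteqP; split=> w.
    by move=> [Dw [u Uu E1]]; split=> //; exists u => //; rewrite -phth // E1.
  move=> [Aw [u Uu E1]]; split=> //; exists u => //; rewrite -(vplane_chartK w).
  by rewrite thE E1.
move=> E1; apply: (etrans (muE (Phi @^-1` (A `&` phi @` U)))); apply: (etrans E1).
have -> : (U : set (bo m.+1)) `&` th @^-1` D = (U : set (bo m.+1)) `&` phi @^-1` A.
  by apply/seteqP; split=> u [Uu]; rewrite /D /= phth.
rewrite (leb_int_indic mUA (w := vol_density phi)); last 2 first.
- by apply: measurable_funS mvp => // u [].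
- by move=> u _; exact: sqrtr_ge0.
apply: eq_integral => u /set_mem[Uu _]; rewrite -EFinM /v.
rewrite -(vol_comp oU openT Cth C1P (fun _ _ => I) Uu).
have CC := C1map_comp oU openT Cth C1P (fun _ _ => I).
apply: congr1; apply: (etrans (vol_densityE oU CC Uu)); apply/esym.
by apply: (etrans (vol_densityE oU Cphi Uu)); rewrite -(near_jac u Uu) (phth u Uu).
Qed.

End chart.
End plane.

Lemma pair_continuous (T U : topologicalType) (x : T) (y : U) : {for y, continuous (pair x)}.
Proof.
move=> A [[P Q] [/= Px Qy] PQ]; apply: filterS Qy => z Qz; apply: PQ; split=> //=.
exact: nbhs_singleton.
Qed.

Section radius.
Context {R : realType} (G : carnot R).
Local Notation n := (cdim G).
Local Notation pt := 'rV[R]_n.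
Variables (m : nat) (S : set pt) (nu : pt -> pt).
Hypothesis nm : n = m.+2.
Hypotheses (hS : compact_hypersurface S nu) (S0 : mbd S = set0).
Hypothesis hs0 : is_riem_measure m.+1 S (riem_measure n.-1 S).
Variable rho : pt -> pt -> R.
Hypothesis hrho : homogeneous_distance rho.
Variable x0 : pt.
Hypothesis Sx0 : S x0.
Local Notation bo p := (borelT R p).

Lemma rho_lt1_near : exists2 d : R, 0 < d & forall x y : pt, S x -> `|x - y| < d -> rho x y < 1.
Proof.
pose P (W : set pt) := exists2 d : R, 0 < d & forall x y : pt, W x -> `|x - y| < d -> rho x y < 1.
have [x _|N [W [HW SW]]] := @finite_subcover R n S P (hyp_compact hS).
  have r00 : rho x x = 0 by apply/(hd_eq0 hrho).
  have cr := @hd_cont _ _ _ hrho (x, x).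
  have : \forall p \near (x, x), rho p.1 p.2 < 1 by apply: (cvgr_lt _ cr); rewrite /= r00.
  move=> /nbhs_ballP[e /= e0 He]; have e20 : 0 < e / 2 by rewrite divr_gt0.
  exists (ball x (e / 2)); split; [exact: ball_open|exact: ballxx|exists (e / 2) => // y z /ballN xy yz].
  apply: (He (y, z)); split; apply/ballN => /=; first by apply: lt_trans xy _; rewrite ltr_pdivrMr // ltr_pMr // ltr1n.
  rewrite -(subrK y x) -addrA [e](splitr e); apply: le_lt_trans (ler_normD _ _) _; exact: ltrD.
have [d Hd] := choice (fun i : 'I_N => let: ex_intro2 d d0 Hd := (HW i (ltn_ord i)).2 in
  ex_intro (fun d => 0 < d /\ forall x y : pt, W i x -> `|x - y| < d -> rho x y < 1) d (conj d0 Hd)).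
have [e e0 He] := @fin_min_gt0 R _ d (fun i => (Hd i).1).
exists e => // x y Sx xy; have [i /= iN Wx] := SW x Sx.
by have [_ H] := Hd (Ordinal iN); apply: H => //; exact: lt_le_trans xy (He _).
Qed.

Lemma det_frame_bound (r : R) : exists2 c : R, 0 < c & forall y : pt, `|y| <= r -> `|\det (frame y)| <= c.
Proof.
pose r' := `|r| + 1; have r'0 : 0 < r' by rewrite ltr_wpDl.
have cf : {within closed_ball (0 : pt) r', continuous (fun y : pt => \det (frame y))}.
  apply: continuous_subspaceT => y; apply: continuous_det => i j; exact: (Ck_cont (frame_smooth i j 0%N)).
have /compact_bounded [N [_ /(_ (`|N| + 1))]] := continuous_compact cf (closed_ball_compact (x := 0 : pt) r'0).
rewrite (le_lt_trans (ler_norm N)) ?ltrDl // => /(_ isT) H.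
exists (`|N| + 1) => [|y yr]; first by rewrite ltr_wpDl.
apply: H; exists y => //; apply: subset_closed_ball; apply/ballN; rewrite sub0r normrN.
by apply: le_lt_trans yr _; rewrite /r' (le_lt_trans (ler_norm r)) // ltrDl.
Qed.

(** For [x] in the compact [S] the unit ball of [rho] contains a ball of radius [d] independent of
    [x]. The volume density of the plane is the inverse of the determinant of the frame, which is
    bounded on bounded sets. Neither bound sees the direction of the normal. *)
Lemma metric_factor_ge : exists2 c : R, 0 < c &
  forall x, S x -> enorm (P_H (nu x)) != 0 -> (c%:E <= metric_factor rho nu x)%E.
Proof.
have [d d0 Hd] := rho_lt1_near.
have [r Hr] : exists r : R, forall x, S x -> `|x| <= r.
  have [N [_ /(_ (N + 1))]] := compact_bounded (hyp_compact hS).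
  by rewrite ltrDl ltr01 => /(_ isT) H; exists (N + 1) => x Sx; exact: H.
have [D D0 HD] := det_frame_bound (r + 1).
(* The entries of [E] are at most 1, so [v *m E] is at most [m.+1] times [v] in norm; [m.+2] makes
   the inequality strict. *)
pose dl : R := Num.min d 1 / m.+2%:R.
have md0 : 0 < Num.min d 1 by rewrite lt_min d0 ltr01.
have dl0 : 0 < dl by rewrite divr_gt0.
exists (D^-1 * (dl *+ 2) ^+ m.+1) => [|x Sx nx].
  by rewrite mulr_gt0 ?invr_gt0 // exprn_gt0 // mulrn_wgt0.
pose N := nuH nu x.
have n0 : P_H (nu x) != 0.
  by apply: contraNneq nx => ->; rewrite /enorm /dot mul0mx mxE sqrtr0.
have N1 : enorm N = 1 by exact: enorm_normalize.
have NN : dot N N = 1 by rewrite -enorm_sqr N1 expr1n.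
have HN : P_H N = N.
  rewrite /N /nuH /normalize P_HZ; congr (_ *: _); rewrite !P_HE -mulmxA; congr (_ *m _).
  rewrite /flag mulmx_diag; congr diag_mx; apply/rowP => j; rewrite !mxE.
  by case: (_ <= _)%N; rewrite ?mulr1 ?mulr0.
have nm' : n = (m.+1 + 1)%N by rewrite addn1.
have [E [EE EN EsN]] := orthonormal_complement nm' NN.
pose M := vplane x N; pose mu := riem_measure m.+1 M.
have hmu : is_riem_measure m.+1 M mu.
  by apply: riem_measureP; eapply vplane_riem; eassumption.
pose A : set (bo n) := M `&` [set y | rho x y < 1].
have mA : measurable A.
  apply: measurableI.
    have mf : measurable_fun setT ((fun y : pt => dot y N) : bo n -> R).
      apply: measurable_fun_on => //; last exact: openT.
      by move=> y _; apply: (Ck_cont (Ck_dot 0 N openT)).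
    rewrite (_ : M = setT `&` (fun y : pt => dot y N) @^-1` [set dot x N]).
      by apply: mf => //; exact: measurable_set1.
    apply/seteqP; split=> y.
      by rewrite /M /vplane /= (vplane_funE x HN) dotBl => /eqP; rewrite subr_eq0 => /eqP ->.
    by move=> [_ /= yx]; rewrite /M /vplane /= (vplane_funE x HN) dotBl yx subrr.
  apply: open_borel; rewrite -[X in open X]setTI.
  have := @open_setI_preimage pt R setT (rho x) [set t : R | t < 1] openT; apply; last exact: open_lt.
  move=> y _; apply: (@continuous_comp _ _ _ (fun y => (x, y)) (fun p : pt * pt => rho p.1 p.2)).
    exact: pair_continuous.
  exact: (@hd_cont _ _ _ hrho (x, y)).
have -> : metric_factor rho nu x = mu A.
  rewrite /metric_factor /sigmaH /int_sigmaH -/N -/M (dim_pred nm) -/mu -/A.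
  rewrite -[RHS]mul1e -integral_cst //; apply: eq_integral => y _ /=.
  by rewrite (rgrad_vplane x HN) /normalize N1 invr1 scale1r HN N1 mulr1.
pose Phi (v : 'rV[R]_m.+1) : pt := x + v *m E.
have PT : M = Phi @` setT.
  apply/seteqP; split=> [y My|_ [v _ <-]]; last exact: (vplane_chart x HN EN).
  by exists ((y - x) *m E^T) => //; exact: (vplane_invK HN EsN My).
have C1P : C1map setT Phi := vplane_chart_C1 x E.
have mP : measurable_fun setT (Phi : bo m.+1 -> bo n).
  by apply: measurable_fun_on_borel; [exact: openT|move=> u _; exact: C1map_continuous C1P _].
have mPA : measurable (setT `&` Phi @^-1` A : set (bo m.+1)) by exact: mP.
have mv : measurable_fun setT (vol_density Phi : bo m.+1 -> R) := vol_measurable openT C1P.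
have -> : mu A = (\int[lebm m.+1]_(v in (setT `&` Phi @^-1` A : set (bo m.+1))) (vol_density Phi v)%:E)%E.
  have AM : A = A `&` Phi @` setT by rewrite -PT; apply/seteqP; split=> y; [move=> [My Ay]; split|case].
  apply: (etrans (congr1 mu AM)); have [h1 _] := hmu.
  transitivity (leb_int (fun u : 'rV[R]_m.+1 => (vol_density Phi u * \1_(setT `&` Phi @^-1` A) u)%:E)).
    by apply: h1 mA; eapply vplane_patch; [eassumption..|exact: openT].
  apply: (leb_int_indic mPA (w := vol_density Phi)); last by move=> u _; exact: sqrtr_ge0.
  exact: measurable_funS mv.
have bA v : ball (0 : 'rV[R]_m.+1) dl v -> `|v *m E| < Num.min d 1.
  move=> /ballN; rewrite sub0r normrN => vd.
  have E1 i j : `|E i j| <= 1.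
    have := congr1 (fun X : 'M[R]_m.+1 => X i i) EE; rewrite !mxE eqxx => H0; have H : \sum_j E i j * E^T j i = 1 := H0.
    rewrite -sqrtr_sqr -[leRHS]sqrtr1 ler_sqrt // -H (bigD1 j) //= mxE expr2 lerDl.
    by apply: sumr_ge0 => k _; rewrite mxE -expr2 sqr_ge0.
  apply: le_lt_trans (_ : m.+1%:R * `|v| < _).
    apply: rV_norm_le => [|j]; first by rewrite mulr_ge0.
    rewrite mxE; apply: le_trans (ler_norm_sum _ _ _) _.
    apply: le_trans (_ : \sum_(i < m.+1) `|v| <= _); last by rewrite sumr_const card_ord mulr_natl.
    apply: ler_sum => i _; rewrite normrM -[leRHS]mulr1; apply: ler_pM => //; exact: rV_coord_le.
  apply: le_lt_trans (_ : m.+1%:R * dl < _); first by rewrite ler_wpM2l // ltW.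
  by rewrite /dl mulrCA -[ltRHS]mulr1 ltr_pM2l // ltr_pdivrMr // mul1r ltr_nat.
have bsub : ball (0 : 'rV[R]_m.+1) dl `<=` setT `&` Phi @^-1` A.
  move=> v /bA vE; split=> //; split; first exact: (vplane_chart x HN EN).
  apply: Hd => //; rewrite /Phi opprD addNKr normrN; apply: lt_le_trans vE _.
  by rewrite ge_min lexx.
pose Bd : set (bo m.+1) := ball (0 : 'rV[R]_m.+1) dl.
have mB : measurable Bd by exact: ball_borel.
have H1 : ((D^-1 * (dl *+ 2) ^+ m.+1)%:E <= \int[lebm m.+1]_(v in Bd) (vol_density Phi v)%:E)%E.
  have -> : (D^-1 * (dl *+ 2) ^+ m.+1)%:E = (\int[lebm m.+1]_(v in Bd) (D^-1)%:E)%E.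
    apply/esym; apply: (etrans (integral_cst (lebm m.+1) mB (D^-1)%:E)).
    by rewrite EFinM; apply: congr1; exact: lebm_ball.
  apply: ge0_le_integral => //.
  - by move=> v _; rewrite lee_fin invr_ge0 ltW.
  - by apply/measurable_EFinP; exact: measurable_funS mv.
  move=> v bv; rewrite lee_fin /Phi (vol_vplane_chart nm x HN NN EE EN EsN).
  have u0 : 0 < `|\det (frame (x + v *m E))|.
    by rewrite normr_gt0 -unitfE -unitmxE frame_unit.
  rewrite lef_pV2 ?posrE //; apply: HD.
  apply: le_trans (ler_normD _ _) _; apply: lerD; first exact: Hr.
  by apply/ltW/(lt_le_trans (bA v bv)); rewrite ge_min lexx orbT.
have H2 : (\int[lebm m.+1]_(v in Bd) (vol_density Phi v)%:E <=
    \int[lebm m.+1]_(v in (setT `&` Phi @^-1` A : set (bo m.+1))) (vol_density Phi v)%:E)%E.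
  apply: ge0_subset_integral => //.
  - by apply/measurable_EFinP; exact: measurable_funS mv.
  - by move=> v _; rewrite lee_fin sqrtr_ge0.
exact: (le_trans H1 H2).
Qed.

(** At a maximum on [S] of a coordinate of degree 1, its gradient is normal to [S]. The component of
    that gradient along the corresponding horizontal field is 1 by [frame_H], so the normal has a
    horizontal part. *)
Lemma noncharacteristic_point : exists2 x, S x & enorm (P_H (nu x)) != 0.
Proof.
have [a da] := ex_deg1 G; pose f := fun y : pt => y 0 a.
have f1 : Ck 1 setT f := Ck_coord 1 setT a.
have [|x Sx xmax] := @EVT_max_rV R n f S (ex_intro _ x0 Sx0) (hyp_compact hS).
  by apply: continuous_subspaceT => y; exact: (Ck_cont f1).
move: Sx => /set_mem Sx; exists x => //; apply/eqP => nx.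
(* Otherwise the coordinate would be the first coordinate of a patch of [S], and could be increased
   there. *)
have nrf : ~ row_free (col_mx (nu x) (rgrad f x)).
  move=> rf; have [W [b [r [phi [pi [c [Wx sp fphi]]]]]]] := adapted_spatch nm hS S0 f1 Sx rf.
  have [[r0 oW Cphi] H1 H2 _] := sp; have [bx px] := H2 x Wx Sx.
  have := fphi _ bx; rewrite px => fx.
  move: bx => /ballN bx; pose t : R := (r - `|b - pi x|) / 2.
  have t0 : 0 < t by rewrite divr_gt0 // subr_gt0.
  have by_ : ball b r (pi x + t *: ee 0).
    apply/ballN; rewrite opprD addrA; apply: le_lt_trans (ler_normB _ _) _.
    rewrite normrZ (gtr0_norm t0); apply: le_lt_trans (_ : `|b - pi x| + t < _).
      by rewrite lerD2l ler_piMr ?norm_delta // ltW.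
    by rewrite /t; move: bx; set z := `|_|; lra.
  have [Sy _ _ _] := H1 _ by_; have := xmax (phi (pi x + t *: ee 0)) (mem_set Sy).
  by rewrite (fphi _ by_) fx !mxE !eqxx mulr1 -subr_ge0 opprD addNKr oppr_ge0 leNgt t0.
have N1 := nuE_sq nm hS S0 Sx.
have N0 : nu x != 0 by rewrite -dot_eq0 N1 oner_eq0.
have /sub_rVP[c rE] : (rgrad f x <= nu x)%MS.
  by apply: contrapT => H; apply: nrf; apply: row_free_col => //; exact/negP.
have P0 : P_H (nu x) = 0 by apply/eqP; rewrite -dot_eq0 -enorm_sqr nx expr0n.
have : P_H (rgrad f x) = 0 by rewrite rE P_HZ P0 scaler0.
rewrite (rgrad_grad openT f1) // grad_coord P_HE => /(congr1 (fun v : pt => v 0 a)).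
rewrite /flag mul_mx_diag !mxE da leqnn mulr1 (bigD1 a) //= big1 ?addr0 => [|k ka].
  by rewrite [(ee a : pt) 0 a]mxE !eqxx mul1r [(frame x)^T a a]mxE frame_H // eqxx => /eqP; rewrite oner_eq0.
by rewrite !mxE (negPf ka) mul0r.
Qed.

Lemma max_radius_ge0 : (0 <= max_radius rho S nu)%E.
Proof.
have [x Sx nx] := noncharacteristic_point.
apply: le_trans (_ : (radius_at rho S nu x <= _)%E).
  by apply: mule_ge0 => //; exact: poweR_ge0.
apply: ereal_sup_ubound; exists x => //; split; first exact: (mint_surface S0 Sx).
by move=> [_ c]; move/eqP: nx.
Qed.

Lemma max_radius_lty : (max_radius rho S nu < +oo)%E.
Proof.
have [c c0 Hc] := metric_factor_ge; have sl := sigmaH_lty nm hS S0 hs0.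
have sg0 : (0 <= sigmaH S nu S)%E.
  by rewrite sigmaHE; apply: integral_ge0 => x _; rewrite lee_fin hweight_ge0.
have e0 : (0 : R) <= ((homdim G)%:R - 1)^-1.
  have : (3 : R) <= (homdim G)%:R by rewrite ler_nat homdim_ge3.
  by move=> h; rewrite invr_ge0; lra.
apply: le_lt_trans (_ : (2%:E * (sigmaH S nu S * (c^-1)%:E) `^ ((homdim G)%:R - 1)^-1 < +oo)%E).
  apply: ge_ereal_sup => _ [x [mx cx] <-]; apply: lee_wpmul2l => //.
  have Sx : S x by case: mx.
  have nx : enorm (P_H (nu x)) != 0 by apply/eqP => E; apply: cx.
  have k0 : (0 <= metric_factor rho nu x)%E by apply: le_trans (Hc x Sx nx); rewrite lee_fin ltW.
  apply: poweR_le => //; first by apply: mule_ge0 => //; rewrite inve_ge0.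
  apply: lee_wpmul2l => //.
  have -> : (c^-1)%:E = (c%:E)^-1%E by rewrite inver gt_eqF.
  by rewrite lee_pV2 ?inE ?lee_fin ?(ltW c0) // Hc.
move: sl sg0; case: (sigmaH S nu S) => [t| |] // _ _.
have -> : (t%:E * (c^-1)%:E)%E = (t * c^-1)%:E by [].
by rewrite poweR_EFin -EFinM ltry.
Qed.

End radius.

(** * Smoothing *)

Section step.
Context {R : realType}.

Definition pos_pow k (t : R) : R := Num.max 0 t ^+ k.

Lemma pos_pow_ge0 k t : 0 <= pos_pow k t.
Proof. by rewrite exprn_ge0 // le_max lexx. Qed.

Lemma pos_pow_neg k t : t <= 0 -> pos_pow k.+1 t = 0.
Proof. by move=> t0; rewrite /pos_pow max_l // expr0n. Qed.

Lemma pos_pow_pos k t : 0 <= t -> pos_pow k t = t ^+ k.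
Proof. by move=> t0; rewrite /pos_pow max_r. Qed.

Lemma pos_continuous : continuous (fun t : R => Num.max 0 t).
Proof.
move=> t; rewrite (_ : (fun t : R => _) = fun t : R => (t + `|t|) / 2).
  apply: cvgM; last exact: cvg_cst.
  by apply: cvgD; [exact: cvg_id|exact: norm_continuous].
apply/funext => x; case: (leP 0 x) => x0; first by rewrite ger0_norm //; field.
by rewrite ltr0_norm // subrr mul0r.
Qed.

Lemma pos_pow_continuous k : continuous (pos_pow k).
Proof.
move=> t; apply: (@continuous_comp _ _ _ (fun t : R => Num.max 0 t) (fun s : R => s ^+ k)).
  exact: pos_continuous.
exact: exprn_continuous.
Qed.

Lemma pos_pow_derive k (t : R) : is_derive t 1 (pos_pow k.+2) (k.+2%:R * pos_pow k.+1 t).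
Proof.
have [t0|t0|t0] := ltgtP t 0.
- rewrite pos_pow_neg ?ltW // mulr0.
  refine (near_eq_is_derive (f := cst (0 : R)) _ (is_derive_cst _ _ _)).
  near=> s; rewrite /= pos_pow_neg // ltW //; near: s.
  exact: lt_nbhsl.
- rewrite pos_pow_pos ?ltW //.
  have D := is_deriveX k.+2 (is_derive_id t (1 : R)).
  have E : (fun s : R => s ^+ k.+2) = (id : R -> R) ^+ k.+2 by apply/funext => s; rewrite exprfctE.
  have D' : is_derive t 1 (fun s : R => s ^+ k.+2) (k.+2%:R * t ^+ k.+1).
    by rewrite E; apply: (is_derive_eq D); rewrite /GRing.scale /= mulr1.
  refine (near_eq_is_derive _ D').
  near=> s; rewrite pos_pow_pos // ltW //; near: s.
  exact: lt_nbhsr.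
rewrite t0 pos_pow_neg // mulr0.
(* At 0 the difference quotient of [pos_pow k.+2] is [pos_pow k.+1], which is continuous and
   vanishes there. *)
have H : (fun h : R => h^-1 *: ((pos_pow k.+2 \o shift 0) (h *: 1) - pos_pow k.+2 0)) @ 0^' --> (0 : R).
  apply: (@cvg_trans _ ((pos_pow k.+1) @ 0^')).
    apply: near_eq_cvg; near=> h.
    have h0 : h != 0 by near: h; exact: nbhs_dnbhs_neq.
    rewrite /= addr0 [h *: 1]mulr1 [pos_pow k.+2 0]pos_pow_neg // subr0 [RHS]/GRing.scale /=.
    have [hn|hn] := leP h 0; first by rewrite !pos_pow_neg // mulr0.
    by rewrite !pos_pow_pos ?ltW // [X in _ = _ * X]exprS mulKf.
  apply: cvg_trans (_ : pos_pow k.+1 @ (0 : R) --> (0 : R)).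
    by apply: cvg_app; exact: cvg_within.
  by rewrite -[X in _ --> X](pos_pow_neg k (lexx 0)); exact: pos_pow_continuous.
apply: DeriveDef; first by apply/cvg_ex; exists 0.
exact: cvg_lim H.
Unshelve. all: by end_near. Qed.

Lemma Ck_pos_pow n r (U : set 'rV[R]_n) f : open U -> Ck r U f -> Ck r U (fun x => pos_pow r.+2 (f x)).
Proof.
move=> oU; have cs k x : {for x, continuous f} -> {for x, continuous (fun x => pos_pow k (f x))}.
  by move=> cf; apply: (@continuous_comp _ _ _ f (pos_pow k)) cf _; exact: pos_pow_continuous.
elim: r => [|r IH] Cf; have [cf df] := Cf; first by split=> // x Ux; exact/cs/cf.
split=> [x Ux|j]; first exact/cs/cf.
have [f1 f2] := df j.
have D x : U x -> is_derive x (ee j) (fun x => pos_pow r.+3 (f x)) (r.+3%:R * pos_pow r.+2 (f x) * 'D_(ee j) f x).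
  by move=> Ux; apply: is_derive_comp1; [exact: pos_pow_derive|exact/derivableP/f1].
split; first by move=> x /D[].
apply: Ck_eq (CkM oU (CkZ r.+3%:R oU (IH (CkS Cf))) f2) => // x Ux.
by have [_ ->] := D x Ux.
Qed.

(** [step] is a quotient of truncated powers rising from 0 to 1 on the unit interval. One of [t],
    [1 - t] is at least 1/2, so the denominator is bounded below. The exponent 4 is what
    [Ck_pos_pow] asks for class C^2. *)
Definition step_den (t : R) : R := pos_pow 4 t + pos_pow 4 (1 - t).
Definition step (t : R) : R := pos_pow 4 t / step_den t.
Definition stepd (t : R) : R :=
  4 * (pos_pow 3 t * pos_pow 4 (1 - t) + pos_pow 4 t * pos_pow 3 (1 - t)) / step_den t ^+ 2.

Lemma step_den_ge (t : R) : 2^-1 ^+ 4 <= step_den t.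
Proof.
have p0 k s := pos_pow_ge0 k s; have h0 : 0 <= 2^-1 :> R by rewrite invr_ge0.
rewrite /step_den; have [h|h] := leP 2^-1 t.
  rewrite -[leLHS]addr0; apply: lerD; last exact: p0.
  by rewrite pos_pow_pos ?(le_trans h0 h) // lerXn2r // nnegrE // (le_trans h0 h).
rewrite -[leLHS]add0r; apply: lerD; first exact: p0.
have h' : 2^-1 <= 1 - t by lra.
by rewrite pos_pow_pos ?(le_trans h0 h') // lerXn2r // nnegrE // (le_trans h0 h').
Qed.

Lemma step_den_gt0 t : 0 < step_den t.
Proof. by apply: lt_le_trans (step_den_ge t); rewrite exprn_gt0 // invr_gt0. Qed.

Lemma step_ge0 t : 0 <= step t.
Proof. by rewrite divr_ge0 ?pos_pow_ge0 // ltW // step_den_gt0. Qed.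

Lemma step_le1 t : step t <= 1.
Proof. by rewrite ler_pdivrMr ?step_den_gt0 // mul1r lerDl pos_pow_ge0. Qed.

Lemma step_0 t : t <= 0 -> step t = 0.
Proof. by move=> t0; rewrite /step pos_pow_neg // mul0r. Qed.

Lemma step_1 t : 1 <= t -> step t = 1.
Proof.
move=> t1; have := step_den_gt0 t; rewrite /step /step_den [pos_pow 4 (1 - t)]pos_pow_neg ?subr_le0 // addr0.
by move=> h; rewrite divff // gt_eqF.
Qed.

Lemma step_derive (t : R) : is_derive t 1 step (stepd t).
Proof.
have d1 : is_derive t 1 (pos_pow 4) (4 * pos_pow 3 t) := pos_pow_derive 2 t.
have d2 : is_derive t 1 (fun s : R => pos_pow 4 (1 - s)) (4 * pos_pow 3 (1 - t) * (0 - 1)).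
  apply: (@is_derive_comp1 R R (fun s : R => 1 - s) (pos_pow 4)); first exact: (pos_pow_derive 2).
have d3 : is_derive t 1 step_den (4 * pos_pow 3 t + 4 * pos_pow 3 (1 - t) * (0 - 1)) := is_deriveD d1 d2.
have n0 : step_den t != 0 by rewrite gt_eqF // step_den_gt0.
have := is_deriveM d1 (is_deriveV n0 d3).
rewrite (_ : pos_pow 4 * _ = step); last by apply/funext.
move=> H; apply: (is_derive_eq H).
rewrite /stepd /GRing.scale /=; move: n0; rewrite /step_den => n0; field.
by [].
Qed.

Lemma stepd_0 t : t <= 0 -> stepd t = 0.
Proof. by move=> t0; rewrite /stepd !(pos_pow_neg _ t0) !mul0r addr0 mulr0 mul0r. Qed.

Lemma stepd_1 t : 1 <= t -> stepd t = 0.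
Proof.
move=> t1; have h : 1 - t <= 0 by rewrite subr_le0.
by rewrite /stepd !(pos_pow_neg _ h) !mulr0 addr0 mulr0 mul0r.
Qed.

Lemma stepd_bound : exists2 K : R, 0 <= K & forall t, `|stepd t| <= K.
Proof.
pose c : R := 2^-1 ^+ 4; have c0 : 0 < c by rewrite exprn_gt0 // invr_gt0.
exists (8 / c ^+ 2) => [|t]; first by rewrite divr_ge0 // sqr_ge0.
have K0 : 0 <= 8 / c ^+ 2 by rewrite divr_ge0 // sqr_ge0.
have [t0|t0] := leP t 0; first by rewrite stepd_0 ?normr0.
have [t1|t1] := leP 1 t; first by rewrite stepd_1 ?normr0.
have dc := step_den_ge t; have d0 := step_den_gt0 t.
have q0 k s := pos_pow_ge0 k s.
have p1 k : pos_pow k t <= 1.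
  by rewrite pos_pow_pos ?(ltW t0) //; apply: exprn_ile1; exact: ltW.
have q1 k : pos_pow k (1 - t) <= 1.
  have h1 : 0 <= 1 - t by lra.
  have h2 : 1 - t <= 1 by lra.
  by rewrite pos_pow_pos //; exact: exprn_ile1.
have num : pos_pow 3 t * pos_pow 4 (1 - t) + pos_pow 4 t * pos_pow 3 (1 - t) <= 1 * 1 + 1 * 1.
  by apply: lerD; apply: ler_pM.
have num0 : 0 <= pos_pow 3 t * pos_pow 4 (1 - t) + pos_pow 4 t * pos_pow 3 (1 - t).
  by apply: addr_ge0; apply: mulr_ge0.
have D2 : c ^+ 2 <= step_den t ^+ 2 by apply: lerXn2r; rewrite ?nnegrE ?(ltW c0) ?(ltW d0).
rewrite /stepd; move: num num0; set x := (_ + _ : R) => num num0.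
have X0 : 0 <= 4 * x by apply: mulr_ge0.
have D0 : 0 < step_den t ^+ 2 by exact: exprn_gt0.
rewrite ger0_norm; last by apply: divr_ge0 => //; exact: ltW.
apply: ler_pM => //; first by rewrite invr_ge0 ltW.
  by move: num; clear; lra.
by rewrite lef_pV2 // posrE // exprn_gt0.
Qed.

Lemma Ck_step n (U : set 'rV[R]_n) f : open U -> Ck 2 U f -> Ck 2 U (fun x => step (f x)).
Proof.
move=> oU Cf; have C1f : Ck 2 U (fun x => 1 - f x) := CkB oU (Ck_cst 2 U 1) Cf.
have Cp := Ck_pos_pow oU Cf; have Cq := Ck_pos_pow oU C1f.
have d0 x : U x -> step_den (f x) != 0 by move=> _; rewrite gt_eqF // step_den_gt0.
exact: (CkM oU Cp (CkV oU d0 (CkD oU Cp Cq))).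
Qed.

(** Differences of shifted steps, so that sums telescope to 1; each lives on an interval of length
    2. *)
Definition pbump (i : nat) (t : R) : R := step (t - i%:R) - step (t - i.+1%:R).
Definition pbumpd (i : nat) (t : R) : R := stepd (t - i%:R) - stepd (t - i.+1%:R).

Lemma pbump_ge0 i t : 0 <= pbump i t.
Proof.
rewrite subr_ge0; have [h|h] := leP (t - i.+1%:R) 0; first by rewrite [leLHS]step_0 // step_ge0.
rewrite [leRHS]step_1 ?step_le1 //; move: h; rewrite -natr1; lra.
Qed.

Lemma pbump_telescope (F : R -> R) M t : \sum_(i < M) (F (t - i%:R) - F (t - i.+1%:R)) = F t - F (t - M%:R).
Proof.
elim: M => [|M IH]; first by rewrite big_ord0 subr0 subrr.
by rewrite big_ord_recr /= IH addrA subrK.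
Qed.

Lemma pbump_sum M t : 1 <= t <= M%:R -> \sum_(i < M) pbump i t = 1.
Proof.
move=> /andP[t1 tM]; rewrite (pbump_telescope step) step_1 // step_0 ?subr0 //.
by rewrite subr_le0.
Qed.

Lemma pbumpd_sum M t : 1 <= t <= M%:R -> \sum_(i < M) pbumpd i t = 0.
Proof.
move=> /andP[t1 tM]; rewrite (pbump_telescope stepd) stepd_1 // stepd_0 ?subr0 //.
by rewrite subr_le0.
Qed.

Lemma pbump_supp i t : pbump i t != 0 \/ pbumpd i t != 0 -> i%:R <= t <= i%:R + 2.
Proof.
move=> H; have [ti|ti] := leP i%:R t; last first.
  have h1 : t - i%:R <= 0 by rewrite subr_le0 ltW.
  have h2 : t - i.+1%:R <= 0 by move: h1; rewrite -natr1; lra.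
  by case: H; rewrite /pbump /pbumpd ?step_0 ?stepd_0 // subrr eqxx.
have [//|ti2] := leP t (i%:R + 2).
have h2 : 1 <= t - i.+1%:R by move: ti2; rewrite -natr1; lra.
have h1 : 1 <= t - i%:R by move: ti2; lra.
by case: H; rewrite /pbump /pbumpd ?step_1 ?stepd_1 // subrr eqxx.
Qed.

Lemma sum_single_bound (M : nat) (F : 'I_M -> R) (K : R) : 0 <= K -> (forall i, `|F i| <= K) ->
  (forall i j, F i != 0 -> F j != 0 -> i = j) -> \sum_(i < M) `|F i| <= K.
Proof.
move=> K0 FK F1; have [[i Hi]|no] := pselect (exists i, F i != 0).
  rewrite (bigD1 i) //= big1 ?addr0 // => j ji; apply/eqP; rewrite normr_eq0.
  by apply: contraT => Fj; rewrite (F1 j i Fj Hi) eqxx in ji.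
rewrite big1 // => i _; apply/eqP; rewrite normr_eq0; apply: contraT => Hi.
by exfalso; apply: no; exists i.
Qed.

(** The bound does not depend on the number of bumps, as at most one shifted [stepd] is nonzero at a
    given point. *)
Lemma pbumpd_sum_bound : exists2 K : R, 0 <= K & forall M t, \sum_(i < M) `|pbumpd i t| <= K.
Proof.
have [K K0 HK] := stepd_bound; exists (K + K) => [|M t]; first exact: addr_ge0.
have H t' : \sum_(i < M) `|stepd (t' - i%:R)| <= K.
  apply: sum_single_bound => // i j.
  have supp (k : 'I_M) : stepd (t' - k%:R) != 0 -> k%:R < t' < k%:R + 1.
    move=> H; apply/andP; split; rewrite ltNge; apply/negP => h; move/negP: H; apply; apply/eqP.
      by apply: stepd_0; rewrite subr_le0.
    by apply: stepd_1; lra.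
  move=> /supp/andP[i1 i2] /supp/andP[j1 j2]; apply/val_inj.
  have h1 : (j : nat)%:R < (i : nat).+1%:R :> R by rewrite -natr1; lra.
  have h2 : (i : nat)%:R < (j : nat).+1%:R :> R by rewrite -natr1; lra.
  by move: h1 h2; rewrite !ltr_nat !ltnS => h1 h2; apply/eqP; rewrite eqn_leq h1 h2.
apply: le_trans (_ : \sum_(i < M) (`|stepd (t - i%:R)| + `|stepd (t - 1 - i%:R)|) <= _).
  apply: ler_sum => i _; apply: le_trans (ler_normB _ _) _; rewrite lerD2l -natr1.
  by rewrite (_ : t - (i%:R + 1) = t - 1 - i%:R) //; ring.
by rewrite big_split /=; apply: lerD; exact: H.
Qed.

Lemma pbump_derive i (t : R) : is_derive t 1 (pbump i) (pbumpd i t).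
Proof.
have H (k : nat) : is_derive t 1 (fun s : R => step (s - k%:R)) (stepd (t - k%:R)).
  have := @is_derive_comp1 R R (fun s : R => s - k%:R) step t 1 1 (stepd (t - k%:R)) (step_derive _).
  rewrite mulr1; apply; apply: is_derive_eq (is_deriveB (is_derive_id _ _) (is_derive_cst _ _ _)) _.
  by rewrite subr0.
exact: is_deriveB (H i) (H i.+1).
Qed.

Lemma Ck_pbump n (U : set 'rV[R]_n) f i : open U -> Ck 2 U f -> Ck 2 U (fun x => pbump i (f x)).
Proof.
move=> oU Cf; have H (k : nat) : Ck 2 U (fun x => step (f x - k%:R)).
  exact: (Ck_step oU (CkB oU Cf (Ck_cst 2 U k%:R))).
exact: (CkB oU (H i) (H i.+1)).
Qed.

End step.

Lemma is_derive_bigsum (R : realType) (V : normedModType R) (I : Type) (s : seq I) (h : I -> V -> R) (x v : V)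
    (dh : I -> R) : (forall i, is_derive x v (h i) (dh i)) ->
  is_derive x v (fun y => \sum_(i <- s) h i y) (\sum_(i <- s) dh i).
Proof.
move=> H; elim: s => [|i s IH].
  rewrite big_nil (_ : (fun y => _) = cst 0); first exact: is_derive_cst.
  by apply/funext => y; rewrite big_nil.
rewrite big_cons (_ : (fun y => _) = h i + (fun y => \sum_(j <- s) h j y)); first exact: is_deriveD.
by apply/funext => y; rewrite big_cons.
Qed.

Section grid.
Context {R : realType} (n M : nat) (eta L : R).
Implicit Types (c : {ffun 'I_n -> 'I_M}) (x : 'rV[R]_n).

(** Grid coordinates of mesh [eta]; the shift [L] moves a bounded set into the range where the bumps
    sum to 1. *)
Definition gridc (j : 'I_n) x : R := x 0 j / eta + L.
Definition weight c x : R := \prod_j pbump (c j) (gridc j x).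
(** This is [eta] times the [l]-th partial derivative of [weight]; keeping [eta] apart makes its
    bounds independent of the mesh. *)
Definition weightd (l : 'I_n) c x : R :=
  \prod_j (if j == l then pbumpd (c j) (gridc j x) else pbump (c j) (gridc j x)).

Lemma gridc_C2 j : Ck 2 setT (gridc j).
Proof.
have H : Ck 2 setT (fun x : 'rV[R]_n => eta^-1 * x 0 j + L).
  exact: (CkD openT (CkZ eta^-1 openT (Ck_coord 2 setT j)) (Ck_cst 2 setT L)).
by apply: (Ck_eq openT _ H) => x _; rewrite /gridc mulrC.
Qed.

Lemma weight_C2 c : Ck 2 setT (weight c).
Proof. by apply: Ck_prod; [exact: openT|move=> j; exact: (Ck_pbump _ openT (gridc_C2 j))]. Qed.

Lemma weight_derive l c x : is_derive x (ee l) (weight c) (eta^-1 * weightd l c x).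
Proof.
pose P (y : 'rV[R]_n) := \prod_(j | j != l) pbump (c j) (gridc j y).
have D1 : is_derive x (ee l) (fun y => pbump (c l) (gridc l y)) (pbumpd (c l) (gridc l x) * eta^-1).
  apply: is_derive_comp1; first exact: pbump_derive.
  have D := is_deriveD (is_deriveZ eta^-1 (is_derive_coord l x (ee l : 'rV[R]_n))) (is_derive_cst L x (ee l : 'rV[R]_n)).
  have E : gridc l = eta^-1 \*: (fun y : 'rV[R]_n => y 0 l) + cst L.
    by apply/funext => y; rewrite /gridc mulrC.
  by rewrite E; apply: (is_derive_eq D); rewrite mxE !eqxx addr0 /GRing.scale /= mulr1.
have D2 : is_derive x (ee l) P 0.
  apply/is_derive_lineE; rewrite (_ : (fun s : R => _) = cst (P x)); first exact: is_derive_cst.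
  apply/funext => s; apply: eq_bigr => j jl; rewrite /gridc !mxE [j == l](negPf jl) andbF.
  by rewrite mulr0 add0r.
have D := is_deriveM D1 D2.
have E : weight c = (fun y => pbump (c l) (gridc l y)) * P.
  by apply/funext => y; rewrite /weight (bigD1 l).
rewrite E; apply: (is_derive_eq D); rewrite scaler0 add0r /GRing.scale /=.
rewrite /weightd (bigD1 l) //= eqxx.
rewrite (eq_bigr (fun j => pbump (c j) (gridc j x))) => [|j /negPf -> //].
by rewrite -/(P x); ring.
Qed.

Lemma weight_ge0 c x : 0 <= weight c x.
Proof. by apply: prodr_ge0 => j _; exact: pbump_ge0. Qed.

Section point.
Variable x : 'rV[R]_n.
Hypothesis gx : forall j, 1 <= gridc j x <= M%:R.

Lemma weight_sum : \sum_c weight c x = 1.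
Proof.
rewrite /weight -(bigA_distr_bigA (fun j (i : 'I_M) => pbump i (gridc j x))).
by apply: big1 => j _; rewrite pbump_sum.
Qed.

Lemma weightd_sum l : \sum_c weightd l c x = 0.
Proof.
rewrite /weightd -(bigA_distr_bigA (fun j (i : 'I_M) => if j == l then pbumpd i (gridc j x) else pbump i (gridc j x))).
by rewrite (bigD1 l) //= eqxx pbumpd_sum // mul0r.
Qed.

Lemma weightd_bound (K : R) l : (forall t, \sum_(i < M) `|pbumpd i t| <= K) -> \sum_c `|weightd l c x| <= K.
Proof.
move=> HK; rewrite (eq_bigr (fun c : {ffun 'I_n -> 'I_M} => \prod_j (if j == l then `|pbumpd (c j) (gridc j x)| else pbump (c j) (gridc j x)))).
  rewrite -(bigA_distr_bigA (fun j (i : 'I_M) => if j == l then `|pbumpd i (gridc j x)| else pbump i (gridc j x))).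
  rewrite (bigD1 l) //= eqxx [X in _ * X]big1 ?mulr1 // => j /negPf ->.
  exact: pbump_sum.
move=> c _; rewrite /weightd normr_prod; apply: eq_bigr => j _; case: ifP => // _.
by rewrite ger0_norm ?pbump_ge0.
Qed.
End point.

Lemma weight_supp c x : 0 < eta -> weight c x != 0 \/ (exists l, weightd l c x != 0) ->
  `|x - \row_j (((c j)%:R + 1 - L) * eta)| <= eta.
Proof.
move=> eta0 H; apply: rV_norm_le => [|j]; first exact: ltW.
have : (c j)%:R <= gridc j x <= (c j)%:R + 2.
  apply: pbump_supp; case: H => [|[l]].
    by rewrite /weight => /prodf_neq0 /(_ j isT); left.
  by rewrite /weightd => /prodf_neq0 /(_ j isT); case: ifP => _; [right|left].
rewrite /gridc !mxE => /andP[h1 h2].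
have -> : x 0 j - ((c j)%:R + 1 - L) * eta = (x 0 j / eta + L - (c j)%:R - 1) * eta.
  by field; rewrite gt_eqF.
rewrite normrM (gtr0_norm eta0) ler_piMl ?(ltW eta0) // ler_norml.
by apply/andP; split; lra.
Qed.
End grid.

Section smoothing.
Context {R : realType} (G : carnot R).
Local Notation n := (cdim G).
Local Notation pt := 'rV[R]_n.
Variables (m : nat) (S : set pt) (nu : pt -> pt).
Hypothesis nm : n = m.+2.
Hypotheses (hS : compact_hypersurface S nu) (S0 : mbd S = set0).
Variable psi : pt -> R.
Hypothesis psi1 : C1_on S psi.

Lemma frame_bound : exists2 K : R, 0 <= K & forall (x w : pt), S x -> enorm (w *m (frame x)^T) <= K * `|w|.
Proof.
have H i j : exists2 N : R, 0 <= N & forall x : pt, S x -> `|frame x i j| <= N.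
  have cf : {within S, continuous (fun x : pt => frame x i j)}.
    by apply: continuous_subspaceT => x; exact: (Ck_cont (frame_smooth i j 0%N)).
  have /compact_bounded [N [_ /(_ (`|N| + 1))]] := continuous_compact cf (hyp_compact hS).
  rewrite (le_lt_trans (ler_norm N)) ?ltrDl // => /(_ isT) H; exists (`|N| + 1); first exact: addr_ge0.
  by move=> x Sx; apply: H; exists x.
have [N HN] := choice (fun p : 'I_n * 'I_n => let: ex_intro2 N N0 HN := H p.1 p.2 in
  ex_intro (fun N => 0 <= N /\ forall x : pt, S x -> `|frame x p.1 p.2| <= N) N (conj N0 HN)).
pose K0 := \sum_i \sum_j N (i, j).
have N0 p : 0 <= N p by case: (HN p).
have K00 : 0 <= K0 by apply: sumr_ge0 => i _; apply: sumr_ge0.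
exists (n%:R * K0) => [|x w Sx]; first exact: mulr_ge0.
apply: le_trans (enorm_norm_le _) _; rewrite -mulrA; apply: ler_wpM2l => //.
apply: rV_norm_le => [|j]; first exact: mulr_ge0.
rewrite mxE mulr_suml; apply: le_trans (ler_norm_sum _ _ _) _.
rewrite (bigD1 j (F := fun i => (\sum_k N (i, k)) * `|w|)) //= -[leLHS]addr0; apply: lerD; last first.
  by apply: sumr_ge0 => i _; apply: mulr_ge0 => //; exact: sumr_ge0.
rewrite mulr_suml; apply: ler_sum => k _; rewrite [(frame x)^T k j]mxE normrM mulrC.
apply: ler_pM => //; last exact: rV_coord_le.
by have [_ ->] := HN (j, k).
Qed.

(** A first-order expansion of [psi] along [S], uniform by compactness. For [v] a local extension is
    differentiated at a fixed nearby point, and the second estimate compares the tangential part of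
    this constant vector, taken at [x], with the tangential gradient of [psi] at [x]. *)
Lemma tangential_taylor (e : R) : 0 < e -> exists2 d : R, 0 < d &
  forall p, S p -> exists v : pt, forall x, S x -> `|x - p| < d ->
    `|psi x - psi p - dot (x - p) v| <= e * `|x - p| /\
    enorm (oproj (TS (nu x)) (v *m (frame x)^T) - tgrad S nu psi x) <= e.
Proof.
move=> e0; have [K K0 HK] := frame_bound.
pose P (W : set pt) := exists2 d : R, 0 < d & exists v : pt, forall p x, W p -> S p -> S x -> `|x - p| < d ->
    `|psi x - psi p - dot (x - p) v| <= e * `|x - p| /\
    enorm (oproj (TS (nu x)) (v *m (frame x)^T) - tgrad S nu psi x) <= e.
have [p0 Sp0|N [W [HW SW]]] := @finite_subcover R n S P (hyp_compact hS).
  have [U [F ext]] := psi1 Sp0; have [oU Up0 F1 Fpsi] := ext.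
  have [r [r0 rU Hr]] := C1_strict oU F1 Up0 e0.
  pose e' := e / (K + 1); have e'0 : 0 < e' by rewrite divr_gt0 // ltr_wpDl.
  have Hj j : exists2 d : R, 0 < d & forall x, ball p0 d x -> `|'D_(ee j) F p0 - 'D_(ee j) F x| < e'.
    have cD : {for p0, continuous (fun x => 'D_(ee j) F x)} by case: F1 => _ /(_ j)[_ [+ _]]; apply.
    have FF := nbhs_filter p0.
    have /cvgrPdist_lt /(_ e' e'0) /nbhs_ballP[d /= d0 Hd] := cD.
    by exists d => // x /Hd.
  have [d Hd] := choice (fun j => let: ex_intro2 d d0 Hd := Hj j in
    ex_intro (fun d => 0 < d /\ forall x, ball p0 d x -> `|'D_(ee j) F p0 - 'D_(ee j) F x| < e') d (conj d0 Hd)).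
  have [d' d'0 Hd'] := @fin_min_gt0 R _ d (fun j => (Hd j).1).
  pose q := Num.min r d' / 2.
  have q0 : 0 < q by rewrite divr_gt0 // lt_min r0.
  have qq : q + q = Num.min r d' by rewrite /q -splitr.
  exists (ball p0 q); split; [exact: ball_open|exact: ballxx|exists q => //; exists (grad F p0)].
  move=> p x /ballN bp Sp Sx xp.
  have bx' : `|p0 - x| < Num.min r d'.
    rewrite -qq -(subrK p p0) -addrA; apply: le_lt_trans (ler_normD _ _) _; apply: ltrD => //.
    by rewrite distrC.
  have bp' : `|p0 - p| < Num.min r d' by apply: lt_trans bp _; rewrite -qq ltrDl.
  have brx : ball p0 r x by apply/ballN; apply: lt_le_trans bx' _; rewrite ge_min lexx.
  have brp : ball p0 r p by apply/ballN; apply: lt_le_trans bp' _; rewrite ge_min lexx.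
  have [Ux Up] := (rU _ brx, rU _ brp).
  split.
    rewrite -(Fpsi x Sx Ux) -(Fpsi p Sp Up) dotE.
    rewrite (eq_bigr (fun j => (x - p) 0 j * 'D_(ee j) F p0)) => [|j _]; first exact: Hr.
    by rewrite [grad F p0 0 j]mxE.
  have [U' [F' ch]] := surface_chart nm hS S0 Sx; have [_ U'x _ _] := ch.
  have extx : C1_ext S psi x U F by [].
  rewrite (tgrad_chart nm ch Sx U'x extx) -oprojB; apply: le_trans (oproj_enorm_le _ _) _.
  rewrite (rgrad_grad oU F1 Ux) -mulmxBl; apply: le_trans (HK _ _ Sx) _.
  apply: le_trans (_ : K * e' <= _).
    apply: ler_wpM2l => //; apply: rV_norm_le => [|j]; first exact: ltW.
    rewrite !mxE; have [_ H] := Hd j; apply/ltW/H/ballN; apply: lt_le_trans bx' _.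
    by apply: le_trans (Hd' j); rewrite ge_min lexx orbT.
  by rewrite /e' mulrCA ler_piMr ?(ltW e0) // ler_pdivrMr ?ltr_wpDl // mul1r lerDl.
have [d Hd] := choice (fun i : 'I_N => let: ex_intro2 d d0 Hd := (HW i (ltn_ord i)).2 in
  ex_intro (fun d => 0 < d /\ exists v : pt, forall p x, W i p -> S p -> S x -> `|x - p| < d ->
    `|psi x - psi p - dot (x - p) v| <= e * `|x - p| /\
    enorm (oproj (TS (nu x)) (v *m (frame x)^T) - tgrad S nu psi x) <= e) d (conj d0 Hd)).
have [d' d'0 Hd'] := @fin_min_gt0 R _ d (fun i => (Hd i).1).
exists d' => // p Sp; have [i /= iN Wp] := SW p Sp.
have [_ [v Hv]] := Hd (Ordinal iN); exists v => x Sx xp.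
by apply: Hv => //; exact: lt_le_trans xp (Hd' _).
Qed.

(** A partition of unity on a grid of mesh [eta] glues the affine expansions [T c] of [psi] at
    points of [S] near the grid points. Differentiating the weights costs a factor [1 / eta]. As the
    derivatives of the weights sum to 0, [T c] may be replaced by [T c - psi], which is of order
    [e' * eta], so this factor is compensated. *)
Lemma smoothing (e : R) : 0 < e -> exists h : pt -> R, Ck 2 setT h /\ forall x, S x ->
  `|h x - psi x| <= e /\ enorm (oproj (TS (nu x)) (rgrad h x) - tgrad S nu psi x) <= e.
Proof.
move=> e0; have [Kf Kf0 HKf] := frame_bound; have [K K0 HK] := @pbumpd_sum_bound R.
(* The 1 stands for the error of the expansions. [2 * K * Kf] stands for the derivatives of the
   weights: [K] bounds their sum, 2 comes from the distance [2 * eta], and [Kf] converts coordinates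
   to frame components. *)
pose e' := e / (1 + 2 * K * Kf).
have den : 1 <= 1 + 2 * K * Kf by rewrite lerDl !mulr_ge0.
have den0 : 0 < 1 + 2 * K * Kf by exact: lt_le_trans den.
have e'0 : 0 < e' by rewrite divr_gt0.
have e'e : e' <= e by rewrite ler_pdivrMr // ler_peMr // ltW.
have [d d0 Hd] := tangential_taylor e'0.
pose eta := Num.min d 1 / 3.
have md0 : 0 < Num.min d 1 by rewrite lt_min d0 ltr01.
have eta0 : 0 < eta by rewrite divr_gt0.
have eta2 : 2 * eta < Num.min d 1 by rewrite /eta; move: md0; set z := Num.min _ _; lra.
have eta2d : 2 * eta < d by apply: lt_le_trans eta2 _; rewrite ge_min lexx.
have eta21 : 2 * eta <= 1 by apply/ltW/(lt_le_trans eta2); rewrite ge_min lexx orbT.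
have [r Hr] : exists r : R, forall x, S x -> `|x| <= r.
  have [N [_ /(_ (N + 1))]] := compact_bounded (hyp_compact hS).
  by rewrite ltrDl ltr01 => /(_ isT) H; exists (N + 1) => x Sx; exact: H.
pose L := (Num.Def.archi_bound (`|r| / eta)).+1; pose M := (L + L)%N.
have HL : `|r| / eta + 1 <= L%:R.
  rewrite /L -natr1 lerD2r; apply/ltW/archi_boundP; by rewrite divr_ge0 // ltW.
have gx x : S x -> forall j, 1 <= gridc eta L%:R j x <= M%:R.
  move=> Sx j; have : `|x 0 j / eta| <= `|r| / eta.
    rewrite normrM normfV (gtr0_norm eta0) ler_pM2r ?invr_gt0 //.
    exact: le_trans (le_trans (rV_coord_le x j) (Hr x Sx)) (ler_norm r).
  rewrite ler_norml /gridc /M natrD => /andP[h1 h2].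
  by move: HL h1 h2; set u := _ / eta; set v := _ / eta => *; apply/andP; split; lra.
pose q (c : {ffun 'I_n -> 'I_M}) : pt := \row_j (((c j)%:R + 1 - L%:R) * eta).
(* Grid points far from [S] receive a dummy expansion; their weights and the derivatives of these
   vanish on [S]. *)
have Hc c : exists pv : pt * pt * R, (exists2 p, S p & `|p - q c| <= eta) ->
    [/\ S pv.1.1, `|pv.1.1 - q c| <= eta, pv.2 = psi pv.1.1 &
      forall x, S x -> `|x - pv.1.1| < d ->
    `|psi x - psi pv.1.1 - dot (x - pv.1.1) pv.1.2| <= e' * `|x - pv.1.1| /\
    enorm (oproj (TS (nu x)) (pv.1.2 *m (frame x)^T) - tgrad S nu psi x) <= e'].
  have [[p Sp pq]|no] := pselect (exists2 p, S p & `|p - q c| <= eta); last by exists (0, 0, 0).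
  by have [v Hv] := Hd p Sp; exists (p, v, psi p).
have [pv Hpv] := choice Hc.
pose T c (x : pt) : R := (pv c).2 - dot (pv c).1.1 (pv c).1.2 + dot x (pv c).1.2.
pose h x := \sum_c weight eta L%:R c x * T c x.
have T2 c : Ck 2 setT (T c) := CkD openT (Ck_cst 2 setT _) (Ck_dot 2 (pv c).1.2 openT).
have h2 : Ck 2 setT h.
  by apply: Ck_sum => [|c]; [exact: openT|exact: (CkM openT (weight_C2 eta L%:R c) (T2 c))].
exists h; split=> // x Sx.
pose w (c : {ffun 'I_n -> 'I_M}) := weight eta L%:R c x.
pose wd l (c : {ffun 'I_n -> 'I_M}) := weightd eta L%:R l c x.
have w0 c : 0 <= w c by exact: weight_ge0.
have w1 : \sum_c w c = 1 by apply: weight_sum; exact: gx.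
have supp c : w c != 0 \/ (exists l, wd l c != 0) ->
    `|T c x - psi x| <= e' * (2 * eta) /\
    enorm (oproj (TS (nu x)) ((pv c).1.2 *m (frame x)^T) - tgrad S nu psi x) <= e'.
  move=> H; have xq := weight_supp eta0 H.
  have [Sp pq pE Hp] := Hpv c (ex_intro2 _ _ x Sx xq).
  have xp : `|x - (pv c).1.1| <= 2 * eta.
    rewrite -(subrK (q c) x) -addrA; apply: le_trans (ler_normD _ _) _.
    by rewrite mulr_natl mulr2n; apply: lerD => //; rewrite distrC.
  have [H1 H2] := Hp x Sx (le_lt_trans xp eta2d); split=> //.
  apply: le_trans (_ : e' * `|x - (pv c).1.1| <= _); last by rewrite ler_wpM2l // ltW.
  have -> : T c x - psi x = - (psi x - psi (pv c).1.1 - dot (x - (pv c).1.1) (pv c).1.2).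
    by rewrite /T pE dotBl; ring.
  by rewrite normrN.
have e'2 : 0 <= e' * (2 * eta) by apply: mulr_ge0; [exact: ltW|apply: mulr_ge0 => //; exact: ltW].
have wT (g : {ffun 'I_n -> 'I_M} -> R) : (forall c, g c != 0 -> w c != 0 \/ (exists l, wd l c != 0)) ->
    `|\sum_c g c * (T c x - psi x)| <= (\sum_c `|g c|) * (e' * (2 * eta)).
  move=> gs; apply: le_trans (ler_norm_sum _ _ _) _; rewrite mulr_suml; apply: ler_sum => c _.
  have [->|gc] := eqVneq (g c) 0; first by rewrite mul0r normr0 mul0r.
  by rewrite normrM ler_wpM2l //; have [] := supp c (gs c gc).
split.
  have -> : h x - psi x = \sum_c w c * (T c x - psi x).
    under eq_bigr do rewrite mulrBr.
    by rewrite sumrB -mulr_suml w1 mul1r.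
  apply: le_trans (wT w _) _; first by move=> c wc; left.
  rewrite (eq_bigr w) => [|c _]; last by rewrite ger0_norm.
  rewrite w1 mul1r; apply: le_trans e'e; by rewrite ler_piMr // ltW.
(* The contribution of the differentiated weights, where [psi x] has been subtracted at no cost. *)
pose E : pt := \row_l (eta^-1 * \sum_c wd l c * (T c x - psi x)).
have gE : grad h x = \sum_c w c *: (pv c).1.2 + E.
  apply/rowP => l; rewrite [RHS]mxE [LHS]mxE summxE [E 0 l]mxE.
  have D : is_derive x (ee l) h (\sum_c (w c * (pv c).1.2 0 l + T c x * (eta^-1 * wd l c))).
    apply: is_derive_bigsum => c.
    have DT : is_derive x (ee l) (T c) ((pv c).1.2 0 l).
      apply: DeriveDef; first exact: (C1_derivable openT (CkS (T2 c))).
      have := congr1 (fun v : pt => v 0 l) (grad_pert (Ck_cst 2 setT ((pv c).2 - dot (pv c).1.1 (pv c).1.2)) (pv c).1.2 x).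
      rewrite mxE => ->; rewrite mxE [grad _ _ _ _]mxE.
      by rewrite (_ : 'D_(ee l) _ x = 0) ?add0r //; exact: derive_cst.
    have Dw := weight_derive eta L%:R l c x.
    exact: is_deriveM Dw DT.
  rewrite (derive_val (is_derive := D)) big_split /=; congr (_ + _).
    by apply: eq_bigr => c _; rewrite mxE.
  under [in RHS]eq_bigr do rewrite mulrBr.
  rewrite sumrB -[X in _ - X]mulr_suml weightd_sum ?mul0r ?subr0; last exact: gx.
  by rewrite mulr_sumr; apply: eq_bigr => c _; ring.
have En : `|E| <= 2 * K * e'.
  apply: rV_norm_le => [|l]; first by apply: mulr_ge0; [exact: mulr_ge0|exact: ltW].
  rewrite mxE normrM normfV (gtr0_norm eta0) ler_pdivrMl //.
  apply: le_trans (wT (wd l) _) _; first by move=> c wc; right; exists l.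
  apply: le_trans (_ : K * (e' * (2 * eta)) <= _).
    apply: ler_wpM2r => //; apply: weightd_bound; [exact: gx|exact: HK].
  by rewrite le_eqVlt; apply/orP; left; apply/eqP; ring.
rewrite (rgrad_grad openT (CkS h2)) // gE mulmxDl oprojD.
have -> : oproj (TS (nu x)) ((\sum_c w c *: (pv c).1.2) *m (frame x)^T) =
    \sum_c w c *: oproj (TS (nu x)) ((pv c).1.2 *m (frame x)^T).
  by rewrite mulmx_suml /oproj mulmx_suml; apply: eq_bigr => c _; rewrite -!scalemxAl.
have -> : tgrad S nu psi x = \sum_c w c *: tgrad S nu psi x by rewrite -scaler_suml w1 scale1r.
rewrite addrAC -sumrB; apply: le_trans (enormD _ _) _.
have -> : e = e' + 2 * K * Kf * e' by rewrite /e'; field; rewrite gt_eqF.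
apply: lerD; last first.
  apply: le_trans (oproj_enorm_le _ _) _; apply: le_trans (HKf _ _ Sx) _.
  by rewrite mulrAC [leRHS]mulrC; apply: ler_wpM2l.
rewrite (eq_bigr (fun c => w c *: (oproj (TS (nu x)) ((pv c).1.2 *m (frame x)^T) - tgrad S nu psi x))) => [|c _]; last by rewrite scalerBr.
apply: le_trans (_ : \sum_c w c * e' <= _); last by rewrite -mulr_suml w1 mul1r.
elim/big_rec2 : _ => [|c y1 y2 _ IH]; first by rewrite enorm0.
apply: le_trans (enormD _ _) _; apply: lerD => //; rewrite enormZ ger0_norm //.
have [->|wc] := eqVneq (w c) 0; first by rewrite !mul0r.
by apply: ler_wpM2l => //; have [] := supp c (or_introl wc).
Qed.

End smoothing.

(** * Approximation by regular functions *)

Section sobolev.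
Context {R : realType} (G : carnot R).
Local Notation n := (cdim G).
Local Notation pt := 'rV[R]_n.
Variables (m : nat) (S : set pt) (nu : pt -> pt).
Hypothesis nm : n = m.+2.
Hypotheses (hS : compact_hypersurface S nu) (S0 : mbd S = set0).
Variable psi : pt -> R.
Hypothesis psi1 : C1_on S psi.
Local Notation w := (hweight nu).
Local Notation bo := (borelT R n).

(** The limits of the terms [tterm] along the approximation of [psi]. *)
Definition pterm (i : nat) (x : pt) : R :=
  if i == 1%N then w x * enorm (oproj (HS (nu x)) (tgrad S nu psi x))
  else enorm (oproj (HiS i (nu x)) (tgrad S nu psi x)).

Lemma pterm_ge0 i x : 0 <= pterm i x.
Proof. by rewrite /pterm; case: ifP => _; rewrite ?mulr_ge0 ?enorm_ge0. Qed.

Lemma psi_measurable : measurable_fun (S : set bo) (psi : bo -> R).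
Proof.
apply: measurable_fun_locally; first exact: surface_borel hS.
move=> x Sx; have [U [F [oU Ux F1 FE]]] := psi1 Sx; exists U, F; split=> //.
  by move=> y Uy; exact: Ck_cont F1 Uy.
by move=> y Sy Uy; rewrite FE.
Qed.

(** [tgrad] is defined by a pointwise choice; it is measurable as the limit on [S] of the tangential
    gradients of smoothings. *)
Lemma tgrad_measurable : rv_measurable (S : set bo) (tgrad S nu psi : bo -> pt).
Proof.
move=> j; have mS := surface_borel hS.
have H (i : nat) : exists h : pt -> R, Ck 2 setT h /\ forall x, S x ->
    `|h x - psi x| <= i.+1%:R^-1 /\ enorm (oproj (TS (nu x)) (rgrad h x) - tgrad S nu psi x) <= i.+1%:R^-1.
  by apply: (smoothing nm hS S0 psi1); rewrite invr_gt0.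
have [h Hh] := choice H.
apply: (@measurable_fun_cvg _ _ _ _ (fun i (x : bo) => tang nu (h i) x 0 j)).
- move=> i; have h1 : Ck 1 setT (h i) by apply: CkS; case: (Hh i).
  have mr := rgrad_measurable h1 mS; have mN := nu_measurable nm hS S0.
  apply: (@eq_measurable_fun _ _ bo R S (fun x : bo => (rgrad (h i) x - dot (rgrad (h i) x) (nu x) *: nu x) 0 j)).
    by move=> x /set_mem Sx; rewrite (tangE nm hS S0).
  move: j; apply: rvB_measurable => //; apply: rvZ_measurable => //.
  exact: dot_measurable.
- move=> x Sx; apply/cvgrPdist_lt => e e0.
  have := near_infty_natSinv_lt (PosNum e0) => /= He.
  near=> i; have [_ /(_ x Sx)[_ H2]] := Hh i.
  apply: le_lt_trans (_ : i.+1%:R^-1 < _); last by near: i.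
  apply: le_trans H2; apply: le_trans (norm_enorm_le _); rewrite distrC.
  by apply: le_trans (rV_coord_le _ j); rewrite !mxE.
Unshelve. all: by end_near. Qed.

Lemma pterm_measurable i : (0 < i)%N -> measurable_fun (S : set bo) (pterm i : bo -> R).
Proof.
move=> i0; have mt := tgrad_measurable; have mN := nu_measurable nm hS S0.
case E : (i == 1%N).
  rewrite (_ : (pterm i : bo -> R) = fun x : bo =>
      hweight nu x * enorm (flag_proj 1 (nu x) (tgrad S nu psi x))); last first.
    by apply/funext => x; rewrite /pterm E oproj_HS.
  apply: measurable_funM; first exact: (hweight_measurable nm hS S0).
  by apply: enorm_measurable; exact: flag_proj_measurable.
rewrite (_ : (pterm i : bo -> R) = fun x : bo =>
    enorm (flag_proj i (nu x) (tgrad S nu psi x) - flag_proj i.-1 (nu x) (tgrad S nu psi x))); last first.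
  by apply/funext => x; rewrite /pterm E oproj_HiS.
by apply: enorm_measurable; apply: rvB_measurable; exact: flag_proj_measurable.
Qed.

Lemma grad_addc (h : pt -> R) (c : R) x : Ck 1 setT h -> grad (fun y => h y + c) x = grad h x.
Proof.
move=> h1; apply/rowP => j; rewrite !mxE.
have D1 : is_derive x (ee j) h ('D_(ee j) h x) by apply/derivableP/(C1_derivable openT h1).
have D := is_deriveD D1 (is_derive_cst c x (ee j : pt)).
by have := derive_val (is_derive := D); rewrite addr0.
Qed.

Lemma grad_sqrt (h : pt -> R) (e : R) x : Ck 2 setT h -> 0 < e ->
  grad (fun y => Num.sqrt (h y ^+ 2 + e ^+ 2)) x = (h x / Num.sqrt (h x ^+ 2 + e ^+ 2)) *: grad h x.
Proof.
move=> h2 e0; apply/rowP => j; rewrite !mxE.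
have p0 y : 0 < h y ^+ 2 + e ^+ 2 by rewrite ltr_wpDl ?sqr_ge0 // exprn_gt0.
have D1 : is_derive x (ee j) h ('D_(ee j) h x).
  by apply/derivableP/(C1_derivable openT (CkS h2)).
have D2 : is_derive x (ee j) (fun y => h y ^+ 2 + e ^+ 2) (2 * h x * 'D_(ee j) h x).
  have D := is_deriveD (is_deriveM D1 D1) (is_derive_cst (e ^+ 2) x (ee j : pt)).
  rewrite (_ : (fun y => _) = h * h + cst (e ^+ 2)); last by apply/funext => y; rewrite expr2.
  by apply: (is_derive_eq D); rewrite addr0 /GRing.scale /=; ring.
have D3 := @is_derive_comp1 R _ (fun y => h y ^+ 2 + e ^+ 2) (@Num.sqrt R) x (ee j : pt) _ _ (is_derive1_sqrt (p0 x)) D2.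
rewrite (derive_val (is_derive := D3)).
have s0 : Num.sqrt (h x ^+ 2 + e ^+ 2) != 0 by rewrite gt_eqF // sqrtr_gt0.
by field.
Qed.

(** With [h] a smoothing of [psi], the square root of [h^2 + e^2] is a C^2 function above the
    absolute value of [h]. Its gradient is a multiple of that of [h] by a factor of modulus at most
    1, so the terms do not grow. A constant restores the majorisation, and the linear function from
    [small_bad_levels] makes the levels regular. *)
Lemma regular_majorant : exists2 c : R, 0 <= c & forall e : R, 0 < e -> exists (g : pt -> R) (D : set R),
  [/\ Ck 1 setT g, forall x, S x -> 0 < g x /\ `|psi x| <= g x <= `|psi x| + c * e,
      open D /\ (@lebesgue_measure R D <= e%:E)%E,
      forall x, S x -> ~ D (g x) -> row_free (col_mx (nu x) (rgrad g x))
    & forall i x, S x -> tterm nu g i x <= pterm i x + c * e].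
Proof.
have [Kf Kf0 HKf] := frame_bound hS.
have [r r0 Hr] : exists2 r : R, 0 <= r & forall x, S x -> `|x| <= r.
  have [N [_ /(_ (`|N| + 1))]] := compact_bounded (hyp_compact hS).
  rewrite (le_lt_trans (ler_norm N)) ?ltrDl // => /(_ isT) H; exists (`|N| + 1); first exact: addr_ge0.
  by move=> x Sx; exact: H.
pose B := n%:R * r; have B0 : 0 <= B by exact: mulr_ge0.
(* [2 * B + 3] bounds the error of the values and [1 + Kf] that of the gradients, the latter from
   the smoothing and from the linear function. *)
exists (2 * B + 3 + 1 + Kf) => [|e e0]; first by rewrite !addr_ge0 // mulr_ge0.
have [h [h2 Hh]] := smoothing nm hS S0 psi1 e0.
pose g0 y := Num.sqrt (h y ^+ 2 + e ^+ 2).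
have p0 y : 0 < h y ^+ 2 + e ^+ 2 by rewrite ltr_wpDl ?sqr_ge0 // exprn_gt0.
have g02 : Ck 2 setT g0.
  apply: (Ck_sqrt openT (fun y _ => p0 y)).
  exact: (CkD openT (CkM openT h2 h2) (Ck_cst 2 setT (e ^+ 2))).
have g0e y : e <= g0 y.
  by rewrite -[leLHS](ger0_norm (ltW e0)) -sqrtr_sqr ler_sqrt ?lerDr ?sqr_ge0 // ltW.
have g0h y : `|h y| <= g0 y.
  by rewrite -sqrtr_sqr ler_sqrt ?lerDl ?sqr_ge0 // ltW.
have g0u y : g0 y <= `|h y| + e.
  rewrite -[leRHS]ger0_norm ?addr_ge0 ?(ltW e0) // -sqrtr_sqr ler_sqrt ?sqr_ge0 //.
  by rewrite sqrrD -normrX ger0_norm ?sqr_ge0 // -addrA [_ *+ 2 + _]addrC addrA lerDl mulrn_wge0 // mulr_ge0 // ltW.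
(* [B * e] compensates the linear function on [S], and the further [e] the distance between [h] and
   [psi]. *)
pose g1 y := g0 y + (B + 1) * e.
have g12 : Ck 2 setT g1 := CkD openT g02 (Ck_cst 2 setT _).
have [a [D [ae oD lD reg]]] := small_bad_levels nm hS S0 g12 e0.
exists (fun y => g1 y + dot y a), D.
have da x : S x -> `|dot x a| <= B * e.
  move=> Sx; rewrite dotE; apply: le_trans (ler_norm_sum _ _ _) _.
  apply: le_trans (_ : \sum_(i < n) r * e <= _); last by rewrite sumr_const card_ord -mulr_natl mulrA.
  apply: ler_sum => i _; rewrite normrM; apply: ler_pM => //.
    exact: le_trans (rV_coord_le _ _) (Hr x Sx).
  exact: le_trans (rV_coord_le _ _) ae.
split=> //.
- exact: CkS (pert_C2 g12 a).
- move=> x Sx; have := da x Sx; rewrite ler_norml => /andP[d1 d2].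
  have [H1 _] := Hh x Sx; have hp : `|psi x| <= `|h x| + e.
    rewrite -(subrK (h x) (psi x)) addrC; apply: le_trans (ler_normD _ _) _.
    by rewrite lerD2l distrC.
  have ph : `|h x| <= `|psi x| + e.
    rewrite -(subrK (psi x) (h x)) addrC; apply: le_trans (ler_normD _ _) _.
    by rewrite lerD2l.
  have k1 := g0e x; have k2 := g0h x; have k3 := g0u x.
  have Ke : 0 <= Kf * e by rewrite mulr_ge0 // ltW.
  rewrite /g1; move: d1 d2 hp ph k1 k2 k3 Ke e0; set z := dot x a; set y := g0 x; set t := B * e.
  rewrite !mulrDl -mulrA -/t !mul1r => *; split; first by lra.
  by apply/andP; split; lra.
move=> i x Sx; have [_ H2] := Hh x Sx.
have N1 := nuE_sq nm hS S0 Sx.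
have rg : rgrad (fun y => g1 y + dot y a) x = (h x / g0 x) *: rgrad h x + a *m (frame x)^T.
  rewrite (rgrad_grad openT (CkS (pert_C2 g12 a))) //.
  have -> : grad (fun y => g1 y + dot y a) x = grad g1 x + a := grad_pert g12 a x.
  rewrite mulmxDl; congr (_ + _).
  rewrite (rgrad_grad openT (CkS h2)) // scalemxAl -grad_sqrt //; congr (_ *m _).
  exact: (grad_addc _ _ (CkS g02)).
have q1 : `|h x / g0 x| <= 1.
  have g00 : 0 < g0 x by exact: lt_le_trans e0 (g0e x).
  by rewrite normrM normfV (gtr0_norm g00) ler_pdivrMr // mul1r.
have proj E : (forall f : pt -> R, oproj E (tang nu f x) = oproj E (rgrad f x)) ->
    enorm (oproj E (rgrad (fun y => g1 y + dot y a) x)) <= enorm (oproj E (tgrad S nu psi x)) + (1 + Kf) * e.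
  move=> HE; rewrite rg oprojD oprojZ -HE.
  apply: le_trans (enormD _ _) _; rewrite mulrDl mul1r addrA; apply: lerD; last first.
    apply: le_trans (oproj_enorm_le _ _) _; apply: le_trans (HKf _ _ Sx) _.
    exact: ler_wpM2l.
  rewrite enormZ; apply: le_trans (_ : enorm (oproj E (tang nu h x)) <= _).
    by rewrite ler_piMl // enorm_ge0.
  rewrite -(subrK (tgrad S nu psi x) (tang nu h x)) oprojD addrC.
  apply: le_trans (enormD _ _) _; rewrite lerD2r.
  exact: le_trans (oproj_enorm_le _ _) H2.
have ce : (1 + Kf) * e <= (2 * B + 3 + 1 + Kf) * e.
  by apply: ler_wpM2r; [exact: ltW|rewrite -addrA lerDr addr_ge0 // mulr_ge0].
have w1 := hweight_le1 nm hS S0 Sx; have w0 := hweight_ge0 nu x.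
rewrite /tterm /pterm; case: ifP => _.
  apply: le_trans (_ : w x * (enorm (oproj (HS (nu x)) (tgrad S nu psi x)) + (1 + Kf) * e) <= _).
    by apply: ler_wpM2l => //; apply: proj => f; exact: (proj_tang_HS nm hS S0).
  rewrite mulrDr lerD2l; apply: le_trans ce; rewrite ler_piMl // mulr_ge0 ?(ltW e0) //.
  exact: addr_ge0.
apply: le_trans (_ : enorm (oproj (HiS i (nu x)) (tgrad S nu psi x)) + (1 + Kf) * e <= _).
  by apply: proj => f; exact: (proj_tang_HiS nm hS S0).
by rewrite lerD2l.
Qed.

End sobolev.

(** * Passage to the limit *)

Lemma combine_errors (R : realType) (a a' b b' H s : \bar R) (r t t' : nat -> \bar R)
    (q : R) (j l : nat) :
  0 <= q -> (0 <= a')%E -> (0 <= b')%E -> (0 <= H)%E -> (0 <= s)%E ->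
  (forall i, 0 <= r i)%E -> (forall i, 0 <= t' i)%E ->
  (a <= a' + q%:E * H)%E -> (b <= b' + q%:E * s)%E ->
  (forall i, (j <= i)%N -> t i <= t' i + q%:E * s)%E ->
  (a + b + \sum_(j <= i < l) r i * t i <=
   a' + b' + \sum_(j <= i < l) r i * t' i
   + q%:E * (H + s + \sum_(j <= i < l) r i * s))%E.
Proof.
move=> q0 a0 b0 H0 s0 r0 t0 ha hb ht.
have rs0 i : (0 <= r i * s)%E by exact: mule_ge0.
rewrite (ge0_muleDr _ (y := H + s)%E); [|exact: adde_ge0|exact: sume_ge0].
rewrite addeACA; apply: leeD.
  by rewrite ge0_muleDr // addeACA; exact: leeD.
rewrite ge0_sume_distrr // -big_split /= big_nat_cond [leRHS]big_nat_cond.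
apply: lee_sum => i /andP[/andP[ji _] _].
rewrite muleCA -ge0_muleDr //; last by apply: mule_ge0 => //; rewrite lee_fin.
exact: lee_wpmul2l (ht i ji).
Qed.

Section sobolev.
Context {R : realType} (G : carnot R).
Local Notation n := (cdim G).
Local Notation pt := 'rV[R]_n.
Local Notation k := (cstep G).
Variables (m : nat) (S : set pt) (nu : pt -> pt).
Hypothesis nm : n = m.+2.
Hypotheses (hS : compact_hypersurface S nu) (S0 : mbd S = set0).
Variables (rho : pt -> pt -> R) (C : R).
Hypotheses (hrho : homogeneous_distance rho) (hC : isoperimetric_constant rho C).
Hypothesis hL1 : hmean_curv_L1 S nu.
Local Notation s := (riem_measure n.-1 S).
Hypothesis hs0 : is_riem_measure m.+1 S s.
Variable psi : pt -> R.
Hypothesis psi1 : C1_on S psi.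
Local Notation w := (hweight nu).
Local Notation bo := (borelT R n).
Local Notation rS := (max_radius rho S nu).

Lemma hmean_integral_lty :
  (\int[s]_(x in (S : set bo)) (`|hmean_curv S nu x| * w x)%:E < +oo)%E.
Proof.
have mS := surface_borel hS; have mw := hweight_measurable nm hS S0.
have mH := hmean_measurable nm hS S0 hL1.
pose A := S `\` char_set S nu : set bo; pose B := S `&` w @^-1` [set 0] : set bo.
have mB : measurable B by apply: mw => //; exact: measurable_set1.
have SU : A `|` B = S.
  apply/seteqP; split=> x; first by move=> [[]|[]].
  by move=> Sx; have [cx|cx] := pselect (w x = 0); [right|left; split=> // -[_ c]; apply: cx].
have mA : measurable A.
  rewrite (_ : A = (S : set bo) `\` B); first exact: measurableD.
  by apply/seteqP; split=> x [Sx cx]; split.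
have H0 x : 0 <= `|hmean_curv S nu x| * w x by rewrite mulr_ge0 ?hweight_ge0.
rewrite -[X in (\int[_]_(x in X) _)%E]SU ge0_integral_setU //.
- rewrite [X in (_ + X)%E](_ : _ = 0%E) ?adde0; last first.
    by apply: integral0_eq => x [_ /= ->]; rewrite mulr0.
  have [/measurable_EFinP mh] := integrableP _ _ _ hL1; apply: le_lt_trans.
  apply: ge0_le_integral => //.
  + by move=> x _; rewrite lee_fin.
  + by apply/measurable_EFinP; apply: measurable_funS mH => // x [].
  + by apply/measurable_EFinP; apply: (measurableT_comp (@normr_measurable R setT) mh).
  + move=> x [Sx _]; rewrite lee_fin ler_piMr //; exact: (hweight_le1 nm hS S0).
- by rewrite SU; apply/measurable_EFinP.
- by move=> x _; rewrite lee_fin.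
- by apply/eqP/seteqP; split=> // x [[Sx cx] [_ wx]]; apply: cx; split.
Qed.

Lemma majorant_integral (a b : pt -> R) (q : R) :
  measurable_fun (S : set bo) (a : bo -> R) -> measurable_fun (S : set bo) (b : bo -> R) ->
  0 <= q -> (forall x, S x -> 0 <= a x <= b x + q) -> (forall x, S x -> 0 <= b x) ->
  (\int[s]_(x in (S : set bo)) (a x)%:E <=
   \int[s]_(x in (S : set bo)) (b x)%:E + q%:E * s S)%E.
Proof.
move=> ma mb q0 ab b0; have mS := surface_borel hS.
rewrite -integral_cst // -ge0_integralD //.
- apply: ge0_le_integral => //.
  + by move=> x Sx; rewrite lee_fin; case/andP: (ab x Sx).
  + exact/measurable_EFinP.
  + by apply/measurable_EFinP; apply: measurable_funD => //; exact: measurable_cst.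
  + by move=> x Sx; rewrite lee_fin; case/andP: (ab x Sx).
- exact/measurable_EFinP.
Qed.

Local Notation T i := (\int[s]_(x in (S : set bo)) (pterm S nu psi i x)%:E)%E.

Lemma sobolev : S !=set0 ->
  ((\int[s]_(x in (S : set bo)) (`|psi x| `^ (hexp G)^-1 * w x)%:E) `^ hexp G <=
   C%:E * (\int[s]_(x in (S : set bo)) (`|psi x| * (`|hmean_curv S nu x| * w x))%:E
           + T 1 + \sum_(2 <= i < k.+1) rS ^+ i.-1 * T i))%E.
Proof.
move=> [x0 Sx0]; have rS0 := max_radius_ge0 nm hS S0 rho Sx0.
have rSoo := max_radius_lty nm hS S0 hs0 hrho.
have mS := surface_borel hS; have mw := hweight_measurable nm hS S0.
have mH := hmean_measurable nm hS S0 hL1; have mpsi := psi_measurable hS psi1.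
have mpsiN : measurable_fun (S : set bo) (fun x : bo => `|psi x|).
  exact: (measurableT_comp (@normr_measurable R setT) mpsi).
have w0 x : 0 <= w x := hweight_ge0 nu x.
have H0 x : 0 <= `|hmean_curv S nu x| * w x by rewrite mulr_ge0.
have sfin := surface_finite nm hS S0 hs0; have Hfin := hmean_integral_lty.
have [C0 _] := hC; have [h0 h1] := andP (hexp01 G).
have [c c0 maj] := regular_majorant nm hS S0 psi1.
set IH := (\int[s]_(x in (S : set bo)) (`|hmean_curv S nu x| * w x)%:E)%E in Hfin.
have IH0 : (0 <= IH)%E by apply: integral_ge0 => x _; rewrite lee_fin.
have T0 i : (0 <= T i)%E by apply: integral_ge0 => x _; rewrite lee_fin pterm_ge0.
have rT i : (0 <= rS ^+ i.-1 * T i)%E by apply: mule_ge0 => //; exact: expe_ge0.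
have ss0 : (0 <= s S)%E by exact: measure_ge0.
have rs i : (0 <= rS ^+ i.-1 * s S)%E by apply: mule_ge0 => //; exact: expe_ge0.
(* All errors are collected as [e] times one quantity independent of [e]. It is finite because the
   area, the curvature integral and the maximal radius are. *)
pose Z := (C%:E * (c%:E * (IH + s S + \sum_(2 <= i < k.+1) rS ^+ i.-1 * s S)) + sigmaH S nu S `^ hexp G)%E.
have sg0 : (0 <= sigmaH S nu S)%E by rewrite sigmaHE; apply: integral_ge0 => x _; rewrite lee_fin.
have Y0 : (0 <= IH + s S + \sum_(2 <= i < k.+1) rS ^+ i.-1 * s S)%E.
  by apply: adde_ge0; [exact: adde_ge0|apply: sume_ge0 => i _].
have X0 : (0 <= C%:E * (c%:E * (IH + s S + \sum_(2 <= i < k.+1) rS ^+ i.-1 * s S)))%E.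
  by apply: mule_ge0; [rewrite lee_fin ltW|apply: mule_ge0; rewrite ?lee_fin].
have Z0 : (0 <= Z)%E.
  by apply: adde_ge0; last exact: poweR_ge0.
have Zoo : (Z < +oo)%E.
  rewrite /Z lte_add_pinfty //; last by apply: poweR_lty; exact: sigmaH_lty nm hS S0 hs0.
  rewrite -(fineK (x := s S)) ?ge0_fin_numE // -(fineK (x := IH)) ?ge0_fin_numE // -(fineK (x := rS)) ?ge0_fin_numE //.
  under eq_bigr do rewrite -EFin_expe -EFinM.
  by rewrite sumEFin -!EFinD -!EFinM ltry.
set R0 := (C%:E * _)%E; suff main e : 0 < e -> ((\int[s]_(x in (S : set bo)) (`|psi x| `^ (hexp G)^-1 * w x)%:E) `^ hexp G <= R0 + e%:E * Z)%E.
  apply/lee_addgt0Pr => e e0; have z0 : 0 < fine Z + 1 by rewrite ltr_wpDl // fine_ge0.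
  apply: le_trans (main (e / (fine Z + 1)) _) _; first exact: divr_gt0.
  apply: leeD => //; rewrite -[Z](fineK (x := Z)) ?ge0_fin_numE // -EFinM lee_fin /=.
  by rewrite -mulrA ler_piMr ?(ltW e0) // mulrC ler_pdivrMr // mul1r lerDl.
move=> e0; have [g [D [g1 gpsi [oD De] reg tg]]] := maj e e0.
have mg := regular_measurable g1.
have g0 x : S x -> 0 < g x by case/gpsi.
have ce : 0 <= c * e by rewrite mulr_ge0 // ltW.
apply: le_trans (_ : ((\int[s]_(x in (S : set bo)) (g x `^ (hexp G)^-1 * w x)%:E) `^ hexp G <= _)%E).
  apply: poweR_le; first exact: ltW.
    by apply: integral_ge0 => x _; rewrite lee_fin mulr_ge0 ?powR_ge0.
  apply: ge0_le_integral => //.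
  - by move=> x _; rewrite lee_fin mulr_ge0 ?powR_ge0.
  - by apply/measurable_EFinP; apply: measurable_funM => //; exact: powR_measurable.
  - apply/measurable_EFinP; apply: measurable_funM => //; apply: powR_measurable => //.
    by apply: measurable_funS mg.
  - move=> x Sx; rewrite lee_fin ler_wpM2r //; have [_ /andP[gx _]] := gpsi x Sx.
    by apply: ge0_ler_powR; rewrite ?nnegrE ?invr_ge0 ?(ltW h0) ?(ltW (g0 x Sx)).
apply: le_trans (isop_sobolev_regular nm hS S0 hC hL1 hs0 rS0 g1 g0 oD De reg) _.
have I1 : (\int[s]_(x in (S : set bo)) (g x * (`|hmean_curv S nu x| * w x))%:E <=
    \int[s]_(x in (S : set bo)) (`|psi x| * (`|hmean_curv S nu x| * w x))%:E + (c * e)%:E * IH)%E.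
  rewrite -ge0_integralZl //; last 2 first.
  - exact/measurable_EFinP.
  - by move=> x _; rewrite lee_fin.
  rewrite -ge0_integralD //; last 4 first.
  - by move=> x _; rewrite lee_fin mulr_ge0.
  - by apply/measurable_EFinP; exact: measurable_funM.
  - by move=> x _; rewrite -EFinM lee_fin mulr_ge0.
  - by apply/measurable_EFinP; apply: measurable_funM => //; exact: measurable_cst.
  apply: ge0_le_integral => //.
  - by move=> x Sx; rewrite lee_fin mulr_ge0 // ltW // g0.
  - by apply/measurable_EFinP; apply: measurable_funM => //; exact: measurable_funS mg.
  - apply/measurable_EFinP; apply: measurable_funD; apply: measurable_funM => //; exact: measurable_cst.
  - move=> x Sx; rewrite -EFinM -EFinD lee_fin -mulrDl ler_wpM2r //.
    by have [_ /andP[]] := gpsi x Sx.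
have I2 i : (0 < i)%N -> (\int[s]_(x in (S : set bo)) (tterm nu g i x)%:E <= T i + (c * e)%:E * s S)%E.
  move=> i0; apply: majorant_integral => //.
  - exact: (tterm_measurable nm hS S0 g1).
  - exact: (pterm_measurable nm hS S0 psi1).
  - by move=> x Sx; rewrite tterm_ge0 tg.
  - by move=> x _; exact: pterm_ge0.
have e0' : (0 <= e%:E)%E by rewrite lee_fin ltW.
rewrite /Z (ge0_muleDr e%:E X0) ?poweR_ge0 //.
rewrite [leRHS]addeA; apply: leeD; last exact: lexx.
have P0 : (0 <= \int[s]_(x in (S : set bo)) (`|psi x| * (`|hmean_curv S nu x| * w x))%:E)%E.
  by apply: integral_ge0 => x _; rewrite lee_fin mulr_ge0.
rewrite (muleCA e%:E) (muleA e%:E) (muleC e%:E) -EFinM.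
have A0 : (0 <= \sum_(2 <= i < k.+1) rS ^+ i.-1 * T i)%E by apply: sume_ge0 => i _; exact: rT.
rewrite /R0 -(ge0_muleDr C%:E (adde_ge0 (adde_ge0 P0 (T0 1%N)) A0)); last first.
  by apply: mule_ge0; [rewrite lee_fin|exact: Y0].
apply: lee_wpmul2l; first by rewrite lee_fin ltW.
apply: (combine_errors _ ce P0 (T0 1%N) IH0 ss0 (fun i => expe_ge0 i.-1 rS0) T0 I1 (I2 1%N isT)).
by move=> i i2; apply: I2; exact: ltnW.
Qed.

End sobolev.

Theorem theorem1p5 (R : realType) (G : carnot R)
    (rho : 'rV[R]_(cdim G) -> 'rV[R]_(cdim G) -> R)
    (C : R) (S : set 'rV[R]_(cdim G))
    (nu : 'rV[R]_(cdim G) -> 'rV[R]_(cdim G))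
    (psi : 'rV[R]_(cdim G) -> R) :
  homogeneous_distance rho ->
  isoperimetric_constant rho C ->
  compact_hypersurface S nu ->
  mbd S = set0 ->
  hmean_curv_L1 S nu ->
  C1_on S psi ->
  ((int_sigmaH S nu S (fun x => `|psi x|%R `^
       (((homdim G)%:R - 1) / ((homdim G)%:R - 2)))%R)
     `^ (((homdim G)%:R - 2) / ((homdim G)%:R - 1))
   <= C%:E *
      (int_sigmaH S nu S (fun x =>
         (`|psi x| * `|hmean_curv S nu x|
          + enorm (oproj (HS (nu x)) (tgrad S nu psi x)))%R)
       + \sum_(2 <= i < (cstep G).+1)
           (max_radius rho S nu) ^+ i.-1 *
           int_sigmaR S (fun x =>
             enorm (oproj (HiS i (nu x)) (tgrad S nu psi x)))))%E.
Proof.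
move=> hrho hC hS S0 hL1 psi1; have [m nm] := cdim_ge2 G; have [C0 _] := hC.
set s := riem_measure (cdim G).-1 S.
have [h0 h1] := andP (hexp01 G).
rewrite -hexpV -/(hexp G).
(* This case makes both sides 0. It contains the empty surface and the surface without a Riemannian
   measure, where [s] is [mzero]. *)
have [z|nz] := pselect (forall f : 'rV[R]_(cdim G) -> R,
    (\int[s]_(x in (S : set (borelT R (cdim G)))) (f x)%:E = 0)%E).
  rewrite /int_sigmaH !z poweR0r; last by rewrite gt_eqF.
  rewrite big1 ?adde0 ?mule0 // => i _; rewrite /int_sigmaR z; exact: mule0.
have [es|nes] := pselect (exists s : {measure set (borelT R (cdim G)) -> \bar R},
    is_riem_measure (cdim G).-1 S s); last first.
  by case: nz => f; rewrite /s riem_measure0 // integral_measure_zero.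
have [Se|/set0P Sne] := eqVneq S set0.
  by case: nz => f; rewrite [X in (\int[_]_(x in X) _)%E]Se integral_set0.
have hs0 : is_riem_measure m.+1 S s by have := riem_measureP es; rewrite {1}(dim_pred nm).
apply: le_trans (sobolev nm hS S0 hrho hC hL1 hs0 psi1 Sne) _.
have mS := surface_borel hS; have mw := hweight_measurable nm hS S0.
have mH := hmean_measurable nm hS S0 hL1; have mpsi := psi_measurable hS psi1.
apply: lee_wpmul2l; first by rewrite lee_fin ltW.
apply: leeD.
  rewrite -ge0_integralD //; last 4 first.
  - by move=> x _; rewrite lee_fin !mulr_ge0 ?hweight_ge0.
  - apply/measurable_EFinP; apply: measurable_funM => //.
    exact: (measurableT_comp (@normr_measurable R setT) mpsi).
  - by move=> x _; rewrite lee_fin pterm_ge0.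
  - by apply/measurable_EFinP; exact: (pterm_measurable nm hS S0 psi1).
  rewrite le_eqVlt; apply/orP; left; apply/eqP; apply: eq_integral => x _.
  by rewrite -EFinD; congr (_%:E); rewrite /pterm /= /hweight; ring.
rewrite big_nat_cond [leRHS]big_nat_cond; apply: lee_sum => i /andP[/andP[i2 _] _].
rewrite le_eqVlt; apply/orP; left; apply/eqP; congr (_ * _)%E.
by apply: eq_integral => x _; rewrite /pterm; case: eqP i2 => [->|].
Qed.
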